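(* The Buschman--Erdelyi operators of zero order smoothness $${}_1S_{0+}^{\nu}f(x)=\frac{d}{dx}\int_0^x P_\nu\!\left(\frac{x}{t}\right)f(t)\,dt,\qquad {}_1P_{0+}^{\nu}f(x)=\int_0^x P_\nu\!\left(\frac{t}{x}\right)\frac{df(t)}{dt}\,dt,$$ $${}_1P_{-}^{\nu}f(x)=\int_x^\infty P_\nu\!\left(\frac{t}{x}\right)\left(-\frac{df(t)}{dt}\right)dt,\qquad {}_1S_{-}^{\nu}f(x)=\left(-\frac{d}{dx}\right)\int_x^\infty P_\nu\!\left(\frac{x}{t}\right)f(t)\,dt$$ are unitary in $L_2$ if and only if the parameter $\nu$ is an integer. In this case the pairs of operators $({}_1S_{0+}^{\nu},\,{}_1P_{-}^{\nu})$ and $({}_1S_{-}^{\nu},\,{}_1P_{0+}^{\nu})$ are mutually inverse.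
   Context: $\nu\in\mathbb{C}$ is a parameter, and $P_\nu(z)=P_\nu^0(z)$ is the Legendre function (of the first kind). All functions are defined on the positive semiaxis $(0,\infty)$, and $L_2$ denotes $L_2(0,\infty)$. The four operators are also written $B_{0+}^{\nu,1}={}_1S_{0+}^{\nu}$, $E_{0+}^{\nu,1}={}_1P_{0+}^{\nu}$, $B_{-}^{\nu,1}={}_1P_{-}^{\nu}$, $E_{-}^{\nu,1}={}_1S_{-}^{\nu}$. *)

(* Defs.v *)
From HB Require Import structures.
From mathcomp Require Import all_boot all_order all_algebra.
From mathcomp Require Import complex.
From mathcomp Require Import all_classical all_reals all_analysis.

Set Implicit Arguments.
Unset Strict Implicit.
Unset Printing Implicit Defensive.
Import Order.TTheory GRing.Theory Num.Theory.
Import numFieldNormedType.Exports.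
Local Open Scope classical_set_scope.
Local Open Scope complex_scope.
Local Open Scope ring_scope.

Section complex_valued_functions.
Context {R : realType}.
Local Notation C := R[i].
Local Notation mu := (@lebesgue_measure R).
Implicit Types (D : set R) (f g : R -> C).

Definition cmeasurable D f : Prop :=
  measurable_fun D (fun x => complex.Re (f x)) /\
  measurable_fun D (fun x => complex.Im (f x)).

Definition cintegrable D f : Prop :=
  mu.-integrable D (fun x => (complex.Re (f x))%:E) /\
  mu.-integrable D (fun x => (complex.Im (f x))%:E).

Definition cintegral D f : C :=
  (\int[mu]_(x in D) complex.Re (f x)) +i*
  (\int[mu]_(x in D) complex.Im (f x)).

Definition is_cderive f (x : R) (l : C) : Prop :=
  is_derive x 1 (fun t => complex.Re (f t)) (complex.Re l) /\
  is_derive x 1 (fun t => complex.Im (f t)) (complex.Im l).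

(* f is locally absolutely continuous on (0, oo) and its derivative, which then
   exists a.e., is f'.  Absolute continuity is stated as: f is an indefinite
   Lebesgue integral of its a.e. derivative. *)
Definition loc_AC_derive f (f' : R -> C) : Prop :=
  {ae mu, forall x, 0 < x -> is_cderive f x (f' x)} /\
  forall a b : R, 0 < a -> a < b ->
    cintegrable `[a, b] f' /\ f b - f a = cintegral `[a, b] f'.

Definition halfline : set R := `]0, +oo[.

(* Elements of L_2(0, oo) are represented by functions on R, whose values
   outside (0, oo) are irrelevant; equality in L_2 is equality a.e. on (0, oo). *)
Definition L2sq f : \bar R :=
  (\int[mu]_(x in halfline) ((Normc.normc (f x)) ^+ 2)%:E)%E.

Definition inL2 f : Prop := cmeasurable halfline f /\ (L2sq f < +oo)%E.

Definition L2inner f g : C := cintegral halfline (fun x => f x * (g x)^*).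

Definition L2cvg (u : nat -> R -> C) f : Prop :=
  (fun n => L2sq (fun x => u n x - f x)) @ \oo --> 0%E.

(* A possibly unbounded, partially defined operator T in L_2 is given by its
   graph: T f g means that f is in the domain of T and T f = g. *)
Definition L2op : Type := (R -> C) -> (R -> C) -> Prop.

Definition L2closure (T : L2op) : L2op := fun f g =>
  [/\ inL2 f, inL2 g &
   exists u v : nat -> R -> C,
     [/\ forall n, T (u n) (v n), L2cvg u f & L2cvg v g] ].

(* Everywhere defined, onto and inner-product preserving; the last condition
   forces the relation to be single-valued up to a.e. equality, and linear. *)
Definition L2unitary_graph (T : L2op) : Prop :=
  [/\ forall f, inL2 f -> exists2 g, inL2 g & T f g,
      forall g, inL2 g -> exists2 f, inL2 f & T f g &
      forall f1 g1 f2 g2, T f1 g1 -> T f2 g2 ->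
        L2inner g1 g2 = L2inner f1 f2].

(* An operator given by a formula on its natural domain in L_2 is unitary in
   L_2 when its closure is a unitary operator on the whole of L_2. *)
Definition unitary_in_L2 (T : L2op) : Prop := L2unitary_graph (L2closure T).

Definition mutually_inverse_in_L2 (T U : L2op) : Prop :=
  forall f g, L2closure T f g <-> L2closure U g f.

End complex_valued_functions.

Section legendre_function.
Context {R : realType}.
Local Notation C := R[i].

Definition cpowR (b : R) (s : C) : C :=
  (expR (complex.Re s * ln b))%:C *
  (cos (complex.Im s * ln b) +i* sin (complex.Im s * ln b)).

Definition pochhammer (a : C) (k : nat) : C := \prod_(i < k) (a + i%:R).

Definition hyp2F1_term (a b c : C) (w : R) (k : nat) : C :=
  pochhammer a k * pochhammer b k / (pochhammer c k * (k`!)%:R) * (w ^+ k)%:C.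

Definition hyp2F1_series (a b c : C) (w : R) : C :=
  limn (series (fun k => complex.Re (hyp2F1_term a b c w k))) +i*
  limn (series (fun k => complex.Im (hyp2F1_term a b c w k))).

(* Gauss's hypergeometric function on (-oo, 1): the hypergeometric series for
   |w| < 1, and for w <= -1 its analytic continuation, given by Pfaff's
   transformation F(a,b;c;w) = (1-w)^(-a) F(a,c-b;c;w/(w-1)).  Values at
   w >= 1 are not used. *)
Definition hyp2F1 (a b c : C) (w : R) : C :=
  if `|w| < 1 then hyp2F1_series a b c w
  else cpowR (1 - w) (- a) * hyp2F1_series a (c - b) c (w / (w - 1)).

(* P_nu on the half-line z > 0 (in fact z > -1). *)
Definition legendreP (nu : C) (z : R) : C :=
  hyp2F1 (- nu) (nu + 1) 1 ((1 - z) / 2).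

End legendre_function.

(* The operators are taken on their maximal domains in L_2: the integral
   converges absolutely for every x > 0, every function that is differentiated
   is locally absolutely continuous, and the result is in L_2. *)
Section Buschman_Erdelyi.
Context {R : realType}.
Local Notation C := R[i].
Local Notation mu := (@lebesgue_measure R).
Variable nu : C.
Local Notation P := (legendreP nu).

(* d/dx \int_0^x P_nu(x/t) f(t) dt *)
Definition BE_S0 : @L2op R := fun f g =>
  let F (x t : R) := P (x / t) * f t in
  [/\ inL2 f, inL2 g,
      forall x, 0 < x -> cintegrable `]0, x[ (F x) &
      loc_AC_derive (fun x => cintegral `]0, x[ (F x)) g].

(* \int_0^x P_nu(t/x) f'(t) dt *)
Definition BE_P0 : @L2op R := fun f g =>
  [/\ inL2 f, inL2 g &
   exists2 f', loc_AC_derive f f' &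
     let F (x t : R) := P (t / x) * f' t in
     (forall x, 0 < x -> cintegrable `]0, x[ (F x)) /\
     {ae mu, forall x, 0 < x -> g x = cintegral `]0, x[ (F x)}].

(* \int_x^oo P_nu(t/x) (- f'(t)) dt *)
Definition BE_Pm : @L2op R := fun f g =>
  [/\ inL2 f, inL2 g &
   exists2 f', loc_AC_derive f f' &
     let F (x t : R) := P (t / x) * - f' t in
     (forall x, 0 < x -> cintegrable `]x, +oo[ (F x)) /\
     {ae mu, forall x, 0 < x -> g x = cintegral `]x, +oo[ (F x)}].

(* (- d/dx) \int_x^oo P_nu(x/t) f(t) dt *)
Definition BE_Sm : @L2op R := fun f g =>
  let F (x t : R) := P (x / t) * f t in
  [/\ inL2 f, inL2 g,
      forall x, 0 < x -> cintegrable `]x, +oo[ (F x) &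
      loc_AC_derive (fun x => cintegral `]x, +oo[ (F x)) (fun x => - g x)].

End Buschman_Erdelyi.

(* Main.v *)
(* Let P = P_nu, k = P', and let K f(x) = \int_0^x (1/x) k(t/x) f(t) dt, with
   transpose K' f(t) = \int_t^oo (1/x) k(t/x) f(x) dx; both are bounded in L_2 by
   Hardy's inequality.  Put A = 1 - K and A' = 1 - K' ([Aop] and [Aop']).
   For f Lipschitz with compact support in (0, oo), integration by parts and
   the Legendre equation give, for every nu,
     P_{0+} f = A f,   S_- f = A' f,   S_{0+} (A f) = f,   P_- (A' f) = f.

   If nu is an integer, P is a polynomial, orthogonal on [0, 1] to the
   monomials of its own parity and of smaller degree; hence \int_0^1 z^i k = 1
   for every monomial z^i of k, so that \int_0^1 k(z) k(zr) dz = k(r).  This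
   gives A' A = A A' = 1, and A, A' are unitary since k is real.  On its whole
   domain each operator agrees with A or A', by Fubini's theorem; for P_{0+} and
   P_- this is first obtained up to a multiple of a power of x, which is in L_2
   only if it vanishes.
   Compactly supported Lipschitz functions are dense, so the closures are
   A, A', A' and A, and the pairs are mutually inverse.

   Conversely, if one of the operators is unitary, then A or A' preserves the
   orthogonality of two bumps with disjoint supports.  Sending one of them to
   infinity (to 0 for A') and taking the leading term yields k(0) P(0) = 0.
   The moments m_j = \int_0^1 z^j P satisfy
     (nu(nu+1) - j(j+1)) m_j + j(j-1) m_{j-2} = 0^j k(0) - j 0^{j-1} P(0),
   so if nu(nu+1) were not of the form j(j+1), all moments of one parity would
   vanish, whereas (j+1) m_j -> 1. *)

Require Import Defs.
From mathcomp Require Import all_boot all_order all_algebra complex ring lra.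
From mathcomp Require Import all_classical all_reals all_analysis.
From mathcomp Require Import measurable_realfun.
Set Implicit Arguments.
Unset Strict Implicit.
Unset Printing Implicit Defensive.
Import Order.TTheory GRing.Theory Num.Theory numFieldNormedType.Exports.
Local Open Scope classical_set_scope.
Local Open Scope complex_scope.
Local Open Scope ring_scope.
Import Normc.
Local Notation Re := complex.Re.
Local Notation Im := complex.Im.

(** * Complex functions of a real variable *)

(** When nu is not an integer the natural domains are hard to describe, and they are never
    determined: unitarity of the closure is tested on bumps only, where the four identities hold
    pointwise. Two of these identities are integrations by parts. The other two say that [P (x / t)]
    yields the resolvent of the Volterra kernel of K, and they rest on Lagrange's identity: as
    functions of t, [P (x / t)] and [P (y / t)] solve rescaled Legendre equations with the same
    eigenvalue, so a quadratic weight times their Wronskian has an explicit derivative. Each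
    exchange of integrals is Fubini's theorem on 0 < t < x for an integrand [q (t / x) * u t * v x]
    with q bounded. Absolute convergence comes from Hardy's inequality in L_2, from boundedness for
    test functions, and from L_1 bounds for general elements of a domain. In this last case the
    kernel may be unbounded; for a polynomial one splits off powers of t and x, and the reversed
    polynomial that remains is bounded. S_{0+} and P_- are studied through their transposed graphs,
    since it is their inverses that are known in closed form. *)

Section complex_parts.
Context {R : realType}.
Implicit Types (z w : R[i]) (a b : R).

Lemma complex_ext z w : Re z = Re w -> Im z = Im w -> z = w.
Proof. by case: z => a b; case: w => c d /= -> ->. Qed.

Lemma cRe_add z w : Re (z + w) = Re z + Re w.
Proof. by case: z; case: w. Qed.
Lemma cIm_add z w : Im (z + w) = Im z + Im w.
Proof. by case: z; case: w. Qed.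
Lemma cRe_opp z : Re (- z) = - Re z.
Proof. by case: z. Qed.
Lemma cIm_opp z : Im (- z) = - Im z.
Proof. by case: z. Qed.
Lemma cRe_mul z w : Re (z * w) = Re z * Re w - Im z * Im w.
Proof. by case: z; case: w. Qed.
Lemma cIm_mul z w : Im (z * w) = Re z * Im w + Im z * Re w.
Proof. by case: z; case: w. Qed.
Lemma cRe_conj z : Re z^* = Re z.
Proof. by case: z. Qed.
Lemma cIm_conj z : Im z^* = - Im z.
Proof. by case: z. Qed.
Lemma cRe_real a : Re (a%:C) = a. Proof. by []. Qed.
Lemma cIm_real a : Im (a%:C) = 0. Proof. by []. Qed.
Lemma Re0 : Re (0 : R[i]) = 0. Proof. by []. Qed.
Lemma Im0 : Im (0 : R[i]) = 0. Proof. by []. Qed.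
Lemma Re1 : Re (1 : R[i]) = 1. Proof. by []. Qed.
Lemma Im1 : Im (1 : R[i]) = 0. Proof. by []. Qed.

Definition cReIm := (cRe_add, cIm_add, cRe_opp, cIm_opp, cRe_mul, cIm_mul, cRe_conj,
  cIm_conj, cRe_real, cIm_real, Re0, Im0, Re1, Im1).

Lemma normcE2 z : normc z ^+ 2 = Re z ^+ 2 + Im z ^+ 2.
Proof. by case: z => a b; rewrite /= sqr_sqrtr// addr_ge0// sqr_ge0. Qed.

Lemma normc_ge0 z : 0 <= normc z.
Proof. by case: z => a b; rewrite /= sqrtr_ge0. Qed.

Lemma cRe_le_normc z : `|Re z| <= normc z.
Proof.
by rewrite -(@ler_pXn2r _ 2)// ?nnegrE ?normc_ge0// normcE2 real_normK ?num_real// lerDl sqr_ge0.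
Qed.

Lemma cIm_le_normc z : `|Im z| <= normc z.
Proof.
by rewrite -(@ler_pXn2r _ 2)// ?nnegrE ?normc_ge0// normcE2 real_normK ?num_real// lerDr sqr_ge0.
Qed.

Lemma normc_le_ReIm z : normc z <= `|Re z| + `|Im z|.
Proof.
rewrite -(@ler_pXn2r _ 2)// ?nnegrE ?normc_ge0// ?addr_ge0// normcE2 sqrrD.
rewrite !real_normK ?num_real// addrAC lerDl.
by rewrite mulrn_wge0// mulr_ge0.
Qed.

Lemma normc_real a : normc a%:C = `|a|.
Proof. by rewrite /= expr0n/= addr0 sqrtr_sqr. Qed.

Lemma normc_conj z : normc z^* = normc z.
Proof. by case: z => a b /=; rewrite sqrrN. Qed.

End complex_parts.

Section real_derivatives.
Context {R : realType}.
Implicit Types (f g : R -> R) (x a b : R).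

Lemma is_derive1D f g x a b : is_derive x 1 f a -> is_derive x 1 g b ->
  is_derive x 1 (fun t => f t + g t) (a + b).
Proof. by move=> df dg; exact: is_deriveD. Qed.

Lemma is_derive1N f x a : is_derive x 1 f a -> is_derive x 1 (fun t => - f t) (- a).
Proof. by move=> df; exact: is_deriveN. Qed.

Lemma is_derive1M f g x a b : is_derive x 1 f a -> is_derive x 1 g b ->
  is_derive x 1 (fun t => f t * g t) (a * g x + f x * b).
Proof.
move=> df dg; apply: (is_derive_eq (is_deriveM df dg)).
by rewrite /GRing.scale/= addrC [g x * a]mulrC.
Qed.

Lemma is_derive1X f n x a : is_derive x 1 f a ->
  is_derive x 1 (fun t => f t ^+ n.+1) (n.+1%:R * f x ^+ n * a).
Proof.
move=> df; elim: n => [|n IH].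
  by under eq_fun do rewrite expr1; rewrite expr0 mulr1 mul1r.
under eq_fun do rewrite exprS.
apply: (is_derive_eq (is_derive1M df IH)).
by rewrite !exprS; ring.
Qed.

Lemma is_derive1V f x a : f x != 0 -> is_derive x 1 f a ->
  is_derive x 1 (fun t => (f t)^-1) (- (f x) ^- 2 * a).
Proof. by move=> f0 df; apply: (is_derive_eq (is_deriveV f0 df)). Qed.

Lemma is_derive1_cst c x : is_derive x 1 (fun=> c) (0 : R).
Proof. exact: is_derive_cst. Qed.

Lemma is_derive1_id x : is_derive x 1 (fun t => t) (1 : R).
Proof. exact: is_derive_id. Qed.

End real_derivatives.

Lemma is_derive1_eq {R : realType} (f : R -> R) (x a b : R) :
  is_derive x 1 f a -> a = b -> is_derive x 1 f b.
Proof. by move=> ? <-. Qed.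

(** [is_derive] is a type class; [notypeclasses refine] leaves its premises as goals, so that the
    structural rules alone drive the differentiation. The derivative found is compared with the
    expected one afterwards. *)
Ltac rderive := notypeclasses refine (is_derive1_eq _ _);
  [repeat first [eassumption | notypeclasses refine (is_derive1_cst _ _) |
     notypeclasses refine (is_derive1_id _) |
     notypeclasses refine (is_derive1D _ _) | notypeclasses refine (is_derive1N _) |
     notypeclasses refine (is_derive1M _ _) |
     notypeclasses refine (is_derive1X _ _) | notypeclasses refine (is_derive1V _ _)]|cbv beta].

Section cderive.
Context {R : realType}.
Implicit Types (f g : R -> R[i]) (x : R) (z l m : R[i]).

Lemma is_cderive_eq f x l m : is_cderive f x l -> l = m -> is_cderive f x m.
Proof. by move=> ? <-. Qed.

Lemma is_cderive_cst z x : is_cderive (fun=> z) x 0.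
Proof. by split; exact: is_derive_cst. Qed.

Lemma is_cderiveD f g x l m : is_cderive f x l -> is_cderive g x m ->
  is_cderive (fun t => f t + g t) x (l + m).
Proof.
move=> [f1 f2] [g1 g2]; split; rewrite cReIm.
  by under eq_fun do rewrite cRe_add; exact: is_deriveD.
by under eq_fun do rewrite cIm_add; exact: is_deriveD.
Qed.

Lemma is_cderiveN f x l : is_cderive f x l -> is_cderive (fun t => - f t) x (- l).
Proof.
move=> [f1 f2]; split; rewrite cReIm.
  by under eq_fun do rewrite cRe_opp; exact: is_deriveN.
by under eq_fun do rewrite cIm_opp; exact: is_deriveN.
Qed.

Lemma is_cderiveB f g x l m : is_cderive f x l -> is_cderive g x m ->
  is_cderive (fun t => f t - g t) x (l - m).
Proof. by move=> df dg; apply: is_cderiveD => //; exact: is_cderiveN. Qed.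

Lemma is_cderiveM f g x l m : is_cderive f x l -> is_cderive g x m ->
  is_cderive (fun t => f t * g t) x (l * g x + f x * m).
Proof.
move=> [f1 f2] [g1 g2]; split.
  under eq_fun do rewrite cRe_mul.
  apply: (is_derive_eq (is_deriveB (is_deriveM f1 g1) (is_deriveM f2 g2))).
  by rewrite !cReIm /GRing.scale/=; ring.
under eq_fun do rewrite cIm_mul.
apply: (is_derive_eq (is_deriveD (is_deriveM f1 g2) (is_deriveM f2 g1))).
by rewrite !cReIm /GRing.scale/=; ring.
Qed.

Lemma is_cderive_real (f : R -> R) x (l : R) : is_derive x 1 f l ->
  is_cderive (fun t => (f t)%:C) x l%:C.
Proof. by move=> fl; split => //=; exact: is_derive_cst. Qed.

Lemma is_cderive_comp f (p : R -> R) x l (d : R) :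
  is_cderive f (p x) l -> is_derive x 1 p d ->
  is_cderive (fun t => f (p t)) x (l * d%:C).
Proof.
move=> [f1 f2] dp; split.
  apply: is_derive_eq; first exact: (@is_derive1_comp _ _ p x _ _ f1 dp).
  by rewrite !cReIm /GRing.scale/=; ring.
apply: is_derive_eq; first exact: (@is_derive1_comp _ _ p x _ _ f2 dp).
by rewrite !cReIm /GRing.scale/=; ring.
Qed.

Lemma is_cderive_unique f x l m : is_cderive f x l -> is_cderive f x m -> l = m.
Proof.
move=> [[_ f1] [_ f2]] [[_ g1] [_ g2]].
by apply: complex_ext; [rewrite -f1 g1|rewrite -f2 g2].
Qed.

Lemma near_eq_is_cderive f g x l : (\near x, f x = g x) ->
  is_cderive f x l -> is_cderive g x l.
Proof.
move=> fg [f1 f2]; split.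
  apply: near_eq_is_derive f1 => //.
  by apply: filterS fg => t ->.
apply: near_eq_is_derive f2 => //.
by apply: filterS fg => t ->.
Qed.

Definition ccontinuous_at f x :=
  {for x, continuous (fun t => Re (f t))} /\ {for x, continuous (fun t => Im (f t))}.

Lemma is_cderive_continuous f x l : is_cderive f x l -> ccontinuous_at f x.
Proof.
by move=> [[f1 _] [f2 _]]; split; apply: differentiable_continuous; apply/derivable1_diffP.
Qed.

End cderive.

(** * Power series with complex coefficients at real points *)

Section power_series.
Context {R : realType}.
Implicit Types (c d : nat -> R[i]) (r w : R) (z : R[i]).

Definition cps c w : R[i] :=
  limn (pseries (fun k => Re (c k)) w) +i* limn (pseries (fun k => Im (c k)) w).

Definition cdiffs c : nat -> R[i] := fun i => i.+1%:R * c i.+1.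

Definition cshift c : nat -> R[i] := fun i => if i is j.+1 then c j else 0.

(** A bound on the terms at every smaller radius, in place of convergence: it can be read off a
    recurrence, and it passes to sums, multiples, shifts and formal derivatives. *)
Definition radius_ge c r := forall s, 0 < s < r ->
  exists M, forall k, normc (c k) * s ^+ k <= M.

(** Abel's lemma, by comparison with a geometric series of ratio [|w| / s] where [s] lies between
    [|w|] and [r]. Any real sequence dominated by [normc (c k)] is allowed, which serves real and
    imaginary parts at once. *)
Lemma radius_ge_cvg_part (p : nat -> R) c r w :
  (forall k, `|p k| <= normc (c k)) -> radius_ge c r -> `|w| < r -> cvgn (pseries p w).
Proof.
move=> pc cr wr.
pose s := (`|w| + r) / 2.
have ws : `|w| < s by rewrite /s; lra.
have s0 : 0 < s by apply: le_lt_trans ws.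
have sr : 0 < s < r by rewrite s0 /s /=; lra.
have [M MP] := cr _ sr.
apply: normed_cvg; rewrite /normed_series_of /=.
apply: (@series_le_cvg _ _ (geometric M (`|w| / s))).
- by move=> n /=; exact: normr_ge0.
- move=> n; rewrite /geometric/=; apply: mulr_ge0.
    by apply: le_trans (MP 0%N); rewrite mulr_ge0// ?normc_ge0.
  by rewrite exprn_ge0// divr_ge0// ltW.
- move=> n /=; rewrite normrM normrX expr_div_n mulrA mulrAC.
  apply: ler_wpM2r; first by rewrite exprn_ge0.
  rewrite ler_pdivlMr ?exprn_gt0//; apply: le_trans (MP n).
  by apply: ler_wpM2r => //; rewrite exprn_ge0// ltW.
- by apply: is_cvg_geometric_series; rewrite normrM normr_id normfV (gtr0_norm s0) ltr_pdivrMr ?mul1r.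
Qed.

Lemma radius_ge_cvg c r w : radius_ge c r -> `|w| < r ->
  cvgn (pseries (fun k => Re (c k)) w) /\ cvgn (pseries (fun k => Im (c k)) w).
Proof.
move=> cr wr; split; apply: radius_ge_cvg_part cr wr => k;
  [exact: cRe_le_normc|exact: cIm_le_normc].
Qed.

Lemma natmul_exp_bounded (q : R) : 0 < q < 1 -> exists M, forall k, k%:R * q ^+ k <= M.
Proof.
move=> /andP[q0 q1]; exists (1 / (1 - q)) => k.
have q1' : 0 < 1 - q by lra.
rewrite ler_pdivlMr// mulrAC.
(* The inductive form compares [n] copies of [q ^+ n] with the geometric sum
   [1 + q + ... + q ^+ n.-1], each term of which is at least as large. *)
have H n : n%:R * (1 - q) * q ^+ n <= 1 - q ^+ n.
  elim: n => [|n IH]; first by rewrite !mul0r expr0 subrr.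
  have qn : 0 <= q ^+ n by rewrite exprn_ge0// ltW.
  have qn1 : q ^+ n <= 1 by rewrite exprn_ile1// ltW.
  rewrite exprS -natr1.
  suff : q * (n%:R * (1 - q) * q ^+ n) <= q * (1 - q ^+ n) /\ (1 - q) * q * q ^+ n <= 1 - q by lra.
  split; first by rewrite ler_pM2l.
  by rewrite -[leRHS]mulr1 -mulrA ler_pM2l// mulr_ile1// ltW.
have := H k; have : 0 <= q ^+ k by rewrite exprn_ge0// ltW.
lra.
Qed.

Lemma radius_ge_diffs c r : radius_ge c r -> radius_ge (cdiffs c) r.
Proof.
move=> cr s /andP[s0 sr].
(* The factor [k] produced by differentiation is absorbed by [(s / s') ^+ k]. *)
pose s' := (s + r) / 2.
have ss' : s < s' by rewrite /s'; lra.
have s'0 : 0 < s' by lra.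
have s'r : s' < r by rewrite /s'; lra.
clearbody s'.
have [M MP] := cr s' ltac:(by rewrite s'0).
have [M' MP'] := @natmul_exp_bounded (s / s') ltac:(by rewrite divr_gt0//= ltr_pdivrMr// mul1r).
exists (M * M' / s) => k.
have M0 : 0 <= M by apply: le_trans (MP 0%N); rewrite mulr_ge0// ?normc_ge0.
rewrite /cdiffs normcM ler_pdivlMr// -[_ * s ^+ k * s]mulrA -exprSr.
have -> : normc (k.+1%:R : R[i]) = k.+1%:R.
  rewrite -[k.+1%:R]/(1 *+ k.+1) normcMn.
  by rewrite normc1.
have -> : k.+1%:R * normc (c k.+1) * s ^+ k.+1 = (normc (c k.+1) * s' ^+ k.+1) * (k.+1%:R * (s / s') ^+ k.+1).
  have s'k : s' ^+ k.+1 != 0 by rewrite expf_neq0// gt_eqF.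
  rewrite expr_div_n; move: (s' ^+ k.+1) s'k (s ^+ k.+1) => u u0 v.
  by field.
apply: ler_pM => //; first by rewrite mulr_ge0// ?normc_ge0// exprn_ge0// ltW.
by rewrite mulr_ge0// exprn_ge0// divr_ge0// ltW.
Qed.

Lemma cps_derive c r w : radius_ge c r -> `|w| < r ->
  is_cderive (cps c) w (cps (cdiffs c) w).
Proof.
move=> cr wr.
(* Differentiation term by term at [w] uses convergence, at the larger point [s], of the series and
   of its first two formal derivatives. *)
pose s := (`|w| + r) / 2.
have ws : `|w| < s by rewrite /s; lra.
have s0 : 0 < s by apply: le_lt_trans ws.
have sr : `|s| < r by rewrite gtr0_norm// /s; lra.
have cr1 := radius_ge_diffs cr.
have cr2 := radius_ge_diffs cr1.
have E1 d : (fun k => Re (cdiffs d k)) = pseries_diffs (fun k => Re (d k)).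
  apply/funext => k; rewrite /cdiffs /pseries_diffs cRe_mul.
  by rewrite -[k.+1%:R in LHS]/(1 *+ k.+1) -(rmorphMn (real_complex R) k.+1 1) !cReIm mul0r subr0.
have E2 d : (fun k => Im (cdiffs d k)) = pseries_diffs (fun k => Im (d k)).
  apply/funext => k; rewrite /cdiffs /pseries_diffs cIm_mul.
  by rewrite -[k.+1%:R in LHS]/(1 *+ k.+1) -(rmorphMn (real_complex R) k.+1 1) !cReIm mul0r addr0.
have [h1 h2] := radius_ge_cvg cr sr.
have [h3 h4] := radius_ge_cvg cr1 sr.
have [h5 h6] := radius_ge_cvg cr2 sr.
rewrite !E1 !E2 in h3 h4 h5 h6.
split; rewrite /cps/=.
  by rewrite E1; apply: (@pseries_snd_diffs _ _ s) => //; rewrite (gtr0_norm s0).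
by rewrite E2; apply: (@pseries_snd_diffs _ _ s) => //; rewrite (gtr0_norm s0).
Qed.

Lemma cpsD c d r w : radius_ge c r -> radius_ge d r -> `|w| < r ->
  cps (fun k => c k + d k) w = cps c w + cps d w.
Proof.
move=> cr dr wr.
have [h1 h2] := radius_ge_cvg cr wr.
have [h3 h4] := radius_ge_cvg dr wr.
have E1 : pseries (fun k => Re (c k + d k)) w =
    pseries (fun k => Re (c k)) w + pseries (fun k => Re (d k)) w.
  apply/funext => n; rewrite /pseries /series fctE -big_split/=.
  by apply: eq_bigr => i _; rewrite cRe_add mulrDl.
have E2 : pseries (fun k => Im (c k + d k)) w =
    pseries (fun k => Im (c k)) w + pseries (fun k => Im (d k)) w.
  apply/funext => n; rewrite /pseries /series fctE -big_split/=.
  by apply: eq_bigr => i _; rewrite cIm_add mulrDl.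
by rewrite /cps E1 E2 !limD.
Qed.

Lemma cpsZ z c r w : radius_ge c r -> `|w| < r ->
  cps (fun k => z * c k) w = z * cps c w.
Proof.
move=> cr wr.
have [h1 h2] := radius_ge_cvg cr wr.
have E1 : pseries (fun k => Re (z * c k)) w =
    Re z *: pseries (fun k => Re (c k)) w - Im z *: pseries (fun k => Im (c k)) w.
  apply/funext => n; rewrite /pseries /series !fctE !scaler_sumr -sumrB/=.
  by apply: eq_bigr => i _; rewrite cRe_mul mulrBl -!mulrA.
have E2 : pseries (fun k => Im (z * c k)) w =
    Re z *: pseries (fun k => Im (c k)) w + Im z *: pseries (fun k => Re (c k)) w.
  apply/funext => n; rewrite /pseries /series !fctE !scaler_sumr -big_split/=.
  by apply: eq_bigr => i _; rewrite cIm_mul mulrDl -!mulrA.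
rewrite /cps E1 E2 limB; [|exact: is_cvgZr|exact: is_cvgZr].
rewrite limD; [|exact: is_cvgZr|exact: is_cvgZr].
by rewrite !limZr//; apply: complex_ext; rewrite !cReIm.
Qed.

End power_series.

(** * The Legendre equation *)

Section legendre_uniqueness.
Context {R : realType}.
Implicit Types (f g : R -> R) (a b : R).

Lemma derive_ge0_le g g' a b : a <= b ->
  (forall z, a <= z <= b -> is_derive z 1 g (g' z)) ->
  (forall z, a <= z <= b -> 0 <= g' z) -> g a <= g b.
Proof.
rewrite le_eqVlt => /predU1P[->//|ab] dg g0.
have [||c cab E] := @MVT R g g' a b ab.
- by move=> z; rewrite in_itv/= => /andP[az zb]; apply: dg; rewrite !ltW.
- apply: derivable_within_continuous => z; rewrite in_itv/= => zab.
  by case: (dg z zab).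
rewrite -subr_ge0 E mulr_ge0 ?subr_ge0 ?(ltW ab)//.
by move: cab; rewrite in_itv/= => /andP[? ?]; apply: g0; rewrite !ltW.
Qed.

(** Integration of an inequality by monotonicity: [C / k.+1%:R * (z - 1) ^+ k.+1] plus or minus [f]
    has a nonnegative derivative and vanishes at 1. *)
Lemma derive_pow_bound f f' b (C : R) k :
  (forall z, 1 <= z <= b -> is_derive z 1 f (f' z)) -> f 1 = 0 ->
  (forall z, 1 <= z <= b -> `|f' z| <= C * (z - 1) ^+ k) ->
  forall z, 1 <= z <= b -> `|f z| <= C / k.+1%:R * (z - 1) ^+ k.+1.
Proof.
move=> df f1 bf z /andP[z1 zb].
pose p t : R := C / k.+1%:R * (t - 1) ^+ k.+1.
have dp (t : R) : is_derive t 1 p (C * (t - 1) ^+ k).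
  rewrite /p; rderive.
  by rewrite -[in RHS](@divfK _ k.+1%:R _ C) ?pnatr_eq0//; ring.
have p1 : p 1 = 0 by rewrite /p subrr expr0n mulr0.
have bb t : 1 <= t <= z -> - (C * (t - 1) ^+ k) <= f' t <= C * (t - 1) ^+ k.
  by move=> /andP[t1 tz]; rewrite -ler_norml; apply: bf; rewrite t1 (le_trans tz zb).
rewrite ler_norml; apply/andP; split.
  rewrite -subr_ge0 opprK -/(p z).
  have := @derive_ge0_le (f \+ p) (fun t => f' t + C * (t - 1) ^+ k) 1 z z1.
  rewrite /= f1 p1 addr0; apply => t tz.
    by apply: is_deriveD => //; apply: df; case/andP: tz => -> tz; rewrite (le_trans tz).
  by have := bb t tz; lra.
rewrite -subr_ge0 -/(p z).
have := @derive_ge0_le (p \- f) (fun t => C * (t - 1) ^+ k - f' t) 1 z z1.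
rewrite /= f1 p1 subr0; apply => t tz.
  by apply: is_deriveB => //; apply: df; case/andP: tz => -> tz; rewrite (le_trans tz).
by have := bb t tz; lra.
Qed.

Lemma continuous_bounded f a b :
  (forall z, a <= z <= b -> {for z, continuous f}) ->
  exists2 M : R, 0 <= M & forall z, a <= z <= b -> `|f z| <= M.
Proof.
move=> cf; have [ab|ba] := leP a b; last first.
  by exists 0 => // z /andP[az zb]; have := le_lt_trans (le_trans az zb) ba; rewrite ltxx.
have [|c _ cP] := @EVT_max _ (fun t => `|f t|) a b ab.
  apply: continuous_in_subspaceT => z; rewrite inE/= in_itv/= => zab.
  apply: continuous_comp; first exact: cf.
  exact: norm_continuous.
by exists `|f c| => // z zab; apply: cP; rewrite in_itv.
Qed.

(** The terms of an exponential series tend to 0; this ends the iteration in [legendre_unique]. *)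
Lemma exp_coeff_le0 (M x y : R) : (forall k, y <= M * (x ^+ k / k`!%:R)) -> y <= 0.
Proof.
move=> yk.
have c0 : (fun k => M * (x ^+ k / k`!%:R)) @ \oo --> (0 : R).
  rewrite -[X in _ --> X](mulr0 M); apply: cvgMl_tmp.
  exact: (cvg_series_cvg_0 (is_cvg_series_exp_coeff x)).
rewrite -(cvg_lim _ c0)//; apply: limr_ge; first by apply/cvg_ex; exists 0.
by apply: nearW.
Qed.

(** At the singular point 1 the equation reads [- 2 * D1 1 + lam * D 1 = 0], so the value there
    fixes the slope: [D 1 = 0] gives [D1 1 = 0]. A Picard iteration started at 1 then bounds [D] by
    the terms of an exponential series. *)
Lemma legendre_unique (lam : R[i]) (D D1 D2 : R -> R[i]) b :
  (forall z, 1 <= z < b -> [/\ is_cderive D z (D1 z), is_cderive D1 z (D2 z) &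
    (1 - z ^+ 2)%:C * D2 z - (2 * z)%:C * D1 z + lam * D z = 0]) ->
  D 1 = 0 -> forall z, 1 <= z < b -> D z = 0.
Proof.
move=> ode D0 y /andP[y1 yb].
have ode' z : 1 <= z <= y -> [/\ is_cderive D z (D1 z), is_cderive D1 z (D2 z) &
    (1 - z ^+ 2)%:C * D2 z - (2 * z)%:C * D1 z + lam * D z = 0].
  by move=> /andP[z1 zy]; apply: ode; rewrite z1 (le_lt_trans zy).
have D10 : D1 1 = 0.
  have [|_ _] := ode' 1; first by rewrite lexx.
  rewrite D0 expr1n subrr mulr1 mul0r mulr0 addr0 sub0r => /eqP.
  rewrite oppr_eq0 mulf_eq0 => /orP[|/eqP//].
  by rewrite (_ : 0 = 0%:C)// (inj_eq (@complexI R)) pnatr_eq0.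
have [M1 M10 M1P] := @continuous_bounded (fun t => Re (D t)) 1 y
  (fun z zy => (is_cderive_continuous (let: And3 h _ _ := ode' z zy in h)).1).
have [M2 M20 M2P] := @continuous_bounded (fun t => Im (D t)) 1 y
  (fun z zy => (is_cderive_continuous (let: And3 h _ _ := ode' z zy in h)).2).
pose M := M1 + M2.
(* If both parts of [D] have the same bound, both parts of [lam * D] have [L] times that bound. *)
pose L := `|Re lam| + `|Im lam|.
have L0 : 0 <= L by rewrite addr_ge0.
pose B k := M * (L ^+ k / k`!%:R).
have M0 : 0 <= M by rewrite addr_ge0.
have B0 k : 0 <= B k by rewrite mulr_ge0// mulr_ge0 ?invr_ge0 ?exprn_ge0.
have BS k : B k.+1 = L * B k / k.+1%:R.
  rewrite /B exprS factS natrM invfM; ring.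
have BE k : B k = M * (L ^+ k / k`!%:R) by [].
clearbody B.
(* [(1 - z^2) D' = - lam * \int_1^z D], so a bound [B_k (z - 1)^k] on [D]
   improves to [B_(k+1) (z - 1)^(k+1)]. *)
have main k z : 1 <= z <= y -> `|Re (D z)| <= B k * (z - 1) ^+ k /\
    `|Im (D z)| <= B k * (z - 1) ^+ k.
  elim: k z => [|k IH] z zy.
    have B0E : M <= B 0%N by rewrite BE expr0 fact0 divr1 mulr1.
    rewrite expr0 mulr1; split; apply: le_trans B0E; rewrite /M.
      by apply: le_trans (M1P z zy) _; rewrite lerDl.
    by apply: le_trans (M2P z zy) _; rewrite lerDr.
  pose u t : R[i] := (t ^+ 2 - 1)%:C * D1 t.
  have du t : 1 <= t <= y -> is_cderive u t (lam * D t).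
    move=> /ode'[_ dD1 E].
    have dsq : is_derive t 1 (fun s => s ^+ 2 - 1) (2 * t) by rderive; ring.
    apply: is_cderive_eq (is_cderiveM (is_cderive_real dsq) dD1) _.
    move: E; rewrite !rmorphB/= !rmorphM/= !rmorph1 rmorph_nat => E.
    apply/eqP; rewrite -subr_eq0 -oppr0 -E; apply/eqP; ring.
  have u1 : u 1 = 0 by rewrite /u expr1n subrr mul0r.
  have lamb t : 1 <= t <= y -> `|Re (lam * D t)| <= L * B k * (t - 1) ^+ k /\
      `|Im (lam * D t)| <= L * B k * (t - 1) ^+ k.
    move=> /IH[h1 h2]; rewrite !cReIm -[L * _ * _]mulrA /L !mulrDl; split.
      by apply: le_trans (ler_normB _ _) _; rewrite !normrM lerD// ler_wpM2l.
    by apply: le_trans (ler_normD _ _) _; rewrite !normrM lerD// ler_wpM2l.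
  have uR := derive_pow_bound (fun t ty => (du t ty).1) (congr1 (@complex.Re R) u1)
    (fun t ty => (lamb t ty).1).
  have uI := derive_pow_bound (fun t ty => (du t ty).2) (congr1 (@complex.Im R) u1)
    (fun t ty => (lamb t ty).2).
  (* Here [p] is the real or the imaginary part. Dividing by [t ^+ 2 - 1] loses one power of
     [t - 1], which the integration of [D1] regains; at [t = 1] the value [D1 1 = 0] replaces the
     division. *)
  have D1b (p : R[i] -> R) : (forall (a : R) w, p (a%:C * w) = a * p w) -> p 0 = 0 ->
      (forall t, 1 <= t <= y -> `|p (u t)| <= L * B k / k.+1%:R * (t - 1) ^+ k.+1) ->
      forall t, 1 <= t <= y -> `|p (D1 t)| <= B k.+1 * (t - 1) ^+ k.
    move=> pM p0 pu t ty; have /andP[t1 _] := ty; move: t1; rewrite le_eqVlt => /predU1P[<-|t1].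
      by rewrite D10 p0 normr0 mulr_ge0// exprn_ge0// subrr.
    have := pu t ty; rewrite /u pM normrM -BS.
    have -> : `|t ^+ 2 - 1| = (t - 1) * (t + 1).
      rewrite ger0_norm; first by ring.
      by rewrite subr_ge0 exprn_ege1// ltW.
    rewrite (_ : B k.+1 * (t - 1) ^+ k.+1 = (t - 1) * (B k.+1 * (t - 1) ^+ k)); last first.
      by rewrite exprS mulrCA.
    rewrite -mulrA ler_pM2l ?subr_gt0//; apply: le_trans.
    by rewrite ler_peMl// lerDr; lra.
  have ReZ (a : R) (w : R[i]) : Re (a%:C * w) = a * Re w by rewrite !cReIm mul0r subr0.
  have ImZ (a : R) (w : R[i]) : Im (a%:C * w) = a * Im w by rewrite !cReIm mul0r addr0.
  have D1R := D1b _ ReZ Re0 uR.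
  have D1I := D1b _ ImZ Im0 uI.
  have le2 t : 1 <= t <= y -> B k.+1 / k.+1%:R * (t - 1) ^+ k.+1 <= B k.+1 * (t - 1) ^+ k.+1.
    move=> /andP[t1 _]; apply: ler_wpM2r; first by rewrite exprn_ge0// subr_ge0.
    by rewrite ler_pdivrMr ?ltr0n// ler_peMr// ler1n.
  split; (apply: le_trans; last exact: le2).
    exact: (derive_pow_bound (fun t ty => (let: And3 h _ _ := ode' t ty in h).1)
      (congr1 (@complex.Re R) D0) D1R).
  exact: (derive_pow_bound (fun t ty => (let: And3 h _ _ := ode' t ty in h).2)
      (congr1 (@complex.Im R) D0) D1I).
have yy : 1 <= y <= y by rewrite y1 lexx.
have Bexp k : B k * (y - 1) ^+ k = M * ((L * (y - 1)) ^+ k / k`!%:R).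
  by rewrite BE exprMn; ring.
apply: complex_ext; apply/eqP; rewrite -normr_le0;
  apply: (@exp_coeff_le0 M (L * (y - 1))) => k; rewrite -Bexp; by case: (main k y yy).
Qed.

End legendre_uniqueness.

Section power_series_algebra.
Context {R : realType}.
Implicit Types (c d : nat -> R[i]) (r w : R) (z : R[i]).

Lemma radius_geD c d r : radius_ge c r -> radius_ge d r ->
  radius_ge (fun k => c k + d k) r.
Proof.
move=> cr dr s sr; have [M MP] := cr s sr; have [N NP] := dr s sr.
have s0 : 0 <= s by apply: ltW; case/andP: sr.
exists (M + N) => k; apply: le_trans (lerD (MP k) (NP k)); rewrite -mulrDl.
by rewrite ler_wpM2r ?exprn_ge0//; exact: le_normcD.
Qed.

Lemma radius_geZ z c r : radius_ge c r -> radius_ge (fun k => z * c k) r.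
Proof.
move=> cr s sr; have [M MP] := cr s sr.
by exists (normc z * M) => k; rewrite normcM -mulrA ler_wpM2l// normc_ge0.
Qed.

Lemma radius_ge_shift c r : radius_ge c r -> radius_ge (cshift c) r.
Proof.
move=> cr s sr; have [M MP] := cr s sr.
have s0 : 0 <= s by apply: ltW; case/andP: sr.
have M0 : 0 <= M by apply: le_trans (MP 0%N); rewrite mulr_ge0// ?normc_ge0.
exists (M * s) => -[|k] /=; first by rewrite expr0n/= addr0 sqrtr0 mul0r mulr_ge0.
by rewrite exprSr mulrA ler_wpM2r.
Qed.

Lemma cps_shift c r w : radius_ge c r -> `|w| < r ->
  cps (cshift c) w = w%:C * cps c w.
Proof.
move=> cr wr; have [h1 h2] := radius_ge_cvg cr wr.
have E (p : R[i] -> R) : p 0 = 0 -> cvgn (pseries (fun k => p (c k)) w) ->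
    limn (pseries (fun k => p (cshift c k)) w) = w * limn (pseries (fun k => p (c k)) w).
  move=> p0 cv; apply/cvg_lim => //; rewrite -cvg_shiftS.
  have -> : (fun n => pseries (fun k => p (cshift c k)) w n.+1) =
      (fun n => w * pseries (fun k => p (c k)) w n).
    apply/funext => n; rewrite /pseries /series/= big_nat_recl//= p0 mul0r add0r mulr_sumr.
    by apply: eq_bigr => i _; rewrite exprS mulrCA.
  exact: cvgMl_tmp.
rewrite /cps (E (@complex.Re R))// (E (@complex.Im R))//.
by apply: complex_ext; rewrite !cReIm !mul0r ?subr0 ?addr0.
Qed.

Lemma cps_at0 c : cps c 0 = c 0%N.
Proof.
have E (p : R[i] -> R) : limn (pseries (fun k => p (c k)) 0) = p (c 0%N).
  apply/cvg_lim => //; rewrite -cvg_shiftS.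
  have -> : (fun n => pseries (fun k => p (c k)) 0 n.+1) = (fun=> p (c 0%N)).
    apply/funext => n; rewrite /pseries /series/= big_nat_recl//= expr0 mulr1.
    by rewrite big1 ?addr0// => i _; rewrite exprS mul0r mulr0.
  exact: cvg_cst.
by rewrite /cps (E (@complex.Re R)) (E (@complex.Im R)); case: (c 0%N).
Qed.

Lemma eventually_nonincreasing_bounded (x : nat -> R) K :
  (forall k, 0 <= x k) -> (forall k, (K <= k)%N -> x k.+1 <= x k) ->
  exists M, forall k, x k <= M.
Proof.
move=> x0 xd; pose M k := \sum_(i < k.+1) x i.
have xM k : x k <= M k by rewrite /M big_ord_recr/= lerDr sumr_ge0.
exists (M K) => k; have [kK|Kk] := leqP k K.
  apply: (le_trans (xM k)); rewrite /M -!(big_mkord xpredT x).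
  by rewrite (@big_cat_nat _ _ _ k.+1 0 K.+1)//= lerDl sumr_ge0.
rewrite -(subnKC (ltnW Kk)); elim: (k - K)%N => [|n IH]; first by rewrite addn0.
by rewrite addnS (le_trans _ IH)// xd// leq_addr.
Qed.

End power_series_algebra.

(** * Gauss's hypergeometric equation with third parameter 1 *)

Section hypergeometric.
Context {R : realType}.
Implicit Types (a b z : R[i]) (r w : R).

Definition hyp_coef a b k : R[i] :=
  pochhammer a k * pochhammer b k / (pochhammer 1 k * (k`!)%:R).

Lemma pochhammerS a k : pochhammer a k.+1 = pochhammer a k * (a + k%:R).
Proof. by rewrite /pochhammer big_ord_recr. Qed.

Lemma pochhammer1 k : pochhammer (1 : R[i]) k = k`!%:R.
Proof.
elim: k => [|k IH]; first by rewrite /pochhammer big_ord0.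
by rewrite pochhammerS IH addrC natr1 factS natrM mulrC.
Qed.

Lemma hyp_coefS a b k :
  k.+1%:R ^+ 2 * hyp_coef a b k.+1 = (a + k%:R) * (b + k%:R) * hyp_coef a b k.
Proof.
rewrite /hyp_coef !pochhammerS !pochhammer1 factS natrM.
have k1 : (k.+1%:R : R[i]) != 0 by rewrite pnatr_eq0.
have kf : (k`!%:R : R[i]) != 0 by rewrite pnatr_eq0 -lt0n fact_gt0.
rewrite [1 + _]addrC natr1; move: (k.+1%:R : R[i]) k1 (k`!%:R : R[i]) kf => u u0 v v0.
by field; rewrite u0 v0.
Qed.

Lemma hyp_coef0 a b : hyp_coef a b 0 = 1.
Proof. by rewrite /hyp_coef /pochhammer !big_ord0 fact0 !mulr1 invr1 mulr1. Qed.

Lemma hyp2F1_series_cps a b w : hyp2F1_series a b 1 w = cps (hyp_coef a b) w.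
Proof.
have E1 : (fun k => Re (hyp2F1_term a b 1 w k)) = (fun k => Re (hyp_coef a b k) * w ^+ k).
  by apply/funext => k; rewrite /hyp2F1_term -/(hyp_coef a b k) !cReIm mulr0 subr0.
have E2 : (fun k => Im (hyp2F1_term a b 1 w k)) = (fun k => Im (hyp_coef a b k) * w ^+ k).
  by apply/funext => k; rewrite /hyp2F1_term -/(hyp_coef a b k) !cReIm mulr0 add0r.
by rewrite /hyp2F1_series E1 E2.
Qed.

Lemma normc_nat k : normc (k%:R : R[i]) = k%:R.
Proof. by rewrite -(rmorph_nat (real_complex R)) normc_real normr_nat. Qed.

(** Ratio test. With [n = k + 1] the ratio of consecutive coefficients is at most [1 + A / n], so
    the terms at radius [s] decrease once [s * A <= (1 - s) * n]. *)
Lemma hyp_coef_radius a b : radius_ge (hyp_coef a b) 1.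
Proof.
move=> s /andP[s0 s1].
pose A := normc a + normc b + normc a * normc b.
have [a0 b0] := (normc_ge0 a, normc_ge0 b).
have A0 : 0 <= A by rewrite !addr_ge0// mulr_ge0.
have [K KA] : exists K, s * A / (1 - s) <= K%:R.
  by exists (Num.truncn (s * A / (1 - s))).+1; apply/ltW/truncnS_gt.
apply: (@eventually_nonincreasing_bounded _ _ K) => k.
  by rewrite mulr_ge0 ?normc_ge0// exprn_ge0// ltW.
move=> Kk; pose n : R := k.+1%:R.
have n1 : 1 <= n by rewrite ler1n.
have n0 : 0 < n by lra.
have nA : s * A <= (1 - s) * n.
  rewrite [(1 - s) * n]mulrC -ler_pdivrMr ?subr_gt0//; apply: (le_trans KA).
  by rewrite ler_nat ltnW.
have cE : n ^+ 2 * normc (hyp_coef a b k.+1) =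
    normc (a + k%:R) * normc (b + k%:R) * normc (hyp_coef a b k).
  by have := congr1 (@normc R) (hyp_coefS a b k); rewrite !normcM normc_nat -expr2.
have kn : (k%:R : R) <= n by rewrite ler_nat.
have le1 z : normc (z + k%:R) <= normc z + n.
  by apply: (le_trans (le_normcD _ _)); rewrite lerD2l normc_nat.
have n2 : 0 < n ^+ 2 by rewrite exprn_gt0.
rewrite exprS mulrA -[leLHS](mulKf (lt0r_neq0 n2)) ler_pdivrMl// !mulrA ler_wpM2r ?exprn_ge0 ?(ltW s0)//.
rewrite cE mulrAC ler_wpM2r ?normc_ge0//.
apply: (@le_trans _ _ ((normc a + n) * (normc b + n) * s)).
  by rewrite ler_wpM2r ?ler_pM ?normc_ge0 ?(ltW s0)//; exact: le1.
have : s * A * n <= (1 - s) * n * n by rewrite ler_wpM2r// ltW.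
have : s * (normc a * normc b) <= s * (normc a * normc b) * n.
  by rewrite ler_peMr// mulr_ge0 ?(ltW s0)// mulr_ge0.
by rewrite /A expr2; nra.
Qed.

(** Once multiplication by [w] is written as [cshift], the k-th coefficient of the left side is the
    recurrence [hyp_coefS]. *)
Lemma hyp_ode a b r w : radius_ge (hyp_coef a b) r -> `|w| < r ->
  let c := hyp_coef a b in
  (w * (1 - w))%:C * cps (cdiffs (cdiffs c)) w +
  (1 - (a + b + 1) * w%:C) * cps (cdiffs c) w - a * b * cps c w = 0.
Proof.
move=> cr wr c.
have dr := radius_ge_diffs cr; have ddr := radius_ge_diffs dr.
have sd := radius_ge_shift dr; have sdd := radius_ge_shift ddr.
have ssdd := radius_ge_shift sdd.
transitivity (cps (fun k => 0 * c k) w); last by rewrite (cpsZ _ cr wr) mul0r.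
have -> : (fun k => 0 * c k) = (fun k => cshift (cdiffs (cdiffs c)) k +
  (-1 * cshift (cshift (cdiffs (cdiffs c))) k + (cdiffs c k +
    (- (a + b + 1) * cshift (cdiffs c) k + (- (a * b)) * c k)))).
  apply/funext => k; rewrite mul0r /cdiffs.
  case: k => [|k] /=.
    have := hyp_coefS a b 0; rewrite -/c expr1n => E.
    rewrite mul1r in E; rewrite E -/c; ring.
  have := hyp_coefS a b k.+1; rewrite -/c => E.
  (* The factor [k%:R] vanishes at [k = 0], exactly where the shifted sequence has its default value
     0. *)
  have -> : cshift (fun i => i.+1%:R * (i.+2%:R * c i.+2)) k = k%:R * (k.+1%:R * c k.+1).
    by case: k {E} => [|k] /=; rewrite ?mul0r.
  apply: esym; transitivity (k.+2%:R ^+ 2 * c k.+2 - (a + k.+1%:R) * (b + k.+1%:R) * c k.+1); last by rewrite E subrr.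
  by rewrite -[k.+2%:R]natr1 -[k.+1%:R]natr1; ring.
rewrite (cpsD (r := r))//; last by do 3 (apply: radius_geD; first by [|exact: radius_geZ]); exact: radius_geZ.
rewrite (cpsD (r := r))//; [|exact: radius_geZ|]; last first.
  by apply: radius_geD => //; apply: radius_geD; exact: radius_geZ.
rewrite (cpsD (r := r))//; last by apply: radius_geD; exact: radius_geZ.
rewrite (cpsD (r := r))//; [|exact: radius_geZ|exact: radius_geZ].
rewrite !(cpsZ _ (r := r))// !(cps_shift (r := r))//.
rewrite rmorphM rmorphB rmorph1/=; ring.
Qed.

End hypergeometric.

(** * The Legendre function from its two series *)

Section legendre_package.
Context {R : realType}.
Variable nu : R[i].
Implicit Types (w z y : R).

Let c := hyp_coef (- nu) (nu + 1).
(** Pfaff's transformation replaces the parameter [b = nu + 1] by [1 - b = - nu]. *)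
Let d := hyp_coef (- nu) (- nu).

Let cr : radius_ge c 1. Proof. exact: hyp_coef_radius. Qed.
Let dr : radius_ge d 1. Proof. exact: hyp_coef_radius. Qed.

Let half z := (1 - z) / 2.
Let P0 z := cps c (half z).
Let P1 z := (- 2^-1)%:C * cps (cdiffs c) (half z).
Let P2 z := (4^-1)%:C * cps (cdiffs (cdiffs c)) (half z).

Let dhalf z : is_derive z 1 half (- 2^-1).
Proof. by rewrite /half; rderive; ring. Qed.

Let half_lt1 z : -1 < z < 3 -> `|half z| < 1.
Proof. by move=> ?; rewrite /half ltr_norml; lra. Qed.

Let dP0 z : -1 < z < 3 -> is_cderive P0 z (P1 z).
Proof.
move=> /half_lt1 zz; apply: is_cderive_eq.
  exact: (is_cderive_comp (cps_derive cr zz) (dhalf z)).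
by rewrite mulrC.
Qed.

Let dP1 z : -1 < z < 3 -> is_cderive P1 z (P2 z).
Proof.
move=> /half_lt1 zz; apply: is_cderive_eq.
  apply: (is_cderiveM (is_cderive_cst _ _)).
  exact: (is_cderive_comp (cps_derive (radius_ge_diffs cr) zz) (dhalf z)).
rewrite /P2 mul0r add0r mulrCA -rmorphM/= mulrC; congr (_%:C * _); by field.
Qed.

Let dP2 z : -1 < z < 3 -> exists l, is_cderive P2 z l.
Proof.
move=> /half_lt1 zz; eexists; apply: (is_cderiveM (is_cderive_cst _ _)).
exact: (is_cderive_comp (cps_derive (radius_ge_diffs (radius_ge_diffs cr)) zz) (dhalf z)).
Qed.

Let odeP0 z : -1 < z < 3 ->
  (1 - z ^+ 2)%:C * P2 z - (2 * z)%:C * P1 z + nu * (nu + 1) * P0 z = 0.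
Proof.
move=> /half_lt1 zz; have := hyp_ode cr zz; rewrite /P0 /P1 /P2 /= -/c.
move: (cps _ _) (cps _ _) (cps _ _) => s2 s1 s0 E; rewrite -[RHS]E.
rewrite /half (_ : (1 - z) / 2 * (1 - (1 - z) / 2) = (1 - z ^+ 2) / 4); last by field.
rewrite !(rmorphM, rmorphXn, rmorphB, rmorphN, rmorph1, rmorph_nat, fmorphV)/=.
by move: (z%:C) => x; field.
Qed.

(** Pfaff's variable [w / (w - 1)] at [w = (1 - z) / 2]; it maps the whole half-line z > 0 into ]-1,
    1[. Below, [E0] is the prefactor, and [Q1], [Q2] are the derivatives of [Q0] computed by
    hand. *)
Let zeta z := (z - 1) / (z + 1).
Let E0 z := cpowR ((1 + z) / 2) nu.
Let D0 z := cps d (zeta z).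
Let D1 z := cps (cdiffs d) (zeta z).
Let D2 z := cps (cdiffs (cdiffs d)) (zeta z).
Let Q0 z := E0 z * D0 z.
Let Q1 z := E0 z * ((nu * (1 + z)^-1%:C) * D0 z + (2 * (1 + z) ^- 2)%:C * D1 z).
Let Q2 z := E0 z * (((nu ^+ 2 - nu) * ((1 + z) ^- 2)%:C) * D0 z +
  ((4 * nu - 4) * ((1 + z) ^- 3)%:C) * D1 z + (4 * (1 + z) ^- 4)%:C * D2 z).

Let zeta_lt1 z : 0 < z -> `|zeta z| < 1.
Proof.
move=> z0; rewrite /zeta normrM normfV ltr_pdivrMr ?normr_gt0 ?gt_eqF; [|lra|lra].
by rewrite mul1r (gtr0_norm (_ : 0 < z + 1)); [rewrite ltr_norml; lra|lra].
Qed.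

Let dzeta z : 0 < z -> is_derive z 1 zeta (2 * (1 + z) ^- 2).
Proof.
move=> z0; have z1 : z + 1 != 0 by rewrite gt_eqF; lra.
have z2 : 1 + z != 0 by rewrite gt_eqF; lra.
by rewrite /zeta; rderive; rewrite ?[1 + z]addrC; field.
Qed.

Let dE0 z : 0 < z -> is_cderive E0 z (E0 z * (nu * (1 + z)^-1%:C)).
Proof.
move=> z0; have z2 : 1 + z != 0 by rewrite gt_eqF; lra.
have y0 : 0 < (1 + z) / 2 by lra.
have dh : is_derive z 1 (fun z => (1 + z) / 2) (2^-1) by rderive; ring.
have dl a : is_derive z 1 (fun z => a * ln ((1 + z) / 2)) (a * (1 + z)^-1).
  have h := @is_derive1_comp _ _ _ z _ _ (is_derive1_ln y0) dh.
  apply: (is_derive1_eq (is_derive1M (is_derive1_cst _ _) h)); cbv beta.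
  by rewrite /GRing.scale/=; field.
have dexp := @is_derive1_comp _ _ _ z _ _ (is_derive_expR _) (dl (Re nu)).
have dcos := @is_derive1_comp _ _ _ z _ _ (is_derive_cos _) (dl (Im nu)).
have dsin := @is_derive1_comp _ _ _ z _ _ (is_derive_sin _) (dl (Im nu)).
have h1 := is_cderive_real dexp.
have h2 : is_cderive (fun z => cos (Im nu * ln ((1 + z) / 2)) +i* sin (Im nu * ln ((1 + z) / 2))) z
  ((- sin (Im nu * ln ((1 + z) / 2)) *: (Im nu * (1 + z)^-1)) +i*
   (cos (Im nu * ln ((1 + z) / 2)) *: (Im nu * (1 + z)^-1))) by split.
apply: (is_cderive_eq (is_cderiveM h1 h2)).
rewrite /E0 /cpowR /GRing.scale/=.
move: (expR _) (cos _) (sin _) ((1 + z)^-1) => e co si y.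
by case: nu => a b; apply/eqP; rewrite eq_complex /=; apply/andP; split; apply/eqP; ring.
Qed.

Let dD0 z : 0 < z -> is_cderive D0 z (D1 z * (2 * (1 + z) ^- 2)%:C).
Proof. by move=> z0; exact: (is_cderive_comp (cps_derive dr (zeta_lt1 z0)) (dzeta z0)). Qed.

Let dD1 z : 0 < z -> is_cderive D1 z (D2 z * (2 * (1 + z) ^- 2)%:C).
Proof.
move=> z0.
exact: (is_cderive_comp (cps_derive (radius_ge_diffs dr) (zeta_lt1 z0)) (dzeta z0)).
Qed.

Let dinvR z n : 0 < z ->
  is_derive z 1 (fun z => (1 + z) ^- n.+1) (- n.+1%:R * (1 + z) ^- n.+2).
Proof.
move=> z0; have z2 : 1 + z != 0 by rewrite gt_eqF; lra.
have zn : (1 + z) ^+ n.+1 != 0 by rewrite expf_neq0.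
by rderive; rewrite !exprS; field; rewrite ?z2 ?expf_neq0.
Qed.

Let dinv z n : 0 < z ->
  is_cderive (fun z => ((1 + z) ^- n.+1)%:C) z (- n.+1%:R * ((1 + z) ^- n.+2)%:C).
Proof.
move=> z0; apply: (is_cderive_eq (is_cderive_real (dinvR n z0))).
by rewrite rmorphM rmorphN rmorph_nat.
Qed.

Let dQ0 z : 0 < z -> is_cderive Q0 z (Q1 z).
Proof.
move=> z0; apply: (is_cderive_eq (is_cderiveM (dE0 z0) (dD0 z0))).
by rewrite /Q1; ring.
Qed.

Let dQ1 z : 0 < z -> is_cderive Q1 z (Q2 z).
Proof.
move=> z0; have z2 : 1 + z != 0 by rewrite gt_eqF; lra.
have dz1 : is_cderive (fun z => (1 + z)^-1%:C) z (- ((1 + z) ^- 2)%:C).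
  by have := dinv 0 z0; rewrite mulN1r; under eq_fun do rewrite expr1.
have dz2 : is_cderive (fun z => (2 * (1 + z) ^- 2)%:C) z (- 4 * ((1 + z) ^- 3)%:C).
  apply: (is_cderive_eq (is_cderive_real (is_derive1M (is_derive1_cst 2 z) (dinvR 1 z0)))).
  by rewrite !(rmorphD, rmorphM, rmorphN, rmorph_nat)/=; ring.
apply: is_cderive_eq.
  apply: is_cderiveM (dE0 z0) _; apply: is_cderiveD.
    by apply: is_cderiveM (dD0 z0); apply: is_cderiveM dz1; exact: is_cderive_cst.
  by apply: is_cderiveM (dD1 z0); exact: dz2.
rewrite /Q2 !(rmorphM, rmorphXn, fmorphV, rmorph_nat, rmorphD, rmorph1)/=.
have z2C : 1 + z%:C != 0 :> R[i].
  by rewrite -[1]/(1%:C) -rmorphD/= -[0]/(0%:C) (inj_eq (@complexI R)).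
by move: (z%:C) z2C (E0 z) (D0 z) (D1 z) (D2 z) => x x0 e e0 e1 e2; field.
Qed.

Let dQ2 z : 0 < z -> exists l, is_cderive Q2 z l.
Proof.
move=> z0; eexists; apply: is_cderiveM (dE0 z0) _; apply: is_cderiveD; last first.
  apply: is_cderiveM; last first.
    exact: (is_cderive_comp (cps_derive (radius_ge_diffs (radius_ge_diffs dr)) (zeta_lt1 z0)) (dzeta z0)).
  under eq_fun do rewrite rmorphM.
  apply: is_cderiveM (dinv 3 z0); exact: is_cderive_cst.
apply: is_cderiveD.
  apply: is_cderiveM (dD0 z0); apply: is_cderiveM (dinv 1 z0); exact: is_cderive_cst.
apply: is_cderiveM (dD1 z0); apply: is_cderiveM (dinv 2 z0); exact: is_cderive_cst.
Qed.

Let odeQ z : 0 < z ->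
  (1 - z ^+ 2)%:C * Q2 z - (2 * z)%:C * Q1 z + nu * (nu + 1) * Q0 z = 0.
Proof.
move=> z0; have := hyp_ode dr (zeta_lt1 z0); rewrite /Q0 /Q1 /Q2 /= -/d -/(D0 z) -/(D1 z) -/(D2 z).
have z2 : 1 + z != 0 by rewrite gt_eqF; lra.
have z2' : z + 1 != 0 by rewrite gt_eqF; lra.
rewrite (_ : zeta z * (1 - zeta z) = 2 * (z - 1) / (1 + z) ^+ 2); last first.
  by rewrite /zeta [1 + z]addrC; field.
rewrite /zeta [z + 1]addrC.
rewrite !(rmorphM, rmorphXn, fmorphV, rmorph_nat, rmorphD, rmorphB, rmorphN, rmorph1)/=.
have z2C : 1 + z%:C != 0 :> R[i].
  by rewrite -[1]/(1%:C) -rmorphD/= -[0]/(0%:C) (inj_eq (@complexI R)).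
move: (z%:C) z2C (E0 z) (D0 z) (D1 z) (D2 z) => x x0 e e0 e1 e2 E.
(* Legendre's expression for [Q0] is [- 2 * E0 / (1 + z)] times Gauss's expression for [D0] at
   [zeta z]. The factors that cancel make the 0 easy to single out in the next rewrite. *)
transitivity (- 2 * (1 + x)^-1 * (1 + x) * e * 0 * (1 + x)^-1 * 1); last by rewrite mulr0 !mul0r.
rewrite -[X in _ = _ * X * _ * _]E; field.
by [].
Qed.

(** Both functions solve Legendre's equation on [1, 3[ and take the value 1 at 1, so no
    transformation formula for the series has to be proved. *)
Let PQ z : 1 <= z < 3 -> P0 z = Q0 z.
Proof.
move=> z13; apply/eqP; rewrite -subr_eq0; apply/eqP.
apply: (@legendre_unique _ (nu * (nu + 1)) (fun z => P0 z - Q0 z)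
  (fun z => P1 z - Q1 z) (fun z => P2 z - Q2 z) 3) z13.
  move=> y y13; have y0 : 0 < y by case/andP: y13 => + _; exact: lt_le_trans.
  have y3 : -1 < y < 3 by case/andP: y13 => ? ->; rewrite andbT; lra.
  split; [exact: is_cderiveB (dP0 y3) (dQ0 y0)|exact: is_cderiveB (dP1 y3) (dQ1 y0)|].
  by rewrite -[RHS]subr0 -{1}(odeP0 y3) -(odeQ y0); ring.
rewrite /P0 /half /Q0 /D0 /zeta /E0 !subrr !mul0r !cps_at0 /c /d !hyp_coef0 mulr1.
rewrite (_ : (1 + 1) / 2 = 1 :> R); last by field.
by rewrite /cpowR ln1 !mulr0 expR0 cos0 sin0 mul1r subrr.
Qed.

(** The agreement on [1, 3[ passes to derivatives at interior points, hence the strict bound at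
    1. *)
Let PQ1 z : 1 < z < 3 -> P1 z = Q1 z.
Proof.
move=> /andP[z1 z3]; have z0 : 0 < z by lra.
apply: (@is_cderive_unique _ P0 z); first by apply: dP0; lra.
apply: near_eq_is_cderive (dQ0 z0).
near=> y; apply/esym/PQ; apply/andP; split; [apply/ltW|]; near: y.
  exact: lt_nbhsr.
exact: lt_nbhsl.
Unshelve. all: by end_near. Qed.

Let PQ2 z : 1 < z < 3 -> P2 z = Q2 z.
Proof.
move=> /andP[z1 z3]; have z0 : 0 < z by lra.
apply: (@is_cderive_unique _ P1 z); first by apply: dP1; lra.
apply: near_eq_is_cderive (dQ1 z0).
near=> y; apply/esym/PQ1; apply/andP; split; near: y.
  exact: lt_nbhsr.
exact: lt_nbhsl.
Unshelve. all: by end_near. Qed.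

Let legP_lt3 z : -1 < z < 3 -> legendreP nu z = P0 z.
Proof.
by move=> z3; rewrite /legendreP /hyp2F1 (half_lt1 z3) hyp2F1_series_cps.
Qed.

Let legP_gt1 z : 1 < z -> legendreP nu z = Q0 z.
Proof.
move=> z1; have [z3|z3] := ltP z 3.
  by rewrite legP_lt3 ?PQ//; lra.
rewrite /legendreP /hyp2F1 ifF; last first.
  by apply/negbTE; rewrite -leNgt ler_normr; apply/orP; right; lra.
have e1 : 1 - (1 - z) / 2 = (1 + z) / 2 by field.
have e2 : 1 - (nu + 1) = - nu by ring.
have e3 : (1 - z) / 2 / ((1 - z) / 2 - 1) = zeta z.
  have z2 : z + 1 != 0 by rewrite gt_eqF; lra.
  have z2' : (1 - z) / 2 - 1 != 0 by rewrite lt_eqF; lra.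
  by rewrite /zeta; apply/eqP; rewrite eqr_div//; apply/eqP; field.
by rewrite hyp2F1_series_cps e1 e2 e3 opprK.
Qed.

(* [P_nu] is given by different series on the two sides of [z = 3]; the Legendre
   equation, with the value at its singular point [z = 1], glues them. *)
Lemma legendreP_ode : exists k k2 : R -> R[i],
  [/\ legendreP nu 1 = 1,
      forall z, -1 < z -> is_cderive (legendreP nu) z (k z),
      forall z, -1 < z -> is_cderive k z (k2 z),
      forall z, -1 < z -> exists l, is_cderive k2 z l &
      forall z, -1 < z ->
        (1 - z ^+ 2)%:C * k2 z - (2 * z)%:C * k z + nu * (nu + 1) * legendreP nu z = 0].
Proof.
(* The switch at 2 lies inside ]1, 3[, where both branches agree; thus each point has a
   neighbourhood on which a single branch represents P. *)
pose k z := if z < 2 then P1 z else Q1 z.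
pose k2 z := if z < 2 then P2 z else Q2 z.
have kP z : z < 3 -> k z = P1 z.
  by move=> z3; rewrite /k; case: ltP => // z2; rewrite PQ1//; lra.
have kQ z : 1 < z -> k z = Q1 z.
  by move=> z1; rewrite /k; case: ltP => // z2; rewrite PQ1//; lra.
have k2P z : z < 3 -> k2 z = P2 z.
  by move=> z3; rewrite /k2; case: ltP => // z2; rewrite PQ2//; lra.
have k2Q z : 1 < z -> k2 z = Q2 z.
  by move=> z1; rewrite /k2; case: ltP => // z2; rewrite PQ2//; lra.
have near13 z : -1 < z < 2 -> \forall y \near z, -1 < y < 3.
  move=> /andP[z1 z2]; near=> y; apply/andP; split; near: y.
    exact: lt_nbhsr.
  by apply: lt_nbhsl; lra.
have near1 z : 2 <= z -> \forall y \near z, 1 < y.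
  by move=> z2; near=> y; near: y; apply: lt_nbhsr; lra.
exists k, k2; split.
- rewrite legP_lt3; last by lra.
  by rewrite /P0 /half subrr mul0r cps_at0 /c hyp_coef0.
- move=> z z1; case: (ltP z 2) => z2.
    have z3 : -1 < z < 3 by lra.
    have z4 : -1 < z < 2 by lra.
    rewrite kP; last by lra.
    apply: near_eq_is_cderive (dP0 z3).
    by apply: filterS (near13 z z4) => y y3; rewrite legP_lt3.
  rewrite kQ; last by lra.
  apply: near_eq_is_cderive (dQ0 (ltac:(lra) : 0 < z)).
  by apply: filterS (near1 z z2) => y y3; rewrite legP_gt1.
- move=> z z1; case: (ltP z 2) => z2.
    have z3 : -1 < z < 3 by lra.
    have z4 : -1 < z < 2 by lra.
    rewrite k2P; last by lra.
    apply: near_eq_is_cderive (dP1 z3).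
    by apply: filterS (near13 z z4) => y y3; rewrite kP//; case/andP: y3.
  rewrite k2Q; last by lra.
  apply: near_eq_is_cderive (dQ1 (ltac:(lra) : 0 < z)).
  by apply: filterS (near1 z z2) => y y3; rewrite kQ.
- move=> z z1; case: (ltP z 2) => z2.
    have z3 : -1 < z < 3 by lra.
    have z4 : -1 < z < 2 by lra.
    have [l dl] := dP2 z3; exists l.
    apply: near_eq_is_cderive dl.
    by apply: filterS (near13 z z4) => y y3; rewrite k2P//; case/andP: y3.
  have [l dl] := dQ2 (ltac:(lra) : 0 < z); exists l.
  apply: near_eq_is_cderive dl.
  by apply: filterS (near1 z z2) => y y3; rewrite k2Q.
- move=> z z1; case: (ltP z 2) => z2.
    by rewrite kP ?k2P ?legP_lt3 ?odeP0//; lra.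
  by rewrite kQ ?k2Q ?legP_gt1 ?odeQ//; lra.
Unshelve. all: by end_near. Qed.

End legendre_package.

(** * Complex Lebesgue integrals *)

Section cmeas.
Context d (T : measurableType d) {R : realType}.
Implicit Types (D : set T) (f g : T -> R[i]).

(** This is [cmeasurable] over an arbitrary measurable space, as Fubini's theorem needs it on the
    plane; on the line the two are convertible. *)
Definition cmeas D f :=
  measurable_fun D (fun x => Re (f x)) /\ measurable_fun D (fun x => Im (f x)).

Lemma cmeas_cst D z : cmeas D (fun=> z).
Proof. by split; exact: measurable_cst. Qed.

Lemma cmeas_real D (f : T -> R) : measurable_fun D f -> cmeas D (fun x => (f x)%:C).
Proof. by move=> mf; split => //; exact: measurable_cst. Qed.

Lemma cmeasD D f g : cmeas D f -> cmeas D g -> cmeas D (fun x => f x + g x).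
Proof.
move=> [f1 f2] [g1 g2]; split.
  by under eq_fun do rewrite cRe_add; exact: measurable_funD.
by under eq_fun do rewrite cIm_add; exact: measurable_funD.
Qed.

Lemma cmeasN D f : cmeas D f -> cmeas D (fun x => - f x).
Proof.
move=> [f1 f2]; split.
  by under eq_fun do rewrite cRe_opp; exact: measurable_funN.
by under eq_fun do rewrite cIm_opp; exact: measurable_funN.
Qed.

Lemma cmeasB D f g : cmeas D f -> cmeas D g -> cmeas D (fun x => f x - g x).
Proof. by move=> mf mg; apply: cmeasD => //; exact: cmeasN. Qed.

Lemma cmeasM D f g : cmeas D f -> cmeas D g -> cmeas D (fun x => f x * g x).
Proof.
move=> [f1 f2] [g1 g2]; split.
  under eq_fun do rewrite cRe_mul.
  by apply: measurable_funB; exact: measurable_funM.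
under eq_fun do rewrite cIm_mul.
by apply: measurable_funD; exact: measurable_funM.
Qed.

Lemma cmeas_conj D f : cmeas D f -> cmeas D (fun x => (f x)^*).
Proof.
move=> [f1 f2]; split.
  by under eq_fun do rewrite cRe_conj.
by under eq_fun do rewrite cIm_conj; exact: measurable_funN.
Qed.

Lemma cmeas_normc D f : cmeas D f -> measurable_fun D (fun x => normc (f x)).
Proof.
move=> [f1 f2].
have -> : (fun x => normc (f x)) = (@Num.sqrt R \o (fun x => Re (f x) ^+ 2 + Im (f x) ^+ 2)).
  by apply/funext => x /=; case: (f x).
apply: measurableT_comp; first exact: (continuous_measurable_fun (@sqrt_continuous R)).
by apply: measurable_funD; exact: measurable_funX.
Qed.

Lemma cmeasS D E f : measurable E -> D `<=` E -> cmeas E f -> cmeas D f.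
Proof. by move=> mE DE [f1 f2]; split; exact: (measurable_funS mE DE). Qed.

Lemma eq_cmeas D f g : {in D, f =1 g} -> cmeas D f -> cmeas D g.
Proof.
move=> fg [f1 f2]; split.
  by apply: eq_measurable_fun f1 => x xD; rewrite fg.
by apply: eq_measurable_fun f2 => x xD; rewrite fg.
Qed.

Definition cutoff D f : T -> R[i] := fun x => if x \in D then f x else 0.

Lemma cutoff_in D f x : x \in D -> cutoff D f x = f x.
Proof. by rewrite /cutoff => ->. Qed.

Lemma cutoff_notin D f x : x \notin D -> cutoff D f x = 0.
Proof. by rewrite /cutoff => /negbTE ->. Qed.

Lemma Re_cutoff D f : (fun x => Re (cutoff D f x)) = (fun x => Re (f x)) \_ D.
Proof. by apply/funext => x; rewrite /cutoff patchE; case: ifP. Qed.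

Lemma Im_cutoff D f : (fun x => Im (cutoff D f x)) = (fun x => Im (f x)) \_ D.
Proof. by apply/funext => x; rewrite /cutoff patchE; case: ifP. Qed.

Lemma cmeas_cutoff D f : measurable D -> cmeas D f <-> cmeas setT (cutoff D f).
Proof.
move=> mD; rewrite /cmeas Re_cutoff Im_cutoff.
by split => -[f1 f2]; split; apply/(measurable_restrictT _ mD).
Qed.

End cmeas.

Section measurable_arith.
Context {R : realType}.

Lemma measurable_inv : measurable_fun [set: R] (fun x => x^-1).
Proof.
(* The inverse is continuous off 0 only, where it takes the default value 0; a single point does not
   affect measurability. *)
have -> : [set: R] = [set x | x != 0] `|` [set 0].
  by apply/seteqP; split => // x _; have [->|] := eqVneq x 0; [right|left].
have o0 : open [set x : R | x != 0] by exact: open_neq.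
apply/measurable_funU => //; first exact: open_measurable.
split; last exact: measurable_fun_set1.
apply: open_continuous_measurable_fun => // x; rewrite inE/= => x0.
exact: inv_continuous.
Qed.

Lemma ccontinuous_cmeas (D : set R) (f : R -> R[i]) : open D ->
  (forall x, D x -> ccontinuous_at f x) -> cmeas D f.
Proof.
by move=> oD cf; split; apply: open_continuous_measurable_fun => // x /set_mem/cf[? ?].
Qed.

End measurable_arith.
Arguments measurable_inv {R}.

Section lebesgue_wrappers.
Context {R : realType}.
Local Notation mu := (@lebesgue_measure R).

Lemma ae_mono (P Q : R -> Prop) : (forall x, P x -> Q x) ->
  {ae mu, forall x, P x} -> {ae mu, forall x, Q x}.
Proof.
by move=> PQ; apply: filterS => //; exact: (ae_filter_ringOfSetsType mu).
Qed.

Lemma ae_and (P Q : R -> Prop) : {ae mu, forall x, P x} -> {ae mu, forall x, Q x} ->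
  {ae mu, forall x, P x /\ Q x}.
Proof.
by move=> aP aQ; apply: filterI => //; exact: (ae_filter_ringOfSetsType mu).
Qed.

Lemma ae_all (P : R -> Prop) : (forall x, P x) -> {ae mu, forall x, P x}.
Proof. by move=> aP; exact: aeW. Qed.

Lemma rintegrableS (D E : set R) (g : R -> R) : measurable E -> measurable D -> D `<=` E ->
  mu.-integrable E (fun x => (g x)%:E) -> mu.-integrable D (fun x => (g x)%:E).
Proof. exact: (@integrableS _ _ R mu E D). Qed.

Lemma rintegrable_mkcond (D : set R) (g : R -> R) : measurable D ->
  mu.-integrable D (fun x => (g x)%:E) <-> mu.-integrable setT (fun x => ((g \_ D) x)%:E).
Proof.
move=> mD.
have -> : (fun x => ((g \_ D) x)%:E) = (fun x => (g x)%:E) \_ D.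
  by apply/funext => x; rewrite !patchE; case: ifP.
exact: (@integrable_mkcond _ _ R mu D (fun x => (g x)%:E) mD).
Qed.

Lemma rintegrableZl (D : set R) (g : R -> R) (k : R) : measurable D ->
  mu.-integrable D (fun x => (g x)%:E) -> mu.-integrable D (fun x => (k * g x)%:E).
Proof. by move=> mD ig; under eq_fun do rewrite EFinM; exact: integrableZl. Qed.

Lemma rintegrableD (D : set R) (g h : R -> R) : measurable D ->
  mu.-integrable D (fun x => (g x)%:E) -> mu.-integrable D (fun x => (h x)%:E) ->
  mu.-integrable D (fun x => (g x + h x)%:E).
Proof. by move=> mD ig ih; under eq_fun do rewrite EFinD; exact: integrableD. Qed.

Lemma le_rintegrable (D : set R) (g h : R -> R) : measurable D -> measurable_fun D g ->
  mu.-integrable D (fun x => (h x)%:E) -> (forall x, D x -> `|g x| <= h x) ->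
  mu.-integrable D (fun x => (g x)%:E).
Proof.
move=> mD mg ih gh; apply: le_integrable ih => //; first exact/measurable_EFinP.
by move=> x Dx; rewrite /= lee_fin (le_trans (gh x Dx))// ler_norm.
Qed.

End lebesgue_wrappers.

Section cintegral.
Context {R : realType}.
Local Notation mu := (@lebesgue_measure R).
Implicit Types (D : set R) (f g : R -> R[i]).

Lemma Re_cintegral D f : Re (cintegral D f) = \int[mu]_(x in D) Re (f x).
Proof. by []. Qed.

Lemma Im_cintegral D f : Im (cintegral D f) = \int[mu]_(x in D) Im (f x).
Proof. by []. Qed.

Lemma cintegrable_norm D f : measurable D -> cintegrable D f ->
  mu.-integrable D (fun x => (normc (f x))%:E).
Proof.
move=> mD [i1 i2]; have [m1 m2] := (measurable_int _ i1, measurable_int _ i2).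
have mf : cmeas D f by split; apply/measurable_EFinP.
apply: (@le_integrable _ _ _ mu D mD _ (fun x => `|(Re (f x))%:E| + `|(Im (f x))%:E|)%E).
- by apply/measurable_EFinP; exact: cmeas_normc.
- move=> x Dx; rewrite [leRHS]/= lee_fin (ger0_norm (normc_ge0 _)).
  by rewrite ger0_norm ?addr_ge0//; exact: normc_le_ReIm.
- by apply: integrableD => //; exact: integrable_abse.
Qed.

Lemma le_cintegrable D f (g : R -> R) : measurable D -> cmeas D f ->
  mu.-integrable D (fun x => (g x)%:E) -> (forall x, D x -> normc (f x) <= g x) ->
  cintegrable D f.
Proof.
move=> mD [f1 f2] ig fg; split.
  apply: le_integrable ig => //; first exact/measurable_EFinP.
  move=> x Dx; rewrite lee_fin (le_trans (cRe_le_normc _))//.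
  by apply: (le_trans (fg x Dx)); exact: ler_norm.
apply: le_integrable ig => //; first exact/measurable_EFinP.
move=> x Dx; rewrite lee_fin (le_trans (cIm_le_normc _))//.
by apply: (le_trans (fg x Dx)); exact: ler_norm.
Qed.

Lemma cintegrable_meas D f : cintegrable D f -> cmeas D f.
Proof.
move=> [i1 i2]; have [m1 m2] := (measurable_int _ i1, measurable_int _ i2).
by split; apply/measurable_EFinP.
Qed.

Lemma cintegrableS D E f : measurable E -> measurable D -> D `<=` E ->
  cintegrable E f -> cintegrable D f.
Proof. by move=> mE mD DE [f1 f2]; split; exact: (rintegrableS mE mD DE). Qed.

Lemma cintegrableD D f g : measurable D -> cintegrable D f -> cintegrable D g ->
  cintegrable D (fun x => f x + g x).
Proof.
move=> mD [f1 f2] [g1 g2]; split.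
  by under eq_fun do rewrite cRe_add EFinD; exact: integrableD.
by under eq_fun do rewrite cIm_add EFinD; exact: integrableD.
Qed.

Lemma cintegrableN D f : measurable D -> cintegrable D f -> cintegrable D (fun x => - f x).
Proof.
move=> mD [f1 f2]; split.
  by under eq_fun do rewrite cRe_opp EFinN; exact: integrableN.
by under eq_fun do rewrite cIm_opp EFinN; exact: integrableN.
Qed.

Lemma cintegrableB D f g : measurable D -> cintegrable D f -> cintegrable D g ->
  cintegrable D (fun x => f x - g x).
Proof. by move=> mD fi gi; apply: cintegrableD => //; exact: cintegrableN. Qed.

Lemma cintegrable_bdM D f g (M : R) : measurable D -> cmeas D g ->
  (forall x, D x -> normc (g x) <= M) -> cintegrable D f ->
  cintegrable D (fun x => g x * f x).
Proof.
move=> mD mg gM fi; have nf := cintegrable_norm mD fi.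
apply: (@le_cintegrable _ _ (fun x => M * normc (f x))) => //.
- by apply: cmeasM => //; exact: cintegrable_meas.
- by under eq_fun do rewrite EFinM; exact: integrableZl.
- by move=> x Dx; rewrite normcM ler_wpM2r ?normc_ge0// gM.
Qed.

Lemma cintegrableZ D f z : measurable D -> cintegrable D f ->
  cintegrable D (fun x => z * f x).
Proof.
move=> mD fi; apply: (@cintegrable_bdM _ _ (fun=> z) (normc z)) => //.
Qed.

Lemma eq_cintegrable D f g : measurable D -> {in D, f =1 g} -> cintegrable D f -> cintegrable D g.
Proof.
move=> mD fg [f1 f2]; split.
  by apply: eq_integrable f1 => // x xD; rewrite fg.
by apply: eq_integrable f2 => // x xD; rewrite fg.
Qed.

Lemma eq_cintegral D f g : {in D, f =1 g} -> cintegral D f = cintegral D g.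
Proof. by move=> fg; congr (_ +i* _); apply: eq_Rintegral => x xD; rewrite fg. Qed.

Lemma cintegralD D f g : measurable D -> cintegrable D f -> cintegrable D g ->
  cintegral D (fun x => f x + g x) = cintegral D f + cintegral D g.
Proof.
move=> mD [f1 f2] [g1 g2]; apply: complex_ext; rewrite !cReIm ?Re_cintegral ?Im_cintegral.
  by rewrite -RintegralD//; apply: eq_Rintegral => x _; rewrite cRe_add.
by rewrite -RintegralD//; apply: eq_Rintegral => x _; rewrite cIm_add.
Qed.

Lemma cintegralZ D f z : measurable D -> cintegrable D f ->
  cintegral D (fun x => z * f x) = z * cintegral D f.
Proof.
move=> mD [f1 f2]; apply: complex_ext; rewrite ?cRe_mul ?cIm_mul !Re_cintegral !Im_cintegral.
  under eq_Rintegral do rewrite cRe_mul.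
  rewrite RintegralB//; first by rewrite !RintegralZl.
  - exact: rintegrableZl.
  - exact: rintegrableZl.
under eq_Rintegral do rewrite cIm_mul.
rewrite RintegralD//; first by rewrite !RintegralZl.
- exact: rintegrableZl.
- exact: rintegrableZl.
Qed.

Lemma cintegralN D f : measurable D -> cintegrable D f ->
  cintegral D (fun x => - f x) = - cintegral D f.
Proof.
move=> mD fi; rewrite -mulN1r -cintegralZ//.
by apply: eq_cintegral => x _; rewrite mulN1r.
Qed.

Lemma cintegralB D f g : measurable D -> cintegrable D f -> cintegrable D g ->
  cintegral D (fun x => f x - g x) = cintegral D f - cintegral D g.
Proof. by move=> mD fi gi; rewrite cintegralD ?cintegralN//; exact: cintegrableN. Qed.

(** The constant 2 is the price of estimating the real and imaginary parts separately; it reappears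
    in all later bounds. *)
Lemma normc_cintegral_le D f (g : R -> R) : measurable D -> cintegrable D f ->
  mu.-integrable D (fun x => (g x)%:E) -> (forall x, D x -> normc (f x) <= g x) ->
  normc (cintegral D f) <= 2 * \int[mu]_(x in D) g x.
Proof.
move=> mD fi gi fg; have [f1 f2] := fi.
apply: (le_trans (normc_le_ReIm _)); rewrite Re_cintegral Im_cintegral mulrDl mul1r.
apply: lerD.
  apply: (le_trans (@le_normr_Rintegral _ _ _ mu D (fun x => Re (f x)) mD f1)).
  apply: le_Rintegral => //; first exact: integrable_norm.
  by move=> x Dx; rewrite (le_trans (cRe_le_normc _))// fg.
apply: (le_trans (@le_normr_Rintegral _ _ _ mu D (fun x => Im (f x)) mD f2)).
apply: le_Rintegral => //; first exact: integrable_norm.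
by move=> x Dx; rewrite (le_trans (cIm_le_normc _))// fg.
Qed.

Lemma cintegral_setU D E f : measurable D -> measurable E -> cintegrable (D `|` E) f ->
  [disjoint D & E] -> cintegral (D `|` E) f = cintegral D f + cintegral E f.
Proof.
move=> mD mE [f1 f2] DE; apply: complex_ext; rewrite !cReIm ?Re_cintegral ?Im_cintegral; exact: Rintegral_setU.
Qed.

Lemma cintegral_conj D f : measurable D -> cintegrable D f ->
  cintegral D (fun x => (f x)^*) = (cintegral D f)^*.
Proof.
move=> mD [f1 f2]; apply: complex_ext; rewrite !cReIm ?Re_cintegral ?Im_cintegral.
  by apply: eq_Rintegral => x _; rewrite cRe_conj.
under eq_Rintegral do rewrite cIm_conj -mulN1r.
by rewrite RintegralZl// mulN1r.
Qed.

Lemma cintegrable_conj D f : measurable D -> cintegrable D f ->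
  cintegrable D (fun x => (f x)^*).
Proof.
move=> mD [f1 f2]; split.
  by under eq_fun do rewrite cRe_conj.
by under eq_fun do rewrite cIm_conj EFinN; exact: integrableN.
Qed.

Lemma cintegral_mkcond D f : cintegral D f = cintegral setT (cutoff D f).
Proof.
by rewrite /cintegral Re_cutoff Im_cutoff -!Rintegral_mkcond.
Qed.

Lemma cintegrable_mkcond D f : measurable D ->
  cintegrable D f <-> cintegrable setT (cutoff D f).
Proof.
move=> mD; rewrite /cintegrable (rintegrable_mkcond (fun x => Re (f x)) mD).
by rewrite (rintegrable_mkcond (fun x => Im (f x)) mD) -Re_cutoff -Im_cutoff.
Qed.

Lemma ae_eq_cintegral D f g : measurable D -> cmeas D f -> cmeas D g ->
  {ae mu, forall x, D x -> f x = g x} -> cintegral D f = cintegral D g.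
Proof.
move=> mD [f1 f2] [g1 g2] fg; congr (_ +i* _); congr fine; apply: ae_eq_integral => //.
- exact/measurable_EFinP.
- exact/measurable_EFinP.
- by apply: ae_mono fg => x h /h ->.
- exact/measurable_EFinP.
- exact/measurable_EFinP.
- by apply: ae_mono fg => x h /h ->.
Qed.

Lemma cintegral0 D : cintegral D (fun=> 0) = 0.
Proof. by apply: complex_ext; rewrite ?Re_cintegral ?Im_cintegral /Rintegral integral0. Qed.

End cintegral.

Section intervals.
Context {R : realType}.
Local Notation mu := (@lebesgue_measure R).
Implicit Types (D : set R) (f g : R -> R[i]) (a b x : R).

Lemma ae_neq a : {ae mu, forall y : R, y != a}.
Proof.
exists [set a]; split => //; first exact: lebesgue_measure_set1.
by move=> y /= /negP; rewrite negbK => /eqP.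
Qed.

Lemma integrable_add_point D a (g : R -> R) : measurable D ->
  mu.-integrable D (fun x => (g x)%:E) -> mu.-integrable (D `|` [set a]) (fun x => (g x)%:E).
Proof.
move=> mD ig; have [aD|aD] := pselect (D a).
  by have -> : D `|` [set a] = D by apply/seteqP; split => [x [//|->//]|x]; left.
have /integrableP[mg gi] := ig.
have mU : measurable_fun (D `|` [set a]) (fun x => (g x)%:E).
  by apply/measurable_funU => //; split => //; exact: measurable_fun_set1.
apply/integrableP; split => //.
rewrite ge0_integral_setU//=.
- by rewrite integral_set1 adde0.
- apply/measurable_EFinP; apply: measurableT_comp => //; exact/measurable_EFinP.
- by rewrite disj_set2E; apply/eqP/seteqP; split => // x [Dx xa]; apply: aD; rewrite -xa.
Qed.

Lemma cintegrable_add_point D a f : measurable D ->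
  cintegrable D f -> cintegrable (D `|` [set a]) f.
Proof.
move=> mD [f1 f2]; split.
  exact: (@integrable_add_point D a (fun x => Re (f x))).
exact: (@integrable_add_point D a (fun x => Im (f x))).
Qed.

Lemma cintegral_ae_dom D E f : measurable D -> measurable E -> cmeas D f -> cmeas E f ->
  {ae mu, forall x, D x <-> E x} -> cintegral D f = cintegral E f.
Proof.
move=> mD mE fD fE DE; rewrite cintegral_mkcond [RHS]cintegral_mkcond.
apply: ae_eq_cintegral => //; [exact: ((cmeas_cutoff f mD).1 fD)|exact: ((cmeas_cutoff f mE).1 fE)|].
by apply: ae_mono DE => x DEx _; rewrite /cutoff (_ : (x \in D) = (x \in E))//; apply/idP/idP; rewrite !inE => /DEx.
Qed.

(** Bridge between [loc_AC_derive], which integrates over closed intervals, and the triangle lemmas,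
    whose intervals are open. *)
Lemma cintegral_oo_cc a b f : cintegrable `]a, b[ f ->
  cintegral `]a, b[ f = cintegral `[a, b] f /\ cintegrable `[a, b] f.
Proof.
move=> fi; have [ab|ba] := leP a b; last first.
  by rewrite !set_itv_ge ?bnd_simp -?ltNge -?leNgt ?(ltW ba)// in fi *.
have cci : cintegrable `[a, b] f.
  have -> : `[a, b]%classic = `]a, b[%classic `|` [set a] `|` [set b].
    apply/seteqP; split => x /=; rewrite !in_itv/=.
      move=> /andP[]; rewrite le_eqVlt => /predU1P[->|ax]; first by left; right.
      by rewrite le_eqVlt => /predU1P[->|xb]; [right|left; left; rewrite ax].
    by move=> [[/andP[/ltW-> /ltW->]//|->]|->]; rewrite lexx ?ab.
  apply: cintegrable_add_point; first exact: measurableU.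
  exact: cintegrable_add_point.
split => //; apply: cintegral_ae_dom => //; [exact: cintegrable_meas|exact: cintegrable_meas|].
apply: ae_mono (ae_and (ae_neq a) (ae_neq b)) => x [xa xb].
rewrite /= !in_itv/=; split => /andP[h1 h2]; first by rewrite !ltW.
by rewrite !lt_neqAle h1 h2 xb eq_sym xa.
Qed.

Lemma cintegrable_cc_oo a b f : cintegrable `[a, b] f -> cintegrable `]a, b[ f.
Proof. by apply: cintegrableS => //; exact: subset_itv_oo_cc. Qed.

(** The upper bound is abstract so as to cover bounded intervals and half-lines; only the null set
    {x} is lost. *)
Lemma cintegral_split a x (b : itv_bound R) f : a <= x -> (BRight x <= b)%O ->
  cintegrable [set` Interval (BRight a) b] f ->
  [/\ cintegrable `]a, x[ f, cintegrable [set` Interval (BRight x) b] f &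
  cintegral [set` Interval (BRight a) b] f =
    cintegral `]a, x[ f + cintegral [set` Interval (BRight x) b] f].
Proof.
move=> ax xb fi.
have s1 : `]a, x[%classic `<=` [set` Interval (BRight a) b].
  by apply: subset_itvl; rewrite (le_trans _ xb)// bnd_simp.
have s2 : [set` Interval (BRight x) b] `<=` [set` Interval (BRight a) b].
  by apply: subset_itvr; rewrite bnd_simp.
have i1 : cintegrable `]a, x[ f by apply: cintegrableS s1 fi.
have i2 : cintegrable [set` Interval (BRight x) b] f by apply: cintegrableS s2 fi.
split => //; rewrite -cintegral_setU//; last 2 first.
- by apply: cintegrableS fi => //; [exact: measurableU|move=> y [/s1|/s2]].
- apply/disj_setPS => y [/=]; rewrite in_itv/= => /andP[_ yx].
  by rewrite itv_boundlr => /andP[+ _]; rewrite bnd_simp => /(lt_trans yx); rewrite ltxx.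
apply: cintegral_ae_dom => //.
- exact: measurableU.
- exact: cintegrable_meas.
- by apply: cmeasS (cintegrable_meas fi) => // y [/s1|/s2].
apply: ae_mono (ae_neq x) => y yx; split; last by move=> [/s1|/s2].
move=> yab; have : y \in Interval (BRight a) b by [].
rewrite itv_boundlr => /andP[h1 h2].
have [yx'|xy|yx'] := ltgtP y x.
- by left; rewrite /= in_itv/= yx' andbT; move: h1; rewrite bnd_simp.
- by right; rewrite /= itv_boundlr h2 andbT bnd_simp.
- by rewrite yx' eqxx in yx.
Qed.

Lemma ccontinuous_cintegrable a b f :
  (forall x, a <= x <= b -> ccontinuous_at f x) -> cintegrable `[a, b] f.
Proof.
move=> cf; split.
  apply: continuous_compact_integrable; first exact: segment_compact.
  apply: continuous_in_subspaceT => x; rewrite inE/= in_itv/= => /cf[cx _]; exact: cx.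
apply: continuous_compact_integrable; first exact: segment_compact.
apply: continuous_in_subspaceT => x; rewrite inE/= in_itv/= => /cf[_ cx]; exact: cx.
Qed.

Lemma cFTC2 (F f : R -> R[i]) a b : a <= b ->
  (forall x, a <= x <= b -> is_cderive F x (f x)) ->
  (forall x, a <= x <= b -> ccontinuous_at f x) ->
  cintegral `]a, b[ f = F b - F a.
Proof.
move=> ab dF cf.
have icc := ccontinuous_cintegrable cf.
have [-> _] := cintegral_oo_cc (cintegrable_cc_oo icc).
move: ab; rewrite le_eqVlt => /predU1P[->|ab].
  rewrite subrr; apply: complex_ext; rewrite ?Re_cintegral ?Im_cintegral set_itv1.
    by rewrite Rintegral_set1.
  by rewrite Rintegral_set1.
have H (p q : R -> R) : (forall x, a <= x <= b -> is_derive x 1 p (q x)) ->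
    (forall x, a <= x <= b -> {for x, continuous q}) ->
    \int[mu]_(x in `[a, b]) q x = p b - p a.
  move=> dp cq; rewrite /Rintegral (continuous_FTC2 (F := p))//.
  - by apply: continuous_in_subspaceT => x; rewrite inE/= in_itv/=; exact: cq.
  - have cp x : a <= x <= b -> {for x, continuous p}.
      by move=> /dp[dpx _]; apply: differentiable_continuous; apply/derivable1_diffP.
    split.
    + by move=> x; rewrite in_itv/= => /andP[? ?]; case: (dp x _) => //; rewrite !ltW.
    + by apply: cvg_at_right_filter; apply: cp; rewrite lexx ltW.
    + by apply: cvg_at_left_filter; apply: cp; rewrite lexx ltW.
  - move=> x; rewrite in_itv/= => /andP[/ltW ax /ltW xb]; rewrite derive1E.
    have xab : a <= x <= b by rewrite ax.
    by have [_ ->] := dp x xab.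
apply: complex_ext; rewrite ?Re_cintegral ?Im_cintegral ?cReIm.
  by apply: (H (fun x => Re (F x)) (fun x => Re (f x))) => x xab; [case: (dF x xab)|case: (cf x xab)].
by apply: (H (fun x => Im (F x)) (fun x => Im (f x))) => x xab; [case: (dF x xab)|case: (cf x xab)].
Qed.

End intervals.

(** * Fubini's theorem for real and complex integrands *)

Section fubini_real.
Context {R : realType}.
Local Notation mu := (@lebesgue_measure R).
Local Notation RT := (measurableTypeR R).
Local Open Scope ereal_scope.

(** A real integral is [fine] of an extended one, so an iterated real integral has a [fine] inside;
    being finite almost everywhere, the inner integral is not changed by it. *)
Lemma fine_integrable (F : R -> \bar R) : mu.-integrable setT F ->
  mu.-integrable setT (fun x => (fine (F x))%:E) /\
  \int[mu]_x (fine (F x))%:E = \int[mu]_x F x.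
Proof.
move=> iF; have mF := measurable_int _ iF.
have mf : measurable_fun setT (fun x : R => (fine (F x))%:E).
  by apply/measurable_EFinP; apply: measurableT_comp => //; exact: fine_measurable.
split.
  apply: le_integrable iF => // x _.
  by case: (F x) => [r| |] //=; rewrite normr0 leey.
apply: ae_eq_integral => //.
have := integrable_ae measurableT iF.
by apply: ae_mono => x h _; rewrite fineK// h.
Qed.

Lemma real_fubini (phi : RT * RT -> R) : measurable_fun setT phi ->
  \int[mu]_x \int[mu]_y `|(phi (x, y))%:E| < +oo ->
  [/\ mu.-integrable setT (fun x => (\int[mu]_y phi (x, y))%R%:E),
      mu.-integrable setT (fun y => (\int[mu]_x phi (x, y))%R%:E),
      {ae mu, forall x, mu.-integrable setT (fun y => (phi (x, y))%:E)},
      {ae mu, forall y, mu.-integrable setT (fun x => (phi (x, y))%:E)} &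
      (\int[mu]_x \int[mu]_y phi (x, y) = \int[mu]_y \int[mu]_x phi (x, y))%R].
Proof.
move=> mphi fin.
have mf : measurable_fun setT (EFin \o phi) by exact/measurable_EFinP.
have ip : (mu \x mu).-integrable setT (EFin \o phi).
  exact/(@integrable12ltyP _ _ RT RT R mu mu (EFin \o phi) mf).
have [i1 e1] := fine_integrable (integrable_fubini_F ip).
(* The other iterated integral is that of the function with its two coordinates exchanged. *)
have [i2 e2] : mu.-integrable setT (fun y : RT => (\int[mu]_x phi (x, y))%R%:E) /\
    \int[mu]_y (\int[mu]_x phi (x, y))%R%:E = \int[mu]_y \int[mu]_x (phi (x, y))%:E.
  have ms : measurable_fun setT (EFin \o (fun p : RT * RT => phi (p.2, p.1))).
    apply/measurable_EFinP; apply: (measurableT_comp mphi).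
    by apply: measurable_fun_pair; [exact: measurable_snd|exact: measurable_fst].
  have ips : (mu \x mu).-integrable setT (EFin \o (fun p : RT * RT => phi (p.2, p.1))).
    apply/(@integrable12ltyP _ _ RT RT R mu mu _ ms) => /=.
    exact: ((@integrable21ltyP _ _ RT RT R mu mu (EFin \o phi) mf).1 ip).
  exact: (fine_integrable (integrable_fubini_F ips)).
split; [exact: i1|exact: i2| | |].
- exact: (ae_integrable1 ip).
- exact: (ae_integrable2 ip).
- have := Fubini ip.
  by rewrite /Rintegral => e; congr fine; rewrite e1 e2.
Qed.

Lemma emeasurable_param_integral (f : RT * RT -> \bar R) : measurable_fun setT f ->
  measurable_fun setT (fun x => \int[mu]_y f (x, y)) /\
  measurable_fun setT (fun y => \int[mu]_x f (x, y)).
Proof.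
move=> mf; have mp := measurable_funepos mf; have mn := measurable_funeneg mf; split.
  have -> : (fun x => \int[mu]_y f (x, y)) =
      (fun x => \int[mu]_y f^\+ (x, y)) \- (fun x => \int[mu]_y f^\- (x, y)).
    apply/funext => x; rewrite [LHS]integralE.
    under eq_integral do rewrite funepos_comp/=.
    by under [X in _ - X = _]eq_integral do rewrite funeneg_comp/=.
  by apply: emeasurable_funB; apply: measurable_fun_fubini_tonelli_F.
have -> : (fun y => \int[mu]_x f (x, y)) =
    (fun y => \int[mu]_x f^\+ (x, y)) \- (fun y => \int[mu]_x f^\- (x, y)).
  apply/funext => y; rewrite [LHS]integralE.
  under eq_integral do rewrite (funepos_comp f (fun x => (x, y)))/=.
  by under [X in _ - X = _]eq_integral do rewrite (funeneg_comp f (fun x => (x, y)))/=.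
by apply: emeasurable_funB; apply: measurable_fun_fubini_tonelli_G.
Qed.

Lemma measurable_param_integral (phi : RT * RT -> R) : measurable_fun setT phi ->
  measurable_fun setT (fun x => \int[mu]_y phi (x, y))%R /\
  measurable_fun setT (fun y => \int[mu]_x phi (x, y))%R.
Proof.
move=> mphi; have mf : measurable_fun setT (EFin \o phi) by exact/measurable_EFinP.
have [m1 m2] := emeasurable_param_integral mf.
by split; [apply: (measurableT_comp _ m1)|apply: (measurableT_comp _ m2)]; exact: fine_measurable.
Qed.

End fubini_real.

Section fubini_complex.
Context {R : realType}.
Local Notation mu := (@lebesgue_measure R).
Local Notation RT := (measurableTypeR R).
Implicit Types Phi : RT * RT -> R[i].

Lemma complex_param_meas Phi : cmeas setT Phi ->
  cmeas setT (fun x => cintegral setT (fun y => Phi (x, y))) /\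
  cmeas setT (fun y => cintegral setT (fun x => Phi (x, y))).
Proof.
move=> [m1 m2].
have [r1 r2] := measurable_param_integral m1.
by have [s1 s2] := measurable_param_integral m2.
Qed.

Lemma complex_tonelli Phi : cmeas setT Phi ->
  (\int[mu]_x \int[mu]_y (normc (Phi (x, y)))%:E =
   \int[mu]_y \int[mu]_x (normc (Phi (x, y)))%:E)%E.
Proof.
move=> mPhi.
apply: (fubini_tonelli (fun p => (normc (Phi p))%:E)); last by move=> p; rewrite lee_fin normc_ge0.
by apply/measurable_EFinP; exact: cmeas_normc.
Qed.

Lemma complex_fubini Phi : cmeas setT Phi ->
  (\int[mu]_x \int[mu]_y (normc (Phi (x, y)))%:E < +oo)%E ->
  [/\ cintegrable setT (fun x => cintegral setT (fun y => Phi (x, y))),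
      cintegrable setT (fun y => cintegral setT (fun x => Phi (x, y))),
      {ae mu, forall x, cintegrable setT (fun y => Phi (x, y))},
      {ae mu, forall y, cintegrable setT (fun x => Phi (x, y))} &
      cintegral setT (fun x => cintegral setT (fun y => Phi (x, y))) =
      cintegral setT (fun y => cintegral setT (fun x => Phi (x, y)))].
Proof.
move=> mPhi fin; have [m1 m2] := mPhi.
have mN : measurable_fun setT (fun p => (normc (Phi p))%:E).
  by apply/measurable_EFinP; exact: cmeas_normc.
have le (phi : RT * RT -> R) : measurable_fun setT phi ->
    (forall p, `|phi p| <= normc (Phi p)) ->
    (\int[mu]_x \int[mu]_y `|(phi (x, y))%:E| < +oo)%E.
  move=> mphi le1; apply: le_lt_trans fin.
  have mA : measurable_fun setT (fun p => `|(phi p)%:E|%E).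
    by apply: measurableT_comp => //; exact/measurable_EFinP.
  apply: ge0_le_integral => //.
  - by move=> x _; apply: integral_ge0.
  - exact: (measurable_fun_fubini_tonelli_F (fun p => `|(phi p)%:E|%E)).
  - apply: (measurable_fun_fubini_tonelli_F (fun p => (normc (Phi p))%:E)) => //.
    by move=> p; rewrite lee_fin normc_ge0.
  - move=> x _; apply: ge0_le_integral => //.
    + exact: (measurableT_comp mA (measurable_pair1 x)).
    + exact: (measurableT_comp mN (measurable_pair1 x)).
    + by move=> y _; rewrite /= lee_fin.
have [a1 a2 a3 a4 a5] := real_fubini m1 (le _ m1 (fun p => cRe_le_normc _)).
have [b1 b2 b3 b4 b5] := real_fubini m2 (le _ m2 (fun p => cIm_le_normc _)).
split.
- by split; [exact: a1|exact: b1].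
- by split; [exact: a2|exact: b2].
- by apply: ae_mono (ae_and a3 b3) => x [? ?]; split.
- by apply: ae_mono (ae_and a4 b4) => x [? ?]; split.
- by apply: complex_ext; [exact: a5|exact: b5].
Qed.

End fubini_complex.

(** * Integrals over the triangle 0 < t < x *)

Section triangle.
Context {R : realType}.
Local Notation mu := (@lebesgue_measure R).
Local Notation RT := (measurableTypeR R).
Local Notation H := (@halfline R).
Local Notation I01 := (`]0, 1[%classic : set R).
Implicit Types q u v : R -> R[i].

Lemma halflineE (x : R) : H x = (0 < x).
Proof. by rewrite /halfline /= in_itv/= andbT. Qed.

Lemma measurable_halfline : measurable H.
Proof. exact: measurable_itv. Qed.

(* [q (t / x) * u t * v x] on the triangle [0 < t < x], and [0] elsewhere; the
   point of the plane is [(x, t)]. *)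
Definition tri q u v : RT * RT -> R[i] := fun p =>
  (\1_(`]0, +oo[%classic : set R) (p.1 - p.2))%:C *
  (cutoff I01 q (p.2 / p.1) * cutoff H u p.2 * cutoff H v p.1).

Lemma triE q u v x t : tri q u v (x, t) =
  if 0 < t < x then q (t / x) * u t * v x else 0.
Proof.
rewrite /tri /=; case: ifP => [/andP[t0 tx]|].
  have x0 : 0 < x by exact: lt_trans tx.
  rewrite indicE mem_set /= ?in_itv/= ?subr_gt0 ?tx// mul1r !cutoff_in//;
    rewrite inE ?halflineE//=.
  by rewrite in_itv/= divr_gt0// ltr_pdivrMr// mul1r.
have [t0|t0] := ltP 0 t.
  move=> /= tx; rewrite indicE memNset ?mul0r//= in_itv/= subr_gt0 tx//.
by move=> _; rewrite (@cutoff_notin _ _ _ _ u) ?mulr0 ?mul0r ?mulr0// notin_setE halflineE; apply/negP; rewrite -leNgt.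
Qed.

Lemma cmeas_tri q u v : cmeas I01 q -> cmeas H u -> cmeas H v -> cmeas setT (tri q u v).
Proof.
move=> mq mu' mv.
have m1 : measurable_fun [set: RT * RT] (fun p => p.1) by exact: measurable_fst.
have m2 : measurable_fun [set: RT * RT] (fun p => p.2) by exact: measurable_snd.
have cT (w : R -> R[i]) (s : RT * RT -> R) : cmeas setT w -> measurable_fun setT s ->
    cmeas setT (fun p => w (s p)).
  by move=> [w1 w2] ms; split; [exact: (measurableT_comp w1 ms)|exact: (measurableT_comp w2 ms)].
apply: cmeasM.
  apply: (cT (fun y => (\1_(`]0, +oo[%classic : set R) y)%:C) (fun p => p.1 - p.2)).
    by apply: cmeas_real; exact: measurable_indic.
  exact: measurable_funB.
apply: cmeasM; first apply: cmeasM.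
- apply: cT; first exact: ((cmeas_cutoff q (measurable_itv _)).1 mq).
  by apply: measurable_funM => //; exact: (measurableT_comp measurable_inv m1).
- by apply: cT => //; exact: ((cmeas_cutoff u measurable_halfline).1 mu').
- by apply: cT => //; exact: ((cmeas_cutoff v measurable_halfline).1 mv).
Qed.

Lemma tri_x_cutoff q u v x : 0 < x ->
  (fun t => tri q u v (x, t)) = cutoff `]0, x[ (fun t => q (t / x) * u t * v x).
Proof.
move=> x0; apply/funext => t; rewrite triE /cutoff.
by have -> : (t \in (`]0, x[%classic : set R)) = (0 < t < x) by apply/idP/idP; rewrite inE/= in_itv.
Qed.

Lemma tri_t_cutoff q u v t : 0 < t ->
  (fun x => tri q u v (x, t)) = cutoff `]t, +oo[ (fun x => q (t / x) * u t * v x).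
Proof.
move=> t0; apply/funext => x; rewrite triE /cutoff t0.
by have -> : (x \in (`]t, +oo[%classic : set R)) = (t < x) by apply/idP/idP; rewrite inE/= in_itv/= andbT.
Qed.

Lemma tri_0 q u v x t : x <= 0 \/ t <= 0 -> tri q u v (x, t) = 0.
Proof.
rewrite triE; case: ifP => // /andP[t0 tx] [|]; rewrite leNgt ?t0// (lt_trans t0 tx).
by [].
Qed.

Lemma tri_inner q u v :
  (fun x => cintegral setT (fun t => tri q u v (x, t))) =
  cutoff H (fun x => cintegral `]0, x[ (fun t => q (t / x) * u t * v x)).
Proof.
apply/funext => x; rewrite /cutoff; case: ifPn; rewrite ?inE ?notin_setE halflineE => x0.
  by rewrite tri_x_cutoff// -cintegral_mkcond.
rewrite -[RHS](@cintegral0 _ setT); apply: eq_cintegral => t _.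
by rewrite tri_0//; left; rewrite leNgt; exact/negP.
Qed.

Lemma tri_inner' q u v :
  (fun t => cintegral setT (fun x => tri q u v (x, t))) =
  cutoff H (fun t => cintegral `]t, +oo[ (fun x => q (t / x) * u t * v x)).
Proof.
apply/funext => t; rewrite /cutoff; case: ifPn; rewrite ?inE ?notin_setE halflineE => t0.
  by rewrite tri_t_cutoff// -cintegral_mkcond.
rewrite -[RHS](@cintegral0 _ setT); apply: eq_cintegral => x _.
by rewrite tri_0//; right; rewrite leNgt; exact/negP.
Qed.

Lemma cmeas_tri_inner q u v : cmeas I01 q -> cmeas H u -> cmeas H v ->
  cmeas H (fun x => cintegral `]0, x[ (fun t => q (t / x) * u t * v x)) /\
  cmeas H (fun t => cintegral `]t, +oo[ (fun x => q (t / x) * u t * v x)).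
Proof.
move=> mq mu' mv; have [] := complex_param_meas (cmeas_tri mq mu' mv).
rewrite tri_inner tri_inner' => h1 h2.
by split; [exact: ((cmeas_cutoff _ measurable_halfline).2 h1)|exact: ((cmeas_cutoff _ measurable_halfline).2 h2)].
Qed.

Lemma integral_normc_cutoff (D : set R) (f : R -> R[i]) :
  (\int[mu]_x (normc (cutoff D f x))%:E = \int[mu]_(x in D) (normc (f x))%:E)%E.
Proof.
rewrite [RHS]integral_mkcond; apply: eq_integral => x _.
by rewrite /cutoff patchE; case: ifP => // _; rewrite normc0.
Qed.

Lemma tri_norm q u v :
  (\int[mu]_x \int[mu]_t (normc (tri q u v (x, t)))%:E =
   \int[mu]_(x in H) \int[mu]_(t in `]0%R, x[) (normc (q (t / x) * u t * v x))%:E)%E.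
Proof.
rewrite [RHS]integral_mkcond; apply: eq_integral => x _; rewrite patchE.
case: ifPn; rewrite ?inE ?notin_setE halflineE => x0.
  have := tri_x_cutoff q u v x0 => /(congr1 (fun w => fun t => (normc (w t))%:E)) /= ->.
  exact: integral_normc_cutoff.
rewrite integral0_eq// => t _; rewrite tri_0 ?normc0//; left; rewrite leNgt; exact/negP.
Qed.

Lemma tri_norm' q u v :
  (\int[mu]_t \int[mu]_x (normc (tri q u v (x, t)))%:E =
   \int[mu]_(t in H) \int[mu]_(x in `]t, +oo[) (normc (q (t / x) * u t * v x))%:E)%E.
Proof.
rewrite [RHS]integral_mkcond; apply: eq_integral => t _; rewrite patchE.
case: ifPn; rewrite ?inE ?notin_setE halflineE => t0.
  have := tri_t_cutoff q u v t0 => /(congr1 (fun w => fun t => (normc (w t))%:E)) /= ->.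
  exact: integral_normc_cutoff.
rewrite integral0_eq// => x _; rewrite tri_0 ?normc0//; right; rewrite leNgt; exact/negP.
Qed.

Lemma tri_tonelli q u v : cmeas I01 q -> cmeas H u -> cmeas H v ->
  (\int[mu]_(x in H) \int[mu]_(t in `]0%R, x[) (normc (q (t / x) * u t * v x))%:E =
   \int[mu]_(t in H) \int[mu]_(x in `]t, +oo[) (normc (q (t / x) * u t * v x))%:E)%E.
Proof.
move=> mq mu' mv; rewrite -tri_norm -tri_norm'.
exact: (complex_tonelli (cmeas_tri mq mu' mv)).
Qed.

Lemma tri_fubini q u v : cmeas I01 q -> cmeas H u -> cmeas H v ->
  (\int[mu]_(x in H) \int[mu]_(t in `]0%R, x[) (normc (q (t / x) * u t * v x))%:E < +oo)%E ->
  [/\ cintegrable H (fun x => cintegral `]0, x[ (fun t => q (t / x) * u t * v x)),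
      cintegrable H (fun t => cintegral `]t, +oo[ (fun x => q (t / x) * u t * v x)),
      {ae mu, forall x, 0 < x -> cintegrable `]0, x[ (fun t => q (t / x) * u t * v x)},
      {ae mu, forall t, 0 < t -> cintegrable `]t, +oo[ (fun x => q (t / x) * u t * v x)} &
      cintegral H (fun x => cintegral `]0, x[ (fun t => q (t / x) * u t * v x)) =
      cintegral H (fun t => cintegral `]t, +oo[ (fun x => q (t / x) * u t * v x))].
Proof.
move=> mq mu' mv; rewrite -tri_norm => fin.
have [] := complex_fubini (cmeas_tri mq mu' mv) fin.
rewrite tri_inner tri_inner' => h1 h2 h3 h4 h5; split.
- exact: ((cintegrable_mkcond _ measurable_halfline).2 h1).
- exact: ((cintegrable_mkcond _ measurable_halfline).2 h2).
- apply: ae_mono h3 => x + x0; rewrite (tri_x_cutoff _ _ _ x0) => h.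
  exact: ((cintegrable_mkcond _ (measurable_itv _)).2 h).
- apply: ae_mono h4 => x + x0; rewrite (tri_t_cutoff _ _ _ x0) => h.
  exact: ((cintegrable_mkcond _ (measurable_itv _)).2 h).
- by rewrite cintegral_mkcond h5 -cintegral_mkcond.
Qed.

End triangle.

(** * Hardy's inequalities *)

Section exhaustion.
Context {R : realType}.
Local Notation mu := (@lebesgue_measure R).
Implicit Types (g : R -> R) (a x : R).

Local Notation RT := (measurableTypeR R).

(** Monotone convergence: it carries uniform bounds, obtained where the fundamental theorem of
    calculus applies, to a singular or infinite endpoint. *)
Lemma ge0_exhaust_le (F : (set RT)^nat) (g : RT -> R) (C : \bar R) : nondecreasing_seq F ->
  (forall i, measurable (F i)) -> measurable_fun (\bigcup_i F i) g ->
  (forall i x, F i x -> 0 <= g x) -> (forall i, (\int[mu]_(x in F i) (g x)%:E <= C)%E) ->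
  (\int[mu]_(x in \bigcup_i F i) (g x)%:E <= C)%E.
Proof.
move=> ndF mF mg g0 gC.
have mU : measurable (\bigcup_i F i) by exact: bigcup_measurable.
have cv : (\int[mu]_(x in F i) (g x)%:E)%E @[i --> \oo] --> (\int[mu]_(x in \bigcup_i F i) (g x)%:E)%E.
  refine (@ge0_nondecreasing_set_cvg_integral _ RT R F (fun x => (g x)%:E) mu ndF mF _ _).
    move=> i; apply/measurable_EFinP; apply: measurable_funS mg => //.
    exact: bigcup_sup.
  by move=> i x Fx; rewrite lee_fin; exact: g0 Fx.
rewrite -(cvg_lim _ cv)//; apply: lime_le; first by apply/cvg_ex; eexists; exact: cv.
exact: nearW.
Qed.

Local Notation Iv a b := ([set` Interval (BRight a) b] : set R).

Lemma ge0_exhaust_left (b : itv_bound R) g (C : \bar R) :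
  measurable_fun (Iv 0%R b) g -> (forall x, 0 < x -> 0 <= g x) ->
  (forall e, 0 < e -> (\int[mu]_(x in (Iv e b)) (g x)%:E <= C)%E) ->
  (\int[mu]_(x in (Iv 0%R b)) (g x)%:E <= C)%E.
Proof.
move=> mg g0 gC; pose F n : set R := Iv (n.+1%:R^-1) b.
have E : Iv 0 b = \bigcup_n F n.
  apply/seteqP; split => x.
    rewrite  /= itv_boundlr bnd_simp => /andP[x0 xb].
    exists (Num.truncn x^-1) => //; rewrite /F /= itv_boundlr xb andbT bnd_simp.
    rewrite -[ltRHS]invrK ltf_pV2 ?posrE ?invr_gt0 ?ltr0n//.
    by apply: truncnS_gt.
  move=> [n _]; rewrite /F /= !itv_boundlr !bnd_simp => /andP[+ ->].
  by rewrite andbT; apply: lt_trans; rewrite invr_gt0.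
rewrite E in mg *; apply: ge0_exhaust_le => //.
- move=> m n mn; apply/subsetPset/subset_itvr; rewrite bnd_simp.
  by rewrite lef_pV2 ?posrE ?ltr0n// ler_nat.
- by move=> i; exact: measurable_itv.
- by move=> i x; rewrite /F /= itv_boundlr bnd_simp => /andP[h _]; apply: g0; apply: lt_trans h; rewrite invr_gt0.
- by move=> i; apply: gC; rewrite invr_gt0.
Qed.

Lemma ge0_exhaust_right a g (C : \bar R) :
  measurable_fun (`]a, +oo[ : set R) g -> (forall x, a < x -> 0 <= g x) ->
  (forall X, a <= X -> (\int[mu]_(x in `]a, X[) (g x)%:E <= C)%E) ->
  (\int[mu]_(x in `]a, +oo[) (g x)%:E <= C)%E.
Proof.
move=> mg g0 gC; pose F n : set R := `]a, (a + n%:R)[%classic.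
have E : `]a, +oo[%classic = \bigcup_n F n.
  apply/seteqP; split => x.
    rewrite /= in_itv/= andbT => ax.
    exists (Num.truncn (x - a)).+1 => //; rewrite /F/= in_itv/= ax/= -ltrBlDl.
    by apply: truncnS_gt.
  by move=> [n _]; rewrite /F/= !in_itv/= => /andP[->].
rewrite E in mg *; apply: ge0_exhaust_le => //.
- move=> m n mn; apply/subsetPset/subset_itvl; rewrite bnd_simp.
  by rewrite lerD2l ler_nat.
- by move=> i; exact: measurable_itv.
- by move=> i x; rewrite /F/= in_itv/= => /andP[h _]; apply: g0.
- by move=> i; apply: gC; rewrite lerDl.
Qed.

Lemma rFTC2 (F f : R -> R) a b : a <= b ->
  (forall x, a <= x <= b -> is_derive x 1 F (f x)) ->
  (forall x, a <= x <= b -> {for x, continuous f}) ->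
  mu.-integrable `]a, b[ (fun x => (f x)%:E) /\ \int[mu]_(x in `]a, b[) f x = F b - F a.
Proof.
move=> ab dF cf.
have dF' x : a <= x <= b -> is_cderive (fun x => (F x)%:C) x (f x)%:C.
  by move=> xab; apply: is_cderive_real; exact: dF.
have cf' x : a <= x <= b -> ccontinuous_at (fun x => (f x)%:C) x.
  by move=> xab; split => /=; [exact: cf|exact: cst_continuous].
have [i1 _] := cintegrable_cc_oo (ccontinuous_cintegrable cf').
split; first exact: i1.
by have := congr1 (@complex.Re R) (cFTC2 ab dF' cf').
Qed.

Lemma derive_continuous (F : R -> R) x l : is_derive x 1 F l -> {for x, continuous F}.
Proof. by move=> [dF _]; apply: differentiable_continuous; apply/derivable1_diffP. Qed.

Lemma EFin_Rintegral (D : set R) (g : R -> R) : measurable D ->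
  mu.-integrable D (fun x => (g x)%:E) ->
  (\int[mu]_(x in D) (g x)%:E)%E = (\int[mu]_(x in D) g x)%:E.
Proof.
by move=> mD ig; rewrite /Rintegral fineK//; exact: integrable_fin_num.
Qed.

Lemma ge0_fin_integrable (D : set R) (g : R -> R) : measurable D -> measurable_fun D g ->
  (forall x, D x -> 0 <= g x) -> (\int[mu]_(x in D) (g x)%:E < +oo)%E ->
  mu.-integrable D (fun x => (g x)%:E).
Proof.
move=> mD mg g0 gf; apply/integrableP; split; first exact/measurable_EFinP.
rewrite (_ : (\int[mu]_(x in D) _)%E = (\int[mu]_(x in D) (g x)%:E)%E)//.
by apply: eq_integral => x; rewrite inE => Dx; rewrite /= ger0_norm// g0.
Qed.

Lemma continuous_open_meas (D : set R) g : open D -> (forall x, D x -> {for x, continuous g}) ->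
  measurable_fun D g.
Proof. by move=> oD cg; apply: open_continuous_measurable_fun => // x /set_mem/cg. Qed.

Lemma is_derive_sqrt x : 0 < x -> is_derive x 1 (fun t : R => Num.sqrt t) (2 * Num.sqrt x)^-1.
Proof. by move=> x0; exact: is_derive1_sqrt. Qed.

Lemma is_derive_sqrtV x : 0 < x ->
  is_derive x 1 (fun t : R => (Num.sqrt t)^-1) (- (2 * (x * Num.sqrt x))^-1).
Proof.
move=> x0; have s0 : 0 < Num.sqrt x by rewrite sqrtr_gt0.
apply: (is_derive1_eq (is_derive1V (lt0r_neq0 s0) (is_derive_sqrt x0))).
rewrite -{3}[x](sqr_sqrtr (ltW x0)).
by have := lt0r_neq0 s0; move: (Num.sqrt x) => s sn; field.
Qed.

Lemma sqrtV_continuous x : 0 < x -> {for x, continuous (fun t : R => (Num.sqrt t)^-1)}.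
Proof. by move=> x0; exact: derive_continuous (is_derive_sqrtV x0). Qed.

(** With [integral_xsqrtV], this controls the weights of Schur's test behind Hardy's inequalities;
    upper bounds are enough there. *)
Lemma integral_sqrtV x : 0 < x ->
  mu.-integrable `]0, x[ (fun t => ((Num.sqrt t)^-1)%:E) /\
  \int[mu]_(t in `]0, x[) (Num.sqrt t)^-1 <= 2 * Num.sqrt x.
Proof.
move=> x0.
have mg : measurable_fun (`]0, x[ : set R) (fun t : R => (Num.sqrt t)^-1).
  apply: continuous_open_meas; first exact: interval_open.
  by move=> t; rewrite /= in_itv/= => /andP[t0 _]; exact: sqrtV_continuous.
have le : (\int[mu]_(t in `]0%R, x[) ((Num.sqrt t)^-1)%:E <= (2 * Num.sqrt x)%:E)%E.
  apply: (@ge0_exhaust_left (BLeft x)) => // e e0; have [ex|xe] := leP e x; last first.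
    rewrite set_itv_ge ?integral_set0 ?lee_fin ?mulr_ge0 ?sqrtr_ge0//.
    by rewrite bnd_simp -leNgt ltW.
  have [||ig E] := @rFTC2 (fun t => 2 * Num.sqrt t) (fun t => (Num.sqrt t)^-1) e x ex.
  - move=> t /andP[et _]; have t0 : 0 < t by exact: lt_le_trans et.
    apply: (is_derive1_eq (is_derive1M (is_derive1_cst 2 t) (is_derive_sqrt t0))).
    have := lt0r_neq0 (ltac:(by rewrite sqrtr_gt0) : 0 < Num.sqrt t).
    by cbv beta; move: (Num.sqrt t) => s sn; field.
  - by move=> t /andP[et _]; apply: sqrtV_continuous; exact: lt_le_trans et.
  rewrite EFin_Rintegral// lee_fin E.
  by have := sqrtr_ge0 e; lra.
have ig : mu.-integrable `]0, x[ (fun t => ((Num.sqrt t)^-1)%:E).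
  apply: ge0_fin_integrable => //.
  by apply: (le_lt_trans le); rewrite ltry.
by split => //; rewrite -lee_fin -EFin_Rintegral.
Qed.

Lemma integral_xsqrtV x : 0 < x ->
  mu.-integrable `]x, +oo[ (fun t => ((t * Num.sqrt t)^-1)%:E) /\
  \int[mu]_(t in `]x, +oo[) (t * Num.sqrt t)^-1 <= 2 * (Num.sqrt x)^-1.
Proof.
move=> x0.
have cg t : 0 < t -> {for t, continuous (fun t : R => (t * Num.sqrt t)^-1)}.
  move=> t0; have s0 : t * Num.sqrt t != 0 by rewrite mulf_neq0 ?gt_eqF ?sqrtr_gt0.
  have d0 : is_derive t 1 (fun t : R => t * Num.sqrt t) _ := is_derive1M (is_derive1_id t) (is_derive_sqrt t0).
  exact: derive_continuous (@is_derive1V _ (fun t : R => t * Num.sqrt t) _ _ s0 d0).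
have mg : measurable_fun (`]x, +oo[ : set R) (fun t : R => (t * Num.sqrt t)^-1).
  apply: continuous_open_meas; first exact: interval_open.
  by move=> t; rewrite /= in_itv/= andbT => xt; apply: cg; exact: lt_trans xt.
have g0 t : x < t -> 0 <= (t * Num.sqrt t)^-1.
  by move=> xt; rewrite invr_ge0 mulr_ge0 ?sqrtr_ge0//; apply: ltW; exact: lt_trans xt.
have le : (\int[mu]_(t in `]x, +oo[) ((t * Num.sqrt t)^-1)%:E <= (2 * (Num.sqrt x)^-1)%:E)%E.
  apply: ge0_exhaust_right => // X xX.
  have [||ig E] := @rFTC2 (fun t => - 2 * (Num.sqrt t)^-1) (fun t => (t * Num.sqrt t)^-1) x X xX.
  - move=> t /andP[et _]; have t0 : 0 < t by exact: lt_le_trans et.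
    apply: (is_derive1_eq (is_derive1M (is_derive1_cst (- 2) t) (is_derive_sqrtV t0))).
    have := lt0r_neq0 (ltac:(by rewrite sqrtr_gt0) : 0 < Num.sqrt t).
    by cbv beta; move: (Num.sqrt t) => s sn; field; rewrite sn gt_eqF.
  - by move=> t /andP[et _]; apply: cg; exact: lt_le_trans et.
  rewrite EFin_Rintegral// lee_fin E.
  have : 0 <= (Num.sqrt X)^-1 by rewrite invr_ge0 sqrtr_ge0.
  by lra.
have ig : mu.-integrable `]x, +oo[ (fun t => ((t * Num.sqrt t)^-1)%:E).
  apply: ge0_fin_integrable => //.
    by move=> t; rewrite /= in_itv/= andbT; exact: g0.
  by apply: (le_lt_trans le); rewrite ltry.
by split => //; rewrite -lee_fin -EFin_Rintegral.
Qed.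

(** The right side is smallest where its two terms balance, but testing at [l = s / p] already gives
    the claim. *)
Lemma discriminant_le (s p B : R) : 0 < s -> 0 <= p -> 0 <= B ->
  (forall l, 0 < l -> 2 * s <= l * p + B / l) -> s ^+ 2 <= p * B.
Proof.
move=> s0 p0 B0 h; have [pz|pp] := eqVneq p 0.
  (* If [p = 0], a large [l] contradicts the assumption: [2 * s] would be at most
     [s * B / (B + 1)]. *)
  have l0 : 0 < (B + 1) / s by rewrite divr_gt0// ltr_wpDl.
  have := h _ l0; rewrite pz mulr0 add0r invf_div mulrA ler_pdivlMr; last lra.
  by nra.
have p1 : 0 < p by rewrite lt_def pp.
have := h (s / p) (divr_gt0 s0 p1); rewrite divfK// invf_div mulrA => h1.
have : s <= B * p / s by lra.
by rewrite ler_pdivlMr// [B * p]mulrC expr2.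
Qed.

(* Integrate [2 m <= l w m^2 + wi / l] and optimize over [l > 0]. *)
Lemma cauchy_schwarz_weight (D : set R) (m w wi : R -> R) : measurable D ->
  measurable_fun D m -> (forall t, D t -> 0 <= m t) ->
  (forall t, D t -> 0 < w t) -> (forall t, D t -> wi t = (w t)^-1) ->
  mu.-integrable D (fun t => (wi t)%:E) ->
  mu.-integrable D (fun t => (w t * m t ^+ 2)%:E) ->
  mu.-integrable D (fun t => (m t)%:E) /\
  (\int[mu]_(t in D) m t) ^+ 2 <= (\int[mu]_(t in D) wi t) * \int[mu]_(t in D) (w t * m t ^+ 2).
Proof.
move=> mD mm m0 w0 wiE iwi iwm.
have key t l : D t -> 0 < l -> 2 * m t <= l * wi t + l^-1 * (w t * m t ^+ 2).
  move=> Dt l0; have wt := w0 t Dt; rewrite wiE//.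
  have : 0 <= (l - w t * m t) ^+ 2 / (l * w t).
    by rewrite divr_ge0 ?sqr_ge0// mulr_ge0 ?ltW.
  rewrite (_ : _ / _ = l * (w t)^-1 + l^-1 * (w t * m t ^+ 2) - 2 * m t); first by lra.
  by field; rewrite !gt_eqF.
have im : mu.-integrable D (fun t => (m t)%:E).
  apply: (@le_rintegrable _ _ _ (fun t => wi t + w t * m t ^+ 2)) => //.
    exact: rintegrableD.
  move=> t Dt; rewrite ger0_norm ?m0//.
  have := key t 1 Dt ltr01; rewrite invr1 !mul1r; have := m0 t Dt; lra.
split => //; set s := \int[mu]_(t in D) m t.
have s0 : 0 <= s by apply: Rintegral_ge0.
have p0 : 0 <= \int[mu]_(t in D) wi t.
  by apply: Rintegral_ge0 => t Dt; rewrite wiE// invr_ge0 ltW// w0.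
have B0 : 0 <= \int[mu]_(t in D) (w t * m t ^+ 2).
  by apply: Rintegral_ge0 => t Dt; rewrite mulr_ge0 ?sqr_ge0// ltW// w0.
have [->|sn] := eqVneq s 0; first by rewrite expr0n mulr_ge0.
apply: discriminant_le => //; first by rewrite lt_def sn.
move=> l l0; rewrite [_ / l]mulrC /s -!RintegralZl//.
rewrite -RintegralD//; [|exact: rintegrableZl|exact: rintegrableZl].
apply: le_Rintegral => //; first exact: rintegrableZl.
  by apply: rintegrableD => //; exact: rintegrableZl.
by move=> t Dt; exact: key.
Qed.

End exhaustion.

(** * The space L_2(0, oo) *)

Section L2.
Context {R : realType}.
Local Notation mu := (@lebesgue_measure R).
Local Notation H := (@halfline R).
Implicit Types (f g : R -> R[i]).

Lemma ge0_le_Lint (D : set R) (f g : R -> R) : measurable D ->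
  measurable_fun D f -> measurable_fun D g -> (forall x, D x -> 0 <= f x <= g x) ->
  (\int[mu]_(x in D) (f x)%:E <= \int[mu]_(x in D) (g x)%:E)%E.
Proof.
move=> mD mf mg fg; apply: ge0_le_integral => //.
- by move=> x /fg /andP[]; rewrite lee_fin.
- exact/measurable_EFinP.
- exact/measurable_EFinP.
- by move=> x /fg /andP[]; rewrite lee_fin.
Qed.

Lemma measurable_normc_sqr (D : set R) f : cmeas D f -> measurable_fun D (fun x => normc (f x) ^+ 2).
Proof. by move=> /cmeas_normc h; apply: measurable_funX. Qed.

Lemma L2sq_ge0 f : (0 <= L2sq f)%E.
Proof. by apply: integral_ge0 => x _; rewrite lee_fin sqr_ge0. Qed.

Lemma eq_L2sq f g : (forall x, 0 < x -> f x = g x) -> L2sq f = L2sq g.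
Proof.
by move=> fg; apply: eq_integral => x /set_mem; rewrite halflineE => x0; rewrite fg.
Qed.

Lemma ae_eq_L2sq f g : cmeas H f -> cmeas H g ->
  {ae mu, forall x, 0 < x -> f x = g x} -> L2sq f = L2sq g.
Proof.
move=> mf mg fg; apply: ae_eq_integral => //.
- exact: measurable_halfline.
- by apply/measurable_EFinP; exact: measurable_normc_sqr.
- by apply/measurable_EFinP; exact: measurable_normc_sqr.
- by apply: ae_mono fg => x; rewrite /= halflineE => fg /fg ->.
Qed.

Lemma L2sqZ z f : cmeas H f -> L2sq (fun x => z * f x) = ((normc z ^+ 2)%:E * L2sq f)%E.
Proof.
move=> mf; rewrite /L2sq -ge0_integralZl//.
- by apply: eq_integral => x _; rewrite normcM exprMn EFinM.
- exact: measurable_halfline.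
- by apply/measurable_EFinP; exact: measurable_normc_sqr.
- by move=> x _; rewrite lee_fin sqr_ge0.
- by rewrite lee_fin sqr_ge0.
Qed.

(** From [(a + b) ^+ 2 <= 2 * a ^+ 2 + 2 * b ^+ 2]; this plays the part of Minkowski's inequality
    and avoids square roots of extended reals. *)
Lemma L2sqD_le f g : cmeas H f -> cmeas H g ->
  (L2sq (fun x => f x + g x)%R <= 2%:E * L2sq f + 2%:E * L2sq g)%E.
Proof.
move=> mf mg; have mf2 := measurable_normc_sqr mf; have mg2 := measurable_normc_sqr mg.
have mH := @measurable_halfline R.
rewrite /L2sq -!ge0_integralZl//; try by [apply/measurable_EFinP|move=> x _; rewrite lee_fin sqr_ge0].
rewrite -ge0_integralD//; try by [move=> x _; rewrite -EFinM lee_fin mulr_ge0// sqr_ge0|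
  apply/measurable_EFinP; apply: measurable_funM].
apply: ge0_le_Lint => //.
- by apply: measurable_normc_sqr; exact: cmeasD.
- by apply: measurable_funD; apply: measurable_funM.
- move=> x _; rewrite sqr_ge0/=.
  have h := le_normcD (f x) (g x).
  apply: (@le_trans _ _ ((normc (f x) + normc (g x)) ^+ 2)).
    by rewrite lerXn2r// ?nnegrE ?addr_ge0// normc_ge0.
  have := sqr_ge0 (normc (f x) - normc (g x)).
  by move: (normc _) (normc _) => a b; nra.
Qed.

Lemma inL2D f g : inL2 f -> inL2 g -> inL2 (fun x => f x + g x).
Proof.
move=> [mf ff] [mg fg]; split; first exact: cmeasD.
by apply: (le_lt_trans (L2sqD_le mf mg)); rewrite lte_add_pinfty// lte_mul_pinfty ?L2sq_ge0.
Qed.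

Lemma L2sqN f : L2sq (fun x => - f x) = L2sq f.
Proof.
by apply: eq_integral => x _; rewrite !normcE2 !(cRe_opp, cIm_opp) !sqrrN.
Qed.

Lemma inL2N f : inL2 f -> inL2 (fun x => - f x).
Proof. by move=> [mf ff]; split; [exact: cmeasN|rewrite L2sqN]. Qed.

Lemma inL2B f g : inL2 f -> inL2 g -> inL2 (fun x => f x - g x).
Proof. by move=> hf hg; apply: inL2D => //; exact: inL2N. Qed.

Lemma L2sqB_le f g : cmeas H f -> cmeas H g ->
  (L2sq (fun x => f x - g x)%R <= 2%:E * L2sq f + 2%:E * L2sq g)%E.
Proof. by move=> mf mg; rewrite -(L2sqN g); apply: L2sqD_le => //; exact: cmeasN. Qed.

Lemma inL2_sqr_integrable f : inL2 f -> mu.-integrable H (fun x => (normc (f x) ^+ 2)%:E).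
Proof.
move=> [mf ff]; apply: ge0_fin_integrable => //.
- exact: measurable_halfline.
- exact: measurable_normc_sqr.
- by move=> x _; exact: sqr_ge0.
Qed.

Lemma inL2_mul_integrable f g : inL2 f -> inL2 g -> cintegrable H (fun x => f x * g x).
Proof.
move=> hf hg; have mH := @measurable_halfline R.
apply: (@le_cintegrable _ _ _ (fun x => normc (f x) ^+ 2 + normc (g x) ^+ 2)) => //.
- by apply: cmeasM; [exact: hf.1|exact: hg.1].
- by apply: rintegrableD => //; exact: inL2_sqr_integrable.
- move=> x _; rewrite normcM; have := sqr_ge0 (normc (f x) - normc (g x)).
  have := mulr_ge0 (normc_ge0 (f x)) (normc_ge0 (g x)).
  by move: (normc _) (normc _) => a b; nra.
Qed.

Lemma inL2_conj f : inL2 f -> inL2 (fun x => (f x)^*).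
Proof.
move=> [mf ff]; split; first exact: cmeas_conj.
by rewrite /L2sq; under eq_integral do rewrite normc_conj.
Qed.

Lemma L2sq_eq0 f : cmeas H f -> L2sq f = 0%E -> {ae mu, forall x, 0 < x -> f x = 0}.
Proof.
move=> mf f0.
have := (@ae_eq_integral_abs _ _ R mu H (@measurable_halfline R) (fun x => (normc (f x) ^+ 2)%:E)
   ((measurable_EFinP _ _).2 (measurable_normc_sqr mf))).1.
rewrite (_ : (\int[mu]_(x in H) _)%E = L2sq f); last first.
  by apply: eq_integral => x _; rewrite /= ger0_norm// sqr_ge0.
move=> /(_ f0); apply: ae_mono => x; rewrite /= halflineE => h /h.
by move=> /eqP; rewrite eqe sqrf_eq0 => /eqP/eq0_normc.
Qed.

Lemma inL2_bounded_support f a b (M : R) : cmeas H f -> (forall x, normc (f x) <= M) ->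
  (forall x, ~~ (a < x < b) -> f x = 0) -> inL2 f.
Proof.
move=> mf fM f0; split => //.
have M0 : 0 <= M by apply: le_trans (fM 0); exact: normc_ge0.
have mI : measurable (`]a, b[ : set R) by exact: measurable_itv.
apply: (@le_lt_trans _ _ (\int[mu]_(x in `]a, b[) (M ^+ 2)%:E)%E).
  rewrite /L2sq integral_mkcond [leRHS]integral_mkcond.
  apply: ge0_le_integral => //.
  - by move=> x _; rewrite erestrict_ge0// => y _; rewrite lee_fin sqr_ge0.
  - apply: (measurable_restrictT _ (@measurable_halfline R)).1.
    by apply/measurable_EFinP; exact: measurable_normc_sqr.
  - by apply: (measurable_restrictT _ mI).1; exact: measurable_cst.
  - move=> x _; rewrite !patchE; have [xab|xab] := boolP (a < x < b).
      rewrite [x \in `]a, b[%classic]mem_set//.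
      case: ifP => _; rewrite ?lee_fin ?sqr_ge0//.
      by rewrite lerXn2r// nnegrE normc_ge0.
    rewrite [x \in `]a, b[%classic]memNset/=; last by rewrite in_itv/=; exact/negP.
    by case: ifP => // _; rewrite f0// normc0 expr0n.
rewrite integral_cst//= lebesgue_measure_itv/=.
by case: ifPn => _; rewrite -?EFinB -?EFinM ?ltry// mule0 ltry.
Qed.

End L2.

Section hardy.
Context {R : realType}.
Local Notation mu := (@lebesgue_measure R).
Local Notation H := (@halfline R).
Local Notation I01 := (`]0, 1[%classic : set R).
Implicit Types (u v m : R -> R).

Lemma in_oy (a x : R) : `]a, +oo[%classic x -> a < x.
Proof. by rewrite /= in_itv/= andbT. Qed.

Lemma in_oo (a b x : R) : `]a, b[%classic x -> a < x /\ x < b.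
Proof. by rewrite /= in_itv/= => /andP. Qed.

(** Tonelli's theorem on the triangle with kernel 1, applied to [u t * v x]: the exchange of
    integrals in Schur's test. *)
Lemma real_triangle u v : measurable_fun H u -> measurable_fun H v ->
  (forall x, 0 < x -> 0 <= u x) -> (forall x, 0 < x -> 0 <= v x) ->
  (forall x, 0 < x -> mu.-integrable `]0, x[ (fun t => (u t)%:E)) ->
  (forall t, 0 < t -> mu.-integrable `]t, +oo[ (fun x => (v x)%:E)) ->
  [/\ measurable_fun H (fun x => v x * \int[mu]_(t in `]0, x[) u t),
   measurable_fun H (fun t => u t * \int[mu]_(x in `]t, +oo[) v x) &
   (\int[mu]_(x in H) (v x * \int[mu]_(t in `]0%R, x[) u t)%:E =
    \int[mu]_(t in H) (u t * \int[mu]_(x in `]t, +oo[) v x)%:E)%E].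
Proof.
move=> mu' mv u0 v0 iu iv; have mH := @measurable_halfline R.
pose q : R -> R[i] := fun=> 1; pose U x := (u x)%:C; pose V x := (v x)%:C.
have mq : cmeas I01 q by exact: cmeas_cst.
have mU : cmeas H U by exact: cmeas_real.
have mV : cmeas H V by exact: cmeas_real.
have ReE x t : Re (q (t / x) * U t * V x) = u t * v x.
  by rewrite /q /U /V mul1r -rmorphM.
have nE x t : 0 < t -> 0 < x -> normc (q (t / x) * U t * V x) = u t * v x.
  by move=> t0 x0; rewrite /q /U /V mul1r -rmorphM normc_real ger0_norm// mulr_ge0// ?u0 ?v0.
have E1 x : 0 < x -> Re (cintegral `]0, x[ (fun t => q (t / x) * U t * V x)) =
    v x * \int[mu]_(t in `]0, x[) u t.
  move=> x0; rewrite Re_cintegral -RintegralZl//; last exact: iu.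
  by apply: eq_Rintegral => t _; rewrite ReE mulrC.
have E2 t : 0 < t -> Re (cintegral `]t, +oo[ (fun x => q (t / x) * U t * V x)) =
    u t * \int[mu]_(x in `]t, +oo[) v x.
  move=> t0; rewrite Re_cintegral -RintegralZl//; last exact: iv.
  by apply: eq_Rintegral => x _; rewrite ReE.
have [[m1 _] [m2 _]] := cmeas_tri_inner mq mU mV.
split.
- by apply: eq_measurable_fun m1 => x /set_mem; rewrite halflineE => /E1.
- by apply: eq_measurable_fun m2 => x /set_mem; rewrite halflineE => /E2.
have := tri_tonelli mq mU mV.
rewrite (_ : (\int[mu]_(x in H) _)%E = (\int[mu]_(x in H) (v x * \int[mu]_(t in `]0%R, x[) u t)%:E)%E).
  move=> ->; apply: eq_integral => t /set_mem; rewrite halflineE => t0.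
  rewrite EFinM -EFin_Rintegral//; last exact: iv.
  rewrite -ge0_integralZl//.
  - apply: eq_integral => x /set_mem /in_oy tx.
    by rewrite nE// (lt_trans t0).
  - by have /integrableP[] := iv _ t0.
  - move=> x; rewrite /= in_itv/= andbT => tx; rewrite lee_fin v0//.
    exact: lt_trans tx.
  - by rewrite lee_fin u0.
apply: eq_integral => x /set_mem; rewrite halflineE => x0.
rewrite EFinM -EFin_Rintegral//; last exact: iu.
rewrite -ge0_integralZl//.
- apply: eq_integral => t /set_mem /in_oo[t0 _].
  by rewrite nE// mulrC.
- by have /integrableP[] := iu _ x0.
- by move=> t; rewrite /= in_itv/= => /andP[t0 _]; rewrite lee_fin u0.
- by rewrite lee_fin v0.
Qed.

Lemma sub_halfline_left x : 0 <= x -> `]x, +oo[ `<=` H.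
Proof. by move=> x0 t; rewrite halflineE /= in_itv/= andbT; exact: le_lt_trans. Qed.

Lemma sub_halfline_right x : `]0, x[ `<=` H.
Proof. by move=> t; rewrite halflineE /= in_itv/= => /andP[]. Qed.

Lemma meas_sqrt : measurable_fun H (fun t => Num.sqrt t).
Proof.
apply: continuous_open_meas; first exact: interval_open.
move=> x; rewrite halflineE => x0.
exact: derive_continuous (is_derive_sqrt x0).
Qed.

(** Schur's test. Cauchy-Schwarz with weight [sqrt t] bounds the squared mean by
    [2 * (x * sqrt x)^-1] times the integral of [sqrt t * m t ^+ 2] over ]0, x[. After the exchange,
    the integral of that factor over x > t is at most [4 / sqrt t], which gives Hardy's constant
    4. *)
Lemma hardy_left m : measurable_fun H m -> (forall x, 0 < x -> 0 <= m x) ->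
  mu.-integrable H (fun x => (m x ^+ 2)%:E) ->
  [/\ forall x, 0 < x -> mu.-integrable `]0, x[ (fun t => (m t)%:E),
      measurable_fun H (fun x => x^-1 * \int[mu]_(t in `]0, x[) m t) &
      (\int[mu]_(x in H) ((x^-1 * \int[mu]_(t in `]0%R, x[) m t) ^+ 2)%:E <=
       4%:E * \int[mu]_(x in H) (m x ^+ 2)%:E)%E].
Proof.
move=> mm m0 im2; have mH := @measurable_halfline R.
have ms := meas_sqrt; have mm2 : measurable_fun H (fun x => m x ^+ 2) by exact: measurable_funX.
pose u (t : R) := Num.sqrt t * m t ^+ 2; pose v (x : R) : R := 2 * (x * Num.sqrt x)^-1.
have mu_ : measurable_fun H u by exact: measurable_funM.
have mv : measurable_fun H v.
  apply: measurable_funM => //; apply: measurableT_comp => //; first exact: measurable_inv.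
  by apply: measurable_funM.
have iu x : 0 < x -> mu.-integrable `]0, x[ (fun t => (u t)%:E).
  move=> x0; apply: (@le_rintegrable _ _ _ (fun t => Num.sqrt x * m t ^+ 2)) => //.
  - by apply: measurable_funS mu_ => //; exact: sub_halfline_right.
  - by apply: rintegrableZl => //; apply: rintegrableS im2 => //; exact: sub_halfline_right.
  - move=> t; rewrite /= in_itv/= => /andP[t0 tx].
    rewrite ger0_norm; last by rewrite mulr_ge0 ?sqr_ge0// sqrtr_ge0.
    by rewrite ler_wpM2r ?sqr_ge0// ler_wsqrtr// ltW.
have iv t : 0 < t -> mu.-integrable `]t, +oo[ (fun x => (v x)%:E).
  by move=> t0; apply: rintegrableZl => //; have [] := integral_xsqrtV t0.
have u0 x : 0 < x -> 0 <= u x by move=> _; rewrite mulr_ge0 ?sqr_ge0 ?sqrtr_ge0.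
have v0 x : 0 < x -> 0 <= v x.
  by move=> x0; rewrite mulr_ge0// invr_ge0 mulr_ge0 ?sqrtr_ge0// ltW.
have cs x : 0 < x -> mu.-integrable `]0, x[ (fun t => (m t)%:E) /\
   (x^-1 * \int[mu]_(t in `]0, x[) m t) ^+ 2 <= v x * \int[mu]_(t in `]0, x[) u t.
  move=> x0; have [is1 is2] := integral_sqrtV x0.
  have [|||||||im le] := @cauchy_schwarz_weight R `]0, x[ m (fun t => Num.sqrt t) (fun t => (Num.sqrt t)^-1).
  - exact: measurable_itv.
  - by apply: measurable_funS mm => //; exact: sub_halfline_right.
  - by move=> t /sub_halfline_right; rewrite halflineE; exact: m0.
  - by move=> t /sub_halfline_right; rewrite halflineE sqrtr_gt0.
  - by [].
  - exact: is1.
  - exact: iu.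
  split => //; rewrite exprMn.
  apply: (@le_trans _ _ (x^-1 ^+ 2 * (2 * Num.sqrt x * \int[mu]_(t in `]0, x[) u t))).
    rewrite ler_wpM2l ?sqr_ge0//; apply: (le_trans le).
    rewrite ler_wpM2r//; apply: Rintegral_ge0 => t /sub_halfline_right.
    by rewrite halflineE; exact: u0.
  rewrite mulrA ler_wpM2r//.
    apply: Rintegral_ge0 => t /sub_halfline_right.
    by rewrite halflineE; exact: u0.
  rewrite /v; have s0 : 0 < Num.sqrt x by rewrite sqrtr_gt0.
  rewrite -{1 3}[x](sqr_sqrtr (ltW x0)); rewrite le_eqVlt; apply/orP; left; apply/eqP.
  by move: (Num.sqrt x) s0 => s s0; field; rewrite gt_eqF.
have [mvu muv E] := real_triangle mu_ mv u0 v0 iu iv.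
have mHm : measurable_fun H (fun x => x^-1 * \int[mu]_(t in `]0, x[) m t).
  have [[h _] _] := cmeas_tri_inner (q := fun=> 1) (cmeas_cst I01 1)
    (cmeas_real mm) (cmeas_real (measurable_funS measurableT (@subsetT _ _) (@measurable_inv R))).
  apply: eq_measurable_fun h => x /set_mem; rewrite halflineE => x0.
  rewrite Re_cintegral -RintegralZl//; last by have [] := cs x x0.
  by apply: eq_Rintegral => t _; rewrite mul1r -rmorphM mulrC.
split; [by move=> x /cs[]|by []|].
apply: (@le_trans _ _ (\int[mu]_(x in H) (v x * \int[mu]_(t in `]0%R, x[) u t)%:E)%E).
  apply: ge0_le_Lint; [exact: mH|exact: measurable_funX|by []|].
  by move=> x; rewrite halflineE => x0; rewrite sqr_ge0/=; have [] := cs x x0.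
clear cs; rewrite E -ge0_integralZl; last 4 first.
- exact: mH.
- exact/measurable_EFinP.
- by move=> x _; rewrite lee_fin sqr_ge0.
- by rewrite lee_fin.
apply: ge0_le_Lint; [exact: mH|by []|by apply: measurable_funM; first exact: measurable_cst|].
move=> t; rewrite halflineE => t0; have [i1 i2] := integral_xsqrtV t0.
have s0 : 0 < Num.sqrt t by rewrite sqrtr_gt0.
apply/andP; split.
  rewrite mulr_ge0 ?u0//; apply: Rintegral_ge0 => x /sub_halfline_left.
  by rewrite halflineE => h; apply: v0; apply: h; exact: ltW.
rewrite RintegralZl// /u.
apply: (@le_trans _ _ (Num.sqrt t * m t ^+ 2 * (2 * (2 * (Num.sqrt t)^-1)))).
  apply: ler_wpM2l; first by rewrite mulr_ge0 ?sqr_ge0 ?(ltW s0).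
  by apply: ler_wpM2l; first exact: ler0n.
rewrite le_eqVlt; apply/orP; left; apply/eqP.
by move: (Num.sqrt t) s0 => s s0; field; rewrite gt_eqF.
Qed.

(** The dual inequality by the same test, with weight [t * sqrt t]. Now the factor in front is
    [2 / sqrt x], whose integral over ]0, t[ is at most [4 * sqrt t]. *)
Lemma hardy_right m : measurable_fun H m -> (forall x, 0 < x -> 0 <= m x) ->
  mu.-integrable H (fun x => (m x ^+ 2)%:E) ->
  [/\ forall x, 0 < x -> mu.-integrable `]x, +oo[ (fun t => (m t / t)%:E),
      measurable_fun H (fun x => \int[mu]_(t in `]x, +oo[) (m t / t)) &
      (\int[mu]_(x in H) ((\int[mu]_(t in `]x, +oo[) (m t / t)%R) ^+ 2)%:E <=
       4%:E * \int[mu]_(x in H) (m x ^+ 2)%:E)%E].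
Proof.
move=> mm m0 im2; have mH := @measurable_halfline R.
have ms := meas_sqrt; have mm2 : measurable_fun H (fun x => m x ^+ 2) by exact: measurable_funX.
have mi : measurable_fun H (fun x : R => x^-1).
  exact: (measurable_funS measurableT (@subsetT _ _) (@measurable_inv R)).
pose u t : R := 2 * (Num.sqrt t)^-1; pose v (x : R) := (Num.sqrt x)^-1 * m x ^+ 2.
have msi : measurable_fun H (fun x : R => (Num.sqrt x)^-1).
  by apply: measurableT_comp => //; exact: measurable_inv.
have mu_ : measurable_fun H u by exact: measurable_funM.
have mv : measurable_fun H v by exact: measurable_funM.
have iu x : 0 < x -> mu.-integrable `]0, x[ (fun t => (u t)%:E).
  by move=> x0; apply: rintegrableZl => //; have [] := integral_sqrtV x0.
have iv t : 0 < t -> mu.-integrable `]t, +oo[ (fun x => (v x)%:E).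
  move=> t0; have tH := sub_halfline_left (ltW t0).
  apply: (@le_rintegrable _ _ _ (fun x => (Num.sqrt t)^-1 * m x ^+ 2)) => //.
  - by apply: measurable_funS mv.
  - by apply: rintegrableZl => //; apply: rintegrableS im2.
  - move=> x; rewrite /= in_itv/= andbT => tx.
    rewrite ger0_norm; last by rewrite mulr_ge0 ?sqr_ge0// invr_ge0 sqrtr_ge0.
    have x0 : 0 < x by exact: lt_trans tx.
    by rewrite ler_wpM2r ?sqr_ge0// lef_pV2 ?posrE ?sqrtr_gt0 ?ler_wsqrtr ?ltW.
have u0 x : 0 < x -> 0 <= u x by move=> _; rewrite mulr_ge0 ?invr_ge0 ?sqrtr_ge0.
have v0 x : 0 < x -> 0 <= v x by move=> x0; rewrite mulr_ge0 ?sqr_ge0// invr_ge0 sqrtr_ge0.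
have cs x : 0 < x -> mu.-integrable `]x, +oo[ (fun t => (m t / t)%:E) /\
   (\int[mu]_(t in `]x, +oo[) (m t / t)) ^+ 2 <= u x * \int[mu]_(t in `]x, +oo[) v t.
  move=> x0; have [is1 is2] := integral_xsqrtV x0; have xH := sub_halfline_left (ltW x0).
  have mw t : 0 < t -> t * Num.sqrt t * (m t / t) ^+ 2 = v t.
    move=> t0; rewrite /v; have s0 : 0 < Num.sqrt t by rewrite sqrtr_gt0.
    move: (m t) => y; rewrite -{1 3}[t](sqr_sqrtr (ltW t0)).
    by move: (Num.sqrt t) s0 => s s0; field; rewrite gt_eqF.
  have [|||||||im le] := @cauchy_schwarz_weight R `]x, +oo[ (fun t => m t / t) (fun t => t * Num.sqrt t) (fun t => (t * Num.sqrt t)^-1).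
  - exact: measurable_itv.
  - by apply: measurable_funS (measurable_funM mm mi).
  - by move=> t /xH; rewrite halflineE => t0; rewrite mulr_ge0 ?m0 ?invr_ge0// ltW.
  - by move=> t /xH; rewrite halflineE => t0; rewrite mulr_gt0 ?sqrtr_gt0.
  - by [].
  - exact: is1.
  - apply: eq_integrable (iv _ x0) => // t /set_mem /xH; rewrite halflineE => t0.
    by rewrite mw.
  split => //; apply: (le_trans le).
  rewrite (_ : \int[mu]_(t in _) (_ * _ * _) = \int[mu]_(t in `]x, +oo[) v t); last first.
    by apply: eq_Rintegral => t /set_mem /xH; rewrite halflineE => t0; rewrite mw.
  rewrite ler_wpM2r//; apply: Rintegral_ge0 => t /xH.
  by rewrite halflineE; exact: v0.
have [mvu muv E] := real_triangle mu_ mv u0 v0 iu iv.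
have mHm : measurable_fun H (fun x => \int[mu]_(t in `]x, +oo[) (m t / t)).
  have [_ [h _]] := cmeas_tri_inner (q := fun=> 1) (cmeas_cst I01 1) (cmeas_cst H 1)
    (cmeas_real (measurable_funM mm mi)).
  apply: eq_measurable_fun h => x /set_mem; rewrite halflineE => x0.
  by rewrite Re_cintegral; apply: eq_Rintegral => t _; rewrite !mul1r.
split; [by move=> x /cs[]|by []|].
apply: (@le_trans _ _ (\int[mu]_(x in H) (u x * \int[mu]_(t in `]x, +oo[) v t)%:E)%E).
  apply: ge0_le_Lint; [exact: mH|exact: measurable_funX|by []|].
  by move=> x; rewrite halflineE => x0; rewrite sqr_ge0/=; have [] := cs x x0.
clear cs; rewrite -E -ge0_integralZl; last 4 first.
- exact: mH.
- exact/measurable_EFinP.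
- by move=> x _; rewrite lee_fin sqr_ge0.
- by rewrite lee_fin.
apply: ge0_le_Lint; [exact: mH|by []|by apply: measurable_funM; first exact: measurable_cst|].
move=> t; rewrite halflineE => t0; have [i1 i2] := integral_sqrtV t0.
have s0 : 0 < Num.sqrt t by rewrite sqrtr_gt0.
apply/andP; split.
  rewrite mulr_ge0 ?v0//; apply: Rintegral_ge0 => x /sub_halfline_right.
  by rewrite halflineE; exact: u0.
rewrite RintegralZl// /v.
apply: (@le_trans _ _ ((Num.sqrt t)^-1 * m t ^+ 2 * (2 * (2 * Num.sqrt t)))).
  apply: ler_wpM2l; first by rewrite mulr_ge0 ?sqr_ge0 ?invr_ge0 ?(ltW s0).
  by apply: ler_wpM2l; first exact: ler0n.
rewrite le_eqVlt; apply/orP; left; apply/eqP.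
by move: (Num.sqrt t) s0 => s s0; field; rewrite gt_eqF.
Qed.

End hardy.

Opaque cintegral.

(** * The operators 1 - K and 1 - K' *)

Section hardy_operators.
Context {R : realType}.
Local Notation mu := (@lebesgue_measure R).
Local Notation H := (@halfline R).
Local Notation I01 := (`]0, 1[%classic : set R).
Implicit Types (k f g : R -> R[i]) (M x t : R).

(** Both integrands have the shape [q * u * v] of [tri]; this accounts for the position of [x^-1]
    and for the factor 1 in [Kop']. *)
Definition Kop k f x : R[i] := cintegral `]0, x[ (fun t => k (t / x) * f t * (x^-1)%:C).
Definition Kop' k f t : R[i] :=
  cintegral `]t, +oo[ (fun x => k (t / x) * 1 * (f x * (x^-1)%:C)).

Definition bounded_kernel k M := cmeas I01 k /\ forall y, 0 < y < 1 -> normc (k y) <= M.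

Lemma div_in01 t x : 0 < t < x -> 0 < t / x < 1.
Proof.
move=> /andP[t0 tx]; have x0 : 0 < x by exact: lt_trans tx.
by rewrite divr_gt0//= ltr_pdivrMr// mul1r.
Qed.

Lemma cmeas_ratio k x : cmeas I01 k -> 0 < x -> cmeas `]0, x[ (fun t => k (t / x)).
Proof.
move=> [k1 k2] x0.
have mi : measurable_fun (`]0, x[ : set R) (fun t : R => t / x) by apply: measurable_funM.
have sub : [set t / x | t in `]0, x[] `<=` I01.
  by move=> _ [t /in_oo[t0 tx] <-]; rewrite /= in_itv/=; apply: div_in01; rewrite t0.
by split; [exact: (measurable_comp (measurable_itv _) sub k1)|
  exact: (measurable_comp (measurable_itv _) sub k2)].
Qed.

Lemma measurable_invr_halfline (D : set R) : measurable_fun D (fun x : R => x^-1).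
Proof. exact: (measurable_funS measurableT (@subsetT _ _) (@measurable_inv R)). Qed.

Lemma cmeas_ratio' k t : cmeas I01 k -> 0 < t -> cmeas `]t, +oo[ (fun x => k (t / x)).
Proof.
move=> [k1 k2] t0.
have mi : measurable_fun (`]t, +oo[ : set R) (fun x : R => t / x).
  by apply: measurable_funM => //; exact: measurable_invr_halfline.
have sub : [set t / x | x in `]t, +oo[] `<=` I01.
  by move=> _ [x /in_oy tx <-]; rewrite /= in_itv/=; apply: div_in01; rewrite t0.
by split; [exact: (measurable_comp (measurable_itv _) sub k1)|
  exact: (measurable_comp (measurable_itv _) sub k2)].
Qed.

Lemma cmeas_divx (D : set R) f : cmeas D f -> cmeas D (fun x => f x * (x^-1)%:C).
Proof. by move=> mf; apply: cmeasM => //; apply: cmeas_real; exact: measurable_invr_halfline. Qed.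

Lemma inL2_hardy_left f : inL2 f ->
  [/\ forall x, 0 < x -> mu.-integrable `]0, x[ (fun t => (normc (f t))%:E),
      measurable_fun H (fun x => x^-1 * \int[mu]_(t in `]0, x[) normc (f t)) &
      (\int[mu]_(x in H) ((x^-1 * \int[mu]_(t in `]0%R, x[) normc (f t)) ^+ 2)%:E <=
       4%:E * L2sq f)%E].
Proof.
move=> hf; apply: hardy_left; last exact: inL2_sqr_integrable.
  exact: cmeas_normc hf.1.
by move=> x _; exact: normc_ge0.
Qed.

Lemma inL2_hardy_right f : inL2 f ->
  [/\ forall x, 0 < x -> mu.-integrable `]x, +oo[ (fun t => (normc (f t) / t)%:E),
      measurable_fun H (fun x => \int[mu]_(t in `]x, +oo[) (normc (f t) / t)) &
      (\int[mu]_(x in H) ((\int[mu]_(t in `]x, +oo[) (normc (f t) / t)%R) ^+ 2)%:E <=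
       4%:E * L2sq f)%E].
Proof.
move=> hf; apply: hardy_right; last exact: inL2_sqr_integrable.
  exact: cmeas_normc hf.1.
by move=> x _; exact: normc_ge0.
Qed.

Lemma inL2_cintegrable_left f x : inL2 f -> 0 < x -> cintegrable `]0, x[ f.
Proof.
move=> hf x0; have [h _ _] := inL2_hardy_left hf.
apply: (le_cintegrable (measurable_itv _) _ (h x x0)) => //.
by apply: cmeasS hf.1; [exact: measurable_halfline|exact: sub_halfline_right].
Qed.

Lemma inL2_cintegrable_right f x : inL2 f -> 0 < x ->
  cintegrable `]x, +oo[ (fun t => f t * (t^-1)%:C).
Proof.
move=> hf x0; have [h _ _] := inL2_hardy_right hf.
apply: (le_cintegrable (measurable_itv _) _ (h x x0)) => //.
  apply: cmeas_divx; apply: cmeasS hf.1; first exact: measurable_halfline.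
  exact: sub_halfline_left (ltW x0).
move=> t /in_oy xt; rewrite normcM normc_real ger0_norm// invr_ge0 ltW//.
exact: lt_trans xt.
Qed.

Lemma Kop_int k M f x : bounded_kernel k M -> inL2 f -> 0 < x ->
  cintegrable `]0, x[ (fun t => k (t / x) * f t * (x^-1)%:C).
Proof.
move=> [mk kM] hf x0.
apply: (eq_cintegrable (measurable_itv _) (f := fun t => (x^-1)%:C * (k (t / x) * f t))).
  by move=> t _; rewrite mulrC.
apply: cintegrableZ; first exact: measurable_itv.
apply: (@cintegrable_bdM _ _ _ _ M) (inL2_cintegrable_left hf x0).
- exact: measurable_itv.
- exact: cmeas_ratio.
- by move=> t /in_oo[t0 tx]; apply: kM; apply: div_in01; rewrite t0.
Qed.

Lemma Kop'_int k M f t : bounded_kernel k M -> inL2 f -> 0 < t ->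
  cintegrable `]t, +oo[ (fun x => k (t / x) * 1 * (f x * (x^-1)%:C)).
Proof.
move=> [mk kM] hf t0.
apply: (eq_cintegrable (measurable_itv _) (f := fun x => k (t / x) * (f x * (x^-1)%:C))).
  by move=> x _; rewrite mulr1.
apply: (@cintegrable_bdM _ _ _ _ M) (inL2_cintegrable_right hf t0).
- exact: measurable_itv.
- exact: cmeas_ratio'.
- by move=> x /in_oy tx; apply: kM; apply: div_in01; rewrite t0.
Qed.

Lemma Kop_meas k M f : bounded_kernel k M -> inL2 f -> cmeas H (Kop k f).
Proof.
move=> [mk _] hf.
by have [] := cmeas_tri_inner mk hf.1 (cmeas_real (measurable_invr_halfline (D := H))).
Qed.

Lemma Kop'_meas k M f : bounded_kernel k M -> inL2 f -> cmeas H (Kop' k f).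
Proof.
move=> [mk _] hf.
by have [] := cmeas_tri_inner mk (cmeas_cst H 1) (cmeas_divx hf.1).
Qed.

(** The constant is [2 ^+ 2 * 4]: the square of the 2 from [normc_cintegral_le], times Hardy's
    constant. *)
Lemma sqr_dom_L2 (f g : R -> R[i]) (h : R -> R) M : cmeas H g -> measurable_fun H h ->
  (forall x, 0 < x -> normc (g x) <= 2 * M * h x) ->
  (\int[mu]_(x in H) (h x ^+ 2)%:E <= 4%:E * L2sq f)%E ->
  (L2sq g <= (16 * M ^+ 2)%:E * L2sq f)%E.
Proof.
move=> mg mh gh hf.
apply: (@le_trans _ _ (\int[mu]_(x in H) (4 * M ^+ 2 * h x ^+ 2)%:E)%E).
  apply: ge0_le_Lint.
  - exact: measurable_halfline.
  - exact: measurable_normc_sqr.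
  - by apply: measurable_funM; [exact: measurable_cst|exact: measurable_funX].
  - move=> x; rewrite halflineE => x0; rewrite sqr_ge0/=.
    rewrite (_ : 4 * M ^+ 2 * h x ^+ 2 = (2 * M * h x) ^+ 2); last by ring.
    have := gh x x0; have := normc_ge0 (g x) => n0 le.
    by rewrite lerXn2r// nnegrE// (le_trans n0).
rewrite (_ : (16 * M ^+ 2)%:E = (4 * M ^+ 2)%:E * 4%:E)%E; last by rewrite -EFinM; congr EFin; ring.
have M0 : 0 <= 4 * M ^+ 2 by rewrite mulr_ge0 ?sqr_ge0.
rewrite -muleA; apply: le_trans (lee_wpmul2l _ hf); last by rewrite lee_fin.
rewrite -ge0_integralZl//.
- exact: measurable_halfline.
- by apply/measurable_EFinP; exact: measurable_funX.
- by move=> x _; rewrite lee_fin sqr_ge0.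
Qed.

Lemma Kop_L2 k M f : bounded_kernel k M -> inL2 f ->
  inL2 (Kop k f) /\ (L2sq (Kop k f) <= (16 * M ^+ 2)%:E * L2sq f)%E.
Proof.
move=> bk hf; have mK := Kop_meas bk hf; have [h1 h2 h3] := inL2_hardy_left hf.
have le : (L2sq (Kop k f) <= (16 * M ^+ 2)%:E * L2sq f)%E.
  apply: (sqr_dom_L2 mK h2 _ h3) => x x0.
  apply: (le_trans (normc_cintegral_le (g := fun t => (M * x^-1) * normc (f t)) _ (Kop_int bk hf x0) _ _)).
  - exact: measurable_itv.
  - by apply: rintegrableZl; [exact: measurable_itv|exact: h1].
  - move=> t /in_oo[t0 tx]; rewrite !normcM normc_real ger0_norm ?invr_ge0 ?(ltW x0)//.
    rewrite mulrAC ler_wpM2r ?normc_ge0// ler_wpM2r ?invr_ge0 ?(ltW x0)//.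
    by apply: bk.2; apply: div_in01; rewrite t0.
  rewrite RintegralZl//; last exact: h1.
  by rewrite !mulrA.
split => //; split => //.
apply: (le_lt_trans le); apply: lte_mul_pinfty; last exact: hf.2.
  by rewrite lee_fin mulr_ge0 ?sqr_ge0.
by [].
Qed.

Lemma Kop'_L2 k M f : bounded_kernel k M -> inL2 f ->
  inL2 (Kop' k f) /\ (L2sq (Kop' k f) <= (16 * M ^+ 2)%:E * L2sq f)%E.
Proof.
move=> bk hf; have mK := Kop'_meas bk hf; have [h1 h2 h3] := inL2_hardy_right hf.
have le : (L2sq (Kop' k f) <= (16 * M ^+ 2)%:E * L2sq f)%E.
  apply: (sqr_dom_L2 mK h2 _ h3) => x x0.
  apply: (le_trans (normc_cintegral_le (g := fun t => M * (normc (f t) / t)) _ (Kop'_int bk hf x0) _ _)).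
  - exact: measurable_itv.
  - by apply: rintegrableZl; [exact: measurable_itv|exact: h1].
  - move=> t /in_oy xt; have t0 : 0 < t by exact: lt_trans xt.
    rewrite mulr1 !normcM normc_real [`|t^-1|]ger0_norm ?invr_ge0 ?(ltW t0)//.
    apply: ler_wpM2r; first by rewrite mulr_ge0 ?normc_ge0// invr_ge0 ltW.
    by apply: bk.2; apply: div_in01; rewrite x0.
  rewrite RintegralZl//; last exact: h1.
  by rewrite mulrA.
split => //; split => //.
apply: (le_lt_trans le); apply: lte_mul_pinfty; last exact: hf.2.
  by rewrite lee_fin mulr_ge0 ?sqr_ge0.
by [].
Qed.

Lemma inL2_real_int (h : R -> R) : measurable_fun H h ->
  (\int[mu]_(x in H) (h x ^+ 2)%:E < +oo)%E -> inL2 (fun x => (h x)%:C).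
Proof.
move=> mh fin; split; first exact: cmeas_real.
rewrite /L2sq; apply: le_lt_trans fin; apply: ge0_le_Lint.
- exact: measurable_halfline.
- by apply: measurable_normc_sqr; exact: cmeas_real.
- exact: measurable_funX.
- by move=> x _; rewrite normc_real real_normK ?num_real// sqr_ge0/=.
Qed.

(** For a bounded kernel, absolute convergence over the triangle reduces to integrability of [|v x|]
    times the integral of [|u|] over ]0, x[. In the applications this product is a Hardy mean of [u]
    paired with a function in L_2. *)
Lemma tri_fubini_dom q u v M : cmeas I01 q -> (forall y, 0 < y < 1 -> normc (q y) <= M) ->
  cmeas H u -> cmeas H v ->
  (forall x, 0 < x -> mu.-integrable `]0, x[ (fun t => (normc (u t))%:E)) ->
  mu.-integrable H (fun x => (normc (v x) * \int[mu]_(t in `]0, x[) normc (u t))%:E) ->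
  [/\ cintegrable H (fun x => cintegral `]0, x[ (fun t => q (t / x) * u t * v x)),
      cintegrable H (fun t => cintegral `]t, +oo[ (fun x => q (t / x) * u t * v x)),
      {ae mu, forall x, 0 < x -> cintegrable `]0, x[ (fun t => q (t / x) * u t * v x)},
      {ae mu, forall t, 0 < t -> cintegrable `]t, +oo[ (fun x => q (t / x) * u t * v x)} &
      cintegral H (fun x => cintegral `]0, x[ (fun t => q (t / x) * u t * v x)) =
      cintegral H (fun t => cintegral `]t, +oo[ (fun x => q (t / x) * u t * v x))].
Proof.
move=> mq qM mu' mv iu iuv; apply: tri_fubini => //.
have M0 : 0 <= M by apply: le_trans (qM 2^-1 _); [exact: normc_ge0|lra].
have mH := @measurable_halfline R.
have iE x : 0 < x -> mu.-integrable `]0, x[ (fun t => (M * normc (v x) * normc (u t))%:E).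
  by move=> x0; apply: rintegrableZl; [exact: measurable_itv|exact: iu].
have i2 := rintegrableZl M mH iuv.
apply: (@le_lt_trans _ _ (\int[mu]_(x in H)
    (M * (normc (v x) * \int[mu]_(t in `]0, x[) normc (u t)))%:E)%E); last first.
  rewrite EFin_Rintegral; [exact: ltry|exact: mH|exact: i2].
apply: ge0_le_integral.
- exact: mH.
- by move=> x _; apply: integral_ge0 => t _; rewrite lee_fin normc_ge0.
- have mtri : measurable_fun setT (fun p => (normc (tri q u v p))%:E).
    by apply/measurable_EFinP; apply: cmeas_normc; exact: cmeas_tri.
  have [h _] := emeasurable_param_integral mtri.
  apply: eq_measurable_fun (measurable_funS measurableT (@subsetT _ H) h) => x /set_mem.
  rewrite halflineE => x0; rewrite -[RHS]integral_normc_cutoff.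
  by apply: eq_integral => t _; rewrite -(tri_x_cutoff _ _ _ x0).
- by have /integrableP[] := i2.
- move=> x; rewrite halflineE => x0.
  rewrite mulrA -RintegralZl; [|exact: measurable_itv|exact: iu].
  rewrite -EFin_Rintegral; [|exact: measurable_itv|exact: iE].
  apply: ge0_le_Lint.
  + exact: measurable_itv.
  + apply: cmeas_normc; apply: cmeasM; last exact: cmeas_cst.
    apply: cmeasM; first exact: cmeas_ratio.
    by apply: cmeasS mu'; [exact: mH|exact: sub_halfline_right].
  + by apply/measurable_EFinP; have /integrableP[] := iE x x0.
  + move=> t /in_oo[t0 tx]; rewrite normc_ge0/= !normcM mulrAC.
    apply: ler_wpM2r; first exact: normc_ge0.
    apply: ler_wpM2r; first exact: normc_ge0.
    by apply: qM; apply: div_in01; rewrite t0.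
Qed.

(** The pairing is bilinear, without conjugation, so that it holds for complex kernels. Absolute
    convergence: the Hardy mean of [|f|] is in L_2, and so is [g]. *)
Lemma Kop_adj k M f g : bounded_kernel k M -> inL2 f -> inL2 g ->
  cintegral H (fun x => Kop k f x * g x) = cintegral H (fun t => f t * Kop' k g t).
Proof.
move=> bk hf hg; have [mk kM] := bk; have mv := cmeas_divx hg.1.
have [h1 h2 h3] := inL2_hardy_left hf.
have [] := tri_fubini_dom mk kM hf.1 mv h1.
  have hL : inL2 (fun x => (x^-1 * \int[mu]_(t in `]0, x[) normc (f t))%:C).
    apply: inL2_real_int h2 _; apply: (le_lt_trans h3).
    by apply: lte_mul_pinfty; [rewrite lee_fin|by []|exact: hf.2].
  have := cintegrable_norm (@measurable_halfline R) (inL2_mul_integrable hL hg).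
  apply: eq_integrable; first exact: measurable_halfline.
  move=> x /set_mem; rewrite halflineE => x0; rewrite !normcM !normc_real; congr EFin.
  rewrite ger0_norm; last first.
    rewrite mulr_ge0 ?invr_ge0 ?(ltW x0)//; apply: Rintegral_ge0 => t _.
    exact: normc_ge0.
  by rewrite [`|_^-1|]ger0_norm ?invr_ge0 ?(ltW x0)//; ring.
move=> _ _ _ _ E.
transitivity (cintegral H (fun x => cintegral `]0, x[ (fun t => k (t / x) * f t * (g x * (x^-1)%:C)))).
  apply: eq_cintegral => x /set_mem; rewrite halflineE => x0.
  rewrite mulrC /Kop -cintegralZ; [|exact: measurable_itv|exact: (Kop_int bk hf x0)].
  by apply: eq_cintegral => t _; ring.
rewrite E; apply: eq_cintegral => t /set_mem; rewrite halflineE => t0.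
rewrite /Kop' -cintegralZ; [|exact: measurable_itv|exact: (Kop'_int bk hg t0)].
by apply: eq_cintegral => x _; ring.
Qed.

End hardy_operators.

(** * The compositions of K and K' *)

Section inverse_operators.
Context {R : realType}.
Local Notation mu := (@lebesgue_measure R).
Local Notation H := (@halfline R).
Local Notation I01 := (`]0, 1[%classic : set R).
Implicit Types (k f g : R -> R[i]) (M x t : R).

Lemma cutoff_cutoff (D E : set R) f : E `<=` D -> cutoff D (cutoff E f) = cutoff E f.
Proof.
move=> ED; apply/funext => x; rewrite /cutoff; case: ifPn => // /negP xD.
by case: ifPn => // /set_mem/ED/mem_set.
Qed.

Lemma cintegral_cutoff (D E : set R) f : E `<=` D -> cintegral D (cutoff E f) = cintegral E f.
Proof. by move=> ED; rewrite cintegral_mkcond cutoff_cutoff// -cintegral_mkcond. Qed.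

Lemma cintegrable_cutoff (D E : set R) f : measurable D -> measurable E -> E `<=` D ->
  cintegrable E f -> cintegrable D (cutoff E f).
Proof.
move=> mD mE ED fi; apply/(cintegrable_mkcond _ mD).
by rewrite cutoff_cutoff//; apply/(cintegrable_mkcond _ mE).
Qed.

Lemma cmeas_cutoffT (D E : set R) f : measurable E -> cmeas E f -> cmeas D (cutoff E f).
Proof.
move=> mE /(cmeas_cutoff _ mE) h; apply: cmeasS h; [exact: measurableT|exact: subsetT].
Qed.

Lemma mem_oy (a x : R) : (x \in (`]a, +oo[%classic : set R)) = (a < x).
Proof. by rewrite mem_setE/= in_itv/= andbT. Qed.

Lemma mem_oo (a b x : R) : (x \in (`]a, b[%classic : set R)) = (a < x < b).
Proof. by rewrite mem_setE/= in_itv/=. Qed.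

Lemma rcVK (y : R) : y != 0 -> (y^-1)%:C * y%:C = 1.
Proof. by move=> y0; rewrite -rmorphM mulVf. Qed.

Variables (k : R -> R[i]) (M : R).
Hypothesis bk : bounded_kernel k M.

Let mk : cmeas I01 k := bk.1.
Let kM : forall y, 0 < y < 1 -> normc (k y) <= M := bk.2.
Let mH := @measurable_halfline R.

Lemma KopB f g x : inL2 f -> inL2 g -> 0 < x -> Kop k (fun t => f t - g t) x = Kop k f x - Kop k g x.
Proof.
move=> hf hg x0; rewrite /Kop -cintegralB; [|exact: measurable_itv|exact: (Kop_int bk)|exact: (Kop_int bk)].
by apply: eq_cintegral => t _; ring.
Qed.

Lemma Kop'B f g x : inL2 f -> inL2 g -> 0 < x -> Kop' k (fun t => f t - g t) x = Kop' k f x - Kop' k g x.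
Proof.
move=> hf hg x0; rewrite /Kop' -cintegralB; [|exact: measurable_itv|exact: (Kop'_int bk)|exact: (Kop'_int bk)].
by apply: eq_cintegral => t _; ring.
Qed.

Lemma hardy_left_inL2 f : inL2 f -> inL2 (fun x => (x^-1 * \int[mu]_(t in `]0, x[) normc (f t))%:C).
Proof.
move=> hf; have [_ h2 h3] := inL2_hardy_left hf; apply: inL2_real_int h2 _.
apply: (le_lt_trans h3); apply: lte_mul_pinfty; [by rewrite lee_fin|by []|exact: hf.2].
Qed.

Lemma normc_hardy f x : 0 < x -> normc ((x^-1 * \int[mu]_(t in `]0, x[) normc (f t))%:C) =
  x^-1 * \int[mu]_(t in `]0, x[) normc (f t).
Proof.
move=> x0; rewrite normc_real ger0_norm// mulr_ge0 ?invr_ge0 ?(ltW x0)//.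
by apply: Rintegral_ge0 => t _; exact: normc_ge0.
Qed.

Lemma invsq_integrable t : 0 < t -> mu.-integrable `]t, +oo[ (fun x : R => ((x^-1) ^+ 2)%:E).
Proof.
move=> t0; have [h _] := integral_xsqrtV t0; have mI : measurable (`]t, +oo[ : set R) by exact: measurable_itv.
apply: (le_rintegrable mI _ (rintegrableZl (Num.sqrt t)^-1 mI h)).
  by apply: measurable_funX; exact: measurable_invr_halfline.
move=> x /in_oy tx; have x0 := lt_trans t0 tx; rewrite ger0_norm ?sqr_ge0//.
have st : 0 < Num.sqrt t by rewrite sqrtr_gt0.
have sx : 0 < Num.sqrt x by rewrite sqrtr_gt0.
have sle : Num.sqrt t <= Num.sqrt x by rewrite ler_wsqrtr// ltW.
have xE := sqr_sqrtr (ltW x0).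
rewrite -invfM exprVn lef_pV2 ?posrE ?mulr_gt0 ?exprn_gt0//.
rewrite (_ : x ^+ 2 = Num.sqrt x * (x * Num.sqrt x)); last by rewrite mulrCA -expr2 xE expr2.
by rewrite ler_wpM2r// ltW// mulr_gt0.
Qed.

Lemma kk_integrable s t : 0 < s -> s <= t ->
  cintegrable `]t, +oo[ (fun x => k (t / x) * k (s / x) * ((x^-1) ^+ 2)%:C).
Proof.
move=> s0 st; have t0 : 0 < t by exact: lt_le_trans st.
have mI : measurable (`]t, +oo[ : set R) by exact: measurable_itv.
have sub : `]t, +oo[ `<=` `]s, +oo[ by move=> x /in_oy tx; rewrite /= in_itv/= andbT (le_lt_trans st).
apply: (@cintegrable_bdM _ _ _ _ (M * M)) => //.
- apply: cmeasM; first exact: cmeas_ratio'.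
  by apply: cmeasS (cmeas_ratio' mk s0).
- move=> x /in_oy tx; rewrite normcM; apply: ler_pM; rewrite ?normc_ge0//.
    by apply: kM; apply: div_in01; rewrite t0.
  by apply: kM; apply: div_in01; rewrite s0/= (le_lt_trans st).
- apply: (le_cintegrable mI _ (invsq_integrable t0)).
    by apply: cmeas_real; apply: measurable_funX; exact: measurable_invr_halfline.
  by move=> x _; rewrite normc_real ger0_norm ?sqr_ge0.
Qed.

(** The kernel of K' K at [s <= t] is the integral on the left, so [J1] says that K' K = K + K',
    that is, (1 - K')(1 - K) = 1. In the same way [J2] describes K K'. *)
Hypothesis J1 : forall s t, 0 < s -> s <= t ->
  cintegral `]t, +oo[ (fun x => k (t / x) * k (s / x) * ((x^-1) ^+ 2)%:C) = k (s / t) * (t^-1)%:C.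

Hypothesis J2 : forall x y, 0 < x -> x <= y ->
  cintegral `]0, x[ (fun t => k (t / x) * k (t / y)) = x%:C * k (x / y).

Lemma Kop'_Kop f t : inL2 f -> 0 < t -> Kop' k (Kop k f) t = Kop k f t + Kop' k f t.
Proof.
move=> hf t0; have tH := sub_halfline_left (ltW t0).
have [h1 _ _] := inL2_hardy_left hf.
have mI : measurable (`]t, +oo[ : set R) by exact: measurable_itv.
(* With [t] fixed, K' K f at [t] is an integral over the triangle s < x in which the weight in [x]
   vanishes up to [t]. After the exchange, the part s < t gives K f and the part s > t gives K'
   f. *)
pose v := cutoff `]t, +oo[ (fun x => k (t / x) * ((x^-1) ^+ 2)%:C).
have mkt := cmeas_ratio' mk t0.
have mx2 : cmeas `]t, +oo[ (fun x : R => ((x^-1) ^+ 2)%:C).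
  by apply: cmeas_real; apply: measurable_funX; exact: measurable_invr_halfline.
have mv : cmeas H v by apply: cmeas_cutoffT => //; exact: cmeasM.
have vx x : t < x -> v x = k (t / x) * ((x^-1) ^+ 2)%:C by move=> tx; rewrite /v cutoff_in// mem_oy.
have v0 x : x <= t -> v x = 0 by move=> tx; rewrite /v cutoff_notin// mem_oy -leNgt.
have [] := tri_fubini_dom mk kM hf.1 mv h1.
  have hL := hardy_left_inL2 hf.
  have i1 := cintegrable_bdM mI mkt (M := M) _ (inL2_cintegrable_right hL t0).
  have /(cintegrable_norm mI)/(rintegrable_mkcond _ mI).1 i2 : cintegrable `]t, +oo[ _ := i1 (ltac:(
    by move=> x /in_oy tx; apply: kM; apply: div_in01; rewrite t0)).
  have i3 := rintegrableS measurableT mH (@subsetT _ _) i2.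
  apply: eq_integrable i3 => // x /set_mem; rewrite halflineE => x0; congr EFin.
  rewrite patchE mem_oy; case: ltP => [tx|xt]; last by rewrite v0// normc0 mul0r.
  rewrite vx// !normcM normc_hardy// !normc_real normrX [`|x^-1|]ger0_norm ?invr_ge0 ?ltW//.
  by ring.
move=> _ i2 _ _ E.
have -> : Kop' k (Kop k f) t = cintegral H (fun x => cintegral `]0, x[ (fun s => k (s / x) * f s * v x)).
  rewrite /Kop' -(cintegral_cutoff _ tH).
  apply: eq_cintegral => x /set_mem; rewrite halflineE => x0.
  rewrite /cutoff mem_oy; case: ltP => [tx|xt]; last first.
    rewrite -[LHS](cintegral0 `]0, x[); apply: eq_cintegral => s _.
    by rewrite v0 ?mulr0.
  rewrite (vx x tx) (_ : _ * _ = (k (t / x) * (x^-1)%:C) * Kop k f x); last by ring.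
  rewrite /Kop -(cintegralZ (k (t / x) * (x^-1)%:C) (measurable_itv _) (Kop_int bk hf x0)).
  by apply: eq_cintegral => s _; rewrite rmorphXn; ring.
rewrite E; have [_ _ ->] := @cintegral_split R 0 t +oo%O _ (ltW t0) isT i2.
clear E i2 h1.
congr (_ + _).
  apply: eq_cintegral => s /set_mem/in_oo[s0 st].
  have sub : `]t, +oo[ `<=` `]s, +oo[ by move=> x /in_oy tx; rewrite /= in_itv/= andbT (lt_trans st).
  rewrite (eq_cintegral (g := cutoff `]t, +oo[ (fun x => f s * (k (t / x) * k (s / x) * ((x^-1) ^+ 2)%:C)))).
    rewrite (cintegral_cutoff _ sub) cintegralZ; [|exact: mI|exact: kk_integrable s0 (ltW st)].
    by rewrite (J1 s0 (ltW st)) /Kop; ring.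
  move=> x _; rewrite /cutoff mem_oy; case: ltP => [tx|xt]; last first.
    by rewrite (v0 x xt) mulr0.
  by rewrite (vx x tx); ring.
apply: eq_cintegral => s /set_mem/in_oy ts; have s0 : 0 < s by exact: lt_trans ts.
rewrite (eq_cintegral (g := fun x => f s * (k (s / x) * k (t / x) * ((x^-1) ^+ 2)%:C))).
  rewrite cintegralZ; [|exact: measurable_itv|exact: kk_integrable t0 (ltW ts)].
  by rewrite (J1 t0 (ltW ts)); ring.
by move=> x /set_mem/in_oy sx; rewrite vx ?(lt_trans ts)//; ring.
Qed.

Lemma kk_integrable_left x y : 0 < x -> x <= y -> cintegrable `]0, x[ (fun t => k (t / x) * k (t / y)).
Proof.
move=> x0 xy; have y0 : 0 < y by exact: lt_le_trans xy.
have mI : measurable (`]0, x[ : set R) by exact: measurable_itv.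
have sub : `]0, x[ `<=` `]0, y[ by move=> t /in_oo[t0 tx]; rewrite /= in_itv/= t0 (lt_le_trans tx).
apply: (@le_cintegrable _ _ _ (fun=> M * M)) => //.
- apply: cmeasM; first exact: cmeas_ratio.
  by apply: cmeasS (cmeas_ratio mk y0).
- apply: (@integrableS _ _ _ mu `[0, x]) => //.
    by move=> t /in_oo[t0 tx]; rewrite /= in_itv/= !ltW.
  by apply: continuous_compact_integrable; [exact: segment_compact|
    apply: continuous_subspaceT => z; exact: cst_continuous].
- move=> t /in_oo[t0 tx]; rewrite normcM; apply: ler_pM; rewrite ?normc_ge0//.
    by apply: kM; apply: div_in01; rewrite t0.
  by apply: kM; apply: div_in01; rewrite t0/= (lt_le_trans tx).
Qed.

(** Here the fixed weight [k (t / x) / x] is bounded with support in ]0, x[, hence in L_2, and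
    Hardy's inequality for it gives absolute convergence. *)
Lemma Kop_Kop' f x : inL2 f -> 0 < x -> Kop k (Kop' k f) x = Kop k f x + Kop' k f x.
Proof.
move=> hf x0; have xH := @sub_halfline_right R x.
have mI : measurable (`]0, x[ : set R) by exact: measurable_itv.
pose u := cutoff `]0, x[ (fun t => k (t / x) * (x^-1)%:C).
have mkx := cmeas_ratio mk x0.
have mu' : cmeas H u by apply: cmeas_cutoffT => //; apply: cmeasM => //; exact: cmeas_cst.
have ux t : 0 < t -> t < x -> u t = k (t / x) * (x^-1)%:C.
  by move=> t0 tx; rewrite /u cutoff_in// mem_oo t0.
have u0 t : ~~ (0 < t < x) -> u t = 0 by move=> tx; rewrite /u cutoff_notin// mem_oo.
have M0 : 0 <= M by apply: le_trans (kM (y := 2^-1) _); [exact: normc_ge0|lra].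
have uL : inL2 u.
  apply: (@inL2_bounded_support _ _ 0 x (M * x^-1)) => // t.
  have [/andP[t0 tx]|tx] := boolP (0 < t < x); last by rewrite u0// normc0 mulr_ge0 ?invr_ge0 ?(ltW x0).
  rewrite ux// normcM normc_real ger0_norm ?invr_ge0 ?(ltW x0)// ler_wpM2r ?invr_ge0 ?(ltW x0)//.
  by apply: kM; apply: div_in01; rewrite t0.
have mv := cmeas_divx hf.1.
have [h1 _ _] := inL2_hardy_left uL.
have [] := tri_fubini_dom mk kM mu' mv h1.
  have := cintegrable_norm mH (inL2_mul_integrable (hardy_left_inL2 uL) hf).
  apply: eq_integrable => // y /set_mem; rewrite halflineE => y0; congr EFin.
  rewrite !normcM normc_hardy// normc_real [`|y^-1|]ger0_norm ?invr_ge0 ?ltW//.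
  by ring.
move=> i2 _ _ _ E.
have -> : Kop k (Kop' k f) x = cintegral H (fun t => cintegral `]t, +oo[ (fun y => k (t / y) * u t * (f y * (y^-1)%:C))).
  rewrite /Kop -(cintegral_cutoff _ xH).
  apply: eq_cintegral => t /set_mem; rewrite halflineE => t0.
  rewrite /cutoff mem_oo t0/=; case: ltP => [tx|xt]; last first.
    rewrite -[LHS](cintegral0 `]t, +oo[); apply: eq_cintegral => s _.
    have -> : u t = 0 by apply: u0; rewrite [t < x]ltNge xt andbF.
    by rewrite mulr0 mul0r.
  rewrite (ux t t0 tx) (_ : _ * _ = (k (t / x) * (x^-1)%:C) * Kop' k f t); last by ring.
  rewrite /Kop' -(cintegralZ (k (t / x) * (x^-1)%:C) (measurable_itv _) (Kop'_int bk hf t0)).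
  by apply: eq_cintegral => s _; ring.
rewrite -E; have [_ _ ->] := @cintegral_split R 0 x +oo%O _ (ltW x0) isT i2.
clear E i2 h1.
congr (_ + _).
  apply: eq_cintegral => y /set_mem/in_oo[y0 yx].
  rewrite (eq_cintegral (g := fun t => (f y * (y^-1)%:C * (x^-1)%:C) * (k (t / y) * k (t / x)))).
    rewrite cintegralZ; [|exact: measurable_itv|exact: kk_integrable_left y0 (ltW yx)].
    rewrite (J2 y0 (ltW yx)).
    rewrite (_ : _ * _ = k (y / x) * f y * (x^-1)%:C * ((y^-1)%:C * y%:C)); last by ring.
    by rewrite rcVK ?mulr1// gt_eqF.
  by move=> t /set_mem/in_oo[t0 ty]; rewrite ux ?(lt_trans ty)//; ring.
apply: eq_cintegral => y /set_mem/in_oy xy; have y0 := lt_trans x0 xy.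
have sub : `]0, x[ `<=` `]0, y[ by move=> t /in_oo[t0 tx]; rewrite /= in_itv/= t0 (lt_trans tx).
rewrite (eq_cintegral (g := cutoff `]0, x[ (fun t => (f y * (y^-1)%:C * (x^-1)%:C) * (k (t / x) * k (t / y))))).
  rewrite (cintegral_cutoff _ sub) cintegralZ; [|exact: mI|exact: kk_integrable_left x0 (ltW xy)].
  rewrite (J2 x0 (ltW xy)).
  rewrite (_ : _ * _ = k (x / y) * 1 * (f y * (y^-1)%:C) * ((x^-1)%:C * x%:C)); last by ring.
  by rewrite rcVK ?mulr1// gt_eqF.
move=> t /set_mem/in_oo[t0 ty]; rewrite /cutoff mem_oo t0/=; case: ltP => [tx|xt].
  by rewrite ux//; ring.
have -> : u t = 0 by apply: u0; rewrite [t < x]ltNge xt andbF.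
by rewrite mulr0 mul0r.
Qed.

Definition Aop f x := f x - Kop k f x.
Definition Aop' f x := f x - Kop' k f x.

Lemma Aop_L2 f : inL2 f -> inL2 (Aop f).
Proof. by move=> hf; apply: inL2B => //; have [] := Kop_L2 bk hf. Qed.

Lemma Aop'_L2 f : inL2 f -> inL2 (Aop' f).
Proof. by move=> hf; apply: inL2B => //; have [] := Kop'_L2 bk hf. Qed.

Lemma Aop'_Aop f x : inL2 f -> 0 < x -> Aop' (Aop f) x = f x.
Proof.
move=> hf x0; have [hK _] := Kop_L2 bk hf.
by rewrite /Aop' /Aop Kop'B// Kop'_Kop//; ring.
Qed.

Lemma Aop_Aop' f x : inL2 f -> 0 < x -> Aop (Aop' f) x = f x.
Proof.
move=> hf x0; have [hK _] := Kop'_L2 bk hf.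
by rewrite /Aop' /Aop KopB// Kop_Kop'//; ring.
Qed.

End inverse_operators.

(** * Action on test functions *)

Section absolutely_continuous.
Context {R : realType}.
Local Notation mu := (@lebesgue_measure R).
Local Notation H := (@halfline R).
Implicit Types (g : R -> R) (a b x y : R).

Lemma lebesgue_is_derive g : mu.-integrable setT (fun x => (g x)%:E) ->
  {ae mu, forall x, is_derive x 1 (fun y => \int[mu]_(t in `]-oo, y]) g t) (g x)}.
Proof.
move=> ig.
have h1 y : mu.-integrable `]-oo, y] (EFin \o g).
  by apply: rintegrableS ig => //; exact: subsetT.
have h2 : locally_integrable [set: R] g by exact: (open_integrable_locally openT ig).
apply: ae_mono (FTC1Ny h1 h2) => x [d e].
by split; [exact: d|rewrite -derive1E; exact: e].
Qed.

Lemma ae_derive_on g g' a b : mu.-integrable `[a, b] (fun x => (g' x)%:E) ->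
  (forall y, a < y < b -> g y - g a = \int[mu]_(t in `[a, y]) g' t) ->
  {ae mu, forall x, a < x < b -> is_derive x 1 g (g' x)}.
Proof.
move=> ig gE; have mI : measurable (`[a, b] : set R) by exact: measurable_itv.
have /lebesgue_is_derive := (rintegrable_mkcond _ mI).1 ig.
apply: ae_mono => x dx xab.
have E y : a < y < b -> \int[mu]_(t in `]-oo, y]) (g' \_ `[a, b]) t = g y - g a.
  move=> /andP[ay yb]; rewrite gE ?ay// -[RHS]/(fine _) -[LHS]/(fine _); congr fine.
  rewrite integral_mkcond [RHS]integral_mkcond; apply: eq_integral => t _.
  rewrite !patchE !mem_setE/= !in_itv/=.
  case: (leP t y) => ty; case: (leP a t) => at_ //=.
  by rewrite (le_trans ty (ltW yb)).
have xI : x \in `[a, b]%classic by rewrite mem_setE/= in_itv/= !ltW//; case/andP: xab.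
rewrite patchE xI in dx.
have dx' := is_derive1D dx (is_derive1_cst (g a) x).
rewrite addr0 in dx'.
apply: near_eq_is_derive dx' => //.
near=> y; rewrite E ?subrK//.
near: y; have := near_in_itvoo xab.
by apply: filterS => y; rewrite in_itv.
Unshelve. all: by end_near. Qed.

(** Differentiability almost everywhere follows from the integral identity by Lebesgue's theorem. It
    is applied on the intervals from [n.+1%:R^-1] to [n.+2%:R], since [f'] need not be integrable up
    to 0 or to infinity. *)
Lemma loc_AC_of_integral (f f' : R -> R[i]) :
  (forall a b, 0 < a -> a < b -> cintegrable `[a, b] f' /\ f b - f a = cintegral `[a, b] f') ->
  loc_AC_derive f f'.
Proof.
move=> h; split => //.
suff hn n : {ae mu, forall x, n.+1%:R^-1 < x < n.+2%:R -> is_cderive f x (f' x)}.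
  have := ae_foralln hn; apply: ae_mono => x hx x0.
  pose n := maxn (Num.truncn x^-1) (Num.truncn x); apply: (hx n).
  apply/andP; split.
    rewrite -[ltRHS]invrK ltf_pV2 ?posrE ?invr_gt0 ?ltr0n//.
    by apply: (lt_le_trans (truncnS_gt _)); rewrite ler_nat ltnS leq_maxl.
  apply: (lt_le_trans (truncnS_gt _)); rewrite ler_nat.
  by apply: leqW; rewrite ltnS leq_maxr.
have n0 : 0 < n.+1%:R^-1 :> R by rewrite invr_gt0 ltr0n.
have n1 : n.+1%:R^-1 < n.+2%:R :> R.
  apply: (@le_lt_trans _ _ 1); last by rewrite ltr1n.
  by rewrite invf_le1 ?ltr0n// ler1n.
have [[i1 i2] _] := h _ _ n0 n1.
have gE y : n.+1%:R^-1 < y < n.+2%:R -> f y - f n.+1%:R^-1 = cintegral `[n.+1%:R^-1, y] f'.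
  by move=> /andP[ny _]; have [] := h _ _ n0 ny.
have := ae_and (@ae_derive_on (fun x => Re (f x)) (fun x => Re (f' x)) _ _ i1 _)
  (@ae_derive_on (fun x => Im (f x)) (fun x => Im (f' x)) _ _ i2 _).
move=> hh; apply: ae_mono (hh _ _).
- by move=> x [h1 h2] xn; split; [exact: h1|exact: h2].
- by move=> y /gE /(congr1 (@complex.Re R)); rewrite Re_cintegral cRe_add cRe_opp.
- by move=> y /gE /(congr1 (@complex.Im R)); rewrite Im_cintegral cIm_add cIm_opp.
Qed.

Lemma bounded_cintegrable (D : set R) a b (f : R -> R[i]) (M : R) : measurable D ->
  D `<=` `[a, b] -> cmeas D f -> (forall x, D x -> normc (f x) <= M) -> cintegrable D f.
Proof.
move=> mD Dab mf fM; apply: (@le_cintegrable _ _ _ (fun=> M)) => //.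
apply: (@integrableS _ _ _ mu `[a, b]) => //.
by apply: continuous_compact_integrable; [exact: segment_compact|
  apply: continuous_subspaceT => z; exact: cst_continuous].
Qed.

(** Fubini's theorem for a < t < x < b with bounded data. All three functions are cut off to the
    box, on which t / x stays above a / b. *)
Lemma tri_box (q u v : R -> R[i]) a b (M N L : R) : 0 < a -> cmeas (`]0, 1[ : set R) q ->
  (forall y, a / b < y < 1 -> normc (q y) <= M) ->
  cmeas `]a, b[ u -> cmeas `]a, b[ v ->
  (forall x, a < x < b -> normc (u x) <= N) -> (forall x, a < x < b -> normc (v x) <= L) ->
  [/\ cintegrable `]a, b[ (fun x => cintegral `]a, x[ (fun t => q (t / x) * u t * v x)),
      cintegrable `]a, b[ (fun t => cintegral `]t, b[ (fun x => q (t / x) * u t * v x)) &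
      cintegral `]a, b[ (fun x => cintegral `]a, x[ (fun t => q (t / x) * u t * v x)) =
      cintegral `]a, b[ (fun t => cintegral `]t, b[ (fun x => q (t / x) * u t * v x))].
Proof.
move=> a0 mq qM mu' mv uN vL.
have mI : measurable (`]a, b[ : set R) by exact: measurable_itv.
have mH := @measurable_halfline R.
have [ab|ba] := ltP a b; last first.
  have -> : `]a, b[%classic = set0 :> set R by rewrite set_itv_ge// bnd_simp -leNgt.
  split.
  - by split; exact: integrable_set0.
  - by split; exact: integrable_set0.
  - by apply: eq_cintegral => x; rewrite inE.
have b0 : 0 < b by exact: lt_trans ab.
have M0 : 0 <= Num.max M 0 by rewrite le_max lexx orbT.
have N0 : 0 <= N by apply: le_trans (uN ((a + b) / 2) _); [exact: normc_ge0|rewrite !midf_lt].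
have L0 : 0 <= L by apply: le_trans (vL ((a + b) / 2) _); [exact: normc_ge0|rewrite !midf_lt].
have sH : `]a, b[ `<=` H by move=> x /in_oo[ax _]; rewrite halflineE (lt_trans a0).
pose Q := cutoff `]a / b, 1[ q; pose U := cutoff `]a, b[ u; pose V := cutoff `]a, b[ v.
have mQ : cmeas (`]0, 1[ : set R) Q.
  apply: cmeas_cutoffT; first exact: measurable_itv.
  apply: cmeasS mq; first exact: measurable_itv.
  move=> y /in_oo[y1 y2]; rewrite /= in_itv/= y2 andbT; apply: lt_trans y1.
  by rewrite divr_gt0.
have mU : cmeas H U by exact: cmeas_cutoffT.
have mV : cmeas H V by exact: cmeas_cutoffT.
have Qb y : 0 < y < 1 -> normc (Q y) <= Num.max M 0.
  move=> _; rewrite /Q /cutoff mem_oo; case: ifPn => [h|_]; last by rewrite normc0.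
  by rewrite le_max qM.
have U0 x : ~~ (a < x < b) -> U x = 0 by move=> h; rewrite /U cutoff_notin// mem_oo.
have V0 x : ~~ (a < x < b) -> V x = 0 by move=> h; rewrite /V cutoff_notin// mem_oo.
have UE x : a < x < b -> U x = u x by move=> h; rewrite /U cutoff_in// mem_oo.
have VE x : a < x < b -> V x = v x by move=> h; rewrite /V cutoff_in// mem_oo.
have QE t x : a < t -> t < x -> x < b -> Q (t / x) = q (t / x).
  move=> at_ tx xb; have t0 := lt_trans a0 at_; have x0 := lt_trans t0 tx.
  rewrite /Q cutoff_in// mem_oo; apply/andP; split; last by rewrite ltr_pdivrMr// mul1r.
  by apply: ltr_pM => //; rewrite ?ltf_pV2 ?posrE ?invr_ge0// ltW.
have UL : inL2 U.
  apply: (@inL2_bounded_support _ _ a b N) => // x.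
  by have [h|h] := boolP (a < x < b); [rewrite UE// uN|rewrite U0// normc0].
(* The factor [x] compensates the [x^-1] of the Hardy mean of [U], with which this function is
   paired. *)
have VL : inL2 (fun x => V x * x%:C).
  apply: (@inL2_bounded_support _ _ a b (L * b)).
  - by apply: cmeasM => //; apply: cmeas_real.
  - move=> x; have [h|h] := boolP (a < x < b); last by rewrite V0// mul0r normc0 mulr_ge0 ?(ltW b0).
    rewrite VE// normcM normc_real; apply: ler_pM; rewrite ?normc_ge0 ?vL//.
    by case/andP: h => ax xb; rewrite ger0_norm ltW// (lt_trans a0).
  - by move=> x h; rewrite V0// mul0r.
have [h1 _ _] := inL2_hardy_left UL.
have E1 x : a < x < b -> cintegral `]0, x[ (fun t => Q (t / x) * U t * V x) =
    cintegral `]a, x[ (fun t => q (t / x) * u t * v x).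
  move=> axb; have /andP[ax xb] := axb.
  have sub : `]a, x[ `<=` `]0, x[ by move=> t /in_oo[t1 t2]; rewrite /= in_itv/= t2 andbT (lt_trans a0).
  rewrite -[RHS](cintegral_cutoff _ sub); apply: eq_cintegral => t /set_mem/in_oo[t0 tx].
  rewrite /cutoff mem_oo tx andbT; case: ltP => [at_|ta].
    by rewrite (QE t x at_ tx xb) (VE x axb) UE// at_ (lt_trans tx).
  by rewrite U0 ?mulr0 ?mul0r// [a < t]ltNge ta.
have E1' x : ~~ (a < x < b) -> cintegral `]0, x[ (fun t => Q (t / x) * U t * V x) = 0.
  move=> nx; rewrite -[RHS](cintegral0 `]0, x[); apply: eq_cintegral => t _.
  by rewrite (V0 x nx) mulr0.
have E2 t : a < t < b -> cintegral `]t, +oo[ (fun x => Q (t / x) * U t * V x) =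
    cintegral `]t, b[ (fun x => q (t / x) * u t * v x).
  move=> atb; have /andP[at_ tb] := atb.
  have sub : `]t, b[ `<=` `]t, +oo[ by move=> x /in_oo[t1 t2]; rewrite /= in_itv/= t1.
  rewrite -[RHS](cintegral_cutoff _ sub); apply: eq_cintegral => x /set_mem/in_oy tx.
  rewrite /cutoff mem_oo tx/=; case: ltP => [xb|bx].
    by rewrite (QE t x at_ tx xb) (UE t atb) VE// xb (lt_trans at_).
  by rewrite V0 ?mulr0// [x < b]ltNge bx andbF.
have E2' t : ~~ (a < t < b) -> cintegral `]t, +oo[ (fun x => Q (t / x) * U t * V x) = 0.
  move=> nt; rewrite -[RHS](cintegral0 `]t, +oo[); apply: eq_cintegral => x _.
  by rewrite (U0 t nt) mulr0 mul0r.
have [] := tri_fubini_dom mQ Qb mU mV h1.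
  have := cintegrable_norm mH (inL2_mul_integrable (hardy_left_inL2 UL) VL).
  apply: eq_integrable => // y /set_mem; rewrite halflineE => y0; congr EFin.
  rewrite !normcM normc_hardy// normc_real [`|y|]ger0_norm ?ltW//.
  by rewrite [_ * y]mulrC mulrACA mulVf ?gt_eqF// mul1r mulrC.
move=> i1 i2 _ _ E.
split.
- apply: (eq_cintegrable mI _ (cintegrableS mH mI sH i1)) => x /set_mem/in_oo[ax xb].
  by apply: E1; rewrite ax.
- apply: (eq_cintegrable mI _ (cintegrableS mH mI sH i2)) => t /set_mem/in_oo[at_ tb].
  by apply: E2; rewrite at_.
- rewrite -(cintegral_cutoff _ sH) -[RHS](cintegral_cutoff _ sH).
  transitivity (cintegral H (fun x => cintegral `]0, x[ (fun t => Q (t / x) * U t * V x))).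
    apply: eq_cintegral => x _; rewrite /cutoff mem_oo.
    by case: ifPn => [/E1 ->|/E1' ->].
  rewrite E; apply: eq_cintegral => t _; rewrite /cutoff mem_oo.
  by case: ifPn => [/E2 ->|/E2' ->].
Qed.

End absolutely_continuous.

Section real_complex_morphism.
Context {R : realType}.
Implicit Types a b : R.

Lemma rcM a b : (a * b)%:C = a%:C * b%:C. Proof. exact: (rmorphM (real_complex R)). Qed.
Lemma rcD a b : (a + b)%:C = a%:C + b%:C. Proof. exact: (rmorphD (real_complex R)). Qed.
Lemma rcB a b : (a - b)%:C = a%:C - b%:C. Proof. exact: (rmorphB (real_complex R)). Qed.
Lemma rcN a : (- a)%:C = - a%:C. Proof. exact: (rmorphN (real_complex R)). Qed.
Lemma rcX a n : (a ^+ n)%:C = a%:C ^+ n. Proof. exact: (rmorphXn (real_complex R)). Qed.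
Lemma rc1 : (1 : R)%:C = 1. Proof. by []. Qed.
Lemma rc_nat n : (n%:R : R)%:C = n%:R. Proof. exact: (rmorph_nat (real_complex R)). Qed.

End real_complex_morphism.

Section differentiability.
Context {R : realType}.
Implicit Types (f g : R -> R[i]) (x t : R).

Definition cdiff f x := exists l, is_cderive f x l.

Lemma cdiff_continuous f x : cdiff f x -> ccontinuous_at f x.
Proof. by move=> [l]; exact: is_cderive_continuous. Qed.

Lemma cdiff_cst z x : cdiff (fun=> z) x.
Proof. by exists 0; exact: is_cderive_cst. Qed.

Lemma cdiffM f g x : cdiff f x -> cdiff g x -> cdiff (fun t => f t * g t) x.
Proof. by move=> [l df] [m dg]; eexists; exact: is_cderiveM df dg. Qed.

Lemma is_cderive_inv x : x != 0 -> is_cderive (fun t : R => (t^-1)%:C) x (- ((x^-1) ^+ 2)%:C).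
Proof.
move=> x0; apply: is_cderive_eq (is_cderive_real (is_derive1V x0 (is_derive1_id x))) _.
by rewrite mulr1 -rmorphN exprVn.
Qed.

Lemma cdiff_inv x : x != 0 -> cdiff (fun t : R => (t^-1)%:C) x.
Proof. by move=> x0; eexists; exact: is_cderive_inv. Qed.

Lemma is_cderive_div f (x t : R) l : is_cderive f (t / x) l -> is_cderive (fun t => f (t / x)) t (l * (x^-1)%:C).
Proof.
move=> df; apply: (is_cderive_comp (p := fun t => t / x)) df _.
by apply: (is_derive1_eq (is_derive1M (is_derive1_id t) (is_derive1_cst x^-1 t))); rewrite mulr0 addr0 mul1r.
Qed.

Lemma is_cderive_divV f (x t : R) l : t != 0 -> is_cderive f (x / t) l ->
  is_cderive (fun t => f (x / t)) t (- (l * x%:C * ((t^-1) ^+ 2)%:C)).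
Proof.
move=> t0 df.
have d : is_derive t 1 (fun t => x / t) (- (x * t^-1 ^+ 2)).
  apply: (is_derive1_eq (is_derive1M (is_derive1_cst x t) (is_derive1V t0 (is_derive1_id t)))).
  by rewrite mul0r add0r mulr1 mulrN exprVn.
apply: is_cderive_eq (is_cderive_comp (p := fun t => x / t) df d) _.
by rewrite rcN rcM; ring.
Qed.

Lemma cdiff_div f x t : cdiff f (t / x) -> cdiff (fun t => f (t / x)) t.
Proof. by move=> [l df]; eexists; exact: is_cderive_div df. Qed.

Lemma cdiff_divV f x t : t != 0 -> cdiff f (x / t) -> cdiff (fun t => f (x / t)) t.
Proof. by move=> t0 [l df]; eexists; exact: is_cderive_divV df. Qed.

Lemma ccontinuous_bounded f (a b : R) : (forall z, a <= z <= b -> ccontinuous_at f z) ->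
  exists2 M : R, 0 <= M & forall z, a <= z <= b -> normc (f z) <= M.
Proof.
move=> cf.
have [M M0 h] := @continuous_bounded R (fun t => Re (f t)) a b (fun z zab => (cf z zab).1).
have [N N0 h'] := @continuous_bounded R (fun t => Im (f t)) a b (fun z zab => (cf z zab).2).
exists (M + N); first exact: addr_ge0.
by move=> z zab; apply: (le_trans (normc_le_ReIm _)); apply: lerD; [exact: h|exact: h'].
Qed.

Lemma cFTC_oo (F f : R -> R[i]) (a b : R) : a <= b ->
  (forall x, a <= x <= b -> is_cderive F x (f x)) -> (forall x, a <= x <= b -> cdiff f x) ->
  cintegral `]a, b[ f = F b - F a /\ cintegrable `]a, b[ f.
Proof.
move=> ab dF cf.
have cc x : a <= x <= b -> ccontinuous_at f x by move=> h; apply: cdiff_continuous; exact: cf.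
split; first exact: cFTC2.
by apply: cintegrable_cc_oo; exact: ccontinuous_cintegrable.
Qed.

End differentiability.

(** * Wronskian identities for the Legendre equation *)

Section legendre_identities.
Context {R : realType}.
Variables (lam : R[i]) (P k k2 : R -> R[i]).
Hypothesis P1 : P 1 = 1.
Hypothesis dP : forall z : R, -1 < z -> is_cderive P z (k z).
Hypothesis dk : forall z : R, -1 < z -> is_cderive k z (k2 z).
Hypothesis dk2 : forall z : R, -1 < z -> cdiff k2 z.
Hypothesis ode : forall z : R, -1 < z ->
  (1 - z ^+ 2)%:C * k2 z - (2 * z)%:C * k z + lam * P z = 0.
Implicit Types s t x y : R.

Lemma cdiffP z : -1 < z -> cdiff P z. Proof. by move=> h; exists (k z); exact: dP. Qed.
Lemma cdiffk z : -1 < z -> cdiff k z. Proof. by move=> h; exists (k2 z); exact: dk. Qed.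

Lemma ode_complex z : -1 < z -> (1 - z%:C ^+ 2) * k2 z - 2 * z%:C * k z + lam * P z = 0.
Proof.
move=> h; have := ode h.
by rewrite rcB rcM rcX rc1 rc_nat.
Qed.

Lemma gtN1_div x t : 0 < x -> 0 < t -> -1 < x / t.
Proof. by move=> x0 t0; apply: lt_trans (divr_gt0 x0 t0); rewrite ltrN10. Qed.

(** Lagrange's identity: in the derivative of the weighted Wronskian the terms in [lam] cancel, and
    the integrand is what remains. The weight vanishes at [t = x], so the value comes from [t = y]
    alone. *)
Lemma legendre_wronskian_inv y x : 0 < y -> y < x ->
  cintegral `]y, x[ (fun t => k2 (y / t) * P (x / t) * ((t^-1) ^+ 2)%:C) =
  P (x / y) * k 1 * (y^-1)%:C - k (x / y) * x%:C * ((y^-1) ^+ 2)%:C.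
Proof.
move=> y0 yx; have x0 : 0 < x by exact: lt_trans yx.
have cn : y ^+ 2 - x ^+ 2 != 0.
  by rewrite subr_eq0 lt_eqF// ltr_pXn2r// ?nnegrE ltW.
(* up to a constant, [1 - x^2 / t^2] times the Wronskian of the two solutions
   [P (x / t)] and [P (y / t)] *)
pose G t := ((y ^+ 2 - x ^+ 2)^-1)%:C * ((1 - x%:C ^+ 2 * (t^-1)%:C ^+ 2) *
   (x%:C * (P (y / t) * k (x / t)) - y%:C * (P (x / t) * k (y / t)))).
have [||-> _] := @cFTC_oo R G (fun t => k2 (y / t) * P (x / t) * ((t^-1) ^+ 2)%:C) y x (ltW yx).
- move=> t /andP[yt tx]; have t0 : 0 < t by exact: lt_le_trans yt.
  have tn : t != 0 by rewrite gt_eqF.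
  have dPd z : 0 < z -> is_cderive (fun t => P (z / t)) t _ :=
    fun z0 => is_cderive_divV tn (dP (gtN1_div z0 t0)).
  have dkd z : 0 < z -> is_cderive (fun t => k (z / t)) t _ :=
    fun z0 => is_cderive_divV tn (dk (gtN1_div z0 t0)).
  have di := is_cderive_inv tn.
  have d1 := is_cderiveB (is_cderive_cst 1 t) (is_cderiveM (is_cderive_cst (x%:C ^+ 2) t) (is_cderiveM di di)).
  have d2 z w : 0 < z -> 0 < w -> is_cderive (fun t => P (z / t) * k (w / t)) t _ :=
    fun z0 w0 => is_cderiveM (dPd z z0) (dkd w w0).
  have d3 := is_cderiveB (is_cderiveM (is_cderive_cst x%:C t) (d2 y x y0 x0))
     (is_cderiveM (is_cderive_cst y%:C t) (d2 x y x0 y0)).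
  have d4 := is_cderiveM (is_cderive_cst ((y ^+ 2 - x ^+ 2)^-1)%:C t) (is_cderiveM d1 d3).
  apply: is_cderive_eq d4 _.
  have ex := ode_complex (gtN1_div x0 t0); have ey := ode_complex (gtN1_div y0 t0).
  rewrite !rcM in ex ey.
  move: (P (x / t)) (P (y / t)) (k (x / t)) (k (y / t)) (k2 (x / t)) (k2 (y / t)) ex ey
    => px py kx ky kkx kky ex ey.
  have EE : ((y ^+ 2 - x ^+ 2)^-1)%:C * (y%:C ^+ 2 - x%:C ^+ 2) = 1.
    by rewrite -!rcX -rcB -rcM mulVf.
  move: EE ex ey; rewrite !rcX; set c := (_^-1)%:C; move: (t^-1)%:C x%:C y%:C c => T X Y c EE ex ey.
  apply/eqP; rewrite -subr_eq0; apply/eqP.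
  (* The difference is an explicit combination of the Legendre equations at [x / t] and [y / t] and
     of [c * (y ^+ 2 - x ^+ 2) = 1]. *)
  transitivity (c * T ^+ 2 * (X ^+ 2 * py * ((1 - (X * T) ^+ 2) * kkx - 2 * (X * T) * kx + lam * px) * -1
    + X ^+ 2 * px * ((1 - (Y * T) ^+ 2) * kky - 2 * (Y * T) * ky + lam * py))
    + kky * px * T ^+ 2 * (c * (Y ^+ 2 - X ^+ 2) - 1)); first by ring.
  by rewrite ex ey EE; ring.
- move=> t /andP[yt tx]; have t0 : 0 < t by exact: lt_le_trans yt.
  have tn : t != 0 by rewrite gt_eqF.
  apply: cdiffM; last first.
    rewrite (_ : (fun t => _) = (fun t : R => (t^-1)%:C * (t^-1)%:C)); last by apply/funext => z; rewrite rcX expr2.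
    by apply: cdiffM; exact: cdiff_inv.
  by apply: cdiffM; apply: cdiff_divV => //; [apply: dk2|apply: cdiffP]; exact: gtN1_div.
rewrite /G (divff (lt0r_neq0 x0)) (divff (lt0r_neq0 y0)) P1.
have EE : ((y ^+ 2 - x ^+ 2)^-1)%:C * (y%:C ^+ 2 - x%:C ^+ 2) = 1.
  by rewrite -!rcX -rcB -rcM mulVf.
have EX : x%:C * (x^-1)%:C = 1 by rewrite mulrC rcVK ?gt_eqF.
have EY : y%:C * (y^-1)%:C = 1 by rewrite mulrC rcVK ?gt_eqF.
rewrite (_ : 1 - x%:C ^+ 2 * (x^-1)%:C ^+ 2 = 0); last by rewrite -exprMn EX expr1n subrr.
rewrite mul0r mulr0 sub0r rcX.
move: EE EY; set c := (_^-1)%:C; move: (y^-1)%:C x%:C y%:C c (P _) (k _) (k _) => T X Y c p ka kb EE EY.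
transitivity (T ^+ 2 * (c * (Y ^+ 2 - X ^+ 2)) * (Y * p * ka - X * kb)
  + c * (1 - (Y * T) ^+ 2) * (Y * p * ka - X * kb)); first by ring.
by rewrite EE EY; transitivity ((Y * T) * T * p * ka - X * T ^+ 2 * kb); [ring|rewrite EY; ring].
Qed.

(** The same identity for the solutions [P (t / x)] and [P (t / s)], with weight [t ^+ 2 - x ^+ 2];
    only [t = s] contributes. *)
Lemma legendre_wronskian x s : 0 < x -> x < s ->
  cintegral `]x, s[ (fun t => k2 (t / s) * P (t / x) * ((s^-1) ^+ 2)%:C) =
  P (s / x) * k 1 * (s^-1)%:C - k (s / x) * (x^-1)%:C.
Proof.
move=> x0 xs; have s0 : 0 < s by exact: lt_trans xs.
have cn : s ^+ 2 - x ^+ 2 != 0.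
  by rewrite subr_eq0 gt_eqF// ltr_pXn2r// ?nnegrE ltW.
have EE : ((s ^+ 2 - x ^+ 2)^-1)%:C * (s%:C ^+ 2 - x%:C ^+ 2) = 1.
  by rewrite -!rcX -rcB -rcM mulVf.
have EX : x%:C * (x^-1)%:C = 1 by rewrite mulrC rcVK ?gt_eqF.
have ES : s%:C * (s^-1)%:C = 1 by rewrite mulrC rcVK ?gt_eqF.
pose G (t : R) := ((s ^+ 2 - x ^+ 2)^-1)%:C * ((t%:C * t%:C - x%:C ^+ 2) *
   (P (t / x) * k (t / s) * (s^-1)%:C - k (t / x) * P (t / s) * (x^-1)%:C)).
have [||-> _] := @cFTC_oo R G (fun t => k2 (t / s) * P (t / x) * ((s^-1) ^+ 2)%:C) x s (ltW xs).
- move=> t /andP[xt ts]; have t0 : 0 < t by exact: lt_le_trans xt.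
  have dPd z : 0 < z -> is_cderive (fun t => P (t / z)) t _ :=
    fun z0 => is_cderive_div (dP (gtN1_div t0 z0)).
  have dkd z : 0 < z -> is_cderive (fun t => k (t / z)) t _ :=
    fun z0 => is_cderive_div (dk (gtN1_div t0 z0)).
  have di : is_cderive (fun t : R => t%:C) t 1%:C := is_cderive_real (is_derive1_id t).
  have d1 := is_cderiveB (is_cderiveM di di) (is_cderive_cst (x%:C ^+ 2) t).
  have d3 := is_cderiveB
     (is_cderiveM (is_cderiveM (dPd x x0) (dkd s s0)) (is_cderive_cst (s^-1)%:C t))
     (is_cderiveM (is_cderiveM (dkd x x0) (dPd s s0)) (is_cderive_cst (x^-1)%:C t)).
  have d4 := is_cderiveM (is_cderive_cst ((s ^+ 2 - x ^+ 2)^-1)%:C t) (is_cderiveM d1 d3).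
  apply: is_cderive_eq d4 _.
  have ex := ode_complex (gtN1_div t0 x0); have es := ode_complex (gtN1_div t0 s0).
  rewrite !rcM in ex es; rewrite !rcX rc1.
  move: (P (t / x)) (P (t / s)) (k (t / x)) (k (t / s)) (k2 (t / x)) (k2 (t / s)) ex es
    => px ps kx ks kkx kks ex es.
  move: EE EX ES ex es; set c := (_^-1)%:C.
  move: t%:C x%:C s%:C (x^-1)%:C (s^-1)%:C c => T X S X' S' c EE EX ES ex es.
  apply/eqP; rewrite -subr_eq0; apply/eqP.
  transitivity (c * (ps * ((1 - (T * X') ^+ 2) * kkx - 2 * (T * X') * kx + lam * px)
    - px * ((1 - (T * S') ^+ 2) * kks - 2 * (T * S') * ks + lam * ps))
    + c * (ps * kkx * ((X * X') ^+ 2 - 1) - px * kks * ((S * S') ^+ 2 - 1))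
    + kks * px * S' ^+ 2 * (c * (S ^+ 2 - X ^+ 2) - 1)); first by ring.
  by rewrite ex es EE EX ES; ring.
- move=> t /andP[xt ts]; have t0 : 0 < t by exact: lt_le_trans xt.
  apply: cdiffM; last exact: cdiff_cst.
  by apply: cdiffM; apply: cdiff_div; [apply: dk2|apply: cdiffP]; exact: gtN1_div.
rewrite /G (divff (lt0r_neq0 x0)) (divff (lt0r_neq0 s0)) P1.
move: EE EX ES; set c := (_^-1)%:C.
move: x%:C s%:C (x^-1)%:C (s^-1)%:C c (P _) (k (s / x)) (k _) => X S X' S' c p ka kb EE EX ES.
transitivity (c * (S ^+ 2 - X ^+ 2) * (p * kb * S' - ka * X')); first by ring.
by rewrite EE mul1r.
Qed.

Lemma cintegral_kernel_x (f f' : R -> R[i]) x t : 0 < x -> x <= t ->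
  (forall z, -1 < z -> is_cderive f z (f' z)) -> (forall z, -1 < z -> cdiff f' z) ->
  cintegral `]x, t[ (fun y => f' (y / t) * (t^-1)%:C) = f 1 - f (x / t) /\
  cintegrable `]x, t[ (fun y => f' (y / t) * (t^-1)%:C).
Proof.
move=> x0 xt df df'; have t0 : 0 < t by exact: lt_le_trans xt.
have [||-> ig] := @cFTC_oo R (fun y => f (y / t)) (fun y => f' (y / t) * (t^-1)%:C) x t xt.
- move=> y /andP[xy yt]; apply: is_cderive_div; apply: df; apply: gtN1_div => //.
  exact: lt_le_trans xy.
- move=> y /andP[xy yt]; apply: cdiffM; last exact: cdiff_cst.
  by apply: cdiff_div; apply: df'; apply: gtN1_div => //; exact: lt_le_trans xy.
by split; [rewrite divff ?gt_eqF|exact: ig].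
Qed.

Lemma kernel_bounded (f : R -> R[i]) (b : R) : (forall z, -1 < z -> cdiff f z) ->
  exists2 M : R, 0 <= M & forall z, 0 <= z <= b -> normc (f z) <= M.
Proof.
move=> df; apply: ccontinuous_bounded => z /andP[z0 _]; apply: cdiff_continuous; apply: df.
by apply: lt_le_trans z0; rewrite ltrN10.
Qed.

Lemma kernel_meas (f : R -> R[i]) (D : set R) : open D -> (forall z, D z -> 0 <= z) ->
  (forall z, -1 < z -> cdiff f z) -> cmeas D f.
Proof.
move=> oD D0 df; apply: ccontinuous_cmeas => // z /D0 z0; apply: cdiff_continuous; apply: df.
by apply: lt_le_trans z0; rewrite ltrN10.
Qed.

Lemma kernel_meas01 (f : R -> R[i]) : (forall z, -1 < z -> cdiff f z) -> cmeas (`]0, 1[ : set R) f.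
Proof.
move=> df; apply: kernel_meas df; first exact: interval_open.
by move=> z /in_oo[/ltW].
Qed.

Lemma kernel_meas_div (f : R -> R[i]) (a b x : R) : 0 < x -> 0 <= a -> (forall z, -1 < z -> cdiff f z) ->
  cmeas `]a, b[ (fun t => f (t / x)) /\ cmeas `]a, b[ (fun t => f (x / t)).
Proof.
move=> x0 a0 df; have oI : @open R `]a, b[%classic by exact: interval_open.
split; apply: ccontinuous_cmeas => // t /in_oo[at_ tb]; apply: cdiff_continuous;
  have t0 : 0 < t by exact: le_lt_trans at_.
  by apply: cdiff_div; apply: df; exact: gtN1_div.
by apply: cdiff_divV; [rewrite gt_eqF|apply: df; exact: gtN1_div].
Qed.

Lemma cdiff_cintegrable (f : R -> R[i]) (a b : R) : (forall t, a <= t <= b -> cdiff f t) ->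
  cintegrable `]a, b[ f.
Proof.
move=> df; apply: cintegrable_cc_oo; apply: ccontinuous_cintegrable => t /df.
exact: cdiff_continuous.
Qed.

(** This inverts the Volterra operator 1 - K through P. Write [k (s / t)] as [k 1] minus the
    integral of [k2 (y / t) / t] over ]s, t[, exchange, and evaluate the inner integral by
    [legendre_wronskian_inv]; the terms with [k 1] cancel. *)
Lemma legendre_resolvent s x : 0 < s -> s < x ->
  cintegral `]s, x[ (fun t => k (s / t) * (P (x / t) * (t^-1)%:C)) = P (x / s) - 1.
Proof.
move=> s0 sx; have x0 : 0 < x by exact: lt_trans sx.
have mI : measurable (`]s, x[ : set R) by exact: measurable_itv.
have tpos t : s <= t -> 0 < t by exact: lt_le_trans.
have [M M0 bM] := kernel_bounded 1 dk2.
have [L L0 bL] := kernel_bounded (x / s) cdiffP.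
have mi : cmeas (`]s, x[ : set R) (fun t => (t^-1)%:C) by apply: cmeas_real; exact: measurable_invr_halfline.
have [_ mP] := @kernel_meas_div P s x x x0 (ltW s0) cdiffP.
have iL t : s < t < x -> normc (P (x / t)) <= L.
  move=> /andP[st tx]; apply: bL; rewrite divr_ge0 ?(ltW x0) ?(ltW (tpos _ (ltW st)))//=.
  by rewrite ler_pM2l// lef_pV2 ?posrE ?(tpos _ (ltW st)) ?ltW.
have iV t : s < t -> normc (t^-1)%:C <= s^-1.
  move=> st; rewrite normc_real ger0_norm ?invr_ge0 ?(ltW (tpos _ (ltW st)))//.
  by rewrite lef_pV2 ?posrE ?(tpos _ (ltW st)) ?ltW.
have [|||||_ _ E] := @tri_box R k2 (fun=> 1) (fun t => P (x / t) * ((t^-1)%:C * (t^-1)%:C)) s x M 1 (L * (s^-1 * s^-1)) s0 (kernel_meas01 dk2).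
- move=> y /andP[y0 y1]; apply: bM; rewrite (ltW y1) andbT ltW//.
  by apply: lt_trans y0; rewrite divr_gt0.
- exact: cmeas_cst.
- by apply: cmeasM => //; exact: cmeasM.
- by move=> t _; rewrite normc_real normr1.
- move=> t stx; have /andP[st tx] := stx; rewrite !normcM.
  apply: ler_pM; rewrite ?iL ?mulr_ge0 ?normc_ge0//.
  by apply: ler_pM; rewrite ?iV ?normc_ge0.
have cP t : s <= t <= x -> cdiff (fun t => P (x / t) * (t^-1)%:C) t.
  move=> /andP[/tpos t0 _]; apply: cdiffM; last by apply: cdiff_inv; rewrite gt_eqF.
  by apply: cdiff_divV; [rewrite gt_eqF|apply: cdiffP; exact: gtN1_div].
have I1 := cdiff_cintegrable cP.
have I2 : cintegrable `]s, x[ (fun t => k (s / t) * (P (x / t) * (t^-1)%:C)).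
  apply: cdiff_cintegrable => t stx; apply: cdiffM; last exact: cP.
  case/andP: stx => /tpos t0 _.
  by apply: cdiff_divV; [rewrite gt_eqF|apply: cdiffk; exact: gtN1_div].
have [||E3 I3] := @cFTC_oo R (fun t => - P (x / t)) (fun t => k (x / t) * x%:C * ((t^-1) ^+ 2)%:C) s x (ltW sx).
- move=> t /andP[/tpos t0 _].
  have := is_cderiveN (is_cderive_divV (lt0r_neq0 t0) (dP (gtN1_div x0 t0))).
  by rewrite opprK.
- move=> t /andP[/tpos t0 _]; have tn := lt0r_neq0 t0.
  apply: cdiffM.
    apply: cdiffM; last exact: cdiff_cst.
    by apply: (cdiff_divV tn); apply: cdiffk; exact: gtN1_div.
  rewrite (_ : (fun t => _) = (fun t : R => (t^-1)%:C * (t^-1)%:C)).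
    by apply: cdiffM; exact: cdiff_inv.
  by apply/funext => z; rewrite rcX expr2.
rewrite (divff (lt0r_neq0 x0)) P1 opprK [-1 + _]addrC in E3.
have L1 : cintegral `]s, x[ (fun t => cintegral `]s, t[ (fun y => k2 (y / t) * 1 * (P (x / t) * ((t^-1)%:C * (t^-1)%:C)))) =
    k 1 * cintegral `]s, x[ (fun t => P (x / t) * (t^-1)%:C) -
    cintegral `]s, x[ (fun t => k (s / t) * (P (x / t) * (t^-1)%:C)).
  rewrite -(cintegralZ (k 1) mI I1) -(cintegralB mI (cintegrableZ (k 1) mI I1) I2).
  apply: eq_cintegral => t /set_mem/in_oo[st tx].
  have [K1 K2] := cintegral_kernel_x s0 (ltW st) dk dk2.
  transitivity ((P (x / t) * (t^-1)%:C) * (k 1 - k (s / t))); last by ring.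
  rewrite -K1 -(cintegralZ _ (measurable_itv _) K2).
  by apply: eq_cintegral => y _; ring.
have L2 : cintegral `]s, x[ (fun y => cintegral `]y, x[ (fun t => k2 (y / t) * 1 * (P (x / t) * ((t^-1)%:C * (t^-1)%:C)))) =
    k 1 * cintegral `]s, x[ (fun t => P (x / t) * (t^-1)%:C) - (P (x / s) - 1).
  rewrite -E3 -(cintegralZ (k 1) mI I1) -(cintegralB mI (cintegrableZ (k 1) mI I1) I3).
  apply: eq_cintegral => y /set_mem/in_oo[sy yx].
  rewrite [RHS](_ : _ = P (x / y) * k 1 * (y^-1)%:C - k (x / y) * x%:C * ((y^-1) ^+ 2)%:C); last by ring.
  rewrite -(legendre_wronskian_inv (tpos _ (ltW sy)) yx).
  by apply: eq_cintegral => t _; rewrite rcX; ring.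
by move: E; rewrite L1 L2 => /addrI/oppr_inj.
Qed.

End legendre_identities.

(** * Test functions *)

Section test_functions.
Context {R : realType}.
Local Notation H := (@halfline R).
Implicit Types (f g h : R -> R[i]) (a b x c d : R).

Lemma cintegral_supp (D E : set R) f : E `<=` D -> (forall x, D x -> ~ E x -> f x = 0) ->
  cintegral D f = cintegral E f.
Proof.
move=> ED f0; rewrite -(cintegral_cutoff _ ED); apply: eq_cintegral => x /set_mem Dx.
by rewrite /cutoff; case: ifPn => // /negP h; apply: f0 => // Ex; apply: h; exact: mem_set.
Qed.

Lemma cintegrable_supp (D E : set R) f : measurable D -> measurable E -> E `<=` D ->
  (forall x, D x -> ~ E x -> f x = 0) -> cintegrable E f -> cintegrable D f.
Proof.
move=> mD mE ED f0 iE; apply: (eq_cintegrable mD _ (cintegrable_cutoff mD mE ED iE)).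
move=> x /set_mem Dx; rewrite /cutoff; case: ifPn => // /negP h.
by rewrite f0// => Ex; apply: h; exact: mem_set.
Qed.

Lemma normc_cintegral_bound (x : R) f (N : R) : 0 <= x -> cintegrable `]0, x[ f ->
  (forall t, 0 < t < x -> normc (f t) <= N) -> normc (cintegral `]0, x[ f) <= 2 * (N * x).
Proof.
move=> x0 fi fN.
have [||iN E] := @rFTC2 R (fun t => N * t) (fun=> N) 0 x x0.
- move=> t _; apply: (is_derive1_eq (is_derive1M (is_derive1_cst N t) (is_derive1_id t))).
  by rewrite mul0r add0r mulr1.
- by move=> t _; exact: cst_continuous.
rewrite -[N * x]subr0 -[X in _ - X](mulr0 N) -E.
by apply: normc_cintegral_le => // t /in_oo[t0 tx]; apply: fN; rewrite t0.
Qed.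

Lemma cintegral_set0 f : cintegral set0 f = 0.
Proof. by rewrite -(cintegral0 set0); apply: eq_cintegral => x; rewrite inE. Qed.

Lemma loc_AC_oo f g : (forall c d, 0 < c -> c < d ->
  cintegrable `]c, d[ g /\ f d - f c = cintegral `]c, d[ g) -> loc_AC_derive f g.
Proof.
move=> hcd; apply: loc_AC_of_integral => c d c0 cd.
by have [i1 ->] := hcd c d c0 cd; have [-> i2] := cintegral_oo_cc i1.
Qed.

(** A Lipschitz function with compact support in (0, oo), presented as the primitive of a bounded
    measurable [h] of mean 0. Integration by parts then becomes Fubini's theorem on a triangle, and
    averages of bounded measurable functions qualify, which gives density. *)
Record test_fun a b h f : Prop := TestFun {
  test_a_gt0 : 0 < a;
  test_lt : a < b;
  test_meas : cmeas setT h;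
  test_bound : exists N : R, forall x, normc (h x) <= N;
  test_supp : forall x, ~~ (a < x < b) -> h x = 0;
  test_mean : cintegral `]0, b[ h = 0;
  test_prim : forall x, f x = cintegral `]0, x[ h }.

Section theory.
Variables (a b : R) (h f : R -> R[i]).
Hypothesis tf : test_fun a b h f.

Let a0 : 0 < a := test_a_gt0 tf.
Let ab : a < b := test_lt tf.
Let b0 : 0 < b := lt_trans a0 ab.

Lemma test_h_integrable (D : set R) c d : measurable D -> D `<=` `[c, d] -> cintegrable D h.
Proof.
move=> mD Dcd; have [N hN] := test_bound tf.
apply: (bounded_cintegrable mD Dcd (M := N)) => //.
by apply: cmeasS (test_meas tf); [exact: measurableT|exact: subsetT].
Qed.

Lemma test_h_oo c d : cintegrable `]c, d[ h.
Proof.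
apply: (@test_h_integrable _ c d); first exact: measurable_itv.
by move=> x /in_oo[/ltW cx /ltW xd]; rewrite /= in_itv/= cx.
Qed.

Lemma test_diff c d : 0 <= c -> c <= d -> f d - f c = cintegral `]c, d[ h.
Proof.
move=> c0 cd; rewrite !(test_prim tf).
move: cd; rewrite le_eqVlt => /predU1P[<-|cd].
  by rewrite subrr set_itv_ge ?bnd_simp ?ltxx// cintegral_set0.
move: c0; rewrite le_eqVlt => /predU1P[<-|c0].
  by rewrite [X in _ - X](_ : _ = 0) ?subr0// set_itv_ge ?bnd_simp ?ltxx// cintegral_set0.
have [_ _ ->] := @cintegral_split R 0 c (BLeft d) h (ltW c0) cd (test_h_oo 0 d).
by rewrite addrAC subrr add0r.
Qed.

Lemma test_eq0 x : ~~ (a < x < b) -> f x = 0.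
Proof.
rewrite negb_and -!leNgt => /orP[xa|bx].
  rewrite (test_prim tf) -[RHS](cintegral0 `]0, x[); apply: eq_cintegral => t /set_mem/in_oo[_ tx].
  by rewrite (test_supp tf)// negb_and -leNgt (le_trans (ltW tx) xa).
have <- : f b = 0 by rewrite (test_prim tf) (test_mean tf).
apply/eqP; rewrite -subr_eq0 (test_diff (ltW b0) bx); apply/eqP.
rewrite -[RHS](cintegral0 `]b, x[); apply: eq_cintegral => t /set_mem/in_oo[bt _].
by rewrite (test_supp tf)// negb_and -!leNgt (ltW bt) orbT.
Qed.

Lemma test_right c d : 0 <= c -> c <= d -> b <= d -> cintegral `]c, d[ h = - f c.
Proof.
move=> c0 cd bd; rewrite -(test_diff c0 cd) (test_eq0 (x := d)) ?sub0r//.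
by rewrite negb_and -!leNgt bd orbT.
Qed.

Lemma test_f_bound : exists N : R, forall x, normc (f x) <= N.
Proof.
have [N hN] := test_bound tf; exists (2 * (N * b)) => x.
have N0 : 0 <= N by apply: le_trans (hN 0); exact: normc_ge0.
have [/andP[ax xb]|nx] := boolP (a < x < b); last first.
  by rewrite test_eq0// normc0 !mulr_ge0// ltW.
have x0 : 0 < x by exact: lt_trans ax.
rewrite (test_prim tf); apply: (le_trans (normc_cintegral_bound (ltW x0) (test_h_oo 0 x) (N := N) _)) => //.
by rewrite ler_pM2l// ler_wpM2l// ltW.
Qed.

Lemma test_f_meas : cmeas H f.
Proof.
have mh : cmeas H h by apply: cmeasS (test_meas tf); [exact: measurableT|exact: subsetT].
have [m1 _] := cmeas_tri_inner (q := fun=> 1) (cmeas_cst _ 1) mh (cmeas_cst _ 1).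
apply: eq_cmeas m1 => x _; rewrite (test_prim tf); apply: eq_cintegral => t _.
by rewrite mul1r mulr1.
Qed.

Lemma test_L2 : inL2 f.
Proof.
have [N fN] := test_f_bound.
by apply: (inL2_bounded_support test_f_meas fN (a := a) (b := b)) => x; exact: test_eq0.
Qed.

Lemma test_f_measI c d : 0 <= c -> cmeas `]c, d[ f.
Proof.
move=> c0; apply: cmeasS test_f_meas; first exact: measurable_halfline.
by move=> x /in_oo[cx _]; rewrite halflineE (le_lt_trans c0).
Qed.

Lemma test_f_oo c d : 0 <= c -> cintegrable `]c, d[ f.
Proof.
move=> c0; have [N fN] := test_f_bound.
apply: (@bounded_cintegrable _ _ c d f N) => //; last exact: test_f_measI.
by move=> x /in_oo[/ltW cx /ltW xd]; rewrite /= in_itv/= cx.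
Qed.

End theory.
End test_functions.

(** * The four operators on test functions *)

Section memberships.
Context {R : realType}.
Variables (nu : R[i]) (k k2 : R -> R[i]).
Local Notation P := (legendreP nu).
Hypothesis P1 : P 1 = 1.
Hypothesis dP : forall z : R, -1 < z -> is_cderive P z (k z).
Hypothesis dk : forall z : R, -1 < z -> is_cderive k z (k2 z).
Hypothesis dk2 : forall z : R, -1 < z -> cdiff k2 z.
Hypothesis ode : forall z : R, -1 < z ->
  (1 - z ^+ 2)%:C * k2 z - (2 * z)%:C * k z + nu * (nu + 1) * P z = 0.
Variables (M : R).
Hypothesis bk : bounded_kernel k M.
Variables (a b : R) (h f : R -> R[i]).
Hypothesis tf : test_fun a b h f.

Let a0 : 0 < a := test_a_gt0 tf.
Let ab : a < b := test_lt tf.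
Let b0 : 0 < b := lt_trans a0 ab.
Let cP z : -1 < z -> cdiff P z := cdiffP dP (z := z).
Let ck z : -1 < z -> cdiff k z := cdiffk dk (z := z).
Let m1 : cmeas (`]0, 1[ : set R) (fun=> 1 : R[i]) := cmeas_cst _ 1.

Lemma oo_cc (c d : R) : `]c, d[ `<=` `[c, d].
Proof. by move=> x /in_oo[/ltW cx /ltW xd]; rewrite /= in_itv/= cx. Qed.

Lemma oo_sub (c c' d : R) : c <= c' -> `]c', d[ `<=` `]c, d[.
Proof. by move=> cc x /in_oo[cx xd]; rewrite /= in_itv/= xd (le_lt_trans cc). Qed.

Lemma oo_oy (c d : R) : `]c, d[ `<=` `]c, +oo[.
Proof. by move=> x /in_oo[cx _]; rewrite /= in_itv/= cx. Qed.

Lemma in_a_x x t : `]0, x[%classic t -> ~ `]a, x[%classic t -> ~~ (a < t < b).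
Proof.
move=> /in_oo[_ tx] nt; apply/negP => /andP[at_ _].
by apply: nt; rewrite /= in_itv/= at_ tx.
Qed.

Lemma bounded_ratio (g : R -> R[i]) (x : R) : (forall z, -1 < z -> cdiff g z) ->
  exists2 N : R, 0 <= N & forall t, 0 < t < x -> normc (g (t / x)) <= N.
Proof.
move=> dg; have [N N0 hN] := kernel_bounded 1 dg; exists N => // t tx.
by apply: hN; have /andP[t1 t2] := div_in01 tx; rewrite !ltW.
Qed.

Lemma test_P0_int (x : R) : 0 < x -> cintegrable `]0, x[ (fun t => P (t / x) * h t).
Proof.
move=> x0; have [N N0 hN] := bounded_ratio x cP.
apply: (cintegrable_bdM (measurable_itv _) _ _ (test_h_oo tf 0 x) (M := N)).
  by have [] := kernel_meas_div (a := 0) x x0 (lexx 0) cP.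
by move=> t /in_oo[t0 tx]; apply: hN; rewrite t0.
Qed.

(** Integration by parts: insert the primitive of [h] into K f, exchange, and use that the integral
    of [k (t / x) / x] over ]s, x[ is [1 - P (s / x)]. *)
Lemma test_P0_val (x : R) : 0 < x -> Aop k f x = cintegral `]0, x[ (fun t => P (t / x) * h t).
Proof.
move=> x0; have [bM bm] := bk.
have mI : measurable (`]a, x[ : set R) by exact: measurable_itv.
have [N1 hN1] := test_bound tf; have [N2 N20 hN2] := bounded_ratio x ck.
have sub : `]a, x[ `<=` `]0, x[ by exact: oo_sub (ltW a0).
have h0 t : `]0, x[%classic t -> ~ `]a, x[%classic t -> h t = 0.
  by move=> h1 h2; apply: (test_supp tf); exact: in_a_x h1 h2.
have f0 t : `]0, x[%classic t -> ~ `]a, x[%classic t -> f t = 0.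
  by move=> h1 h2; apply: (test_eq0 tf); exact: in_a_x h1 h2.
have fE t : a < t -> f t = cintegral `]a, t[ h.
  by move=> at_; rewrite -(test_diff tf (ltW a0) (ltW at_)) (test_eq0 tf (x := a)) ?ltxx// subr0.
have [|||||_ _ E] := @tri_box R (fun=> 1) h (fun t => k (t / x) * (x^-1)%:C) a x 1 N1 (N2 * x^-1) a0 m1.
- by move=> y _; rewrite normc_real normr1.
- by apply: cmeasS (test_meas tf); [exact: measurableT|exact: subsetT].
- apply: cmeasM; last exact: cmeas_cst.
  by have [] := kernel_meas_div (a := a) x x0 (ltW a0) ck.
- by move=> t _; exact: hN1.
- move=> t /andP[at_ tx]; rewrite normcM normc_real ger0_norm ?invr_ge0 ?(ltW x0)//.
  by rewrite ler_wpM2r ?invr_ge0 ?(ltW x0)// hN2// tx (lt_trans a0).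
have L1 : cintegral `]a, x[ (fun t => cintegral `]a, t[ (fun s => 1 * h s * (k (t / x) * (x^-1)%:C))) = Kop k f x.
  rewrite /Kop (cintegral_supp sub); last by move=> t h1 h2; rewrite (f0 t h1 h2) mulr0 mul0r.
  apply: eq_cintegral => t /set_mem/in_oo[at_ tx].
  rewrite [RHS](_ : _ = (k (t / x) * (x^-1)%:C) * f t); last by ring.
  rewrite (fE t at_).
  rewrite -(cintegralZ _ (measurable_itv _) (test_h_oo tf a t)).
  by apply: eq_cintegral => s _; ring.
have Ih := test_h_oo tf a x.
have IP : cintegrable `]a, x[ (fun t => P (t / x) * h t).
  by apply: cintegrableS (test_P0_int x0) => //; exact: measurable_itv.
have L2 : cintegral `]a, x[ (fun s => cintegral `]s, x[ (fun t => 1 * h s * (k (t / x) * (x^-1)%:C))) =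
   cintegral `]a, x[ h - cintegral `]a, x[ (fun t => P (t / x) * h t).
  rewrite -(cintegralB mI Ih IP); apply: eq_cintegral => s /set_mem/in_oo[as_ sx].
  have [K1 K2] := cintegral_kernel_x (lt_trans a0 as_) (ltW sx) dP ck.
  rewrite [RHS](_ : _ = h s * (1 - P (s / x))); last by ring.
  rewrite P1 in K1; rewrite -K1 -(cintegralZ _ (measurable_itv _) K2).
  by apply: eq_cintegral => t _; ring.
rewrite /Aop -L1 E L2 (cintegral_supp (f := fun t => P (t / x) * h t) sub); last first.
  by move=> t h1 h2; rewrite (h0 t h1 h2) mulr0.
rewrite (test_prim tf) (cintegral_supp sub); last exact: h0.
by rewrite opprB addrCA subrr addr0.
Qed.

Lemma test_P0 : BE_P0 nu f (Aop k f).
Proof.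
split; [exact: test_L2 tf|exact: (Aop_L2 bk (test_L2 tf))|exists h].
  apply: loc_AC_oo => c d c0 cd; split; first exact: test_h_oo tf c d.
  by rewrite (test_diff tf (ltW c0) (ltW cd)).
split; first exact: test_P0_int.
by apply: ae_all => x; exact: test_P0_val.
Qed.

Lemma test_Aop'_eq0 x : b <= x -> Aop' k f x = 0.
Proof.
move=> bx; rewrite /Aop' (test_eq0 tf) ?sub0r; last by rewrite negb_and -!leNgt bx orbT.
apply/eqP; rewrite oppr_eq0; apply/eqP.
rewrite -[RHS](cintegral0 `]x, +oo[); apply: eq_cintegral => t /set_mem/in_oy xt.
rewrite (test_eq0 tf) ?mul0r ?mulr0//; last by rewrite negb_and -!leNgt (le_trans bx (ltW xt)) orbT.
Qed.

Lemma test_Aop_eq0 x : x <= a -> Aop k f x = 0.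
Proof.
move=> xa; rewrite /Aop (test_eq0 tf) ?sub0r; last by rewrite negb_and -!leNgt xa.
apply/eqP; rewrite oppr_eq0; apply/eqP.
rewrite -[RHS](cintegral0 `]0, x[); apply: eq_cintegral => t /set_mem/in_oo[_ tx].
by rewrite (test_eq0 tf) ?mulr0 ?mul0r// negb_and -!leNgt (le_trans (ltW tx) xa).
Qed.

Lemma outside_B (B x t : R) : b <= B -> `]x, +oo[%classic t -> ~ `]x, B[%classic t -> ~~ (a < t < b).
Proof.
move=> bB /in_oy xt nt; apply/negP => /andP[_ tb]; apply: nt.
by rewrite /= in_itv/= xt (lt_le_trans tb).
Qed.

Lemma Aop'_oo c d : 0 < c -> cintegrable `]c, d[ (Aop' k f).
Proof.
move=> c0; have h2 := inL2_cintegrable_left (Aop'_L2 bk (test_L2 tf)).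
have [cd|dc] := ltP c d; last first.
  by rewrite set_itv_ge ?bnd_simp -?leNgt//; split; exact: integrable_set0.
apply: cintegrableS (h2 d (lt_trans c0 cd)); [exact: measurable_itv|exact: measurable_itv|].
exact: oo_sub (ltW c0).
Qed.

Lemma test_Sm_int (x : R) : 0 < x -> cintegrable `]x, +oo[ (fun t => P (x / t) * f t).
Proof.
move=> x0; have sub := @oo_oy x b.
apply: (cintegrable_supp (measurable_itv _) (measurable_itv _) sub).
  by move=> t h1 h2; rewrite (test_eq0 tf (outside_B (lexx b) h1 h2)) mulr0.
have [N N0 hN] := kernel_bounded 1 cP.
apply: (cintegrable_bdM (measurable_itv _) _ _ (test_f_oo tf b (ltW x0)) (M := N)).
  by have [] := kernel_meas_div (a := x) b x0 (ltW x0) cP.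
move=> t /in_oo[xt tb]; apply: hN.
by have /andP[? ?] : 0 < x / t < 1 by [apply: div_in01; rewrite x0]; rewrite !ltW.
Qed.

(** It exhibits the integral defining S_- f as a primitive of A' f up to sign. The exchange uses
    that [k (y / t) / t] integrates to [1 - P (x / t)] over ]x, t[; the bound [B] beyond the support
    keeps all the data bounded. *)
Lemma test_Sm_val (x B : R) : 0 < x -> x < B -> b <= B ->
  cintegral `]x, +oo[ (fun t => P (x / t) * f t) = cintegral `]x, B[ (Aop' k f).
Proof.
move=> x0 xB bB; have mI : measurable (`]x, B[ : set R) by exact: measurable_itv.
have [N1 hN1] := test_f_bound tf; have [N2 N20 hN2] := kernel_bounded 1 ck.
have sub := @oo_oy x B.
have [|||||_ i2 E] := @tri_box R k (fun=> 1) (fun t => f t * (t^-1)%:C) x B N2 1 (N1 * x^-1) x0 (kernel_meas01 ck).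
- move=> y /andP[y0 y1]; apply: hN2; rewrite (ltW y1) andbT ltW//.
  by apply: lt_trans y0; rewrite divr_gt0// (lt_trans x0).
- exact: cmeas_cst.
- by apply: cmeas_divx; exact: test_f_measI tf _ _ (ltW x0).
- by move=> t _; rewrite normc_real normr1.
- move=> t /andP[xt tB]; have t0 := lt_trans x0 xt; rewrite normcM; apply: ler_pM; rewrite ?normc_ge0//.
  by rewrite normc_real ger0_norm ?invr_ge0 ?(ltW t0)// lef_pV2 ?posrE// ltW.
have If := test_f_oo tf B (ltW x0).
have IP : cintegrable `]x, B[ (fun t => P (x / t) * f t).
  by apply: cintegrableS (test_Sm_int x0) => //; exact: measurable_itv.
have L1 : cintegral `]x, B[ (fun t => cintegral `]x, t[ (fun y => k (y / t) * 1 * (f t * (t^-1)%:C))) =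
    cintegral `]x, B[ f - cintegral `]x, B[ (fun t => P (x / t) * f t).
  rewrite -(cintegralB mI If IP); apply: eq_cintegral => t /set_mem/in_oo[xt tB].
  have [K1 K2] := cintegral_kernel_x x0 (ltW xt) dP ck.
  rewrite [RHS](_ : _ = f t * (1 - P (x / t))); last by ring.
  rewrite P1 in K1; rewrite -K1 -(cintegralZ _ (measurable_itv _) K2).
  by apply: eq_cintegral => y _; ring.
have KE y : `]x, B[%classic y -> cintegral `]y, B[ (fun t => k (y / t) * 1 * (f t * (t^-1)%:C)) = Kop' k f y.
  move=> _; apply/esym; apply: cintegral_supp; first exact: oo_oy.
  by move=> t h1 h2; rewrite (test_eq0 tf (outside_B bB h1 h2)) mul0r mulr0.
have IK : cintegrable `]x, B[ (Kop' k f).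
  by apply: (eq_cintegrable mI _ i2) => y /set_mem/KE.
rewrite (cintegral_supp sub); last first.
  by move=> t h1 h2; rewrite (test_eq0 tf (outside_B bB h1 h2)) mulr0.
have L2 : cintegral `]x, B[ (Aop' k f) = cintegral `]x, B[ f - cintegral `]x, B[ (Kop' k f).
  by rewrite -(cintegralB mI If IK).
rewrite L2 -(eq_cintegral (g := Kop' k f) (fun y yI => KE y (set_mem yI))).
by rewrite -E L1 opprB addrCA subrr addr0.
Qed.

Lemma test_Sm : BE_Sm nu f (Aop' k f).
Proof.
split; [exact: test_L2 tf|exact: (Aop'_L2 bk (test_L2 tf))|exact: test_Sm_int|].
apply: loc_AC_oo => c d c0 cd; have d0 : 0 < d by exact: lt_trans cd.
have Ic := Aop'_oo d c0; split; first exact: cintegrableN.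
have dB : d < b + d by rewrite ltrDr.
have bB : b <= b + d by rewrite lerDl ltW.
rewrite (test_Sm_val c0 (lt_trans cd dB) bB) (test_Sm_val d0 dB bB).
have [_ _ ->] := @cintegral_split R c d (BLeft (b + d)) (Aop' k f) (ltW cd) dB (Aop'_oo _ c0).
by rewrite cintegralN// opprD addrCA subrr addr0.
Qed.

Lemma Aop_oo c d : 0 <= c -> cintegrable `]c, d[ (Aop k f).
Proof.
move=> c0; have h2 := inL2_cintegrable_left (Aop_L2 bk (test_L2 tf)).
have [cd|dc] := ltP c d; last first.
  by rewrite set_itv_ge ?bnd_simp -?leNgt//; split; exact: integrable_set0.
apply: cintegrableS (h2 d (le_lt_trans c0 cd)); [exact: measurable_itv|exact: measurable_itv|].
exact: oo_sub.
Qed.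

Lemma test_S0_bd x t : a < t < x -> 0 <= x / t <= x / a.
Proof.
move=> /andP[at_ tx]; have t0 := lt_trans a0 at_; have x0 := lt_trans t0 tx.
by rewrite divr_ge0 ?(ltW x0) ?(ltW t0)//= ler_pM2l// lef_pV2 ?posrE// ltW.
Qed.

Lemma test_S0_int_a x (g : R -> R[i]) : 0 < x -> cintegrable `]a, x[ g ->
  cintegrable `]a, x[ (fun t => P (x / t) * g t).
Proof.
move=> x0 ig; have [N N0 hN] := kernel_bounded (x / a) cP.
apply: (cintegrable_bdM (measurable_itv _) _ _ ig (M := N)).
  by have [] := kernel_meas_div (a := a) x x0 (ltW a0) cP.
by move=> t /in_oo[at_ tx]; apply: hN; apply: test_S0_bd; rewrite at_.
Qed.

Lemma test_S0_zero x t : `]0, x[%classic t -> ~ `]a, x[%classic t -> P (x / t) * Aop k f t = 0.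
Proof.
move=> /in_oo[_ tx] nt; rewrite test_Aop_eq0 ?mulr0// leNgt; apply/negP => at_.
by apply: nt; rewrite /= in_itv/= at_.
Qed.

Lemma test_S0_int (x : R) : 0 < x -> cintegrable `]0, x[ (fun t => P (x / t) * Aop k f t).
Proof.
move=> x0; apply: (cintegrable_supp (measurable_itv _) (measurable_itv _) (oo_sub (ltW a0)) (@test_S0_zero x)).
by apply: test_S0_int_a => //; exact: Aop_oo (ltW a0).
Qed.

Lemma resolvent_integrable s x : 0 < s -> s < x ->
  cintegrable `]s, x[ (fun t => k (s / t) * (P (x / t) * (t^-1)%:C)).
Proof.
move=> s0 sx; apply: cdiff_cintegrable => t /andP[st tx].
have t0 : 0 < t by exact: lt_le_trans st.
have x0 : 0 < x by exact: lt_le_trans tx.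
apply: cdiffM; first by apply: cdiff_divV; [rewrite gt_eqF|apply: ck; exact: gtN1_div].
apply: cdiffM; last by apply: cdiff_inv; rewrite gt_eqF.
by apply: cdiff_divV; [rewrite gt_eqF|apply: cP; exact: gtN1_div].
Qed.

(** By exchange and [legendre_resolvent], the integral of [P (x / t)] against K f is that of
    [(P (x / s) - 1) * f s]; subtracting it leaves the plain integral of [f]. *)
Lemma test_S0_val (x : R) : 0 < x -> cintegral `]0, x[ (fun t => P (x / t) * Aop k f t) = cintegral `]0, x[ f.
Proof.
move=> x0; have mI : measurable (`]a, x[ : set R) by exact: measurable_itv.
have sub : `]a, x[ `<=` `]0, x[ by exact: oo_sub (ltW a0).
have [N1 hN1] := test_f_bound tf; have [N2 N20 hN2] := kernel_bounded 1 ck.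
have [L L0 hL] := kernel_bounded (x / a) cP.
have f0 t : `]0, x[%classic t -> ~ `]a, x[%classic t -> f t = 0.
  by move=> h1 h2; apply: (test_eq0 tf); exact: in_a_x h1 h2.
have [|||||i1 _ E] := @tri_box R k f (fun t => P (x / t) * (t^-1)%:C) a x N2 N1 (L * a^-1) a0 (kernel_meas01 ck).
- move=> y /andP[y0 y1]; apply: hN2; rewrite (ltW y1) andbT ltW//.
  by apply: lt_trans y0; rewrite divr_gt0.
- exact: test_f_measI tf _ _ (ltW a0).
- by apply: cmeas_divx; have [] := kernel_meas_div (a := a) x x0 (ltW a0) cP.
- by move=> t _; exact: hN1.
- move=> t atx; rewrite normcM; apply: ler_pM; rewrite ?normc_ge0//.
    by apply: hL; exact: test_S0_bd.
  have /andP[at_ _] := atx; have t0 := lt_trans a0 at_.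
  by rewrite normc_real ger0_norm ?invr_ge0 ?(ltW t0)// lef_pV2 ?posrE// ltW.
have KE t : `]a, x[%classic t -> cintegral `]a, t[ (fun s => k (s / t) * f s * (P (x / t) * (t^-1)%:C)) = P (x / t) * Kop k f t.
  move=> /in_oo[at_ _]; have t0 := lt_trans a0 at_.
  rewrite /Kop -(cintegralZ _ (measurable_itv _) (Kop_int bk (test_L2 tf) t0)).
  rewrite (cintegral_supp (D := `]0, t[%classic) (E := `]a, t[%classic)); last 2 first.
  - exact: oo_sub (ltW a0).
  - by move=> s h1 h2; rewrite (test_eq0 tf (in_a_x h1 h2)) mulr0 mul0r mulr0.
  by apply: eq_cintegral => s _; ring.
have IK : cintegrable `]a, x[ (fun t => P (x / t) * Kop k f t).
  by apply: (eq_cintegrable mI _ i1) => t /set_mem/KE.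
have If := test_f_oo tf x (ltW a0).
have IPf := test_S0_int_a x0 If.
rewrite (cintegral_supp sub (@test_S0_zero x)) (cintegral_supp sub f0).
have -> : cintegral `]a, x[ (fun t => P (x / t) * Aop k f t) =
    cintegral `]a, x[ (fun t => P (x / t) * f t) - cintegral `]a, x[ (fun t => P (x / t) * Kop k f t).
  by rewrite -(cintegralB mI IPf IK); apply: eq_cintegral => t _; rewrite /Aop; ring.
rewrite -(eq_cintegral (g := fun t => P (x / t) * Kop k f t) (fun t tI => KE t (set_mem tI))).
rewrite E; have -> : cintegral `]a, x[ (fun s => cintegral `]s, x[ (fun t => k (s / t) * f s * (P (x / t) * (t^-1)%:C))) =
    cintegral `]a, x[ (fun t => P (x / t) * f t) - cintegral `]a, x[ f.
  rewrite -(cintegralB mI IPf If); apply: eq_cintegral => s /set_mem/in_oo[as_ sx].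
  have s0 := lt_trans a0 as_.
  transitivity (f s * (P (x / s) - 1)); last by ring.
  rewrite -(legendre_resolvent P1 dP dk dk2 ode s0 sx) -(cintegralZ _ (measurable_itv _) (resolvent_integrable s0 sx)).
  by apply: eq_cintegral => t _; ring.
by rewrite opprB addrCA subrr addr0.
Qed.

Lemma test_S0 : BE_S0 nu (Aop k f) f.
Proof.
split; [exact: (Aop_L2 bk (test_L2 tf))|exact: test_L2 tf|exact: test_S0_int|].
apply: loc_AC_oo => c d c0 cd; have d0 : 0 < d by exact: lt_trans cd.
split; first exact: (test_f_oo tf d (ltW c0)).
rewrite (test_S0_val c0) (test_S0_val d0).
have [_ _ ->] := @cintegral_split R 0 c (BLeft d) f (ltW c0) cd (test_f_oo tf d (lexx 0)).
by rewrite addrAC subrr add0r.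
Qed.

(** The integral term in the derivative of K' f. The moving endpoint contributes [- k 1 * f t / t]
    besides, whence the signs in [Pm_deriv], a derivative of A' f. *)
Definition Pm_aux (t : R) : R[i] :=
  cintegral `]t, +oo[ (fun s => k2 (t / s) * 1 * (f s * ((s^-1)%:C * (s^-1)%:C))).

Definition Pm_deriv (t : R) : R[i] := h t + k 1 * (f t * (t^-1)%:C) - Pm_aux t.

Lemma Pm_auxE (t B : R) : b <= B ->
  cintegral `]t, B[ (fun s => k2 (t / s) * 1 * (f s * ((s^-1)%:C * (s^-1)%:C))) = Pm_aux t.
Proof.
move=> bB; apply/esym; apply: cintegral_supp; first exact: oo_oy.
by move=> s h1 h2; rewrite (test_eq0 tf (outside_B bB h1 h2)) mul0r mulr0.
Qed.

Lemma Pm_deriv_eq0 t : b <= t -> Pm_deriv t = 0.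
Proof.
move=> bt; have nt : ~~ (a < t < b) by rewrite negb_and -!leNgt bt orbT.
rewrite /Pm_deriv (test_supp tf nt) (test_eq0 tf nt) mul0r mulr0 addr0 sub0r.
apply/eqP; rewrite oppr_eq0; apply/eqP; rewrite /Pm_aux.
rewrite -[RHS](cintegral0 `]t, +oo[); apply: eq_cintegral => s /set_mem/in_oy ts.
rewrite (test_eq0 tf (x := s)) ?mul0r ?mulr0// negb_and -!leNgt.
by rewrite (le_trans bt (ltW ts)) orbT.
Qed.

Lemma f_inv_bd (N x t : R) : (forall t, normc (f t) <= N) -> 0 < x -> x < t ->
  normc (f t * ((t^-1)%:C * (t^-1)%:C)) <= N * (x^-1 * x^-1).
Proof.
move=> fN x0 xt; have t0 := lt_trans x0 xt.
have ti : normc (t^-1)%:C <= x^-1.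
  by rewrite normc_real ger0_norm ?invr_ge0 ?(ltW t0)// lef_pV2 ?posrE// ltW.
rewrite !normcM; apply: ler_pM; rewrite ?mulr_ge0 ?normc_ge0//.
by apply: ler_pM; rewrite ?normc_ge0.
Qed.

Lemma f_inv_meas (x B : R) : 0 < x -> cmeas `]x, B[ (fun t => f t * ((t^-1)%:C * (t^-1)%:C)).
Proof.
move=> x0; have mi : cmeas `]x, B[ (fun t : R => (t^-1)%:C).
  by apply: cmeas_real; exact: measurable_invr_halfline.
by apply: cmeasM; [exact: test_f_measI tf _ _ (ltW x0)|exact: cmeasM].
Qed.

Lemma f_inv_int (x B : R) : 0 < x -> cintegrable `]x, B[ (fun t => f t * (t^-1)%:C).
Proof.
move=> x0; apply: cintegrableS (inL2_cintegrable_right (test_L2 tf) x0).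
- exact: measurable_itv.
- exact: measurable_itv.
- exact: oo_oy.
Qed.

(** Differentiation of K' f under the integral sign, in the integrated form that [loc_AC_oo]
    expects. *)
Lemma Pm_aux_prim (x B : R) : 0 < x -> b <= B -> cintegrable `]x, B[ Pm_aux /\
  cintegral `]x, B[ Pm_aux = k 1 * cintegral `]x, B[ (fun t => f t * (t^-1)%:C) - Kop' k f x.
Proof.
move=> x0 bB; have mI : measurable (`]x, B[ : set R) by exact: measurable_itv.
have [N1 hN1] := test_f_bound tf; have [N2 N20 hN2] := kernel_bounded 1 dk2.
have [|||||_ i2 E] := @tri_box R k2 (fun=> 1) (fun t => f t * ((t^-1)%:C * (t^-1)%:C)) x B N2 1 (N1 * (x^-1 * x^-1)) x0 (kernel_meas01 dk2).
- move=> y /andP[y0 y1]; apply: hN2; rewrite (ltW y1) andbT.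
  have [xB|Bx] := ltP x B; first by apply: ltW; apply: lt_trans y0; rewrite divr_gt0// (lt_trans x0).
  rewrite leNgt; apply/negP => yn; have B0 : 0 < B := lt_le_trans b0 bB.
  by have := lt_trans y0 yn; rewrite ltNge divr_ge0// ltW.
- exact: cmeas_cst.
- exact: f_inv_meas.
- by move=> t _; rewrite normc_real normr1.
- by move=> t /andP[xt _]; exact: f_inv_bd.
have mE (y : R) (yI : y \in (`]x, B[%classic : set R)) := Pm_auxE y bB.
have Ig := f_inv_int B x0.
split; first exact: (eq_cintegrable mI mE i2).
rewrite -(eq_cintegral (g := Pm_aux) mE) -E.
have subK := @oo_oy x B.
have K0 t : `]x, +oo[%classic t -> ~ `]x, B[%classic t -> k (x / t) * 1 * (f t * (t^-1)%:C) = 0.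
  by move=> h1 h2; rewrite (test_eq0 tf (outside_B bB h1 h2)) mul0r mulr0.
have IK : cintegrable `]x, B[ (fun t => k (x / t) * 1 * (f t * (t^-1)%:C)).
  by apply: cintegrableS (Kop'_int bk (test_L2 tf) x0); [exact: measurable_itv|exact: mI|exact: subK].
rewrite /Kop' (cintegral_supp subK K0) -(cintegralZ (k 1) mI Ig).
rewrite -(cintegralB mI (cintegrableZ (k 1) mI Ig) IK).
apply: eq_cintegral => t /set_mem/in_oo[xt tB].
have [K1 K2] := cintegral_kernel_x x0 (ltW xt) dk dk2.
transitivity ((f t * (t^-1)%:C) * (k 1 - k (x / t))); last by ring.
rewrite -K1 -(cintegralZ _ (measurable_itv _) K2).
by apply: eq_cintegral => y _; ring.
Qed.

Lemma Pm_aux_oo (c d : R) : 0 < c -> cintegrable `]c, d[ Pm_aux.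
Proof.
move=> c0; have [cd|dc] := ltP c d; last first.
  by rewrite set_itv_ge ?bnd_simp -?leNgt//; split; exact: integrable_set0.
have d0 := lt_trans c0 cd; have bB : b <= b + d by rewrite lerDl ltW.
have [i _] := Pm_aux_prim c0 bB.
apply: cintegrableS i; [exact: measurable_itv|exact: measurable_itv|].
by move=> x /in_oo[cx xd]; rewrite /= in_itv/= cx (lt_trans xd)// ltrDr.
Qed.

Lemma Pm_deriv_oo (c d : R) : 0 < c -> cintegrable `]c, d[ Pm_deriv.
Proof.
move=> c0; have mI : measurable (`]c, d[ : set R) by exact: measurable_itv.
apply: (cintegrableB mI _ (Pm_aux_oo d c0)); apply: (cintegrableD mI (test_h_oo tf c d)).
exact: (cintegrableZ (k 1) mI (f_inv_int d c0)).
Qed.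

Lemma Pm_deriv_int (c d : R) : 0 < c -> cintegral `]c, d[ Pm_deriv = cintegral `]c, d[ h +
  (k 1 * cintegral `]c, d[ (fun t => f t * (t^-1)%:C) - cintegral `]c, d[ Pm_aux).
Proof.
move=> c0; have mI : measurable (`]c, d[ : set R) by exact: measurable_itv.
have I1 := cintegrableZ (k 1) mI (f_inv_int d c0).
rewrite (cintegralB mI (cintegrableD mI (test_h_oo tf c d) I1) (Pm_aux_oo d c0)).
by rewrite (cintegralD mI (test_h_oo tf c d) I1) (cintegralZ (k 1) mI (f_inv_int d c0)) addrA.
Qed.

Lemma test_Pm_AC : loc_AC_derive (Aop' k f) Pm_deriv.
Proof.
apply: loc_AC_oo => c d c0 cd; have d0 : 0 < d by exact: lt_trans cd.
split; first exact: Pm_deriv_oo.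
have dB : d < b + d by rewrite ltrDr.
have bB : b <= b + d by rewrite lerDl ltW.
have [_ E1] := Pm_aux_prim c0 bB; have [_ E2] := Pm_aux_prim d0 bB.
have [_ _ S1] := @cintegral_split R c d (BLeft (b + d)) Pm_aux (ltW cd) dB (Pm_aux_oo _ c0).
have [_ _ S2] := @cintegral_split R c d (BLeft (b + d)) _ (ltW cd) dB (f_inv_int _ c0).
rewrite (Pm_deriv_int d c0) -(test_diff tf (ltW c0) (ltW cd)) /Aop'.
move: E1 E2; rewrite {}S1 {}S2.
move: (cintegral _ _) (cintegral _ _) (cintegral _ _) (cintegral _ _) (Kop' k f c) (Kop' k f d) (f c) (f d)
  => g2 g1 n2 n1 kc kd fc fd E1 E2.
have -> : kd = k 1 * g2 - n2 by rewrite E2; ring.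
have -> : kc = k 1 * (g1 + g2) - (n1 + n2) by rewrite E1; ring.
by ring.
Qed.

Lemma cintegral_kernel_inv (g g' : R -> R[i]) x t : 0 < x -> x <= t ->
  (forall z, -1 < z -> is_cderive g z (g' z)) -> (forall z, -1 < z -> cdiff g' z) ->
  cintegral `]x, t[ (fun s => g' (s / x) * (x^-1)%:C) = g (t / x) - g 1 /\
  cintegrable `]x, t[ (fun s => g' (s / x) * (x^-1)%:C).
Proof.
move=> x0 xt dg dg'.
have [||-> ig] := @cFTC_oo R (fun s => g (s / x)) (fun s => g' (s / x) * (x^-1)%:C) x t xt.
- move=> y /andP[xy yt]; apply: is_cderive_div; apply: dg; apply: gtN1_div => //.
  exact: lt_le_trans xy.
- move=> y /andP[xy yt]; apply: cdiffM; last exact: cdiff_cst.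
  by apply: cdiff_div; apply: dg'; apply: gtN1_div => //; exact: lt_le_trans xy.
by split; [rewrite divff ?gt_eqF|exact: ig].
Qed.

Lemma Pm_int_B (x B : R) (g : R -> R[i]) : 0 < x -> cintegrable `]x, B[ g ->
  cintegrable `]x, B[ (fun t => P (t / x) * g t).
Proof.
move=> x0 ig; have [N N0 hN] := kernel_bounded (B / x) cP.
apply: (cintegrable_bdM (measurable_itv _) _ _ ig (M := N)).
  by have [] := kernel_meas_div (a := x) B x0 (ltW x0) cP.
move=> t /in_oo[xt tB]; apply: hN; have t0 := lt_trans x0 xt.
by rewrite divr_ge0 ?(ltW t0) ?(ltW x0)//= ler_pM2r ?invr_gt0// ltW.
Qed.

Lemma Pm_zero (x B t : R) : b <= B -> `]x, +oo[%classic t -> ~ `]x, B[%classic t -> P (t / x) * - Pm_deriv t = 0.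
Proof.
move=> bB /in_oy xt nt; rewrite Pm_deriv_eq0 ?oppr0 ?mulr0//; apply: le_trans bB _.
by rewrite leNgt; apply/negP => tB; apply: nt; rewrite /= in_itv/= xt.
Qed.

Lemma test_Pm_int (x : R) : 0 < x -> cintegrable `]x, +oo[ (fun t => P (t / x) * - Pm_deriv t).
Proof.
move=> x0; apply: (cintegrable_supp (measurable_itv _) (measurable_itv _) (@oo_oy x b) (fun t => Pm_zero (lexx b))).
apply: (Pm_int_B x0); apply: cintegrableN; [exact: measurable_itv|exact: Pm_deriv_oo].
Qed.

(** Integration by parts of [P (t / x) * h t]; [f] vanishes at [B], and the endpoint [x] contributes
    [- P 1 * f x]. *)
Lemma Pm_parts (x B : R) : 0 < x -> x <= B -> b <= B ->
  cintegrable `]x, B[ (fun t => k (t / x) * (x^-1)%:C * f t) /\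
  cintegral `]x, B[ (fun t => P (t / x) * h t) = - f x - cintegral `]x, B[ (fun t => k (t / x) * (x^-1)%:C * f t).
Proof.
move=> x0 xB bB; have mI : measurable (`]x, B[ : set R) by exact: measurable_itv.
have [N1 hN1] := test_bound tf; have [N2 N20 hN2] := kernel_bounded (B / x) ck.
have [|||||i1 i2 E] := @tri_box R (fun=> 1) (fun s => k (s / x) * (x^-1)%:C) h x B 1 (N2 * x^-1) N1 x0 m1.
- by move=> y _; rewrite normc_real normr1.
- apply: cmeasM; last exact: cmeas_cst.
  by have [] := kernel_meas_div (a := x) B x0 (ltW x0) ck.
- by apply: cmeasS (test_meas tf); [exact: measurableT|exact: subsetT].
- move=> t /andP[xt tB]; rewrite normcM normc_real ger0_norm ?invr_ge0 ?(ltW x0)//.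
  rewrite ler_wpM2r ?invr_ge0 ?(ltW x0)// hN2//; have t0 := lt_trans x0 xt.
  by rewrite divr_ge0 ?(ltW t0) ?(ltW x0)//= ler_pM2r ?invr_gt0// ltW.
- by move=> t _; exact: hN1.
have fE s (sI : s \in (`]x, B[%classic : set R)) : cintegral `]s, B[ (fun t => 1 * (k (s / x) * (x^-1)%:C) * h t) =
    - (k (s / x) * (x^-1)%:C * f s).
  have [xs sB] := in_oo (set_mem sI); have s0 := lt_trans x0 xs.
  rewrite mul1r (cintegralZ _ (measurable_itv _) (test_h_oo tf s B)).
  by rewrite (test_right tf (ltW s0) (ltW sB) bB) mulrN.
have Ih := test_h_oo tf x B; have IP := Pm_int_B x0 Ih.
have i3 := eq_cintegrable mI fE i2.
have i4 : cintegrable `]x, B[ (fun t => k (t / x) * (x^-1)%:C * f t).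
  have := cintegrableN mI i3; apply: eq_cintegrable; first exact: mI.
  by move=> t _; rewrite opprK.
split; first exact: i4.
rewrite -(test_right tf (ltW x0) xB bB) -(cintegralN mI i4) in E *.
rewrite -(eq_cintegral fE) -E -(cintegralD mI Ih i1).
apply: eq_cintegral => t /set_mem/in_oo[xt tB].
have [K1 K2] := cintegral_kernel_inv x0 (ltW xt) dP ck.
rewrite (_ : cintegral _ _ = h t * (P (t / x) - P 1)); first by rewrite P1; ring.
rewrite -K1 -(cintegralZ _ (measurable_itv _) K2).
by apply: eq_cintegral => s _; ring.
Qed.

(** Of the three terms of [Pm_deriv], the one with [h] gives [f x] plus an integral of
    [k (t / x) * f t / x] by [Pm_parts]. By exchange and [legendre_wronskian] the one with [Pm_aux]
    cancels this integral and the term with [k 1]. *)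
Lemma test_Pm_val (x : R) : 0 < x -> f x = cintegral `]x, +oo[ (fun t => P (t / x) * - Pm_deriv t).
Proof.
move=> x0; pose B := b + x.
have xB : x < B by rewrite ltrDr.
have bB : b <= B by rewrite lerDl ltW.
have mI : measurable (`]x, B[ : set R) by exact: measurable_itv.
have [N1 hN1] := test_f_bound tf; have [N2 N20 hN2] := kernel_bounded 1 dk2.
have [N3 N30 hN3] := kernel_bounded (B / x) cP.
have Bx0 : 0 < B := lt_trans x0 xB.
have [|||||_ _ E] := @tri_box R k2 (fun t => P (t / x)) (fun s => f s * ((s^-1)%:C * (s^-1)%:C)) x B N2 N3 (N1 * (x^-1 * x^-1)) x0 (kernel_meas01 dk2).
- move=> y /andP[y0 y1]; apply: hN2; rewrite (ltW y1) andbT.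
  by apply: ltW; apply: lt_trans y0; rewrite divr_gt0.
- by have [] := kernel_meas_div (a := x) B x0 (ltW x0) cP.
- exact: f_inv_meas.
- move=> t /andP[xt tB]; apply: hN3; have t0 := lt_trans x0 xt.
  by rewrite divr_ge0 ?(ltW t0) ?(ltW x0)//= ler_pM2r ?invr_gt0// ltW.
- by move=> t /andP[xt _]; exact: f_inv_bd.
have [IKf EPh] := Pm_parts x0 (ltW xB) bB.
have If := f_inv_int B x0.
have Im_ := Pm_aux_oo B x0.
have IPh := Pm_int_B x0 (test_h_oo tf x B).
have IPf := Pm_int_B x0 If.
have IPm := Pm_int_B x0 Im_.
have L1 : cintegral `]x, B[ (fun s => cintegral `]x, s[ (fun t => k2 (t / s) * P (t / x) * (f s * ((s^-1)%:C * (s^-1)%:C)))) =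
    k 1 * cintegral `]x, B[ (fun t => P (t / x) * (f t * (t^-1)%:C)) - cintegral `]x, B[ (fun t => k (t / x) * (x^-1)%:C * f t).
  rewrite -(cintegralZ (k 1) mI IPf) -(cintegralB mI (cintegrableZ (k 1) mI IPf) IKf).
  apply: eq_cintegral => s /set_mem/in_oo[xs sB].
  transitivity (f s * (P (s / x) * k 1 * (s^-1)%:C - k (s / x) * (x^-1)%:C)); last by ring.
  rewrite -(legendre_wronskian P1 dP dk dk2 ode x0 xs) -(cintegralZ _ (measurable_itv _)).
    by apply: eq_cintegral => t _; rewrite rcX; ring.
  apply: cdiff_cintegrable => t /andP[xt ts].
  have t0 : 0 < t by exact: lt_le_trans xt.
  have s0 : 0 < s by exact: lt_trans xs.
  apply: cdiffM; last exact: cdiff_cst.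
  by apply: cdiffM; apply: cdiff_div; [apply: dk2|apply: cP]; exact: gtN1_div.
have L2 : cintegral `]x, B[ (fun t => cintegral `]t, B[ (fun s => k2 (t / s) * P (t / x) * (f s * ((s^-1)%:C * (s^-1)%:C)))) =
    cintegral `]x, B[ (fun t => P (t / x) * Pm_aux t).
  apply: eq_cintegral => t /set_mem/in_oo[xt tB].
  rewrite -(Pm_auxE t bB) -cintegralZ; last 2 first.
  - exact: measurable_itv.
  - have t0 := lt_trans x0 xt.
    apply: (eq_cintegrable (measurable_itv _) (f := fun s => k2 (t / s) * (f s * ((s^-1)%:C * (s^-1)%:C)))).
      by move=> s _; rewrite mulr1.
    apply: (cintegrable_bdM (measurable_itv _) _ _ _ (M := N2)).
    + by have [_] := kernel_meas_div (a := t) B t0 (ltW t0) dk2.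
    + move=> s /in_oo[ts sB]; apply: hN2.
      by have /andP[? ?] : 0 < t / s < 1 by [apply: div_in01; rewrite t0]; rewrite !ltW.
    + apply: (bounded_cintegrable (measurable_itv _) (@oo_cc _ _) (f_inv_meas B t0) (M := N1 * (t^-1 * t^-1))).
      by move=> s /in_oo[ts _]; exact: f_inv_bd.
  by apply: eq_cintegral => s _; ring.
rewrite (cintegral_supp (@oo_oy x B) (fun t => Pm_zero bB)).
have -> : cintegral `]x, B[ (fun t => P (t / x) * - Pm_deriv t) =
   - (cintegral `]x, B[ (fun t => P (t / x) * h t) + k 1 * cintegral `]x, B[ (fun t => P (t / x) * (f t * (t^-1)%:C))) +
   cintegral `]x, B[ (fun t => P (t / x) * Pm_aux t).
  rewrite -(cintegralZ (k 1) mI IPf) -(cintegralD mI IPh (cintegrableZ (k 1) mI IPf)).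
  have IS := cintegrableD mI IPh (cintegrableZ (k 1) mI IPf).
  rewrite -(cintegralN mI IS) -(cintegralD mI (cintegrableN mI IS) IPm).
  by apply: eq_cintegral => t _; rewrite /Pm_deriv; ring.
by rewrite -L2 -E L1 EPh; ring.
Qed.

Lemma test_Pm : BE_Pm nu (Aop' k f) f.
Proof.
split; [exact: (Aop'_L2 bk (test_L2 tf))|exact: test_L2 tf|exists Pm_deriv].
  exact: test_Pm_AC.
split; first exact: test_Pm_int.
by apply: ae_all => x; exact: test_Pm_val.
Qed.

End memberships.

Lemma rc0 {R : realType} : (0 : R)%:C = 0. Proof. by []. Qed.

(** * Necessity *)

Section moments.
Context {R : realType}.
Variables (lam : R[i]) (P k k2 : R -> R[i]).
Hypothesis P1 : P 1 = 1.
Hypothesis dP : forall z : R, -1 < z -> is_cderive P z (k z).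
Hypothesis dk : forall z : R, -1 < z -> is_cderive k z (k2 z).
Hypothesis ode : forall z : R, -1 < z ->
  (1 - z ^+ 2)%:C * k2 z - (2 * z)%:C * k z + lam * P z = 0.

Let cP z : -1 < z -> cdiff P z := cdiffP dP (z := z).
Let ck z : -1 < z -> cdiff k z := cdiffk dk (z := z).
Let gtN1 (z : R) : 0 <= z <= 1 -> -1 < z.
Proof. by move=> /andP[z0 _]; apply: lt_le_trans z0; rewrite ltrN10. Qed.
Let mI : measurable (`]0, 1[ : set R) := measurable_itv _.

Lemma cdiff_realM (q : R -> R) (q' : R) (g : R -> R[i]) (z : R) :
  is_derive z 1 q q' -> cdiff g z -> cdiff (fun z => (q z)%:C * g z) z.
Proof. by move=> dq dg; apply: cdiffM => //; exists q'%:C; exact: is_cderive_real. Qed.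

(* Green's identity for the Legendre operator on [0, 1]: the boundary terms at 1
   vanish with [1 - z^2]. *)
Lemma legendre_green (q q1 q2 q3 : R -> R) :
  (forall z : R, is_derive z 1 q (q1 z)) -> (forall z : R, is_derive z 1 q1 (q2 z)) ->
  (forall z : R, is_derive z 1 q2 (q3 z)) ->
  cintegral `]0, 1[ (fun z => lam * ((q z)%:C * P z) + (((1 - z ^+ 2) * q2 z - 2 * z * q1 z)%:C * P z)) =
  (q 0)%:C * k 0 - (q1 0)%:C * P 0.
Proof.
move=> dq dq1 dq2.
pose V (z : R) := ((q1 z * (1 - z ^+ 2))%:C * P z) - ((q z * (1 - z ^+ 2))%:C * k z).
have d1 (z : R) : is_derive z 1 (fun z : R => 1 - z ^+ 2) (- (2 * z)).
  apply: (is_derive1_eq (is_derive1D (is_derive1_cst 1 z) (is_derive1N (is_derive1X 1 (is_derive1_id z))))).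
  by rewrite add0r expr1 mulr1.
have [||-> _] := @cFTC_oo R V (fun z => lam * ((q z)%:C * P z) + (((1 - z ^+ 2) * q2 z - 2 * z * q1 z)%:C * P z)) 0 1 ler01.
- move=> z /gtN1 z1.
  have e1 := is_cderiveM (is_cderive_real (is_derive1M (dq1 z) (d1 z))) (dP z1).
  have e2 := is_cderiveM (is_cderive_real (is_derive1M (dq z) (d1 z))) (dk z1).
  apply: is_cderive_eq (is_cderiveB e1 e2) _.
  have o : lam * P z = (2 * z)%:C * k z - (1 - z ^+ 2)%:C * k2 z.
    by apply/eqP; rewrite -subr_eq0 -[X in _ == X](ode z1); apply/eqP; ring.
  rewrite (_ : lam * _ = (q z)%:C * (lam * P z)); last by ring.
  rewrite o !(rcM, rcD, rcB, rcN, rcX, rc1, rc_nat).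
  by ring.
- move=> z /gtN1 z1; have t1 := is_derive1M (d1 z) (dq2 z).
  have t2 := is_derive1M (is_derive1M (is_derive1_cst 2 z) (is_derive1_id z)) (dq1 z).
  have t3 := is_cderive_real (is_derive1D t1 (is_derive1N t2)).
  have t4 := is_cderiveM (is_cderive_real (dq z)) (dP z1).
  eexists; exact: (is_cderiveD (is_cderiveM (is_cderive_cst lam z) t4) (is_cderiveM t3 (dP z1))).
rewrite /V expr1n subrr !mulr0 !mul0r subrr expr0n/= subr0 !mulr1.
by ring.
Qed.

Definition moment j := cintegral `]0, 1[ (fun z => (z ^+ j)%:C * P z).

Lemma is_derive_exp j (z : R) : is_derive z 1 (fun z : R => z ^+ j) (j%:R * z ^+ j.-1).
Proof.
case: j => [|j]; first by rewrite mul0r; exact: is_derive1_cst.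
by apply: (is_derive1_eq (is_derive1X j (is_derive1_id z))); rewrite mulr1.
Qed.

Lemma moment_int (g : R -> R[i]) j : (forall z, -1 < z -> cdiff g z) ->
  cintegrable `]0, 1[ (fun z => (z ^+ j)%:C * g z).
Proof.
move=> dg; apply: cdiff_cintegrable => z /gtN1 z1.
by apply: (cdiff_realM (is_derive_exp j z)); exact: dg.
Qed.

(** Green's identity for [q = z ^+ j], which the Legendre operator sends to
    [j (j - 1) z^(j - 2) - j (j + 1) z^j]. For [j < 2] the truncated predecessors occur with
    coefficient 0. *)
Lemma moment_rec j : (lam - (j * j.+1)%:R) * moment j + (j * j.-1)%:R * moment j.-2 =
  (0 ^+ j)%:C * k 0 - (j%:R * 0 ^+ j.-1)%:C * P 0.
Proof.
have dj (z : R) n m : is_derive z 1 (fun z : R => m%:R * z ^+ n) (m%:R * (n%:R * z ^+ n.-1)).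
  by apply: (is_derive1_eq (is_derive1M (is_derive1_cst m%:R z) (is_derive_exp n z))); rewrite mul0r add0r.
have dj2 (z : R) : is_derive z 1 (fun z : R => j%:R * (j.-1%:R * z ^+ j.-2)) (j%:R * (j.-1%:R * (j.-2%:R * z ^+ j.-2.-1))).
  by apply: (is_derive1_eq (is_derive1M (is_derive1_cst j%:R z) (dj z j.-2 j.-1))); rewrite mul0r add0r.
rewrite -(legendre_green (fun z => is_derive_exp j z) (fun z => dj z j.-1 j) dj2).
have Ij := moment_int j cP; have Ij2 := moment_int j.-2 cP.
rewrite /moment -(cintegralZ _ mI Ij) -(cintegralZ _ mI Ij2).
rewrite -(cintegralD mI (cintegrableZ _ mI Ij) (cintegrableZ _ mI Ij2)).
apply: eq_cintegral => z _.
rewrite (_ : (1 - z ^+ 2) * (j%:R * (j.-1%:R * z ^+ j.-2)) - 2 * z * (j%:R * z ^+ j.-1) =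
   (j * j.-1)%:R * z ^+ j.-2 - (j * j.+1)%:R * z ^+ j); last first.
  case: j {dj dj2 Ij Ij2} => [|[|j]] /=; rewrite ?muln0 ?muln1 ?mul0n ?mul0r ?mulr0 ?expr0 ?expr1 ?mul0r; [ring|ring|].
  by rewrite !exprS !natrM -!natr1; ring.
by rewrite rcB !rcM !rc_nat; ring.
Qed.

Lemma moment_deriv j : cintegral `]0, 1[ (fun z => (z ^+ j.+1)%:C * k z) = 1 - j.+1%:R * moment j.
Proof.
have [||E _] := @cFTC_oo R (fun z => (z ^+ j.+1)%:C * P z)
  (fun z => (j.+1%:R * z ^+ j)%:C * P z + (z ^+ j.+1)%:C * k z) 0 1 ler01.
- by move=> z /gtN1 z1; exact: (is_cderiveM (is_cderive_real (is_derive_exp j.+1 z)) (dP z1)).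
- move=> z /gtN1 z1; have dz := is_derive1M (is_derive1_cst j.+1%:R z) (is_derive_exp j z).
  eexists; apply: is_cderiveD; first exact: (is_cderiveM (is_cderive_real dz) (dP z1)).
  exact: (is_cderiveM (is_cderive_real (is_derive_exp j.+1 z)) (dk z1)).
have Ij := moment_int j cP.
have IZ : cintegrable `]0, 1[ (fun z => (j.+1%:R * z ^+ j)%:C * P z).
  apply: (eq_cintegrable mI _ (cintegrableZ j.+1%:R mI Ij)) => z _.
  by rewrite rcM rc_nat mulrA.
move: E; rewrite (cintegralD mI IZ (moment_int j.+1 ck)) expr1n mul1r P1 expr0n/= mul0r subr0 => E.
have -> : j.+1%:R * moment j = cintegral `]0, 1[ (fun z => (j.+1%:R * z ^+ j)%:C * P z); last first.
  by apply: (canRL (addrK _)); rewrite addrC.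
by rewrite /moment -(cintegralZ _ mI Ij); apply: eq_cintegral => z _; rewrite rcM rc_nat mulrA.
Qed.

Lemma kernel_mean : cintegral `]0, 1[ k = 1 - P 0.
Proof.
have [||-> _] := @cFTC_oo R P k 0 1 ler01; last by rewrite P1.
- by move=> z /gtN1 z1; exact: dP.
- by move=> z /gtN1 z1; exact: ck.
Qed.

(** If these moments vanish, then by [moment_deriv] the integral of [z ^+ j.+1 * k z] equals 1 for
    arbitrarily large [j], whereas it is at most [2 * M / (j + 2)]. *)
Lemma moments_nonzero (e : nat) : ~ (forall i, moment (e + i.*2) = 0).
Proof.
move=> m0; have [M M0 hM] := kernel_bounded 1 ck.
(* Of the parity of [e], and large enough for [j + 2 > 2 * M]. *)
pose j := (e + (Num.truncn (2 * M)).*2)%N.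
have := moment_deriv j; rewrite m0 mulr0 subr0 => E.
have [||iM EM] := @rFTC2 R (fun t => M / j.+2%:R * t ^+ j.+2) (fun t => M * t ^+ j.+1) 0 1 ler01.
- move=> t _; apply: (is_derive1_eq (is_derive1M (is_derive1_cst _ t) (is_derive_exp j.+2 t))).
  by rewrite mul0r add0r mulrA divfK// pnatr_eq0.
- move=> t _; exact: derive_continuous (is_derive1M (is_derive1_cst M t) (is_derive_exp j.+1 t)).
have := normc_cintegral_le mI (moment_int j.+1 ck) iM; rewrite E EM normc_real normr1 => le.
have : 1 <= 2 * (M / j.+2%:R * 1 ^+ j.+2 - M / j.+2%:R * 0 ^+ j.+2).
  apply: le => z /in_oo[z0 z1]; rewrite normcM normc_real ger0_norm ?exprn_ge0 ?(ltW z0)//.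
  by rewrite mulrC ler_wpM2r ?exprn_ge0 ?(ltW z0)// hM// !ltW.
rewrite expr1n expr0n/= mulr0 subr0 mulr1 mulrA ler_pdivlMr ?ltr0n// mul1r leNgt => /negP; apply.
apply: (lt_le_trans (truncnS_gt _)); rewrite ler_nat /j.
by rewrite ltnS; apply: leqW; rewrite -addnn addnA leq_addl.
Qed.

Lemma legendre_eigenvalue : k 0 * P 0 = 0 -> exists j : nat, lam = (j * j.+1)%:R.
Proof.
move=> kP; apply: contrapT => nex.
have nz j : lam - (j * j.+1)%:R != 0.
  by apply/eqP => /eqP; rewrite subr_eq0 => /eqP E; apply: nex; exists j.
have step j : moment j = 0 -> moment j.+2 = 0.
  move=> mj; have := moment_rec j.+2; rewrite /= mj mulr0 addr0 !expr0n/= mul0r mulr0 mul0r subrr.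
  by move=> /eqP; rewrite mulf_eq0 (negbTE (nz _))/= => /eqP.
(* The boundary term of [moment_rec] at j = 0 is [k 0], and at j = 1 it is [- P 0]. So [k 0 = 0]
   starts the even chain at 0 and [P 0 = 0] the odd one; from j = 2 on there are no boundary
   terms. *)
have [k0|P0] : k 0 = 0 \/ P 0 = 0.
  by move/eqP: kP; rewrite mulf_eq0 => /orP[/eqP|/eqP]; [left|right].
- apply: (@moments_nonzero 0); elim=> [|i IH]; last by rewrite doubleS !addnS; exact: step.
  have := moment_rec 0; rewrite k0 /= !(mul0n, mulr0n, mul0r, mulr0, addr0, subr0, rc0).
  by move=> /eqP; rewrite mulf_eq0 -[lam](subr0) (negbTE (nz 0%N))/= => /eqP.
- apply: (@moments_nonzero 1); elim=> [|i IH]; last by rewrite doubleS !addnS; exact: step.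
  have := moment_rec 1; rewrite P0 /= !(muln0, mulr0n, mul0r, mulr0, addr0, subr0, rc0, expr0n).
  by move=> /eqP; rewrite mulf_eq0 (negbTE (nz 1%N))/= => /eqP.
Qed.

End moments.

(** The difference [nu (nu + 1) - j (j + 1)] factors as [(nu - j) (nu + j + 1)]. *)
Lemma eigenvalue_int {R : realType} (nu : R[i]) (j : nat) :
  nu * (nu + 1) = (j * j.+1)%:R -> exists m : int, nu = m%:~R.
Proof.
rewrite natrM -natr1 => E; have : (nu - j%:R) * (nu + (j%:R + 1)) = 0.
  by transitivity (nu * (nu + 1) - j%:R * (j%:R + 1)); [ring|rewrite E subrr].
move=> /eqP; rewrite mulf_eq0 => /orP[].
  by rewrite subr_eq0 => /eqP ->; exists j%:Z; rewrite pmulrn.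
rewrite addr_eq0 => /eqP ->; exists (- j.+1%:Z).
by rewrite mulrNz -pmulrn -natr1.
Qed.

(** * Improper integrals and decay estimates *)

Section improper.
Context {R : realType}.
Local Notation mu := (@lebesgue_measure R).
Implicit Types (f g F : R -> R[i]) (a c d x t C N : R).

Lemma le0_of_le_div (r a C : R) : (forall X, a <= X -> 0 < X -> r <= C / X) -> r <= 0.
Proof.
move=> h; rewrite leNgt; apply/negP => r0.
pose X := Num.max (Num.max a 1) ((`|C| + 1) / r).
have X1 : 1 <= X by rewrite /X !le_max lexx orbT.
have X0 : 0 < X by exact: lt_le_trans X1.
have := h X _ X0; rewrite /X !le_max lexx => /(_ isT); rewrite -/X ler_pdivlMr//.
apply/negP; rewrite -ltNge; apply: (@lt_le_trans _ _ (`|C| + 1)).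
  by apply: (le_lt_trans (ler_norm C)); rewrite ltrDl.
by rewrite mulrC -ler_pdivrMr// /X le_max lexx orbT.
Qed.

Lemma invsq_integral_le t : 0 < t -> \int[mu]_(x in `]t, +oo[) (x^-1) ^+ 2 <= 2 * t^-1.
Proof.
move=> t0; have mI : measurable (`]t, +oo[ : set R) by exact: measurable_itv.
have [h le] := integral_xsqrtV t0; have st : 0 < Num.sqrt t by rewrite sqrtr_gt0.
apply: (@le_trans _ _ (\int[mu]_(x in `]t, +oo[) ((Num.sqrt t)^-1 * (x * Num.sqrt x)^-1))).
  apply: le_Rintegral; [exact: mI|exact: invsq_integrable|exact: (rintegrableZl _ mI h)|].
  move=> x /in_oy tx; have x0 := lt_trans t0 tx.
  have sx : 0 < Num.sqrt x by rewrite sqrtr_gt0.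
  have sle : Num.sqrt t <= Num.sqrt x by rewrite ler_wsqrtr// ltW.
  have xE := sqr_sqrtr (ltW x0).
  rewrite -invfM exprVn lef_pV2 ?posrE ?mulr_gt0 ?exprn_gt0//.
  rewrite (_ : x ^+ 2 = Num.sqrt x * (x * Num.sqrt x)); last by rewrite mulrCA -expr2 xE expr2.
  by rewrite ler_wpM2r// ltW// mulr_gt0.
rewrite RintegralZl//; apply: (@le_trans _ _ ((Num.sqrt t)^-1 * (2 * (Num.sqrt t)^-1))).
  by rewrite ler_wpM2l// invr_ge0 ltW.
by rewrite mulrCA -invfM -expr2 sqr_sqrtr// ltW.
Qed.

Lemma normc_cintegral_oo c d f N : c <= d -> cintegrable `]c, d[ f ->
  (forall t, c < t < d -> normc (f t) <= N) -> normc (cintegral `]c, d[ f) <= 2 * (N * (d - c)).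
Proof.
move=> cd fi fN.
have [||iN E] := @rFTC2 R (fun t => N * t) (fun=> N) c d cd.
- move=> t _; apply: (is_derive1_eq (is_derive1M (is_derive1_cst N t) (is_derive1_id t))).
  by rewrite mul0r add0r mulr1.
- by move=> t _; exact: cst_continuous.
rewrite mulrBr -E.
by apply: normc_cintegral_le => // t /in_oo[t0 tx]; apply: fN; rewrite t0.
Qed.

(** The limit of [F] is given with a rate, so the half-line can be cut at X with an error of order 1
    / X, and no limit of integrals is taken. *)
Lemma cFTC_oy F f a C (l : R[i]) : 0 < a ->
  (forall x, a <= x -> is_cderive F x (f x)) -> (forall x, a <= x -> cdiff f x) ->
  (forall x, a <= x -> normc (f x) <= C * (x^-1) ^+ 2) ->
  (forall x, a <= x -> normc (F x - l) <= C / x) ->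
  cintegral `]a, +oo[ f = l - F a /\ cintegrable `]a, +oo[ f.
Proof.
move=> a0 dF df fC FC; have mI (b : R) : measurable (`]b, +oo[ : set R) by exact: measurable_itv.
have mf : cmeas `]a, +oo[ f.
  apply: ccontinuous_cmeas; first exact: interval_open.
  by move=> x /in_oy/ltW ax; apply: cdiff_continuous; exact: df.
have IC b : 0 < b -> mu.-integrable `]b, +oo[ (fun x : R => (C * (x^-1) ^+ 2)%:E).
  by move=> b0; exact: (rintegrableZl C (mI b) (invsq_integrable b0)).
have If : cintegrable `]a, +oo[ f.
  by apply: (le_cintegrable (mI a) mf (IC a a0)) => x /in_oy/ltW/fC.
split; last exact: If.
apply/eqP; rewrite -subr_eq0; apply/eqP; apply: eq0_normc; apply/le_anti.
rewrite normc_ge0 andbT.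
(* One [C] bounds [F X - l]; the other four are [2 * 2], from [normc_cintegral_le] and
   [invsq_integral_le] on the tail. *)
apply: (@le0_of_le_div _ a (5 * C)) => X aX X0.
have [E _] := @cFTC_oo R F f a X aX (fun x h => dF x (proj1 (andP h))) (fun x h => df x (proj1 (andP h))).
have [I1 I2 ->] := @cintegral_split R a X +oo%O f aX isT If.
rewrite E.
rewrite (_ : F X - F a + _ - _ = (F X - l) + cintegral `]X, +oo[ f); last by ring.
apply: (le_trans (le_normcD _ _)).
have := normc_cintegral_le (mI X) I2 (IC X X0) (fun x h => fC x (le_trans aX (ltW (in_oy h)))).
rewrite RintegralZl; [|exact: mI|exact: invsq_integrable].
have C0 : 0 <= C.
  have := le_trans (normc_ge0 _) (fC a (lexx a)).
  by rewrite pmulr_lge0// exprn_gt0// invr_gt0.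
have := FC X aX; have := ler_wpM2l C0 (invsq_integral_le X0).
move: (normc _) (normc _) (Rintegral _ _ _) => u v w.
rewrite (_ : C * (2 * X^-1) = 2 * (C / X)); last by ring.
rewrite (_ : 5 * C / X = 5 * (C / X)); last by ring.
lra.
Qed.

Lemma kernel_lipschitz (g g' : R -> R[i]) N : (forall z : R, -1 < z -> is_cderive g z (g' z)) ->
  (forall z : R, -1 < z -> cdiff g' z) -> (forall z, 0 <= z <= 1 -> normc (g' z) <= N) ->
  forall y, 0 <= y <= 1 -> normc (g y - g 0) <= 2 * N * y.
Proof.
move=> dg dg' gN y /andP[y0 y1].
have [||<- I] := @cFTC_oo R g g' 0 y y0.
- by move=> x /andP[x0 _]; apply: dg; apply: lt_le_trans x0; rewrite ltrN10.
- by move=> x /andP[x0 _]; apply: dg'; apply: lt_le_trans x0; rewrite ltrN10.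
have := normc_cintegral_oo y0 I (N := N); rewrite subr0 mulrA; apply.
by move=> t /andP[t0 ty]; apply: gN; rewrite ltW//= (le_trans (ltW ty)).
Qed.

(** The substitution z = t / x, carried out with the primitive [- g (t / x) / t], whose limit at
    infinity comes from the Lipschitz bound at 0. *)
Lemma kernel_tail (g g' : R -> R[i]) t : (forall z : R, -1 < z -> is_cderive g z (g' z)) ->
  (forall z : R, -1 < z -> cdiff g' z) -> 0 < t ->
  cintegral `]t, +oo[ (fun x => g' (t / x) * ((x^-1) ^+ 2)%:C) = (t^-1)%:C * (g 1 - g 0) /\
  cintegrable `]t, +oo[ (fun x => g' (t / x) * ((x^-1) ^+ 2)%:C).
Proof.
move=> dg dg' t0; have [N N0 gN] := kernel_bounded 1 dg'.
have t01 x : t <= x -> 0 <= t / x <= 1.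
  move=> tx; have x0 : 0 < x by exact: lt_le_trans tx.
  by rewrite divr_ge0 ?(ltW x0) ?(ltW t0)//= ler_pdivrMr// mul1r.
have [||||E I] := @cFTC_oy (fun x => - (t^-1)%:C * g (t / x)) (fun x => g' (t / x) * ((x^-1) ^+ 2)%:C)
   t (2 * N) (- (t^-1)%:C * g 0) t0; last by split; [rewrite E divff ?gt_eqF//; ring|exact: I].
- move=> x tx; have x0 : 0 < x by exact: lt_le_trans tx.
  have d1 := is_cderive_divV (lt0r_neq0 x0) (dg _ (gtN1_div t0 x0)).
  apply: is_cderive_eq (is_cderiveM (is_cderive_cst (- (t^-1)%:C) x) d1) _.
  rewrite mul0r add0r mulrNN !mulrA [_ * g' _]mulrC -[_ * _ * t%:C]mulrA.
  by rewrite rcVK ?gt_eqF// mulr1.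
- move=> x tx; have x0 : 0 < x by exact: lt_le_trans tx.
  apply: cdiffM.
    by apply: cdiff_divV; [rewrite gt_eqF|apply: dg'; exact: gtN1_div].
  rewrite (_ : (fun t => _) = (fun t : R => (t^-1)%:C * (t^-1)%:C)).
    by apply: cdiffM; apply: cdiff_inv; rewrite gt_eqF.
  by apply/funext => z; rewrite rcX expr2.
- move=> x tx; rewrite normcM normc_real [`|_|]ger0_norm ?sqr_ge0// ler_wpM2r ?sqr_ge0//.
  by apply: (le_trans (gN _ (t01 x tx))); lra.
- move=> x tx; rewrite -mulrBr normcM -rcN normc_real normrN ger0_norm ?invr_ge0 ?(ltW t0)//.
  apply: (le_trans (ler_wpM2l _ (kernel_lipschitz dg dg' gN (t01 x tx)))).
    by rewrite invr_ge0 ltW.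
  by rewrite (_ : t^-1 * _ = (t^-1 * t) * (2 * N / x)); [rewrite mulVf ?gt_eqF// mul1r|ring].
Qed.

End improper.

(** * Explicit bumps *)

Section hump.
Context {R : realType}.
Local Notation mu := (@lebesgue_measure R).
Implicit Types c x : R.

(** The parabola with zeros [c] and [3 * c] and maximum 1; it is the dilation by [c] of the one for
    [c = 1]. *)
Definition humpR c x : R := (x - c) * (3 * c - x) / c ^+ 2.
Definition hump c : R -> R[i] := cutoff `]c, 3 * c[ (fun x => (humpR c x)%:C).
Definition hump' c : R -> R[i] := cutoff `]c, 3 * c[ (fun x => ((4 * c - 2 * x) / c ^+ 2)%:C).

Lemma hump_in c x : c < x < 3 * c -> hump c x = (humpR c x)%:C.
Proof. by move=> h; rewrite /hump cutoff_in// mem_oo. Qed.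

Lemma hump_out c x : ~~ (c < x < 3 * c) -> hump c x = 0.
Proof. by move=> h; rewrite /hump cutoff_notin// mem_oo. Qed.

Lemma humpR_bound c x : 0 < c -> c <= x <= 3 * c -> 0 <= humpR c x <= 1.
Proof.
move=> c0 /andP[cx xc]; have c2 : 0 < c ^+ 2 by rewrite exprn_gt0.
rewrite /humpR divr_ge0 ?(ltW c2) ?mulr_ge0 ?subr_ge0//= ler_pdivrMr// mul1r.
by have := sqr_ge0 (x - 2 * c); nra.
Qed.

Lemma is_derive_humpR c x : c != 0 -> is_derive x 1 (humpR c) ((4 * c - 2 * x) / c ^+ 2).
Proof.
move=> c0.
have d1 : is_derive x 1 (fun x => x - c) (1 - 0) := is_derive1D (is_derive1_id x) (is_derive1N (is_derive1_cst c x)).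
have d2 : is_derive x 1 (fun x => 3 * c - x) (0 - 1) := is_derive1D (is_derive1_cst (3 * c) x) (is_derive1N (is_derive1_id x)).
have d3 := is_derive1M (is_derive1M d1 d2) (is_derive1_cst (c ^+ 2)^-1 x).
by apply: (is_derive1_eq d3); cbv beta; ring.
Qed.

Lemma hump_test c : 0 < c -> test_fun c (3 * c) (hump' c) (hump c).
Proof.
move=> c0; have c3 : c < 3 * c by lra.
have cn : c != 0 by rewrite gt_eqF.
have mI : measurable (`]c, 3 * c[ : set R) by exact: measurable_itv.
have d (x : R) := is_derive_humpR x cn.
have d' x : cdiff (fun x => ((4 * c - 2 * x) / c ^+ 2)%:C) x.
  have d4 := is_derive1M (is_derive1D (is_derive1_cst (4 * c) x) (is_derive1N
    (is_derive1M (is_derive1_cst 2 x) (is_derive1_id x)))) (is_derive1_cst (c ^+ 2)^-1 x).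
  by eexists; exact: (is_cderive_real d4).
have FTC y : c <= y -> cintegral `]c, y[ (fun x => ((4 * c - 2 * x) / c ^+ 2)%:C) = (humpR c y)%:C.
  move=> cy; have [||-> _] := @cFTC_oo R (fun x => (humpR c x)%:C) (fun x => ((4 * c - 2 * x) / c ^+ 2)%:C) c y cy.
  - by move=> x _; exact: is_cderive_real.
  - by move=> x _; exact: d'.
  by rewrite -rcB {2}/humpR subrr !mul0r subr0.
have prim y : hump c y = cintegral `]0, y[ (hump' c).
  have [yc|cy] := leP y c.
    rewrite hump_out ?negb_and -?leNgt ?yc//.
    rewrite -[LHS](cintegral0 `]0, y[); apply: eq_cintegral => x /set_mem/in_oo[_ xy].
    by rewrite /hump' cutoff_notin// mem_oo negb_and -leNgt (le_trans (ltW xy) yc).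
  have [y3|y3] := ltP y (3 * c).
    rewrite hump_in ?cy// -(FTC y (ltW cy)).
    rewrite (cintegral_supp (D := `]0, y[%classic) (E := `]c, y[%classic)).
    - apply: eq_cintegral => x /set_mem/in_oo[cx xy].
      by rewrite /hump' cutoff_in// mem_oo cx (lt_trans xy).
    - exact: oo_sub (ltW c0).
    - move=> x /in_oo[_ xy] nx; rewrite /hump' cutoff_notin// mem_oo; apply/negP => /andP[cx _].
      by apply: nx; rewrite /= in_itv/= cx.
  rewrite hump_out ?negb_and -?leNgt ?y3 ?orbT//.
  have sub : `]c, 3 * c[ `<=` `]0, y[.
    by move=> x /in_oo[cx xc]; rewrite /= in_itv/= (lt_trans c0 cx) (lt_le_trans xc).
  rewrite /hump' (cintegral_cutoff _ sub) (FTC (3 * c) (ltW c3)).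
  by rewrite /humpR subrr mulr0 mul0r.
split => //.
- apply: cmeas_cutoffT => //; apply: ccontinuous_cmeas; first exact: interval_open.
  by move=> x _; apply: cdiff_continuous; exact: d'.
- exists (2 / c) => x; rewrite /hump' /cutoff mem_oo; case: ifPn => [/andP[cx xc]|_]; last first.
    by rewrite normc0 divr_ge0 ?ltW.
  rewrite normc_real normrM normfV [`|c ^+ 2|]ger0_norm ?sqr_ge0//.
  rewrite ler_pdivrMr ?exprn_gt0// (_ : 2 / c * c ^+ 2 = 2 * c); last by field.
  by rewrite ler_norml; apply/andP; split; lra.
- by move=> x h; rewrite /hump' cutoff_notin// mem_oo.
- by rewrite -prim hump_out// ltxx andbF.
Qed.

Lemma normc_hump c x : 0 < c -> normc (hump c x) <= 1.
Proof.
move=> c0; have [h|h] := boolP (c < x < 3 * c); last by rewrite hump_out// normc0.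
have /andP[b0 b1] : 0 <= humpR c x <= 1.
  by apply: humpR_bound => //; case/andP: h => h1 h2; rewrite !ltW.
by rewrite hump_in// normc_real ger0_norm.
Qed.

Lemma hump_integral c : 0 < c -> cintegral `]c, 3 * c[ (hump c) = (4 / 3 * c)%:C.
Proof.
move=> c0; have c3 : c <= 3 * c by lra.
have cn : c != 0 by rewrite gt_eqF.
pose Q x := (2 * c * x ^+ 2 - x ^+ 3 / 3 - 3 * c ^+ 2 * x) / c ^+ 2.
have dQ (x : R) : is_derive x 1 Q (humpR c x).
  have d2 := is_derive1X 1 (is_derive1_id x); have d3 := is_derive1X 2 (is_derive1_id x).
  have e1 := is_derive1M (is_derive1_cst (2 * c) x) d2.
  have e2 := is_derive1M d3 (is_derive1_cst 3^-1 x).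
  have e3 := is_derive1M (is_derive1_cst (3 * c ^+ 2) x) (is_derive1_id x).
  have e4 := is_derive1M (is_derive1D (is_derive1D e1 (is_derive1N e2)) (is_derive1N e3)) (is_derive1_cst (c ^+ 2)^-1 x).
  by apply: (is_derive1_eq e4); rewrite /humpR; field.
rewrite (eq_cintegral (g := fun x => (humpR c x)%:C)); last first.
  by move=> x /set_mem/in_oo[h1 h2]; rewrite hump_in// h1.
have [||-> _] := @cFTC_oo R (fun x => (Q x)%:C) (fun x => (humpR c x)%:C) c (3 * c) c3.
- by move=> x _; exact: is_cderive_real.
- by move=> x _; eexists; apply: is_cderive_real; exact: is_derive_humpR.
by rewrite -rcB; congr (_%:C); rewrite /Q; field.
Qed.

(** The exact value involves ln 3; the lower bound is the integral [4 / 3 * c] times [(3 * c)^-1],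
    the least value of 1 / x on the support. *)
Lemma hump_div_integral c : 0 < c -> exists2 n : R, 4 / 9 <= n &
  cintegral `]c, 3 * c[ (fun x => hump c x * (x^-1)%:C) = n%:C.
Proof.
move=> c0; have tb := hump_test c0; have mI : measurable (`]c, 3 * c[ : set R) by exact: measurable_itv.
have [i1 _] := f_inv_int tb (3 * c) c0.
have [i2 _] := test_f_oo tb (3 * c) (ltW c0).
exists (\int[mu]_(x in `]c, 3 * c[) Re (hump c x * (x^-1)%:C)); last first.
  apply: complex_ext; first by rewrite Re_cintegral.
  rewrite Im_cintegral; transitivity (\int[mu]_(x in `]c, 3 * c[) (0 : R)); last by rewrite /Rintegral integral0.
  by apply: eq_Rintegral => x /set_mem/in_oo[h1 h2]; rewrite hump_in ?h1// -rcM.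
have : \int[mu]_(x in `]c, 3 * c[) Re (hump c x) = 4 / 3 * c by rewrite -Re_cintegral hump_integral.
move=> E; rewrite (_ : 4 / 9 = (3 * c)^-1 * (4 / 3 * c)); last by field; rewrite gt_eqF.
rewrite -E -RintegralZl//; apply: le_Rintegral => //; first exact: (rintegrableZl _ mI i2).
move=> x /in_oo[cx xc]; rewrite hump_in ?cx// -rcM !cRe_real mulrC.
have x0 := lt_trans c0 cx.
have /andP[b0 _] : 0 <= humpR c x <= 1 by apply: humpR_bound => //; rewrite !ltW.
by rewrite ler_wpM2l// lef_pV2 ?posrE ?ltW ?mulr_gt0.
Qed.

End hump.

Section conjugation.
Context {R : realType}.
Lemma ccM (z w : R[i]) : (z * w)^* = z^* * w^*.
Proof. by apply: complex_ext; rewrite !(cRe_mul, cIm_mul, cRe_conj, cIm_conj); ring. Qed.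
Lemma ccR (x : R) : (x%:C)^* = x%:C.
Proof. by apply: complex_ext; rewrite !(cRe_conj, cIm_conj)/= ?oppr0. Qed.
Lemma ccB (z w : R[i]) : (z - w)^* = z^* - w^*.
Proof. by apply: complex_ext; rewrite !(cRe_add, cIm_add, cRe_opp, cIm_opp, cRe_conj, cIm_conj, cRe_add, cIm_add, cRe_opp, cIm_opp); ring. Qed.
End conjugation.

(** * Bumps at a great distance from each other *)

Section necessity.
Context {R : realType}.
Local Notation mu := (@lebesgue_measure R).
Local Notation H := (@halfline R).
Variables (nu : R[i]) (k k2 : R -> R[i]).
Local Notation P := (legendreP nu).
Hypothesis P1 : P 1 = 1.
Hypothesis dP : forall z : R, -1 < z -> is_cderive P z (k z).
Hypothesis dk : forall z : R, -1 < z -> is_cderive k z (k2 z).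
Hypothesis dk2 : forall z : R, -1 < z -> cdiff k2 z.
Variables (M N : R).
Hypothesis bk : bounded_kernel k M.
Hypothesis k2N : forall z, 0 <= z <= 1 -> normc (k2 z) <= N.
Let mH := @measurable_halfline R.
Let ck z : -1 < z -> cdiff k z := cdiffk dk (z := z).
Implicit Types (c x t : R).

Lemma M_ge0 : 0 <= M.
Proof. by apply: le_trans (bk.2 2^-1 _); [exact: normc_ge0|lra]. Qed.

Lemma N_ge0 : 0 <= N.
Proof. by apply: le_trans (k2N (z := 0) _); [exact: normc_ge0|rewrite lexx ler01]. Qed.

Let kLip := kernel_lipschitz dk dk2 k2N.

Lemma Aop_hump_bound c x : 0 < c -> 0 < x -> normc (Aop k (hump c) x) <= 1 + 2 * M.
Proof.
move=> c0 x0; have fL := test_L2 (hump_test c0).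
apply: (le_trans (le_normcD _ _)); apply: lerD; first exact: normc_hump.
rewrite normcN; have := normc_cintegral_bound (ltW x0) (Kop_int bk fL x0) (N := M * x^-1).
rewrite divfK ?gt_eqF//; apply => t tx; rewrite normcM normc_real ger0_norm ?invr_ge0 ?(ltW x0)//.
rewrite ler_wpM2r ?invr_ge0 ?(ltW x0)// normcM -[leRHS]mulr1.
by apply: ler_pM; rewrite ?normc_ge0 ?normc_hump//; apply: bk.2; exact: div_in01.
Qed.

(** To the right of the support A f = - K f, and replacing [k (t / x)] by [k 0] in K f costs order
    x^-2 by the Lipschitz bound; 4 / 3 is the integral of the bump. In [24 = 2 * 6 * 2] the 6 is
    [2 * 3] from that bound with t < 3, and the last 2 is the length of the support. *)
Lemma Aop_hump_tail x : 3 <= x ->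
  normc (Aop k (hump 1) x + k 0 * (4 / 3)%:C * (x^-1)%:C) <= 24 * N * (x^-1) ^+ 2.
Proof.
move=> x3; have x0 : 0 < x by exact: lt_le_trans x3.
have N0 := N_ge0; have tb := hump_test (ltr01 : 0 < 1 :> R); have fL := test_L2 tb.
have mI : measurable (`]1, 3[ : set R) by exact: measurable_itv.
rewrite mulr1 in tb; have sub : `]1, 3[ `<=` `]0, x[.
  by move=> t /in_oo[t1 t3]; rewrite /= in_itv/= (lt_trans ltr01 t1) (lt_le_trans t3).
have out t : `]0, x[%classic t -> ~ `]1, 3[%classic t -> hump 1 t = 0.
  move=> _ nt; rewrite hump_out// mulr1; apply/negP => /andP[t1 t3]; apply: nt.
  by rewrite /= in_itv/= t1.
have I1 : cintegrable `]1, 3[ (fun t => k (t / x) * hump 1 t * (x^-1)%:C).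
  by apply: cintegrableS (Kop_int bk fL x0) => //; exact: measurable_itv.
have I2 := cintegrableZ (k 0 * (x^-1)%:C) mI (test_f_oo tb 3 ler01).
rewrite /Aop (test_eq0 tb) ?sub0r; last by rewrite negb_and -!leNgt x3 orbT.
rewrite /Kop (cintegral_supp sub); last by move=> t h1 h2; rewrite (out t h1 h2) mulr0 mul0r.
rewrite (_ : k 0 * _ * _ = k 0 * (x^-1)%:C * cintegral `]1, 3[ (hump 1)); last first.
  by have := hump_integral (ltr01 : 0 < 1 :> R); rewrite !mulr1 => ->; ring.
rewrite -(cintegralZ _ mI (test_f_oo tb 3 ler01)) addrC -(cintegralB mI I2 I1).
apply: (le_trans (normc_cintegral_oo (N := 6 * N * (x^-1) ^+ 2) _ (cintegrableB mI I2 I1) _)).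
- lra.
- move=> t /andP[t1 t3]; have t0 : 0 < t by lra.
  rewrite (_ : _ - _ = - ((k (t / x) - k 0) * hump 1 t * (x^-1)%:C)); last by ring.
  rewrite normcN !normcM normc_real [`|_|]ger0_norm ?invr_ge0 ?(ltW x0)//.
  have tx : 0 <= t / x <= 1.
    by rewrite divr_ge0 ?(ltW t0) ?(ltW x0)//= ler_pdivrMr// mul1r; lra.
  have h1 := kLip tx; have h2 := normc_hump t (ltr01 : 0 < 1 :> R).
  have h3 : 2 * N * (t / x) <= 6 * N * x^-1.
    rewrite mulrA ler_wpM2r ?invr_ge0 ?(ltW x0)//; nra.
  rewrite expr2 mulrA ler_wpM2r ?invr_ge0 ?(ltW x0)// -[leRHS]mulr1.
  by apply: ler_pM; rewrite ?normc_ge0// (le_trans h1).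
rewrite le_eqVlt; apply/orP; left; apply/eqP; ring.
Qed.

(** The function 1 / x is an eigenfunction of A' with eigenvalue [P 0], by [kernel_tail]. It is cut
    off at [c] to lie in L_2; for t > c this does not alter the integral over ]t, oo[ in K'. *)
Lemma Aop_hump_mean c : 0 < c ->
  cintegral `]c, +oo[ (fun x => Aop k (hump c) x * (x^-1)%:C) =
  P 0 * cintegral `]c, 3 * c[ (fun x => hump c x * (x^-1)%:C).
Proof.
move=> c0; have tb := hump_test c0; have fL := test_L2 tb.
have mI : measurable (`]c, +oo[ : set R) by exact: measurable_itv.
pose g := cutoff `]c, +oo[ (fun x : R => (x^-1)%:C).
have gE x : c < x -> g x = (x^-1)%:C by move=> h; rewrite /g cutoff_in// mem_oy.
have g0 x : x <= c -> g x = 0 by move=> h; rewrite /g cutoff_notin// mem_oy -leNgt.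
have mg : cmeas H g.
  by apply: cmeas_cutoffT => //; apply: cmeas_real; exact: measurable_invr_halfline.
have gL : inL2 g.
  split; first exact: mg.
  have sH := sub_halfline_left (ltW c0).
  rewrite /L2sq (_ : (\int[mu]_(x in H) _)%E = (\int[mu]_(x in `]c, +oo[) ((x^-1) ^+ 2)%:E)%E).
    by rewrite (EFin_Rintegral mI (invsq_integrable c0)) ltry.
  rewrite integral_mkcond [RHS]integral_mkcond; apply: eq_integral => x _.
  rewrite !patchE (mem_oy c x) (mem_oy 0 x); case: (ltP c x) => [cx|xc].
    rewrite (lt_trans c0 cx).
    by rewrite gE// normc_real real_normK// num_real.
  by rewrite g0// normc0 expr0n/=; case: ifP.
have sH := sub_halfline_left (ltW c0).
have AL := Aop_L2 bk fL; have [KL _] := Kop_L2 bk fL; have [KgL _] := Kop'_L2 bk gL.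
have -> : cintegral `]c, +oo[ (fun x => Aop k (hump c) x * (x^-1)%:C) = cintegral H (fun x => Aop k (hump c) x * g x).
  rewrite (cintegral_supp sH (f := fun x => Aop k (hump c) x * g x)).
    by apply: eq_cintegral => x /set_mem/in_oy cx; rewrite gE.
  move=> x _ nx; rewrite g0 ?mulr0// leNgt; apply/negP => cx; apply: nx.
  by rewrite /= in_itv/= cx.
have -> : cintegral H (fun x => Aop k (hump c) x * g x) =
    cintegral H (fun x => hump c x * g x) - cintegral H (fun x => Kop k (hump c) x * g x).
  rewrite -(cintegralB mH (inL2_mul_integrable fL gL) (inL2_mul_integrable KL gL)).
  by apply: eq_cintegral => x _; rewrite /Aop mulrBl.
rewrite (Kop_adj bk fL gL).
rewrite -(cintegralB mH (inL2_mul_integrable fL gL) (inL2_mul_integrable fL KgL)).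
have sub : `]c, 3 * c[ `<=` H.
  by move=> x /in_oo[cx _]; rewrite halflineE (lt_trans c0).
rewrite (cintegral_supp sub); last first.
  move=> x _ nx; rewrite hump_out ?mul0r ?subr0//; apply/negP => /andP[h1 h2]; apply: nx.
  by rewrite /= in_itv/= h1.
rewrite -(cintegralZ _ (measurable_itv _) (f_inv_int tb (3 * c) c0)).
apply: eq_cintegral => t /set_mem/in_oo[ct tc]; have t0 := lt_trans c0 ct.
have -> : Kop' k g t = (t^-1)%:C * (P 1 - P 0).
  have [<- _] := kernel_tail dP ck t0.
  apply: eq_cintegral => x /set_mem/in_oy tx; rewrite gE ?(lt_trans ct)//.
  by rewrite rcX; ring.
by rewrite gE// P1; ring.
Qed.

(* On the support of [Aop k (hump c)] one has [Aop k (hump 1) x = - k 0 * m / x + O (x^-2)],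
   and [Aop_hump_mean] evaluates the pairing of [Aop k (hump c)] with [1 / x]. *)
Lemma inner_Aop_zero : (forall c, 3 < c -> L2inner (Aop k (hump 1)) (Aop k (hump c)) = 0) ->
  k 0 * P 0 = 0.
Proof.
move=> h; apply: eq0_normc; apply/le_anti; rewrite normc_ge0 andbT.
have M0 := M_ge0; have N0 := N_ge0.
(* The factor 4 is [2 * 2], from [normc_cintegral_le] and [invsq_integral_le]; 27 / 16 inverts the
   product of the mass 4 / 3 and the lower bound 4 / 9. *)
apply: (@le0_of_le_div _ _ 4 (24 * N * (1 + 2 * M) * 4 * (27 / 16))) => c c4 c0.
have c3 : 3 < c by lra.
have tb := hump_test c0; have fL := test_L2 tb; have AL := Aop_L2 bk fL.
have tb1 := hump_test (ltr01 : 0 < 1 :> R); have A1L := Aop_L2 bk (test_L2 tb1).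
have mI : measurable (`]c, +oo[ : set R) by exact: measurable_itv.
have sH := sub_halfline_left (ltW c0).
have [n n49 nE] := hump_div_integral c0.
have IA : cintegrable `]c, +oo[ (fun x => Aop k (hump c) x * (x^-1)%:C) := inL2_cintegrable_right AL c0.
have I1 : cintegrable `]c, +oo[ (fun x => (Aop k (hump c) x)^* * (x^-1)%:C) :=
  inL2_cintegrable_right (inL2_conj AL) c0.
have I0 : cintegrable `]c, +oo[ (fun x => Aop k (hump 1) x * (Aop k (hump c) x)^*).
  by apply: cintegrableS (inL2_mul_integrable A1L (inL2_conj AL)).
have E0 : cintegral `]c, +oo[ (fun x => Aop k (hump 1) x * (Aop k (hump c) x)^*) = 0.
  rewrite -(h c c3) /L2inner (cintegral_supp sH)// => x; rewrite halflineE => x0 nx.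
  rewrite (test_Aop_eq0 k tb) ?rmorph0 ?mulr0// leNgt; apply/negP => cx; apply: nx.
  by rewrite /= in_itv/= cx.
pose z := k 0 * (4 / 3)%:C.
have I2 := cintegrableZ z mI I1.
have E1 : cintegral `]c, +oo[ (fun x => (Aop k (hump 1) x + z * (x^-1)%:C) * (Aop k (hump c) x)^*) =
    z * (P 0)^* * n%:C.
  transitivity (z * cintegral `]c, +oo[ (fun x => (Aop k (hump c) x)^* * (x^-1)%:C)).
    rewrite -[RHS]add0r -E0 -(cintegralZ z mI I1) -(cintegralD mI I0 I2).
    by apply: eq_cintegral => x _; ring.
  rewrite -mulrA; congr (_ * _);
  have -> : (P 0)^* * n%:C = (cintegral `]c, +oo[ (fun x => Aop k (hump c) x * (x^-1)%:C))^*.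
    by rewrite (Aop_hump_mean c0) nE ccM ccR.
  rewrite -(cintegral_conj mI IA); apply: eq_cintegral => x _.
  by rewrite ccM ccR.
have Ie : cintegrable `]c, +oo[ (fun x => (Aop k (hump 1) x + z * (x^-1)%:C) * (Aop k (hump c) x)^*).
  by apply: (eq_cintegrable mI _ (cintegrableD mI I0 I2)) => x _; ring.
have := normc_cintegral_le mI Ie (rintegrableZl (24 * N * (1 + 2 * M)) mI (invsq_integrable c0)).
have pt x : `]c, +oo[%classic x ->
    normc ((Aop k (hump 1) x + z * (x^-1)%:C) * (Aop k (hump c) x)^*) <= 24 * N * (1 + 2 * M) * (x^-1) ^+ 2.
  move=> /in_oy cx; have x0 := lt_trans c0 cx; rewrite normcM normc_conj [leRHS]mulrAC.
  apply: ler_pM; rewrite ?normc_ge0//; last exact: Aop_hump_bound.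
  by apply: Aop_hump_tail; lra.
move=> /(_ pt); rewrite E1 RintegralZl; [|exact: mI|exact: invsq_integrable].
rewrite !normcM !normc_real normc_conj => le.
have K0 : 0 <= 24 * N * (1 + 2 * M) by rewrite !mulr_ge0 ?addr_ge0 ?mulr_ge0.
have := ler_wpM2l K0 (invsq_integral_le c0).
have uv : 0 <= normc (k 0) * normc (P 0) by rewrite mulr_ge0 ?normc_ge0.
have n0 : 0 <= n by lra.
have := ler_wpM2l uv n49.
move: le; rewrite (ger0_norm n0) (_ : `|4 / 3| = 4 / 3 :> R); last by rewrite ger0_norm.
rewrite (_ : 24 * N * (1 + 2 * M) * 4 * (27 / 16) / c = 24 * N * (1 + 2 * M) * (2 * c^-1) * (27 / 8)); last by field; rewrite gt_eqF.
rewrite (_ : normc (k 0) * (4 / 3) * normc (P 0) * n = normc (k 0) * normc (P 0) * n * (4 / 3)); last by ring.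
move: (normc (k 0) * normc (P 0)) (24 * N * (1 + 2 * M) * _) (24 * N * (1 + 2 * M) * _) (_ * n) => A B D E.
lra.
Qed.

Lemma Kop'_hump_int c t : 0 < c -> 0 < t ->
  cintegrable `]t, 3 * c[ (fun x => k (t / x) * 1 * (hump c x * (x^-1)%:C)) /\
  Kop' k (hump c) t = cintegral `]t, 3 * c[ (fun x => k (t / x) * 1 * (hump c x * (x^-1)%:C)).
Proof.
move=> c0 t0; have tb := hump_test c0; have fL := test_L2 tb.
split; first by apply: cintegrableS (Kop'_int bk fL t0); [exact: measurable_itv|exact: measurable_itv|exact: oo_oy].
apply: cintegral_supp; first exact: oo_oy.
by move=> x h1 h2; rewrite (test_eq0 tb (outside_B c (lexx _) h1 h2)) mul0r mulr0.
Qed.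

Lemma Aop'_hump_bound c t : 0 < c -> 0 < t -> t < 3 * c -> normc (Aop' k (hump c) t) <= 1 + 6 * M.
Proof.
move=> c0 t0 t3; have M0 := M_ge0; have [I E] := Kop'_hump_int c0 t0.
apply: (le_trans (le_normcD _ _)); apply: lerD; first exact: normc_hump.
rewrite normcN E; apply: (le_trans (normc_cintegral_oo (N := M * c^-1) (ltW t3) I _)).
  move=> x /andP[tx xc]; have x0 := lt_trans t0 tx; rewrite mulr1 normcM.
  apply: ler_pM; rewrite ?normc_ge0//; first by apply: bk.2; apply: div_in01; rewrite t0.
  have [h|h] := boolP (c < x < 3 * c); last by rewrite hump_out// mul0r normc0 invr_ge0 ltW.
  rewrite normcM normc_real -[leRHS]mul1r ger0_norm ?invr_ge0 ?(ltW x0)//.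
  apply: ler_pM; rewrite ?normc_ge0 ?invr_ge0 ?(ltW x0) ?normc_hump//.
  by case/andP: h => cx _; rewrite lef_pV2 ?posrE// ltW.
have -> : 6 * M = 2 * (M * c^-1 * (3 * c)) by field; rewrite gt_eqF.
rewrite ler_pM2l// ler_wpM2l ?mulr_ge0 ?invr_ge0 ?(ltW c0)//.
by rewrite gerBl ltW.
Qed.

(** To the left of the support A' f = - K' f, and replacing [k (x / t)] by [k 0] costs order x. Thus
    A' f is nearly constant near 0. *)
Lemma Aop'_hump_head n x : 0 < x -> x < 1 ->
  cintegral `]1, 3[ (fun t => hump 1 t * (t^-1)%:C) = n%:C ->
  normc (Aop' k (hump 1) x + k 0 * n%:C) <= 8 * N * x.
Proof.
move=> x0 x1 nE; have N0 := N_ge0.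
have c1 : 0 < 1 :> R by exact: ltr01.
have tb := hump_test c1; have fL := test_L2 tb.
rewrite mulr1 in tb; have mI : measurable (`]1, 3[ : set R) by exact: measurable_itv.
have If := f_inv_int tb 3 c1.
have I2 := cintegrableZ (k 0) mI If.
have sub : `]1, 3[ `<=` `]x, +oo[.
  by move=> t /in_oo[t1 _]; rewrite /= in_itv/= (lt_trans x1).
have I1 : cintegrable `]1, 3[ (fun t => k (x / t) * 1 * (hump 1 t * (t^-1)%:C)).
  by apply: cintegrableS (Kop'_int bk fL x0) => //; exact: measurable_itv.
rewrite /Aop' (test_eq0 tb) ?sub0r; last by rewrite negb_and -!leNgt (ltW x1).
rewrite /Kop' (cintegral_supp sub); last first.
  move=> t _ nt; rewrite hump_out ?mul0r ?mulr0// mulr1; apply/negP => /andP[t1 t3]; apply: nt.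
  by rewrite /= in_itv/= t1.
rewrite -nE -(cintegralZ _ mI If) addrC -(cintegralB mI I2 I1).
apply: (le_trans (normc_cintegral_oo (N := 2 * N * x) _ (cintegrableB mI I2 I1) _)).
- lra.
- move=> t /andP[t1 t3]; have t0 : 0 < t by lra.
  rewrite (_ : _ - _ = - ((k (x / t) - k 0) * (hump 1 t * (t^-1)%:C))); last by ring.
  rewrite normcN !normcM normc_real [`|_|]ger0_norm ?invr_ge0 ?(ltW t0)//.
  have xt1 : x / t <= x by rewrite ler_pdivrMr// ler_peMr// ltW.
  have xt : 0 <= x / t <= 1.
    by rewrite divr_ge0 ?(ltW t0) ?(ltW x0)//= (le_trans xt1)// ltW.
  rewrite -[leRHS]mulr1; apply: ler_pM; rewrite ?normc_ge0 ?mulr_ge0 ?normc_ge0 ?invr_ge0 ?(ltW t0)//.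
    by apply: (le_trans (kLip xt)); rewrite ler_wpM2l// mulr_ge0.
  rewrite -[leRHS]mulr1; apply: ler_pM; rewrite ?normc_ge0 ?invr_ge0 ?(ltW t0) ?normc_hump//.
  by rewrite invf_le1// ltW.
rewrite le_eqVlt; apply/orP; left; apply/eqP; ring.
Qed.

(** Dually to [Aop_hump_mean], the constant 1 is an eigenfunction of A with eigenvalue [P 0]; it is
    cut off at [3 * c], beyond which A' f vanishes. *)
Lemma Aop'_hump_mean c : 0 < c ->
  cintegral `]0, 3 * c[ (Aop' k (hump c)) = P 0 * (4 / 3 * c)%:C.
Proof.
move=> c0; have tb := hump_test c0; have fL := test_L2 tb.
have c3 : 0 < 3 * c by rewrite mulr_gt0.
have mI : measurable (`]0, 3 * c[ : set R) by exact: measurable_itv.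
pose g : R -> R[i] := cutoff `]0, 3 * c[ (fun=> 1).
have gE x : 0 < x -> x < 3 * c -> g x = 1 by move=> h1 h2; rewrite /g cutoff_in// mem_oo h1.
have g0 x : ~~ (0 < x < 3 * c) -> g x = 0 by move=> h; rewrite /g cutoff_notin// mem_oo.
have gL : inL2 g.
  apply: (@inL2_bounded_support _ g 0 (3 * c) 1) => //.
    by apply: cmeas_cutoffT => //; exact: cmeas_cst.
  move=> x; have [/andP[h1 h2]|h] := boolP (0 < x < 3 * c).
    by rewrite gE// normc_real normr1.
  by rewrite g0// normc0.
have AL := Aop'_L2 bk fL; have [KL _] := Kop'_L2 bk fL; have [KgL _] := Kop_L2 bk gL.
have -> : cintegral `]0, 3 * c[ (Aop' k (hump c)) = cintegral H (fun x => g x * Aop' k (hump c) x).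
  rewrite (cintegral_supp (@sub_halfline_right R (3 * c)) (f := fun x => g x * _)).
    by apply: eq_cintegral => x /set_mem/in_oo[h1 h2]; rewrite gE// mul1r.
  by move=> x _ nx; rewrite g0 ?mul0r//; apply/negP => h; apply: nx; rewrite /= in_itv.
have -> : cintegral H (fun x => g x * Aop' k (hump c) x) =
    cintegral H (fun x => g x * hump c x) - cintegral H (fun x => g x * Kop' k (hump c) x).
  rewrite -(cintegralB mH (inL2_mul_integrable gL fL) (inL2_mul_integrable gL KL)).
  by apply: eq_cintegral => x _; rewrite /Aop' mulrBr.
rewrite -(Kop_adj bk gL fL).
rewrite -(cintegralB mH (inL2_mul_integrable gL fL) (inL2_mul_integrable KgL fL)).
have sub : `]c, 3 * c[ `<=` H.
  by move=> x /in_oo[cx _]; rewrite halflineE (lt_trans c0).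
rewrite (cintegral_supp sub); last first.
  move=> x _ nx; rewrite hump_out ?mulr0 ?subr0//; apply/negP => /andP[h1 h2]; apply: nx.
  by rewrite /= in_itv/= h1.
rewrite -(hump_integral c0) -(cintegralZ _ (measurable_itv _) (test_f_oo tb (3 * c) (ltW c0))).
apply: eq_cintegral => t /set_mem/in_oo[ct tc]; have t0 := lt_trans c0 ct.
have -> : Kop k g t = P 1 - P 0.
  have [||E _] := @cFTC_oo R (fun s => P (s / t)) (fun s => k (s / t) * (t^-1)%:C) 0 t (ltW t0).
  - move=> s /andP[s0 _]; apply: is_cderive_div; apply: dP.
    by apply: (@lt_le_trans _ _ 0); rewrite ?ltrN10// divr_ge0// ltW.
  - move=> s /andP[s0 _]; apply: cdiffM; last exact: cdiff_cst.
    apply: cdiff_div; apply: ck.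
    by apply: (@lt_le_trans _ _ 0); rewrite ?ltrN10// divr_ge0// ltW.
  rewrite mul0r divff ?gt_eqF// in E; rewrite -E.
  by apply: eq_cintegral => s /set_mem/in_oo[s0 st]; rewrite gE ?(lt_trans st)// mulr1.
by rewrite gE// P1; ring.
Qed.

(** The image of the bump at [c] lives on ]0, 3c[, where that of the bump at 1 is [- k 0 * n] up to
    order c. The inner product is therefore [k 0] times the conjugate of [P 0], times a negative
    multiple of c, up to order c^2; let c tend to 0. *)
Lemma inner_Aop'_zero :
  (forall c, 0 < c -> 3 * c < 1 -> L2inner (Aop' k (hump 1)) (Aop' k (hump c)) = 0) ->
  k 0 * P 0 = 0.
Proof.
move=> h; apply: eq0_normc; apply/le_anti; rewrite normc_ge0 andbT.
have M0 := M_ge0; have N0 := N_ge0.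
(* With [c = 1 / X], an error of order c^2 against a main term of order c leaves order 1 / X. The
   two factors 3 come from x < 3c and from the length of the interval; 27 / 16 inverts
   [4 / 9 * 4 / 3]. *)
apply: (@le0_of_le_div _ _ 4 (8 * N * 3 * (1 + 6 * M) * 3 * 2 * (27 / 16))) => X X4 X0.
pose c := X^-1; have c0 : 0 < c by rewrite invr_gt0.
have c1 : 3 * c < 1 by rewrite ltr_pdivrMr// mul1r; lra.
rewrite -/c.
have c3 : 0 < 3 * c by rewrite mulr_gt0.
have tb := hump_test c0; have fL := test_L2 tb; have AL := Aop'_L2 bk fL.
have tb1 := hump_test (ltr01 : 0 < 1 :> R); have A1L := Aop'_L2 bk (test_L2 tb1).
have mI : measurable (`]0, 3 * c[ : set R) by exact: measurable_itv.
have sH := @sub_halfline_right R (3 * c).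
have [n n49 nE] := hump_div_integral (ltr01 : 0 < 1 :> R); rewrite mulr1 in nE.
have I1 := cintegrable_conj mI (inL2_cintegrable_left AL c3).
have I0 : cintegrable `]0, 3 * c[ (fun x => Aop' k (hump 1) x * (Aop' k (hump c) x)^*).
  by apply: cintegrableS (inL2_mul_integrable A1L (inL2_conj AL)).
have E0 : cintegral `]0, 3 * c[ (fun x => Aop' k (hump 1) x * (Aop' k (hump c) x)^*) = 0.
  rewrite -(h c c0 c1) /L2inner (cintegral_supp sH)// => x; rewrite halflineE => x0 nx.
  rewrite (test_Aop'_eq0 k tb) ?rmorph0 ?mulr0// leNgt; apply/negP => cx; apply: nx.
  by rewrite /= in_itv/= x0.
pose z := k 0 * n%:C.
have I2 := cintegrableZ z mI I1.
have Ie : cintegrable `]0, 3 * c[ (fun x => (Aop' k (hump 1) x + z) * (Aop' k (hump c) x)^*).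
  by apply: (eq_cintegrable mI _ (cintegrableD mI I0 I2)) => x _; ring.
have E1 : cintegral `]0, 3 * c[ (fun x => (Aop' k (hump 1) x + z) * (Aop' k (hump c) x)^*) =
    z * (P 0)^* * (4 / 3 * c)%:C.
  transitivity (z * cintegral `]0, 3 * c[ (fun x => (Aop' k (hump c) x)^*)).
    rewrite -[RHS]add0r -E0 -(cintegralZ z mI I1) -(cintegralD mI I0 I2).
    by apply: eq_cintegral => x _; ring.
  rewrite -mulrA; congr (_ * _).
  have -> : (P 0)^* * (4 / 3 * c)%:C = (cintegral `]0, 3 * c[ (Aop' k (hump c)))^*.
    by rewrite (Aop'_hump_mean c0) ccM ccR.
  by rewrite -(cintegral_conj mI (inL2_cintegrable_left AL c3)).
have := normc_cintegral_oo (N := 8 * N * (3 * c) * (1 + 6 * M)) (ltW c3) Ie.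
have pt x : 0 < x < 3 * c ->
    normc ((Aop' k (hump 1) x + z) * (Aop' k (hump c) x)^*) <= 8 * N * (3 * c) * (1 + 6 * M).
  move=> /andP[x0 xc]; rewrite normcM normc_conj.
  apply: ler_pM; rewrite ?normc_ge0//; last exact: Aop'_hump_bound.
  apply: (le_trans (Aop'_hump_head x0 (lt_trans xc c1) nE)).
  by rewrite ler_wpM2l ?mulr_ge0// ltW.
move=> /(_ pt); rewrite E1 subr0 !normcM !normc_real normc_conj => le.
have uv : 0 <= normc (k 0) * normc (P 0) by rewrite mulr_ge0 ?normc_ge0.
have n0 : 0 <= n by lra.
have := ler_wpM2l uv n49.
move: le; rewrite (ger0_norm n0) (_ : `|4 / 3 * c| = 4 / 3 * c :> R); last first.
  by rewrite ger0_norm// mulr_ge0// ltW.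
rewrite (_ : normc (k 0) * n * normc (P 0) * (4 / 3 * c) = (normc (k 0) * normc (P 0) * n * (4 / 3)) * c); last by ring.
rewrite (_ : 2 * _ = (2 * (8 * N * 3 * (1 + 6 * M) * (3 * c))) * c); last by ring.
rewrite ler_pM2r//.
rewrite (_ : 8 * N * 3 * (1 + 6 * M) * 3 * 2 * (27 / 16) * c = (2 * (8 * N * 3 * (1 + 6 * M) * (3 * c))) * (27 / 16)); last by ring.
move: (normc (k 0) * normc (P 0)) (2 * _) (_ * n) => A B E.
lra.
Qed.

End necessity.

(** * Legendre polynomials *)

Section legendre_polynomial.
Context {R : realType}.
Variable n : nat.
Implicit Types (i j : nat) (z : R).

(** Coefficients of F(-n, n+1; 1; w), with [(j - n) (j + n + 1)] written as [j (j + 1) - n (n + 1)].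
    This factor vanishes at [j = n], so the series terminates. *)
Fixpoint leg_coef i : R :=
  if i is j.+1 then (j%:R * j.+1%:R - n%:R * n.+1%:R) / j.+1%:R ^+ 2 * leg_coef j else 1.

Lemma leg_coefS j : leg_coef j.+1 * j.+1%:R ^+ 2 = (j%:R * j.+1%:R - n%:R * n.+1%:R) * leg_coef j.
Proof. by rewrite /= mulrAC divfK// expf_neq0// pnatr_eq0. Qed.

Lemma leg_coef_eq0 i : (n < i)%N -> leg_coef i = 0.
Proof.
elim: i => // i IH; rewrite ltnS leq_eqVlt => /predU1P[<-|/IH ni] /=; first by rewrite subrr mul0r mul0r.
by rewrite ni mulr0.
Qed.

Definition leg_hyp : {poly R} := \poly_(i < n.+1) leg_coef i.

Lemma leg_hyp_coef i : leg_hyp`_i = leg_coef i.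
Proof. by rewrite coef_poly; case: ltnP => // /leg_coef_eq0. Qed.

Lemma leg_hyp_ode : 'X * (1 - 'X) * leg_hyp^`()^`() + (1 - 'X *+ 2) * leg_hyp^`() +
  (n * n.+1)%:R * leg_hyp = 0.
Proof.
apply/polyP => i; rewrite coef0.
rewrite (_ : _ + _ = leg_hyp^`()^`() * 'X - (leg_hyp^`()^`() * 'X) * 'X + leg_hyp^`() - (leg_hyp^`() * 'X) *+ 2 + leg_hyp *+ (n * n.+1)); last first.
  by rewrite -[leg_hyp *+ _]mulr_natl; ring.
rewrite !(coefD, coefN, coefMn, coefMX, coef_deriv).
case: i => [|[|i]] /=; rewrite !leg_hyp_coef.
- have := leg_coefS 0; rewrite -[_ *+ (n * _)]mulr_natr natrM.
  move: (leg_coef 1) (leg_coef 0) => c1 c0 E.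
  by transitivity (c1 * 1 ^+ 2 + c0 * (n%:R * n.+1%:R)); [ring|rewrite E; ring].
- have := leg_coefS 1; rewrite -[_ *+ (n * _)]mulr_natr natrM.
  move: (leg_coef 2) (leg_coef 1) => c1 c0 E; rewrite (_ : c1 *+ 2 *+ 1 = c1 * 2 ^+ 2 - c1 *+ 2); last by ring.
  by rewrite E; ring.
- have := leg_coefS i.+2; rewrite -[_ *+ (n * _)]mulr_natr natrM.
  move: (leg_coef i.+3) (leg_coef i.+2) => c1 c0 E.
  rewrite (_ : c1 *+ i.+3 *+ i.+2 = c1 * i.+3%:R ^+ 2 - c1 *+ i.+3); first by rewrite E; ring.
  by ring.
Qed.

Definition leg_poly : {poly R} := leg_hyp \Po (2^-1%:P * (1 - 'X)).

Lemma leg_poly_horner z : leg_poly.[z] = leg_hyp.[(1 - z) / 2].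
Proof. by rewrite horner_comp !hornerE mulrC. Qed.

Lemma leg_poly_at1 : leg_poly.[1] = 1.
Proof. by rewrite leg_poly_horner subrr mul0r horner_coef0 leg_hyp_coef. Qed.

Lemma leg_poly_size : (size leg_poly <= n.+1)%N.
Proof.
have sq : (size leg_hyp <= n.+1)%N by exact: size_poly.
apply: (leq_trans (size_comp_poly_leq _ _)).
set W := (_ * _)%R.
have s2 : (size W <= 2)%N.
  rewrite /W mul_polyC (leq_trans (size_scale_leq _ _))//.
  by rewrite -size_polyN opprB size_XsubC.
rewrite ltnS -[leqRHS]muln1; apply: leq_mul.
  by move: sq; case: (size _).
by move: s2; case: (size _).
Qed.

Lemma leg_poly_ode : (1 - 'X ^+ 2) * leg_poly^`()^`() - 'X *+ 2 * leg_poly^`() +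
  (n * n.+1)%:R * leg_poly = 0.
Proof.
(* Polynomials form no field, so the constant 1 / 2 is named and used only through [c *+ 2 = 1]. *)
pose c : {poly R} := 2^-1%:P; pose W := c * (1 - 'X).
have c2 : c *+ 2 = 1.
  rewrite /c -polyCMn (_ : 2^-1 *+ 2 = 1 :> R)//.
  by rewrite -[_ *+ 2]mulr_natr mulVf// pnatr_eq0.
have dW : W^`() = - c.
  by rewrite /W derivM derivC mul0r add0r derivB derivX -[1]/(1%:P) derivC sub0r mulrN mulr1.
have := congr1 (comp_poly W) leg_hyp_ode.
rewrite !(rmorphD, rmorphM, rmorphB, rmorphN, rmorph1, rmorphMn, rmorph_nat, rmorph0) /= comp_polyX.
have d1 : leg_poly^`() = (leg_hyp^`() \Po W) * - c by rewrite /leg_poly deriv_comp dW.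
have d2 : leg_poly^`()^`() = (leg_hyp^`()^`() \Po W) * - c * - c.
  by rewrite d1 derivM deriv_comp dW derivN derivC oppr0 mulr0 addr0.
rewrite d2 d1 /leg_poly -/c -/W.
move: (leg_hyp^`()^`() \Po W) (leg_hyp^`() \Po W) (leg_hyp \Po W) => q2 q1 q0; rewrite /W => E.
transitivity (c * (1 - 'X) * (1 - c * (1 - 'X)) * q2 + (1 - (c * (1 - 'X)) *+ 2) * q1 + n%:R * n.+1%:R * q0
   + (c *+ 2 - 1) * (q2 * c * (1 - 'X) + q1)); first by ring.
by rewrite E c2 subrr mul0r addr0.
Qed.

(** The expansion of the Legendre equation at 0, unlike that at 1, links coefficients two apart;
    this is where parity comes from. *)
Lemma leg_poly_coef i : leg_poly`_i.+2 * (i.+2%:R * i.+1%:R) =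
  (i%:R * i.+1%:R - n%:R * n.+1%:R) * leg_poly`_i.
Proof.
have := congr1 (fun p : {poly R} => p`_i) leg_poly_ode; rewrite coef0.
rewrite (_ : _ + _ = leg_poly^`()^`() - (leg_poly^`()^`() * 'X) * 'X - (leg_poly^`() * 'X) *+ 2 + leg_poly *+ (n * n.+1)); last first.
  by rewrite -[leg_poly *+ _]mulr_natl; ring.
rewrite !(coefD, coefN, coefMn, coefMX, coef_deriv).
case: i => [|[|i]] /=; rewrite -[_ *+ (n * _)]mulr_natr natrM.
- move: (leg_poly`_2) (leg_poly`_0) => c2 c0 E.
  apply/eqP; rewrite -subr_eq0 -[X in _ == X]E; apply/eqP; ring.
- move: (leg_poly`_3) (leg_poly`_1) => c2 c0 E.
  apply/eqP; rewrite -subr_eq0 -[X in _ == X]E; apply/eqP; ring.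
- move: (leg_poly`_i.+4) (leg_poly`_i.+2) => c2 c0 E.
  apply/eqP; rewrite -subr_eq0 -[X in _ == X]E; apply/eqP; ring.
Qed.

Lemma leg_eigen_neq i : (i < n)%N -> i%:R * i.+1%:R - n%:R * n.+1%:R != 0 :> R.
Proof.
move=> ni; rewrite -!natrM subr_eq0 eqr_nat neq_ltn; apply/orP; left.
by rewrite ltn_mul.
Qed.

(** Induction downwards from the coefficient of degree n + 1, which is 0: for i < n the factor on
    the right of [leg_poly_coef] does not vanish. *)
Lemma leg_poly_parity d i : (i + d.*2.+1 = n)%N -> leg_poly`_i = 0.
Proof.
elim: d i => [|d IH] i E; have ni : (i < n)%N by rewrite -E addnS ltnS leq_addr.
  have := leg_poly_coef i; rewrite [leg_poly`_i.+2]nth_default; last first.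
    by apply: (leq_trans leg_poly_size); rewrite -E double0 addn1.
  by rewrite mul0r => /esym/eqP; rewrite mulf_eq0 (negbTE (leg_eigen_neq ni))/= => /eqP.
have := leg_poly_coef i; rewrite IH; last by rewrite -E doubleS !addSn !addnS.
by rewrite mul0r => /esym/eqP; rewrite mulf_eq0 (negbTE (leg_eigen_neq ni))/= => /eqP.
Qed.

Lemma leg_poly_coef_neq0 i : leg_poly`_i != 0 -> exists d, (i + d.*2 = n)%N.
Proof.
move=> pi; have ni : (i <= n)%N.
  rewrite -ltnS; apply: leq_trans leg_poly_size; rewrite ltnNge; apply: contra pi => h.
  by rewrite nth_default.
exists (n - i)./2; have := odd_double_half (n - i).
case: (boolP (odd (n - i))) => [_|_] /= E; last by rewrite -[RHS](subnKC ni) -{2}E.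
exfalso; move/negP: pi; apply; apply/eqP; apply: (@leg_poly_parity (n - i)./2).
by rewrite -[RHS](subnKC ni) -{2}E.
Qed.

End legendre_polynomial.

Section real_polynomials.
Context {R : realType}.
Implicit Types (p : {poly R}) (z : R).

Definition cpoly p z : R[i] := (p.[z])%:C.

Lemma is_cderive_cpoly p z : is_cderive (cpoly p) z (cpoly p^`() z).
Proof. by apply: is_cderive_real; exact: is_derive_poly. Qed.

Lemma cdiff_cpoly p z : cdiff (cpoly p) z.
Proof. by eexists; exact: is_cderive_cpoly. Qed.

Lemma leg_poly_ode_horner n z : (1 - z ^+ 2)%:C * cpoly (leg_poly n)^`()^`() z -
  (2 * z)%:C * cpoly (leg_poly n)^`() z + (n * n.+1)%:R * cpoly (leg_poly n) z = 0.
Proof.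
have : ((1 - 'X ^+ 2) * (leg_poly n)^`()^`() - 'X *+ 2 * (leg_poly n)^`() +
  (n * n.+1)%:R * leg_poly n).[z] = 0 :> R by rewrite leg_poly_ode horner0.
rewrite !(hornerD, hornerN, hornerM, hornerMn, hornerXn, hornerX, hornerC) => E.
rewrite /cpoly -rc_nat -!rcM -rcB -rcD -[RHS]rc0; congr (_%:C).
by rewrite -[RHS]E; ring.
Qed.

End real_polynomials.

Section legendre_integer.
Context {R : realType}.
Variables (nu : R[i]) (n : nat).
Hypothesis nuE : nu * (nu + 1) = (n * n.+1)%:R.
Implicit Types z : R.

(** The product [(- nu + i) (nu + 1 + i)] depends on [nu] only through [nu (nu + 1)], so [nu = n]
    and [nu = - n - 1] are treated together. *)
Lemma hyp_coef_leg i : hyp_coef (- nu) (nu + 1) i = (leg_coef n i : R)%:C.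
Proof.
elim: i => [|i IH]; first by rewrite hyp_coef0.
have i1 : i.+1%:R ^+ 2 != 0 :> R[i] by rewrite expf_neq0// pnatr_eq0.
apply: (mulfI i1); rewrite hyp_coefS IH.
rewrite [RHS](_ : _ = (leg_coef n i.+1 * i.+1%:R ^+ 2)%:C); last by rewrite rcM rcX rc_nat mulrC.
rewrite leg_coefS rcM rcB !rcM !rc_nat.
rewrite (_ : (- nu + i%:R) * (nu + 1 + i%:R) = i%:R * i.+1%:R - nu * (nu + 1)); last by ring.
by rewrite nuE natrM.
Qed.

Lemma pseries_finite (c : nat -> R) (m : nat) w : (forall i, (m <= i)%N -> c i = 0) ->
  limn (pseries c w) = \sum_(i < m) c i * w ^+ i.
Proof.
move=> c0; apply: cvg_lim; first exact: Rhausdorff.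
apply: cvg_near_cst; near=> N.
have mN : (m <= N)%N by near: N; exact: nbhs_infty_ge.
rewrite /pseries /series/= (big_cat_nat (leq0n m) mN)//= big_mkord [X in _ + X]big1_seq ?addr0//.
by move=> i /andP[_]; rewrite mem_index_iota => /andP[mi _]; rewrite c0 ?mul0r.
Unshelve. all: by end_near. Qed.

Lemma legendreP_poly_lt3 z : -1 < z < 3 -> legendreP nu z = cpoly (leg_poly n) z.
Proof.
move=> z3; have w1 : `|(1 - z) / 2| < 1 by rewrite ltr_norml; lra.
rewrite /legendreP /hyp2F1 w1 hyp2F1_series_cps /cpoly leg_poly_horner /cps.
have c0 i : (n.+1 <= i)%N -> leg_coef n i = 0 :> R by exact: leg_coef_eq0.
apply: complex_ext => /=.
  rewrite (pseries_finite (m := n.+1)); last by move=> i /c0 E; rewrite hyp_coef_leg E.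
  rewrite /leg_hyp horner_poly; apply: eq_bigr => i _; by rewrite hyp_coef_leg.
rewrite (pseries_finite (m := 0)) ?big_ord0//.
by move=> i _; rewrite hyp_coef_leg.
Qed.

(** For z >= 3 the definition goes through Pfaff's series. Instead of summing it, one compares two
    solutions of the Legendre equation equal to 1 at 1. *)
Lemma legendreP_poly z : -1 < z -> legendreP nu z = cpoly (leg_poly n) z.
Proof.
move=> z1; have [z3|z3] := ltP z 3; first by apply: legendreP_poly_lt3; rewrite z1.
have [k [k2 [P1 dP dk _ ode]]] := legendreP_ode nu.
pose p := leg_poly n : {poly R}.
have := @legendre_unique R (nu * (nu + 1)) (fun z => legendreP nu z - cpoly p z)
  (fun z => k z - cpoly p^`() z) (fun z => k2 z - cpoly p^`()^`() z) (z + 1).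
move=> H; apply/eqP; rewrite -subr_eq0; apply/eqP; apply: H.
- move=> y /andP[y1 _]; have y0 : -1 < y by apply: lt_le_trans y1; rewrite -subr_gt0; lra.
  split.
  + by apply: is_cderiveB; [exact: dP|exact: is_cderive_cpoly].
  + by apply: is_cderiveB; [exact: dk|exact: is_cderive_cpoly].
  + have o1 := ode _ y0; have o2 := leg_poly_ode_horner n y; rewrite -nuE in o2.
    by rewrite -[RHS](subrr 0) -{1}o1 -[in RHS]o2; ring.
- by rewrite P1 /cpoly leg_poly_at1 subrr.
- by apply/andP; split; lra.
Qed.

End legendre_integer.

(** * The reproducing property of the polynomial kernel *)

Section kernel_identity.
Context {R : realType}.
Variable n : nat.
Local Notation p := (leg_poly n : {poly R}).
Local Notation kp := (p^`()).
Local Notation lam := ((n * n.+1)%:R : R[i]).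
Implicit Types (z r x y s t : R) (i j d m : nat).

Lemma cpoly_leg1 : cpoly p 1 = 1. Proof. by rewrite /cpoly leg_poly_at1. Qed.
Let P1 := cpoly_leg1.
Let dP z : -1 < z -> is_cderive (cpoly p) z (cpoly kp z). Proof. by move=> _; exact: is_cderive_cpoly. Qed.
Let dk z : -1 < z -> is_cderive (cpoly kp) z (cpoly kp^`() z). Proof. by move=> _; exact: is_cderive_cpoly. Qed.
Let ode z : -1 < z -> (1 - z ^+ 2)%:C * cpoly kp^`() z - (2 * z)%:C * cpoly kp z + lam * cpoly p z = 0.
Proof. by move=> _; exact: leg_poly_ode_horner. Qed.
Let mI : measurable (`]0, 1[ : set R) := measurable_itv _.

Lemma cintegral_sum (D : set R) m (F : nat -> R -> R[i]) : measurable D ->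
  (forall i, cintegrable D (F i)) ->
  cintegrable D (fun x => \sum_(i < m) F i x) /\
  cintegral D (fun x => \sum_(i < m) F i x) = \sum_(i < m) cintegral D (F i).
Proof.
move=> mD iF; elim: m => [|m [I E]].
  split; last by rewrite big_ord0 -[RHS](cintegral0 D); apply: eq_cintegral => x _; rewrite big_ord0.
  apply: (eq_cintegrable mD (f := fun=> 0)) => [x _|]; first by rewrite big_ord0.
  by split; exact: integrable0.
split.
  by apply: (eq_cintegrable mD _ (cintegrableD mD I (iF m))) => x _; rewrite big_ord_recr.
transitivity (cintegral D (fun x => \sum_(i < m) F i x + F m x)).
  by apply: eq_cintegral => x _; rewrite big_ord_recr.
by rewrite (cintegralD mD I (iF m)) E [RHS]big_ord_recr.
Qed.

Lemma lam_neq j : (j < n)%N -> lam - (j * j.+1)%:R != 0.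
Proof.
move=> jn; rewrite subr_eq0 eqr_nat neq_ltn; apply/orP; right.
by rewrite ltn_mul.
Qed.

Lemma cpoly0 (q : {poly R}) : cpoly q 0 = (q`_0)%:C.
Proof. by rewrite /cpoly horner_coef0. Qed.

(** By [moment_rec] in steps of two: the eigenvalue factor is nonzero below n, and parity kills the
    boundary terms, since [k 0 = 0] for n even (j = 0) and [P 0 = 0] for n odd (j = 1). *)
Lemma leg_moment_eq0 j d : (j + d.+1.*2 = n)%N -> moment (cpoly p) j = 0.
Proof.
have [m] := ubnP j; elim: m j d => // m IH j d jm jd.
have jn : (j < n)%N by rewrite -jd doubleS !addnS ltnS leqW// leq_addr.
have := moment_rec dP dk ode j; case: j jm jd jn => [|[|j]] jm jd jn E.
- have k0 : cpoly kp 0 = 0.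
    by rewrite cpoly0 coef_deriv (@leg_poly_parity R n d) ?mul0rn// -jd doubleS add0n add1n.
  move: E; rewrite k0 /= !(mul0n, mulr0n, mul0r, mulr0, addr0, subr0, rc0) => /eqP.
  have := lam_neq jn; rewrite mul0n mulr0n subr0 => l0.
  by rewrite mulf_eq0 (negbTE l0)/= => /eqP.
- have p0 : cpoly p 0 = 0.
    by rewrite cpoly0 (@leg_poly_parity R n d.+1) ?mul0rn// -jd add0n add1n.
  move: E; rewrite p0 /= !(muln0, mulr0n, mul0r, mulr0, addr0, subr0, rc0, expr0n) => /eqP.
  by rewrite mulf_eq0 (negbTE (lam_neq jn))/= => /eqP.
- move: E; rewrite /= (IH j d.+1); last 2 first.
  + by rewrite ltnS in jm; exact: ltnW.
  + by rewrite -jd !doubleS !addSn !addnS.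
  rewrite mulr0 addr0 !expr0n/= mulr0 rc0 !mul0r subrr => /eqP.
  by rewrite mulf_eq0 (negbTE (lam_neq jn))/= => /eqP.
Qed.

(** Integration by parts leaves [P 1 = 1] and a moment of index i - 1, which has the parity of n and
    is smaller than n. For [i = 0] what remains is [P 0], which is 0 because n is then odd. *)
Lemma leg_kernel_moment i : kp`_i != 0 ->
  cintegral `]0, 1[ (fun z => (z ^+ i)%:C * cpoly kp z) = 1.
Proof.
rewrite coef_deriv => ci; have [d E] : exists d, (i.+1 + d.*2 = n)%N.
  by apply: (@leg_poly_coef_neq0 R); apply: contra ci => /eqP ->; rewrite mul0rn.
case: i ci E => [|j] ci E.
  transitivity (cintegral `]0, 1[ (cpoly kp)).
    by apply: eq_cintegral => z _; rewrite expr0 mul1r.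
  by rewrite (kernel_mean P1 dP dk) cpoly0 (@leg_poly_parity R n d) ?subr0// -E.
rewrite (moment_deriv P1 dP dk) (@leg_moment_eq0 j d) ?mulr0 ?subr0//.
by rewrite -E doubleS !addSn !addnS.
Qed.

Lemma leg_kernel_reproducing r :
  cintegral `]0, 1[ (fun z => cpoly kp z * cpoly kp (z * r)) = cpoly kp r.
Proof.
pose F i z : R[i] := (kp`_i * r ^+ i)%:C * ((z ^+ i)%:C * cpoly kp z).
have I0 i := moment_int i (fun z _ => cdiff_cpoly kp z).
have IF i : cintegrable `]0, 1[ (F i) by exact: (cintegrableZ _ mI (I0 i)).
have [_ E] := cintegral_sum (size kp) mI IF.
transitivity (cintegral `]0, 1[ (fun z => \sum_(i < size kp) F i z)).
  apply: eq_cintegral => z _; rewrite {2}/cpoly horner_coef (rmorph_sum (real_complex R)) mulr_sumr.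
  by apply: eq_bigr => i _; rewrite /F exprMn !rcM; ring.
rewrite E /cpoly horner_coef (rmorph_sum (real_complex R)); apply: eq_bigr => i _.
rewrite /F (cintegralZ _ mI (I0 i)).
have [->|ci] := eqVneq (kp`_i) 0; first by rewrite !mul0r.
by rewrite leg_kernel_moment// mulr1.
Qed.

(** The constant coefficient is a quotient by 0, hence 0. *)
Definition poly_prim (q : {poly R}) : {poly R} := \poly_(i < (size q).+1) (q`_i.-1 / i%:R).

Lemma deriv_poly_prim q : (poly_prim q)^`() = q.
Proof.
apply/polyP => i; rewrite coef_deriv coef_poly ltnS; case: ltnP => [_|qi].
  by rewrite -[_ *+ _]mulr_natr /= divfK// pnatr_eq0.
by rewrite mul0rn nth_default.
Qed.

(** A primitive of [k z * k (z * r)]: with it the rescaled integrals of [leg_kernel_J1] and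
    [leg_kernel_J2] follow from the fundamental theorem of calculus, without a change of
    variables. *)
Definition leg_prim r : {poly R} := poly_prim (kp * (kp \Po (r *: 'X))).

Lemma cpoly_leg_prim r z : cpoly (leg_prim r)^`() z = cpoly kp z * cpoly kp (z * r).
Proof. by rewrite deriv_poly_prim /cpoly hornerM horner_comp hornerZ hornerX rcM mulrC [r * z]mulrC mulrC. Qed.

Lemma leg_prim_diff r : cpoly (leg_prim r) 1 - cpoly (leg_prim r) 0 = cpoly kp r.
Proof.
rewrite -leg_kernel_reproducing.
have [||<- _] := @cFTC_oo R (cpoly (leg_prim r)) (cpoly (leg_prim r)^`()) 0 1 ler01.
- by move=> z _; exact: is_cderive_cpoly.
- by move=> z _; exact: cdiff_cpoly.
by apply: eq_cintegral => z _; rewrite cpoly_leg_prim.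
Qed.

Lemma leg_kernel_J1 s t : 0 < s -> s <= t ->
  cintegral `]t, +oo[ (fun x => cpoly kp (t / x) * cpoly kp (s / x) * ((x^-1) ^+ 2)%:C) =
  cpoly kp (s / t) * (t^-1)%:C.
Proof.
move=> s0 st; have t0 : 0 < t by exact: lt_le_trans st.
have [E _] := kernel_tail (fun z _ => is_cderive_cpoly (leg_prim (s / t)) z)
  (fun z _ => cdiff_cpoly (leg_prim (s / t))^`() z) t0.
rewrite -(leg_prim_diff (s / t)) mulrC -E; apply: eq_cintegral => x _.
rewrite cpoly_leg_prim; congr (_ * cpoly kp _ * _).
by rewrite [RHS]mulrC mulrA divfK// gt_eqF.
Qed.

(** An identity between polynomials in the ratio, hence valid also when x > y and k is evaluated
    beyond 1; [leg_kernel_partial] relies on that case. *)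
Lemma leg_kernel_J2 x y : 0 < x -> 0 < y ->
  cintegral `]0, x[ (fun t => cpoly kp (t / x) * cpoly kp (t / y)) = x%:C * cpoly kp (x / y).
Proof.
move=> x0 y0.
have [||E _] := @cFTC_oo R (fun t => x%:C * cpoly (leg_prim (x / y)) (t / x))
  (fun t => cpoly (leg_prim (x / y))^`() (t / x)) 0 x (ltW x0).
- move=> t _; have := is_cderiveM (is_cderive_cst x%:C t) (is_cderive_div (is_cderive_cpoly (leg_prim (x / y)) (t / x))).
  move=> H; apply: is_cderive_eq H _; rewrite mul0r add0r mulrCA [x%:C * _]mulrC rcVK ?mulr1//.
  by rewrite gt_eqF.
- by move=> t _; apply: cdiff_div; exact: cdiff_cpoly.
rewrite (divff (lt0r_neq0 x0)) mul0r -mulrBr leg_prim_diff in E; rewrite -E.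
apply: eq_cintegral => t _; rewrite cpoly_leg_prim; congr (_ * cpoly kp _).
by rewrite mulrA divfK// gt_eqF.
Qed.

End kernel_identity.

(** * Description of the domains for integer nu *)

Section triangle_interval.
Context {R : realType}.
Local Notation mu := (@lebesgue_measure R).
Local Notation H := (@halfline R).
Local Notation I01 := (`]0, 1[%classic : set R).
Implicit Types (q u v f g : R -> R[i]) (c x t : R).

(** Fubini's theorem for [u] and [v] merely integrable: with [q] bounded, the integrand is dominated
    by a multiple of [|u t| * |v x|]. General elements of a domain offer no more than this, after
    multiplication by powers. *)
Lemma tri_L1 (c : R) (e : itv_bound R) q u v M : 0 <= c ->
  cmeas I01 q -> (forall y, 0 < y < 1 -> normc (q y) <= M) ->
  cintegrable [set` Interval (BRight c) e] u -> cintegrable [set` Interval (BRight c) e] v ->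
  [/\ cintegrable [set` Interval (BRight c) e] (fun x => cintegral `]c, x[ (fun t => q (t / x) * u t * v x)),
      cintegrable [set` Interval (BRight c) e]
        (fun t => cintegral [set` Interval (BRight t) e] (fun x => q (t / x) * u t * v x)) &
      cintegral [set` Interval (BRight c) e] (fun x => cintegral `]c, x[ (fun t => q (t / x) * u t * v x)) =
      cintegral [set` Interval (BRight c) e]
        (fun t => cintegral [set` Interval (BRight t) e] (fun x => q (t / x) * u t * v x))].
Proof.
set J := [set` Interval (BRight c) e] => c0 mq qM cu cv.
have mJ : measurable J by exact: measurable_itv.
have Jc x : J x -> c < x by rewrite /J/= in_itv/= => /andP[].
have Jdown t x : J x -> c < t -> t < x -> J t.
  rewrite /J /= !in_itv/= => /andP[_ xe] -> tx /=.
  by move: xe; case: (e) => [[] b|[]] //=; [exact: lt_trans|move=> yb; exact: le_trans (ltW tx) yb].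
have JH : J `<=` H by move=> x /Jc cx; rewrite halflineE (le_lt_trans c0).
pose u' := cutoff J u; pose v' := cutoff J v.
have u'E t : J t -> u' t = u t by move=> h; rewrite /u' cutoff_in//; exact: mem_set.
have u'0 t : ~ J t -> u' t = 0 by move=> h; rewrite /u' cutoff_notin//; apply/negP => /set_mem.
have v'E t : J t -> v' t = v t by move=> h; rewrite /v' cutoff_in//; exact: mem_set.
have v'0 t : ~ J t -> v' t = 0 by move=> h; rewrite /v' cutoff_notin//; apply/negP => /set_mem.
have Iu : cintegrable H u' by exact: (cintegrable_cutoff measurable_halfline mJ JH cu).
have Iv : cintegrable H v' by exact: (cintegrable_cutoff measurable_halfline mJ JH cv).
have sub x : `]c, x[ `<=` `]0, x[.
  by move=> y /in_oo[cy yx]; rewrite /= in_itv/= yx (le_lt_trans c0 cy).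
have Iux x : cintegrable `]0, x[ u'.
  by apply: (cintegrableS measurable_halfline (measurable_itv _) _ Iu); exact: sub_halfline_right.
have nu x := cintegrable_norm (measurable_itv _) (Iux x).
have nin x t : J x -> `]0, x[%classic t -> ~ `]c, x[%classic t -> ~ J t.
  by move=> Jx /in_oo[t0 tx] h /Jc ct; apply: h; rewrite /= in_itv/= ct.
have in1 x : J x -> cintegral `]0, x[ (fun t => q (t / x) * u' t * v' x) =
    cintegral `]c, x[ (fun t => q (t / x) * u t * v x).
  move=> Jx; rewrite (cintegral_supp (@sub x)); last first.
    by move=> t h1 h2; rewrite u'0 ?mulr0 ?mul0r//; exact: nin Jx h1 h2.
  by apply: eq_cintegral => t /set_mem/in_oo[ct tx]; rewrite (u'E _ (Jdown _ _ Jx ct tx)) v'E.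
have out1 x : H x -> ~ J x -> cintegral `]0, x[ (fun t => q (t / x) * u' t * v' x) = 0.
  move=> _ Jx; rewrite -(cintegral0 `]0, x[); apply: eq_cintegral => t _.
  by rewrite v'0// mulr0.
have sub2 t : [set` Interval (BRight t) e] `<=` `]t, +oo[.
  by move=> y /=; rewrite !in_itv/= andbT => /andP[].
have in2 t : J t -> cintegral `]t, +oo[ (fun x => q (t / x) * u' t * v' x) =
    cintegral [set` Interval (BRight t) e] (fun x => q (t / x) * u t * v x).
  move=> Jt; rewrite (cintegral_supp (@sub2 _)); last first.
    move=> y /in_oy ty h; rewrite v'0 ?mulr0// => Jy; apply: h; move: Jy.
    by rewrite /J /= !in_itv/= ty => /andP[_ ->].
  apply: eq_cintegral => y /set_mem hy; rewrite (u'E _ Jt) v'E//; move: hy (Jc _ Jt).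
  by rewrite /J /= !in_itv/= => /andP[ty ->] ct; rewrite (lt_trans ct ty).
have out2 t : H t -> ~ J t -> cintegral `]t, +oo[ (fun x => q (t / x) * u' t * v' x) = 0.
  move=> _ Jt; rewrite -(cintegral0 `]t, +oo[); apply: eq_cintegral => y _.
  by rewrite (u'0 _ Jt) mulr0 mul0r.
have [||||I1 I2 _ _ E] := @tri_fubini_dom R q u' v' M mq qM.
- exact: cintegrable_meas Iu.
- exact: cintegrable_meas Iv.
- by move=> x _; exact: nu.
- pose W := \int[mu]_(t in H) normc (u' t).
  have nuH := cintegrable_norm measurable_halfline Iu.
  have nvH := cintegrable_norm measurable_halfline Iv.
  have mw : measurable_fun H (fun x => \int[mu]_(t in `]0, x[) normc (u' t)).
    have [|||[h _] _] := @cmeas_tri_inner R (fun=> 1) (fun t => (normc (u' t))%:C) (fun=> 1).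
    + exact: cmeas_cst.
    + by apply: cmeas_real; apply: cmeas_normc; exact: cintegrable_meas Iu.
    + exact: cmeas_cst.
    apply: eq_measurable_fun h => x _; rewrite Re_cintegral; apply: eq_Rintegral => t _.
    by rewrite mul1r mulr1.
  apply: (le_rintegrable measurable_halfline (h := fun x => W * normc (v' x))).
  + by apply: measurable_funM => //; apply: cmeas_normc; exact: cintegrable_meas Iv.
  + exact: rintegrableZl measurable_halfline nvH.
  + move=> x Hx; rewrite normrM !ger0_norm ?normc_ge0//; last first.
      by apply: Rintegral_ge0 => t _; exact: normc_ge0.
    rewrite mulrC; apply: ler_wpM2r; first exact: normc_ge0.
    rewrite -lee_fin -(EFin_Rintegral (measurable_itv _) (nu x)) -(EFin_Rintegral measurable_halfline nuH).
    apply: ge0_subset_integral => //.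
    * exact: measurable_halfline.
    * exact: measurable_int nuH.
    * by move=> t _; rewrite lee_fin normc_ge0.
    * exact: sub_halfline_right.
split.
- by apply: (eq_cintegrable mJ _ (cintegrableS measurable_halfline mJ JH I1)) => x /set_mem/in1.
- by apply: (eq_cintegrable mJ _ (cintegrableS measurable_halfline mJ JH I2)) => x /set_mem/in2.
- move: E; rewrite (cintegral_supp JH out1) (cintegral_supp JH out2).
  rewrite (eq_cintegral (fun x h => in1 x (set_mem h))) => ->.
  by apply: eq_cintegral => t /set_mem/in2.
Qed.

Lemma loc_AC_unique f g h : loc_AC_derive f g ->
  (forall c d, 0 < c -> c < d -> cintegrable `]c, d[ h /\ f d - f c = cintegral `]c, d[ h) ->
  {ae mu, forall x, 0 < x -> g x = h x}.
Proof.
move=> [g1 _] /loc_AC_oo[h1 _]; apply: ae_mono (ae_and g1 h1) => x [hg hh] x0.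
exact: is_cderive_unique (hg x0) (hh x0).
Qed.

End triangle_interval.

(** * The domain of S_- *)

Section inclusion_Sm.
Context {R : realType}.
Local Notation mu := (@lebesgue_measure R).
Variables (nu : R[i]) (k k2 : R -> R[i]) (M : R).
Local Notation P := (legendreP nu).
Hypothesis P1 : P 1 = 1.
Hypothesis dP : forall z : R, -1 < z -> is_cderive P z (k z).
Hypothesis dk : forall z : R, -1 < z -> is_cderive k z (k2 z).
Hypothesis bk : bounded_kernel k M.
Let ck z : -1 < z -> cdiff k z := cdiffk dk (z := z).

Lemma Aop'_oo_L2 f c d : inL2 f -> 0 < c -> cintegrable `]c, d[ (Aop' k f).
Proof.
move=> f2 c0; have [cd|dc] := ltP c d; last first.
  rewrite (_ : `]c, d[%classic = set0); first by split; exact: integrable_set0.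
  by apply/seteqP; split => // x /in_oo[cx xd]; have := lt_le_trans (lt_trans cx xd) dc; rewrite ltxx.
have := inL2_cintegrable_left (Aop'_L2 bk f2) (lt_trans c0 cd).
apply: cintegrableS => //; last by apply: oo_sub; exact: ltW.
Qed.

(** The increment over [c, d] of the integral defining S_- f is computed. The integral of K' f over
    ]c, d[ becomes, after the exchange, a single integral of [f] against differences of P, which
    combine into this increment. *)
Lemma BE_Sm_Aop' f g : BE_Sm nu f g -> {ae mu, forall x, 0 < x -> g x = Aop' k f x}.
Proof.
move=> [f2 g2 If AC]; have H := loc_AC_unique (h := fun x => - Aop' k f x) AC.
have : {ae mu, forall x, 0 < x -> - g x = - Aop' k f x}; last first.
  by apply: ae_mono => x h x0; apply: oppr_inj; exact: h.
apply: H => c d c0 cd; have d0 := lt_trans c0 cd.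
have Ia := Aop'_oo_L2 d f2 c0.
have mcd : measurable (`]c, d[ : set R) by exact: measurable_itv.
have mcy : measurable (`]c, +oo[ : set R) by exact: measurable_itv.
split; first exact: cintegrableN.
rewrite (cintegralN mcd Ia).
have sub : `]c, d[ `<=` `]c, +oo[ by exact: oo_oy.
have Ifd : cintegrable `]c, d[ f.
  by apply: cintegrableS (inL2_cintegrable_left f2 d0) => //; apply: oo_sub; exact: ltW.
pose u : R -> R[i] := cutoff `]c, d[ (fun=> 1).
(* The integral of [k (y / s) / s] for y from c to min(s, d); for s < d the upper end contributes
   [P 1 = 1]. *)
pose G s := (if s < d then 1 else P (d / s)) - P (c / s).
have in1 s : c < s -> cintegral `]c, s[ (fun y => k (y / s) * u y * (f s * (s^-1)%:C)) = f s * G s.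
  move=> cs; pose m := Order.min s d; have s0 := lt_trans c0 cs.
  have cm : c <= m by rewrite le_min (ltW cs) ltW.
  have [||V1 V2] := @cFTC_oo R (fun y => P (y / s)) (fun y => k (y / s) * (s^-1)%:C) c m cm.
  + move=> y /andP[cy _]; apply: is_cderive_div; apply: dP; apply: gtN1_div => //.
    exact: lt_le_trans cy.
  + move=> y /andP[cy _]; apply: cdiffM; last exact: cdiff_cst.
    apply: cdiff_div; apply: ck; apply: gtN1_div => //; exact: lt_le_trans cy.
  transitivity (f s * cintegral `]c, m[ (fun y => k (y / s) * (s^-1)%:C)); last first.
    rewrite V1 /G /m minElt; case: ifP => // sd.
    by rewrite divff ?P1// gt_eqF.
  rewrite -(cintegralZ _ (measurable_itv _) V2).
  have subm : `]c, m[ `<=` `]c, s[.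
    by move=> y /in_oo[cy]; rewrite lt_min => /andP[ys _]; rewrite /= in_itv/= cy.
  rewrite (cintegral_supp subm) => [|y /in_oo[cy ys] h]; last first.
    rewrite /u cutoff_notin ?mulr0 ?mul0r//; apply/negP; rewrite mem_oo => /andP[_ yd].
    by apply: h; rewrite /= in_itv/= cy lt_min ys.
  apply: eq_cintegral => y /set_mem/in_oo[cy]; rewrite lt_min => /andP[_ yd].
  by rewrite /u cutoff_in ?mem_oo ?cy//; ring.
have Iu : cintegrable `]c, +oo[ u.
  apply: (cintegrable_cutoff mcy mcd sub).
  by apply: cdiff_cintegrable => t _; exact: cdiff_cst.
have Iv := inL2_cintegrable_right f2 c0.
have IK : cintegrable `]c, d[ (Kop' k f).
  have := inL2_cintegrable_left (Kop'_L2 bk f2).1 d0.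
  by apply: cintegrableS => //; apply: oo_sub; exact: ltW.
have EA : cintegral `]c, d[ (Aop' k f) = cintegral `]c, d[ f - cintegral `]c, d[ (Kop' k f).
  by rewrite -(cintegralB mcd Ifd IK).
have ER : cintegral `]c, +oo[ (fun t => cintegral `]t, +oo[ (fun x => k (t / x) * u t * (f x * (x^-1)%:C))) =
    cintegral `]c, d[ (Kop' k f).
  rewrite (cintegral_supp sub) => [|t /in_oy ct h]; last first.
    rewrite -(cintegral0 `]t, +oo[); apply: eq_cintegral => y _.
    by rewrite /u cutoff_notin ?mulr0 ?mul0r//; apply/negP => /set_mem.
  apply: eq_cintegral => t tI; apply: eq_cintegral => y _.
  by rewrite /u cutoff_in.
have [I1 I2 E] := @tri_L1 R c +oo%O k u (fun t => f t * (t^-1)%:C) M (ltW c0) bk.1 bk.2 Iu Iv.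
have Ic := If _ c0; have Id := If _ d0.
have [Ic1 Ic2 Ec] := @cintegral_split R c d +oo%O _ (ltW cd) isT Ic.
have L : cintegral `]c, +oo[ (fun s => f s * G s) =
  cintegral `]c, d[ f + cintegral `]d, +oo[ (fun t => P (d / t) * f t) - cintegral `]c, +oo[ (fun t => P (c / t) * f t).
  have IG : cintegrable `]c, +oo[ (fun s => f s * G s).
    by apply: (eq_cintegrable mcy _ I1) => s /set_mem/in_oy/in1.
  have [IG1 IG2 ->] := @cintegral_split R c d +oo%O _ (ltW cd) isT IG.
  rewrite Ec opprD addrACA; congr (_ + _).
    rewrite -(cintegralB mcd Ifd Ic1); apply: eq_cintegral => s /set_mem/in_oo[cs sd].
    by rewrite /G sd; ring.
  rewrite -(cintegralB (measurable_itv _) Id Ic2); apply: eq_cintegral => s /set_mem/in_oy sd.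
  by rewrite /G ltNge (ltW sd)/=; ring.
rewrite EA opprB -ER -E (eq_cintegral (fun s h => in1 s (in_oy (set_mem h)))) L.
by rewrite [RHS]addrAC [X in _ = X - _ - _]addrC addrK.
Qed.

End inclusion_Sm.

(** * Growth of polynomials at infinity and at 0 *)

Section polynomial_growth.
Context {R : realType}.
Implicit Types (p : {poly R}) (x y t : R) (m : nat).

(* [z^m p (1 / z)] *)
Definition rev_poly m p : {poly R} := \poly_(i < m.+1) p`_(m - i).

Lemma rev_polyE m p x t : (size p <= m.+1)%N -> x != 0 -> t != 0 ->
  p.[x / t] = (x / t) ^+ m * (rev_poly m p).[t / x].
Proof.
move=> sp x0 t0; rewrite horner_poly (horner_coef_wide _ sp) mulr_sumr.
rewrite (reindex_inj rev_ord_inj)/=; apply: eq_bigr => i _; rewrite subSS.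
rewrite mulrCA; congr (_ * _); have im : (i <= m)%N by rewrite -ltnS.
have -> : (x / t) ^+ m = (x / t) ^+ (m - i) * (x / t) ^+ i by rewrite -exprD subnK.
rewrite -mulrA -[LHS]mulr1; congr (_ * _).
by rewrite -exprMn mulrA divfK// divff// expr1n.
Qed.

Lemma poly_continuous p x : {for x, continuous (fun z => p.[z])}.
Proof. exact: derive_continuous (is_derive_poly p x). Qed.

(** The reversed polynomial takes at 0 the leading coefficient of [p] as its value, so near 0 it
    stays above half of that in absolute value; put z = 1 / y. *)
Lemma poly_growth p : p != 0 ->
  exists2 c : R, 0 < c & exists2 Y : R, 1 <= Y & forall y, Y <= y -> c * y ^+ (size p).-1 <= `|p.[y]|.
Proof.
move=> p0; pose m := (size p).-1; pose r := rev_poly m p.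
have sp : (size p <= m.+1)%N by rewrite /m; exact: leqSpred.
have r0 : r.[0] != 0 by rewrite horner_coef0 coef_poly/= subn0 -lead_coefE lead_coef_eq0.
have n0 : 0 < `|r.[0]| by rewrite normr_gt0.
have h2 : `|r.[0]| / 2 < `|r.[0]| by lra.
have : \forall z \near (0 : R), `|r.[0]| / 2 < `|r.[z]|.
  have cn : {for 0, continuous (fun z => `|r.[z]|)}.
    by apply: (continuous_comp (poly_continuous (x := 0))); exact: norm_continuous.
  exact: (cvgr_gt _ cn).
move=> /nbhs_ballP[d /= d0 hd]; exists (`|r.[0]| / 2); first by rewrite divr_gt0.
exists (1 + d^-1); first by rewrite lerDl invr_ge0 ltW.
move=> y Yy; have y0 : 0 < y by apply: lt_le_trans Yy; rewrite addr_gt0// invr_gt0.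
have := rev_polyE sp (lt0r_neq0 y0) (oner_neq0 R); rewrite divr1 => ->.
rewrite normrM normrX (ger0_norm (ltW y0)) mulrC; apply: ler_wpM2l; first by rewrite exprn_ge0 ?ltW.
apply/ltW/hd; rewrite /ball/= sub0r normrN div1r ger0_norm ?invr_ge0 ?(ltW y0)//.
rewrite -[ltRHS]invrK ltf_pV2 ?posrE ?invr_gt0//.
by apply: lt_le_trans Yy; rewrite ltrDr.
Qed.

Lemma poly_low p : p != 0 -> exists j, exists2 r : {poly R}, r.[0] != 0 &
  forall y, p.[y] = y ^+ j * r.[y].
Proof.
move=> p0; have [j [r r0 E]] := multiplicity_XsubC p 0.
exists j, r; first by move: r0; rewrite p0 /root.
by move=> y; rewrite E !hornerE subr0 mulrC.
Qed.

Lemma cdiff_exp j y : cdiff (fun t : R => (t ^+ j)%:C) y.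
Proof. by eexists; apply: is_cderive_real; exact: is_derive_exp. Qed.

End polynomial_growth.

(** * The domain of S_{0+} *)

Section inclusion_S0.
Context {R : realType}.
Local Notation mu := (@lebesgue_measure R).
Variables (nu : R[i]) (n : nat).
Local Notation p := (leg_poly n : {poly R}).
Local Notation kp := (p^`()).
Local Notation m := (size p).-1.
Hypothesis hP : forall z, -1 < z -> legendreP nu z = cpoly p z.
Local Notation kap := (rev_poly m.-1 kp).
Implicit Types (x y t : R) (f g w : R -> R[i]).

Lemma leg_poly_neq0 : p != 0.
Proof. by apply/eqP => p0; have := @leg_poly_at1 R n; rewrite p0 horner0 => /esym/eqP; rewrite oner_eq0. Qed.

(* When [m = 0], [m.-1] is also [0], but both sides vanish. *)
Lemma kapE y t : 0 < y -> 0 < t ->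
  cpoly kp (y / t) * (t^-1)%:C = cpoly kap (t / y) * ((t^-1) ^+ m)%:C * (y ^+ m.-1)%:C.
Proof.
move=> y0 t0; rewrite /cpoly -!rcM; congr (_%:C).
case mE : (size p).-1 => [|m'] /=; last first.
  have sk : (size kp <= m'.+1)%N.
    by have := lt_size_deriv leg_poly_neq0; move: mE; case: (size p) => //= s' ->.
  rewrite (rev_polyE sk (lt0r_neq0 y0) (lt0r_neq0 t0)) exprMn exprSr.
  by move: (y ^+ m') (t^-1 ^+ m') (_.[_]) => a b c; ring.
have k0 : kp = 0.
  have : (size p <= 1)%N by move: mE; case: (size p) => [|[|]].
  by move=> /size1_polyC ->; rewrite derivC.
rewrite k0 horner0 !(mul0r) (_ : rev_poly 0 0 = 0) ?horner0 ?mul0r//.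
by apply/polyP => i; rewrite coef_poly !coef0; case: ifP.
Qed.

Lemma poly_kernel_bounded (q : {poly R}) : exists M : R, bounded_kernel (cpoly q) M.
Proof.
have [M _ hM] := kernel_bounded 1 (fun z (_ : -1 < z) => cdiff_cpoly q z).
exists M; split; first by apply: kernel_meas01 => z _; exact: cdiff_cpoly.
by move=> y /andP[y0 y1]; apply: hM; rewrite !ltW.
Qed.

(** Convergence of the integral of [P (x * Y / t) * f t] is used at the dilated point [x * Y]: for t
    < x the argument exceeds [Y], where P has no zeros and is at least of order [t ^- m]. *)
Lemma S0_weight_int f x : 0 < x ->
  (forall x, 0 < x -> cintegrable `]0, x[ (fun t => legendreP nu (x / t) * f t)) -> cmeas (@halfline R) f ->
  cintegrable `]0, x[ (fun t => ((t^-1) ^+ m)%:C * f t).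
Proof.
move=> x0 IP mf; have [c c0 [Y Y1 hY]] := poly_growth leg_poly_neq0.
have Y0 : 0 < Y by exact: lt_le_trans Y1.
have xY0 : 0 < x * Y by rewrite mulr_gt0.
have mI : measurable (`]0, x[ : set R) by exact: measurable_itv.
have sub : `]0, x[ `<=` `]0, x * Y[.
  move=> t /in_oo[t0 tx]; rewrite /= in_itv/= t0/=; apply: lt_le_trans tx _.
  by rewrite ler_peMr// ltW.
have I1 := cintegrable_norm mI (cintegrableS (measurable_itv _) mI sub (IP _ xY0)).
have I2 := rintegrableZl (c * (x * Y) ^+ m)^-1 mI I1.
apply: (le_cintegrable mI _ I2) => [|t /in_oo[t0 tx]].
  apply: cmeasM.
    apply: cmeas_real; apply: measurable_funX; exact: measurable_invr_halfline.
  by apply: (cmeasS measurable_halfline _ mf); exact: sub_halfline_right.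
have z1 : -1 < x * Y / t by apply: gtN1_div.
rewrite hP// !normcM mulrA; apply: ler_wpM2r; first exact: normc_ge0.
rewrite /cpoly !normc_real [leLHS]ger0_norm ?exprn_ge0 ?invr_ge0 ?(ltW t0)//.
have Yt : Y <= x * Y / t by rewrite mulrAC ler_peMl ?(ltW Y0)// ler_pdivlMr// mul1r ltW.
rewrite mulrC ler_pdivlMr; last by rewrite mulr_gt0// exprn_gt0.
have EE (a b d : R) : b ^+ m * (d * a ^+ m) = d * (a * b) ^+ m by rewrite exprMn mulrC mulrA.
by rewrite EE; exact: hY.
Qed.

(** The integral term in the derivative of the integral of [P (y / t) * f t]; the moving endpoint
    adds [f y]. *)
Definition S0_aux f y := cintegral `]0, y[ (fun t => cpoly kp (y / t) * (t^-1)%:C * f t).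

Lemma S0_aux_int f x : 0 < x -> (forall x, 0 < x -> cintegrable `]0, x[ (fun t => ((t^-1) ^+ m)%:C * f t)) ->
  cintegrable `]0, x[ (fun t => cpoly kp (x / t) * (t^-1)%:C * f t).
Proof.
have ringE (a b c d : R[i]) : d * (a * (b * c)) = a * b * d * c by ring.
move=> x0 Iu; have [M [mk kM]] := poly_kernel_bounded kap.
have mI : measurable (`]0, x[ : set R) by exact: measurable_itv.
have hh t : `]0, x[%classic t -> normc (cpoly kap (t / x)) <= M by move=> /in_oo/andP/div_in01/kM.
have := cintegrableZ (x ^+ m.-1)%:C mI (cintegrable_bdM mI (cmeas_ratio mk x0) hh (Iu _ x0)).
apply: (eq_cintegrable mI) => t /set_mem/in_oo[t0 _].
by rewrite (kapE x0 t0); exact: ringE.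
Qed.

(** The kernel [k (y / t) / t] may be unbounded as t tends to 0. By [kapE] it is a bounded function
    of t / y times powers of t and y, which go to [f] and [w]. *)
Lemma S0_aux_fubini f w x : 0 < x -> (forall x, 0 < x -> cintegrable `]0, x[ (fun t => ((t^-1) ^+ m)%:C * f t)) ->
  cintegrable `]0, x[ (fun y => (y ^+ m.-1)%:C * w y) ->
  cintegrable `]0, x[ (fun y => w y * S0_aux f y) /\
  cintegral `]0, x[ (fun y => w y * S0_aux f y) =
  cintegral `]0, x[ (fun t => f t * cintegral `]t, x[ (fun y => w y * cpoly kp (y / t) * (t^-1)%:C)).
Proof.
move=> x0 Iu Iv; have [M [mk kM]] := poly_kernel_bounded kap.
have inn y (y0 : 0 < y) := S0_aux_int (x := y) y0 Iu.
have EL y : 0 < y -> cintegral `]0, y[ (fun t => cpoly kap (t / y) * (((t^-1) ^+ m)%:C * f t) * ((y ^+ m.-1)%:C * w y)) = w y * S0_aux f y.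
  move=> y0; rewrite /S0_aux -(cintegralZ _ (measurable_itv _) (inn _ y0)).
  have ringE (a b c d e : R[i]) : a * (b * c) * (d * e) = e * (a * b * d * c) by ring.
  by apply: eq_cintegral => t /set_mem/in_oo[t0 _]; rewrite (kapE y0 t0); exact: ringE.
have mI : measurable (`]0, x[ : set R) by exact: measurable_itv.
have ER t : `]0, x[%classic t -> cintegral `]t, x[ (fun y => cpoly kap (t / y) * (((t^-1) ^+ m)%:C * f t) * ((y ^+ m.-1)%:C * w y)) =
   f t * cintegral `]t, x[ (fun y => w y * cpoly kp (y / t) * (t^-1)%:C).
  move=> /in_oo[t0 tx]; rewrite -cintegralZ.
  - have ringE (a b c d e : R[i]) : a * (b * c) * (d * e) = c * (e * (a * b * d)) by ring.
    by apply: eq_cintegral => y /set_mem/in_oo[ty _]; rewrite -[w y * _ * _]mulrA (kapE (lt_trans t0 ty) t0); exact: ringE.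
  - exact: measurable_itv.
  have mtx : measurable (`]t, x[ : set R) by exact: measurable_itv.
  have sub : `]t, x[ `<=` `]0, x[ by apply: oo_sub; exact: ltW.
  have mt : cmeas `]t, x[ (fun y => cpoly kap (t / y)).
    by apply: cmeasS (cmeas_ratio' mk t0) => //; exact: oo_oy.
  have hh y : `]t, x[%classic y -> normc (cpoly kap (t / y)) <= M.
    by move=> /in_oo[ty _]; apply: kM; apply: div_in01; rewrite t0.
  have := cintegrableZ ((t^-1) ^+ m)%:C mtx (cintegrable_bdM mtx mt hh (cintegrableS mI mtx sub Iv)).
  apply: (eq_cintegrable mtx) => y /set_mem/in_oo[ty _].
  have ringE (a b d e : R[i]) : b * (a * (d * e)) = e * (a * b * d) by ring.
  by rewrite -[w y * _ * _]mulrA (kapE (lt_trans t0 ty) t0); exact: ringE.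
have [I1 I2 E] := @tri_L1 R 0 (BLeft x) _ _ _ M (lexx 0) mk kM (Iu _ x0) Iv.
split; first by apply: (eq_cintegrable mI _ I1) => y /set_mem/in_oo[y0 _]; exact: EL.
rewrite -(eq_cintegral (fun y h => EL y (in_oo (set_mem h)).1)) E.
by apply: eq_cintegral => t /set_mem; exact: ER.
Qed.

(** The reproducing identity over ]0, x[ minus the one over ]0, t[; the former brings in
    [k (x / t)], with an argument above 1. *)
Lemma leg_kernel_partial t x : 0 < t -> t < x ->
  cintegral `]t, x[ (fun y => cpoly kp (y / x) * (x^-1)%:C * cpoly kp (y / t) * (t^-1)%:C) =
  cpoly kp (x / t) * (t^-1)%:C - cpoly kp (t / x) * (x^-1)%:C.
Proof.
move=> t0 tx; have x0 := lt_trans t0 tx.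
have I0 : cintegrable `]0, x[ (fun y => cpoly kp (y / x) * cpoly kp (y / t)).
  apply: cdiff_cintegrable => y _; apply: cdiffM; apply: cdiff_div; exact: cdiff_cpoly.
have [I1 I2 E] := @cintegral_split R 0 t (BLeft x) _ (ltW t0) tx I0.
move: E; rewrite (leg_kernel_J2 _ x0 t0).
rewrite (_ : cintegral `]0, t[ _ = t%:C * cpoly kp (t / x)); last first.
  rewrite -(leg_kernel_J2 _ t0 x0); apply: eq_cintegral => y _; exact: mulrC.
move=> E.
transitivity (((x^-1)%:C * (t^-1)%:C) * cintegral `]t, x[ (fun y => cpoly kp (y / x) * cpoly kp (y / t))).
  rewrite -(cintegralZ _ (measurable_itv _) I2); apply: eq_cintegral => y _; ring.
have -> : cintegral `]t, x[ (fun y => cpoly kp (y / x) * cpoly kp (y / t)) =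
   x%:C * cpoly kp (x / t) - t%:C * cpoly kp (t / x) by rewrite E addrC addKr.
have hx := rcVK (lt0r_neq0 x0); have ht := rcVK (lt0r_neq0 t0).
rewrite -[cpoly kp (x / t) in RHS]mulr1 -[cpoly kp (t / x) in RHS]mulr1 -{1}hx -ht; ring.
Qed.

(** Write L for [S0_aux]. Differentiation gives g = f + L f, and [leg_kernel_partial] gives K (L f)
    = L f - K f; hence A g = f. *)
Lemma BE_S0_Aop f g : BE_S0 nu f g -> {ae mu, forall x, 0 < x -> f x = Aop (cpoly kp) g x}.
Proof.
move=> [f2 g2 IP AC]; have mf := f2.1.
have Iu x (x0 : 0 < x) := S0_weight_int x0 IP mf.
have mI x : measurable (`]0, x[ : set R) by exact: measurable_itv.
have pk z : cdiff (cpoly kp) z by exact: cdiff_cpoly.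
have [M bk] := poly_kernel_bounded kp.
have p1 : cpoly p 1 = 1 by rewrite /cpoly leg_poly_at1.
have IL x : 0 < x -> cintegrable `]0, x[ (S0_aux f) /\ cintegral `]0, x[ (S0_aux f) =
    cintegral `]0, x[ (fun t => legendreP nu (x / t) * f t) - cintegral `]0, x[ f.
  move=> x0; have If := inL2_cintegrable_left f2 x0.
  have [|I1 E] := @S0_aux_fubini f (fun=> 1) x x0 Iu.
    apply: cdiff_cintegrable => y _; apply: cdiffM; last exact: cdiff_cst.
    exact: cdiff_exp.
  split; first by apply: (eq_cintegrable (mI x) _ I1) => y _; rewrite mul1r.
  transitivity (cintegral `]0, x[ (fun y => 1 * S0_aux f y)).
    by apply: eq_cintegral => y _; rewrite mul1r.
  rewrite E -(cintegralB (mI x) (IP _ x0) If); apply: eq_cintegral => t /set_mem/in_oo[t0 tx].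
  have [K1 K2] := cintegral_kernel_inv t0 (ltW tx) (fun z _ => is_cderive_cpoly p z) (fun z _ => cdiff_cpoly kp z).
  rewrite hP; last exact: gtN1_div (lt_trans t0 tx) t0.
  rewrite [RHS](_ : _ = f t * (cpoly p (x / t) - cpoly p 1)); last by rewrite p1; ring.
  by rewrite -K1; congr (_ * _); apply: eq_cintegral => y _; rewrite mul1r.
have gE : {ae mu, forall x, 0 < x -> g x = f x + S0_aux f x}.
  apply: (loc_AC_unique AC) => c d c0 cd; have d0 := lt_trans c0 cd.
  have Ifd := inL2_cintegrable_left f2 d0; have [ILd ELd] := IL _ d0.
  have Ifc := inL2_cintegrable_left f2 c0; have [ILc ELc] := IL _ c0.
  have Is := cintegrableD (mI d) Ifd ILd.
  have [_ Ir E] := @cintegral_split R 0 c (BLeft d) _ (ltW c0) cd Is.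
  rewrite (cintegralD (mI d) Ifd ILd) (cintegralD (mI c) Ifc ILc) ELd ELc in E.
  split; first exact: Ir.
  have subrD (a b : R[i]) : a + (b - a) = b by rewrite addrC subrK.
  by rewrite !subrD in E; rewrite E addrC addKr.
apply: ae_mono (ae_and gE (ae_all (P := fun=> True) (fun=> I))) => x [gx _] x0.
rewrite /Aop (gx x0).
have -> : Kop (cpoly kp) g x = cintegral `]0, x[ (fun t => cpoly kp (t / x) * (f t + S0_aux f t) * (x^-1)%:C).
  apply: ae_eq_cintegral => //.
  - exact: cintegrable_meas (Kop_int bk g2 x0).
  - apply: cmeasM; last exact: cmeas_cst.
    apply: cmeasM; first exact: (cmeas_ratio bk.1 x0).
    exact: cintegrable_meas (cintegrableD (mI x) (inL2_cintegrable_left f2 x0) (IL _ x0).1).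
  - by apply: ae_mono gE => t ht /in_oo[t0 _]; rewrite ht.
pose w y := cpoly kp (y / x) * (x^-1)%:C.
have [|I1 E] := @S0_aux_fubini f w x x0 Iu.
  apply: cdiff_cintegrable => y _; apply: cdiffM; last first.
    by apply: cdiffM; [apply: cdiff_div; exact: cdiff_cpoly|exact: cdiff_cst].
  exact: cdiff_exp.
have IK := Kop_int bk f2 x0.
have -> : cintegral `]0, x[ (fun t => cpoly kp (t / x) * (f t + S0_aux f t) * (x^-1)%:C) =
   Kop (cpoly kp) f x + cintegral `]0, x[ (fun y => w y * S0_aux f y).
  rewrite -(cintegralD (mI x) IK I1); apply: eq_cintegral => t _; rewrite /w; ring.
have IS : cintegrable `]0, x[ (fun t => cpoly kp (x / t) * (t^-1)%:C * f t) by exact: S0_aux_int.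
have -> : cintegral `]0, x[ (fun y => w y * S0_aux f y) = S0_aux f x - Kop (cpoly kp) f x.
  rewrite E -(cintegralB (mI x) IS IK); apply: eq_cintegral => t /set_mem/in_oo[t0 tx].
  rewrite leg_kernel_partial//; ring.
by rewrite [X in _ - X]addrC subrK addrK.
Qed.

End inclusion_S0.

Section power_not_L2.
Context {R : realType}.
Local Notation mu := (@lebesgue_measure R).
Local Notation H := (@halfline R).

Lemma le_exprV (x t : R) i : 0 < x -> x <= t -> (t^-1) ^+ i <= (x^-1) ^+ i.
Proof.
move=> x0 xt; have t0 := lt_le_trans x0 xt.
by apply: lerXn2r; rewrite ?nnegrE ?invr_ge0 ?(ltW x0) ?(ltW t0)// lef_pV2 ?posrE.
Qed.

(** On ]a, 2a[ the function is at least its value at 2a in absolute value, so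
    [|c|^2 a (2 a)^(- 2 j)] stays bounded for all a > 0; this forces c = 0. *)
Lemma power_not_L2 (c : R[i]) j : inL2 (fun x => c * ((x^-1) ^+ j)%:C) -> c = 0.
Proof.
move=> [mc fin]; set f := (fun x => _) in mc fin.
have L0 := L2sq_ge0 f; pose L := fine (L2sq f).
have LE : L2sq f = L%:E by rewrite fineK// ge0_fin_numE.
have low a : 0 < a -> normc c ^+ 2 * (((2 * a)^-1) ^+ j) ^+ 2 * a <= L.
  move=> a0; set w := _ * _ ^+ 2; rewrite -lee_fin -LE.
  have mI : measurable (`]a, 2 * a[ : set R) by exact: measurable_itv.
  have sub : `]a, 2 * a[ `<=` H by move=> t /in_oo[at_ _]; rewrite halflineE (lt_trans a0).
  have mf : measurable_fun H (fun x => normc (f x) ^+ 2) by exact: measurable_normc_sqr.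
  apply: (@le_trans _ _ (\int[mu]_(x in `]a, (2 * a)%R[) (normc (f x) ^+ 2)%:E)%E); last first.
    apply: ge0_subset_integral => //; [exact: measurable_halfline|exact/measurable_EFinP|].
    by move=> t _; rewrite lee_fin sqr_ge0.
  have -> : (w * a)%:E = (\int[mu]_(x in `]a, (2 * a)%R[) w%:E)%E.
    rewrite integral_cst//= lebesgue_measure_itv/= lte_fin (_ : a < 2 * a); last by lra.
    by rewrite -EFinB -EFinM; congr (_%:E); ring.
  apply: ge0_le_Lint => //.
    by apply: (measurable_funS measurable_halfline sub mf).
  move=> t /in_oo[at_ ta]; have t0 := lt_trans a0 at_; apply/andP; split.
    by rewrite mulr_ge0// sqr_ge0.
  rewrite /f normcM normc_real exprMn; apply: ler_wpM2l; first exact: sqr_ge0.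
  have i0 : 0 <= (2 * a)^-1 by rewrite invr_ge0; lra.
  rewrite ger0_norm ?exprn_ge0 ?invr_ge0 ?(ltW t0)//.
  have := le_exprV j t0 (ltW ta); apply: lerXn2r; rewrite nnegrE; apply: exprn_ge0 => //.
  by rewrite invr_ge0 ltW.
have key b : 1 <= b -> 0 < b -> normc c ^+ 2 <= L / b.
  move=> b1 b0; rewrite ler_pdivlMr//.
  (* For j = 0 the window ]b, 2b[ moves to infinity. Otherwise it moves to 0: [a = 1 / (4 b)] makes
     [1 / (2 a)] equal to [2 b], and the bound grows at least like b. *)
  case: j f mc fin L0 L LE low => [|j] f mc fin L0 L LE low.
    by have := low _ b0; rewrite !expr0 expr1n mulr1.
  have ib : 0 < (4 * b)^-1 by rewrite invr_gt0 mulr_gt0.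
  apply: le_trans (low _ ib); rewrite -mulrA; apply: ler_wpM2l; first exact: sqr_ge0.
  have -> : (2 * (4 * b)^-1)^-1 = 2 * b by field; rewrite lt0r_neq0.
  have -> : ((2 * b) ^+ j.+1) ^+ 2 = (2 * b) ^+ 2 * ((2 * b) ^+ j) ^+ 2.
    by rewrite -!exprM -exprD mulSn.
  have h : 1 <= ((2 * b) ^+ j) ^+ 2.
    by rewrite -exprM exprn_ege1//; lra.
  have -> : (2 * b) ^+ 2 * ((2 * b) ^+ j) ^+ 2 / (4 * b) = b * ((2 * b) ^+ j) ^+ 2.
    by move: (_ ^+ j) => z; field; rewrite lt0r_neq0.
  by rewrite ler_peMr// ltW.
have := le0_of_le_div key; rewrite normcE2 => c0.
apply: complex_ext; apply/eqP; rewrite -sqrf_eq0 eq_le sqr_ge0 andbT;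
  apply: le_trans c0; [rewrite lerDl|rewrite lerDr]; exact: sqr_ge0.
Qed.

End power_not_L2.

Lemma cmeas_powV {R : realType} (c : R[i]) j : cmeas (@halfline R) (fun x : R => c * ((x^-1) ^+ j)%:C).
Proof.
apply: cmeasM; first exact: cmeas_cst.
by apply: cmeas_real; apply: measurable_funX; exact: measurable_invr_halfline.
Qed.

(** * The domain of P_- *)

Section inclusion_Pm.
Context {R : realType}.
Local Notation mu := (@lebesgue_measure R).
Variables (nu : R[i]) (n : nat).
Local Notation p := (leg_poly n : {poly R}).
Local Notation kp := (p^`()).
Local Notation m := (size p).-1.
Hypothesis hP : forall z, -1 < z -> legendreP nu z = cpoly p z.
Implicit Types (x y t : R) (f g w : R -> R[i]).

(** The counterpart of [S0_weight_int] at infinity: convergence is used at [x / Y], so that for t >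
    x the argument of P exceeds [Y]. *)
Lemma Pm_weight_int f' x : 0 < x ->
  (forall x, 0 < x -> cintegrable `]x, +oo[ (fun t => legendreP nu (t / x) * - f' t)) ->
  cintegrable `]x, +oo[ (fun t => (t ^+ m)%:C * - f' t).
Proof.
move=> x0 IP; have [c c0 [Y Y1 hY]] := poly_growth (@leg_poly_neq0 R n).
have Y0 : 0 < Y by exact: lt_le_trans Y1.
have xY0 : 0 < x / Y by rewrite divr_gt0.
have mI : measurable (`]x, +oo[ : set R) by exact: measurable_itv.
have sub : `]x, +oo[ `<=` `]x / Y, +oo[.
  by move=> t /in_oy xt; rewrite /= in_itv/= andbT; apply: le_lt_trans xt; rewrite ler_pdivrMr// ler_peMr// ltW.
have I0 := cintegrableS (measurable_itv _) mI sub (IP _ xY0).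
have I2 := rintegrableZl ((x / Y) ^+ m / c) mI (cintegrable_norm mI I0).
have Yt t : x < t -> Y <= t / (x / Y).
  move=> xt; rewrite invf_div mulrA ler_pdivlMr// mulrC ler_pM2r//; exact: ltW.
have low t : x < t -> c * (t / (x / Y)) ^+ m <= `|p.[t / (x / Y)]| by move=> xt; apply: hY; exact: Yt.
have pos t : x < t -> 0 < c * (t / (x / Y)) ^+ m.
  by move=> xt; rewrite mulr_gt0// exprn_gt0// (lt_le_trans Y0)// Yt.
have z1 t : x < t -> -1 < t / (x / Y) by move=> xt; apply: gtN1_div => //; exact: lt_trans xt.
(* The measurability of [f'] is recovered from that of the product by division, P having no zeros on
   this range. *)
have mf : cmeas `]x, +oo[ (fun t => - f' t).
  have mp : cmeas `]x, +oo[ (fun t => ((p.[t / (x / Y)])^-1)%:C).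
    apply: cmeas_real; apply: (measurableT_comp measurable_inv).
    apply: continuous_open_meas; first exact: interval_open.
    move=> t _; apply: derive_continuous.
  apply: eq_cmeas (cmeasM mp (cintegrable_meas I0)) => t /set_mem/in_oy xt.
  rewrite hP ?z1// mulrA /cpoly rcVK ?mul1r//.
  by rewrite -normr_gt0; apply: lt_le_trans (low _ xt); exact: pos.
apply: (le_cintegrable mI _ I2) => [|t /in_oy xt].
  apply: cmeasM => //; apply: cmeas_real.
  by apply: measurable_funTS; apply: exprn_measurable.
have t0 := lt_trans x0 xt; rewrite hP ?z1// !normcM mulrA; apply: ler_wpM2r; first exact: normc_ge0.
rewrite /cpoly !normc_real [leLHS]ger0_norm ?exprn_ge0 ?(ltW t0)//.
rewrite -[leRHS]mulrA mulrC -ler_pdivrMr ?exprn_gt0// mulrC ler_pdivlMl//.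
by have := low _ xt; rewrite exprMn -exprVn [_ * t ^+ _]mulrC.
Qed.

Lemma Pm_kernel_int M x : bounded_kernel (cpoly kp) M -> 0 < x ->
  cintegrable `]x, +oo[ (fun t => cpoly kp (x / t) * ((t^-1)%:C * ((t^-1) ^+ m)%:C)).
Proof.
move=> [mk kM] x0; have mI : measurable (`]x, +oo[ : set R) by exact: measurable_itv.
(* For m = 0 the powers decay only like 1 / t, which is not integrable, but then P is constant and k
   = 0. *)
have [k0|m0] := eqVneq m 0%N.
  have k0' : kp = 0.
    have : (size p <= 1)%N by move: k0; case: (size p) => [|[|]].
    by move=> /size1_polyC ->; rewrite derivC.
  apply: (eq_cintegrable mI (f := fun=> 0)); last by split; exact: integrable0.
  by move=> t _; rewrite k0' /cpoly horner0 mul0r.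
have [m' mE] : exists m', (size p).-1 = m'.+1 by exists m.-1; case: m m0.
apply: (le_cintegrable mI _ (rintegrableZl (M * (x^-1) ^+ m') mI (invsq_integrable x0))).
  apply: cmeasM; first exact: cmeas_ratio' mk x0.
  apply: cmeasM; apply: cmeas_real; first exact: measurable_invr_halfline.
  by apply: measurable_funX; exact: measurable_invr_halfline.
move=> t /in_oy xt; have t0 := lt_trans x0 xt.
have it0 : 0 <= t^-1 by rewrite invr_ge0 ltW.
rewrite mE normcM normcM [normc (t^-1)%:C]normc_real [normc (_ ^+ _)%:C]normc_real.
rewrite (ger0_norm it0) (ger0_norm (exprn_ge0 _ it0)) -[leRHS]mulrA.
have M0 := le_trans (normc_ge0 _) (kM _ (div_in01 (t := x) (x := t) (introT andP (conj x0 xt)))).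
apply: ler_pM; rewrite ?normc_ge0 ?mulr_ge0 ?exprn_ge0//.
  by apply: kM; apply: div_in01; rewrite x0.
rewrite exprS mulrA -expr2 mulrC; apply: ler_wpM2r; first exact: exprn_ge0.
by apply: le_exprV => //; exact: ltW.
Qed.

(** By exchange and [legendre_resolvent], K' g is the integral of [(P (s / x) - 1) * - f' s], so A'
    g is minus the integral of [f'] over ]x, oo[. Hence f - A' g is the limit [l] of f at infinity,
    a constant in L_2, which is 0. *)
Lemma BE_Pm_Aop' f g : BE_Pm nu f g -> {ae mu, forall x, 0 < x -> f x = Aop' (cpoly kp) g x}.
Proof.
move=> [f2 g2 [f' AC [IP gG]]]; have [M bk] := poly_kernel_bounded kp.
have [Mq [mq qM]] := poly_kernel_bounded (rev_poly m p).
pose G x := cintegral `]x, +oo[ (fun t => legendreP nu (t / x) * - f' t).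
have mI x : measurable (`]x, +oo[ : set R) by exact: measurable_itv.
have Iv x (x0 : 0 < x) := Pm_weight_int x0 IP.
have Iu x (x0 : 0 < x) := Pm_kernel_int bk x0.
have If x : 0 < x -> cintegrable `]x, +oo[ f'.
  move=> x0; have mf : cmeas `]x, +oo[ (fun t => ((t^-1) ^+ m)%:C).
    by apply: cmeas_real; apply: measurable_funX; exact: measurable_invr_halfline.
  have bd t : `]x, +oo[%classic t -> normc ((t^-1) ^+ m)%:C <= (x^-1) ^+ m.
    move=> /in_oy xt; have t0 := lt_trans x0 xt.
    rewrite normc_real ger0_norm ?exprn_ge0 ?invr_ge0 ?(ltW t0)//; apply: le_exprV => //; exact: ltW.
  have := cintegrableN (mI x) (cintegrable_bdM (mI x) mf bd (Iv _ x0)).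
  apply: (eq_cintegrable (mI x)) => t /set_mem/in_oy xt.
  rewrite mulrA -rcM -exprMn mulVf ?expr1n ?mul1r ?opprK//.
  by rewrite gt_eqF// (lt_trans x0).
(* As s grows [P (s / t)] may be unbounded; it is split into a bounded function of t / s and powers
   carried by the two other factors. *)
have Pq s t : 0 < t -> 0 < s -> cpoly (rev_poly m p) (t / s) * ((t^-1) ^+ m)%:C * (s ^+ m)%:C = legendreP nu (s / t).
  move=> t0 s0; rewrite hP; last exact: gtN1_div.
  rewrite /cpoly -!rcM; congr (_%:C).
  have sp : (size p <= m.+1)%N by exact: leqSpred.
  by rewrite (rev_polyE sp (lt0r_neq0 s0) (lt0r_neq0 t0)) exprMn -mulrA mulrC [t^-1 ^+ _ * _]mulrC.
have gG' : {ae mu, forall t, 0 < t -> forall z, z * 1 * (g t * (t^-1)%:C) = z * (t^-1)%:C * G t}.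
  by apply: ae_mono gG => t gt t0 z; rewrite gt// mulr1 mulrAC mulrA.
have KG x : 0 < x -> Kop' (cpoly kp) g x = G x + cintegral `]x, +oo[ f'.
  move=> x0.
  have in1 s : x < s -> cintegral `]x, s[ (fun t => cpoly (rev_poly m p) (t / s) *
      (cpoly kp (x / t) * ((t^-1)%:C * ((t^-1) ^+ m)%:C)) * ((s ^+ m)%:C * - f' s)) =
      (legendreP nu (s / x) - 1) * - f' s.
    move=> xs; have s0 := lt_trans x0 xs.
    have := legendre_resolvent (@cpoly_leg1 R n) (fun z _ => is_cderive_cpoly p z)
      (fun z _ => is_cderive_cpoly kp z) (fun z _ => cdiff_cpoly kp^`() z)
      (fun z _ => leg_poly_ode_horner n z) x0 xs.
    rewrite hP; last exact: gtN1_div.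
    move=> <-; rewrite [RHS]mulrC -cintegralZ; last 2 first.
    - exact: measurable_itv.
    - apply: cdiff_cintegrable => t /andP[xt _]; have t0 := lt_le_trans x0 xt.
      have tn := lt0r_neq0 t0.
      by apply: cdiffM; [|apply: cdiffM; [|exact: cdiff_inv]]; apply: cdiff_divV => //; exact: cdiff_cpoly.
    apply: eq_cintegral => t /set_mem/in_oo[xt _]; have t0 := lt_trans x0 xt.
    rewrite -hP; last exact: gtN1_div.
    rewrite -(Pq _ _ t0 s0).
    have ringE (a b c d e h : R[i]) : a * (b * (c * d)) * (e * h) = h * (b * (a * d * e * c)) by ring.
    exact: ringE.
  have in2 t : x < t -> cintegral `]t, +oo[ (fun s => cpoly (rev_poly m p) (t / s) *
      (cpoly kp (x / t) * ((t^-1)%:C * ((t^-1) ^+ m)%:C)) * ((s ^+ m)%:C * - f' s)) =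
      cpoly kp (x / t) * (t^-1)%:C * G t.
    move=> xt; have t0 := lt_trans x0 xt.
    rewrite /G -(cintegralZ _ (mI t) (IP _ t0)); apply: eq_cintegral => s /set_mem/in_oy ts.
    rewrite -(Pq _ _ t0 (lt_trans t0 ts)).
    have ringE (a b c d e h : R[i]) : a * (b * (c * d)) * (e * h) = b * c * (a * d * e * h) by ring.
    exact: ringE.
  have [I1 I2 E] := @tri_L1 R x +oo%O _ _ _ Mq (ltW x0) mq qM (Iu _ x0) (Iv _ x0).
  have I2' : cintegrable `]x, +oo[ (fun t => cpoly kp (x / t) * (t^-1)%:C * G t).
    by apply: (eq_cintegrable (mI x) _ I2) => t /set_mem/in_oy; exact: in2.
  have -> : Kop' (cpoly kp) g x = cintegral `]x, +oo[ (fun t => cpoly kp (x / t) * (t^-1)%:C * G t).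
    apply: (ae_eq_cintegral (mI x)).
    - exact: cintegrable_meas (Kop'_int bk g2 x0).
    - exact: cintegrable_meas I2'.
    - apply: ae_mono gG' => t gt /in_oy xt; exact: (gt (lt_trans x0 xt)).
  rewrite -(eq_cintegral (fun t h => in2 t (in_oy (set_mem h)))) -E.
  rewrite (eq_cintegral (fun t h => in1 t (in_oy (set_mem h)))) /G.
  rewrite -(cintegralD (mI x) (IP _ x0) (If _ x0)); apply: eq_cintegral => s _.
  by rewrite mulrBl mul1r opprK.
pose l := f 1 + cintegral `]1, +oo[ f'.
have le_const c d : 0 < c -> c < d -> f c + cintegral `]c, +oo[ f' = f d + cintegral `]d, +oo[ f'.
  move=> c0 cd; have [_ _ ->] := @cintegral_split R c d +oo%O _ (ltW cd) isT (If _ c0).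
  have [Ic Ecd] := AC.2 _ _ c0 cd.
  rewrite (cintegral_oo_cc (cintegrable_cc_oo Ic)).1 -Ecd.
  by rewrite addrA [f c + _]addrC subrK.
have lE x : 0 < x -> f x + cintegral `]x, +oo[ f' = l.
  move=> x0; have [x1|x1|->//] := ltgtP x 1; first exact: le_const.
  by apply/esym; exact: le_const.
have AE : {ae mu, forall x, 0 < x -> f x - Aop' (cpoly kp) g x = l * ((x^-1) ^+ 0)%:C}.
  apply: ae_mono gG => x gx x0; rewrite /Aop' KG// (gx x0) -(lE _ x0) mulr1.
  by rewrite -/(G x) [X in _ - X](_ : _ = - cintegral `]x, +oo[ f') ?opprK// opprD addrA subrr add0r.
have L2l : inL2 (fun x => l * ((x^-1) ^+ 0)%:C).
  have h2 := inL2B f2 (Aop'_L2 bk g2).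
  have ml : cmeas (@halfline R) (fun x : R => l * ((x^-1) ^+ 0)%:C) by exact: cmeas_powV.
  by split; [exact: ml|rewrite -(ae_eq_L2sq h2.1 ml AE); exact: h2.2].
have l0 := power_not_L2 L2l.
by apply: ae_mono AE => x h x0; apply/eqP; rewrite -subr_eq0 (h x0) l0 mul0r.
Qed.

End inclusion_Pm.

(** * The domain of P_{0+} *)

Section inclusion_P0.
Context {R : realType}.
Local Notation mu := (@lebesgue_measure R).
Variables (nu : R[i]) (n : nat).
Local Notation p := (leg_poly n : {poly R}).
Local Notation kp := (p^`()).
Hypothesis hP : forall z, -1 < z -> legendreP nu z = cpoly p z.
Implicit Types (x y t e : R) (f g h : R -> R[i]).

Lemma cintegral_head h x : 0 < x -> cintegrable `]0, x[ h ->
  (fun e => Re (cintegral `]0, e[ h)) @ 0^'+ --> (0 : R) /\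
  (fun e => Im (cintegral `]0, e[ h)) @ 0^'+ --> (0 : R).
Proof.
move=> x0 ih; have [_ [iR iI]] := cintegral_oo_cc ih.
have small e : 0 < e -> e < x -> cintegral `]0, e[ h = cintegral `[0, e] h.
  move=> e0 ex; apply: (cintegral_oo_cc _).1.
  apply: (cintegrableS (measurable_itv _) (measurable_itv _) _ ih).
  by move=> t /in_oo[t0 te]; rewrite /= in_itv/= t0 (lt_trans te).
have nx : \forall e \near 0^'+, 0 < e < x.
  by near=> e; apply/andP; split; near: e; [exact: nbhs_right_gt|exact: nbhs_right_lt].
split.
- have := parameterized_integral_cvg_left x0 iR => /cvg_at_right_filter; apply: cvg_trans.
  apply: near_eq_cvg; near=> e; have /andP[e0 ex] : 0 < e < x by near: e.
  by rewrite (small _ e0 ex) Re_cintegral.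
- have := parameterized_integral_cvg_left x0 iI => /cvg_at_right_filter; apply: cvg_trans.
  apply: near_eq_cvg; near=> e; have /andP[e0 ex] : 0 < e < x by near: e.
  by rewrite (small _ e0 ex) Im_cintegral.
Unshelve. all: by end_near. Qed.

Lemma poly_ratio_limit (r : {poly R}) (A B cx cy x y : R) (a b : R -> R) : r.[0] != 0 ->
  a @ 0^'+ --> (0 : R) -> b @ 0^'+ --> (0 : R) ->
  (\forall e \near 0^'+, A * r.[e / y] * (cx + a e) = B * r.[e / x] * (cy + b e)) ->
  A * cx = B * cy.
Proof.
move=> r0 ha hb hE.
have lim (z w q : R) (c : R -> R) : c @ 0^'+ --> (0 : R) ->
    (fun e => q * r.[e / z] * (w + c e)) @ 0^'+ --> q * r.[0] * w.
  move=> hc; rewrite -[w in X in _ --> X]addr0; apply: cvgM; last exact: cvgD (cvg_cst _) hc.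
  apply: cvgM; first exact: cvg_cst.
  apply: cvg_at_right_filter; rewrite -{2}(mul0r z^-1).
  rewrite (_ : (fun e => r.[e / z]) = (fun e => (r \Po (z^-1 *: 'X)).[e])).
    have -> : r.[0 / z] = (r \Po (z^-1 *: 'X)).[0] by rewrite horner_comp hornerZ hornerX mulrC.
    exact: poly_continuous.
  by apply/funext => e; rewrite horner_comp hornerZ hornerX mulrC.
have L1 := lim y cx A a ha; have L2 := lim x cy B b hb.
have : A * r.[0] * cx = B * r.[0] * cy.
  apply: (cvg_unique (@Rhausdorff R) L1).
  apply: cvg_trans L2; apply: near_eq_cvg; near=> e; apply/esym; near: e; exact: hE.
by rewrite -!mulrA ![r.[0] * _]mulrC !mulrA => /(mulIf r0).
Unshelve. all: by end_near. Qed.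

(** Integration by parts for an absolutely continuous [f], as an exchange of integrals. It starts at
    e > 0, because near 0 neither [f] nor [f'] is controlled separately. *)
Lemma P0_parts f f' e x : loc_AC_derive f f' -> 0 < e -> e < x ->
  cintegral `]e, x[ (fun t => cpoly p (t / x) * f' t) =
  f x - cpoly p (e / x) * f e - cintegral `]e, x[ (fun t => cpoly kp (t / x) * f t * (x^-1)%:C).
Proof.
move=> AC e0 ex; have x0 := lt_trans e0 ex.
have mI a b : measurable (`]a, b[ : set R) by exact: measurable_itv.
have If' c d : 0 < c -> c < d -> cintegrable `]c, d[ f' /\ f d - f c = cintegral `]c, d[ f'.
  move=> c0 cd; have [Ic E] := AC.2 _ _ c0 cd; have Io := cintegrable_cc_oo Ic.
  by split; rewrite // (cintegral_oo_cc Io).1.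
have [Iu Eu] := If' _ _ e0 ex.
have pk z : cdiff (cpoly kp) z by exact: cdiff_cpoly.
pose v s := cpoly kp (s / x) * (x^-1)%:C.
have dv s : cdiff v s by apply: cdiffM; [apply: cdiff_div|exact: cdiff_cst].
have Iv c d : cintegrable `]c, d[ v by apply: cdiff_cintegrable => s _; exact: dv.
have vint c d : c <= d -> cintegral `]c, d[ v = cpoly p (d / x) - cpoly p (c / x).
  move=> cd; have [||-> _] := @cFTC_oo R (fun y => cpoly p (y / x)) v c d cd; last exact: erefl.
    by move=> s _; apply: is_cderive_div; exact: is_cderive_cpoly.
  by move=> s _; exact: dv.
have m1 : cmeas (`]0, 1[ : set R) (fun=> 1 : R[i]) by exact: cmeas_cst.
have n1 y : 0 < y < 1 -> normc ((fun=> 1 : R[i]) y) <= 1 by rewrite normc_real normr1.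
have in1 s : e < s -> s < x -> cintegral `]e, s[ (fun t => 1 * f' t * v s) = v s * f s - f e * v s.
  move=> es sx; have [Ies <-] : cintegrable `]e, s[ f' /\ v s * (f s - f e) = v s * f s - f e * v s.
    by split; [exact: (If' _ _ e0 es).1|rewrite mulrBr [f e * _]mulrC].
  rewrite (If' _ _ e0 es).2 -(cintegralZ _ (mI e s) Ies); apply: eq_cintegral => t _.
  by rewrite mul1r mulrC.
have in2 t : e < t -> t < x -> cintegral `]t, x[ (fun s => 1 * f' t * v s) = f' t - cpoly p (t / x) * f' t.
  move=> et tx; rewrite (cintegralZ _ (mI t x) (Iv t x)) vint ?ltW// divff ?gt_eqF// cpoly_leg1.
  by rewrite mul1r mulrBr mulr1 [f' t * _]mulrC.
have IP : cintegrable `]e, x[ (fun t => cpoly p (t / x) * f' t).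
  have [N _ hN] := kernel_bounded 1 (fun z (_ : -1 < z) => cdiff_cpoly p z).
  apply: (cintegrable_bdM (M := N) (mI e x) _ _ Iu).
    exact: (kernel_meas_div x x0 (ltW e0) (fun z _ => cdiff_cpoly p z)).1.
  move=> t /in_oo[et tx]; have t0 := lt_trans e0 et; apply: hN.
  by have /div_in01/andP[/ltW -> /ltW ->] : 0 < t < x by rewrite t0.
have ev : cintegral `]e, x[ v = 1 - cpoly p (e / x).
  by rewrite vint ?ltW// divff ?gt_eqF// cpoly_leg1.
have Ife : cintegrable `]e, x[ (fun s => f e * v s) by exact: (cintegrableZ _ (mI e x) (Iv e x)).
have [I1 I2 E] := @tri_L1 R e (BLeft x) _ _ _ 1 (ltW e0) m1 n1 Iu (Iv e x).
have I1' : cintegrable `]e, x[ (fun s => v s * f s - f e * v s).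
  by apply: (eq_cintegrable (mI e x) _ I1) => s /set_mem/in_oo[es sx]; exact: in1.
have Ivf : cintegrable `]e, x[ (fun s => v s * f s).
  apply: (eq_cintegrable (mI e x) _ (cintegrableD (mI e x) I1' Ife)) => s _.
  by rewrite subrK.
have EL : cintegral `]e, x[ (fun s => v s * f s) - f e * (1 - cpoly p (e / x)) =
    f x - f e - cintegral `]e, x[ (fun t => cpoly p (t / x) * f' t).
  rewrite -ev -(cintegralZ _ (mI e x) (Iv e x)) -(cintegralB (mI e x) Ivf Ife) Eu -(cintegralB (mI e x) Iu IP).
  transitivity (cintegral `]e, x[ (fun s => cintegral `]e, s[ (fun t => 1 * f' t * v s))).
    by apply/esym; apply: eq_cintegral => s /set_mem/in_oo[es sx]; exact: in1.
  by rewrite E; apply: eq_cintegral => t /set_mem/in_oo[et tx]; exact: in2.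
have -> : cintegral `]e, x[ (fun t => cpoly kp (t / x) * f t * (x^-1)%:C) = cintegral `]e, x[ (fun s => v s * f s).
  by apply: eq_cintegral => s _; rewrite /v mulrAC.
clear E I1 I2; move: EL; move: (cintegral _ _) (cintegral _ _) (cpoly p (e / x)) => a b c EL.
apply/eqP; rewrite -subr_eq0; apply/eqP; transitivity (b - f e * (1 - c) - (f x - f e - a)); first by ring.
by rewrite EL subrr.
Qed.

(** The defect [C x] is the limit of the boundary term [P (e / x) * f e] as e tends to 0. Comparing
    two points x and y eliminates the unknown [f e]: if P vanishes at 0 to order j, then [C x] is a
    multiple of x^-j, and membership in L_2 makes it 0. *)
Lemma BE_P0_Aop f g : BE_P0 nu f g -> {ae mu, forall x, 0 < x -> g x = Aop (cpoly kp) f x}.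
Proof.
move=> [f2 g2 [f' AC [IP gG]]]; have [M bk] := poly_kernel_bounded kp.
have [j [r r0 pr]] := poly_low (@leg_poly_neq0 R n).
have mI a b : measurable (`]a, b[ : set R) by exact: measurable_itv.
pose h x t := cpoly kp (t / x) * f t * (x^-1)%:C + cpoly p (t / x) * f' t.
pose C x := Aop (cpoly kp) f x - cintegral `]0, x[ (fun t => cpoly p (t / x) * f' t).
have IP' x : 0 < x -> cintegrable `]0, x[ (fun t => cpoly p (t / x) * f' t).
  move=> x0; apply: (eq_cintegrable (mI 0 x) _ (IP _ x0)) => t /set_mem/in_oo[t0 _].
  by rewrite hP//; exact: gtN1_div.
have Ih x : 0 < x -> cintegrable `]0, x[ (h x).
  by move=> x0; exact: (cintegrableD (mI 0 x) (Kop_int bk f2 x0) (IP' _ x0)).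
have CE x e : 0 < e -> e < x -> C x + cintegral `]0, e[ (h x) = ((e / x) ^+ j * r.[e / x])%:C * f e.
  move=> e0 ex; have x0 := lt_trans e0 ex.
  have [J1 _ EJ] := @cintegral_split R 0 e (BLeft x) _ (ltW e0) ex (IP' _ x0).
  have [K1 _ EK] := @cintegral_split R 0 e (BLeft x) _ (ltW e0) ex (Kop_int bk f2 x0).
  rewrite /C /Aop /Kop EJ EK (P0_parts AC e0 ex) (cintegralD (mI 0 e) K1 J1).
  rewrite -pr -/(cpoly p (e / x)).
  clear EJ EK J1 K1; move: (cintegral _ _) (cintegral _ _) (cintegral _ _) => a b c.
  ring.
(* Multiply the two relations [CE] crosswise so that the common factor [e ^+ j * f e] agrees, then
   let e tend to 0. *)
have CR x y : 0 < x -> 0 < y -> ((y^-1) ^+ j)%:C * C x = ((x^-1) ^+ j)%:C * C y.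
  move=> x0 y0; have [aR aI] := cintegral_head x0 (Ih _ x0); have [bR bI] := cintegral_head y0 (Ih _ y0).
  have key e : 0 < e -> e < x -> e < y ->
      ((y^-1) ^+ j * r.[e / y])%:C * (C x + cintegral `]0, e[ (h x)) =
      ((x^-1) ^+ j * r.[e / x])%:C * (C y + cintegral `]0, e[ (h y)).
    move=> e0 ex ey; rewrite (CE x e e0 ex) (CE y e e0 ey) !mulrA -!rcM; congr (_%:C * _).
    rewrite !exprMn; move: (y^-1 ^+ j) (x^-1 ^+ j) (e ^+ j) (r.[e / y]) (r.[e / x]) => a b c d k.
    ring.
  have nE : \forall e \near 0^'+, [/\ 0 < e, e < x & e < y].
    by near=> e; split; near: e; [exact: nbhs_right_gt|exact: nbhs_right_lt|exact: nbhs_right_lt].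
  clear Ih IP' CE.
  apply: complex_ext; rewrite !(cRe_mul, cIm_mul, cRe_real, cIm_real) !mul0r ?subr0 ?addr0.
  - apply: (poly_ratio_limit (x := x) (y := y) r0 aR bR); near=> e.
    have [e0 ex ey] : [/\ 0 < e, e < x & e < y] by near: e.
    have := congr1 (@complex.Re R) (key _ e0 ex ey).
    by rewrite !(cRe_mul, cRe_real, cIm_real) !mul0r !subr0 !cRe_add.
  - apply: (poly_ratio_limit (x := x) (y := y) r0 aI bI); near=> e.
    have [e0 ex ey] : [/\ 0 < e, e < x & e < y] by near: e.
    have := congr1 (@complex.Im R) (key _ e0 ex ey).
    by rewrite !(cIm_mul, cRe_real, cIm_real) !mul0r !addr0 !cIm_add.
have C1 x : 0 < x -> C x = C 1 * ((x^-1) ^+ j)%:C.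
  by move=> x0; have := CR x 1 x0 ltr01; rewrite invr1 expr1n mul1r mulrC.
have AE : {ae mu, forall x, 0 < x -> Aop (cpoly kp) f x - g x = C 1 * ((x^-1) ^+ j)%:C}.
  apply: ae_mono gG => x gx x0; rewrite (gx x0) -C1// /C; congr (_ - _).
  apply: eq_cintegral => t /set_mem/in_oo[t0 _]; rewrite hP//; exact: gtN1_div.
have L2l : inL2 (fun x => C 1 * ((x^-1) ^+ j)%:C).
  have h2 := inL2B (Aop_L2 bk f2) g2.
  have ml := @cmeas_powV R (C 1) j.
  by split; [exact: ml|rewrite -(ae_eq_L2sq h2.1 ml AE); exact: h2.2].
have l0 := power_not_L2 L2l.
apply: ae_mono AE => x hx x0; apply/esym/eqP; rewrite -subr_eq0 (hx x0) l0; by rewrite mul0r.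
Unshelve. all: by end_near. Qed.

End inclusion_P0.

(** * Density of test functions *)

Section translation.
Context {R : realType}.
Local Notation mu := (@lebesgue_measure R).

Lemma lebesgue_measure_translation (s : R) (A : set R) : measurable A ->
  pushforward mu ((fun x => x + s) : measurableTypeR R -> measurableTypeR R) A = mu A.
Proof.
have ms : measurable_fun setT ((fun x => x + s) : measurableTypeR R -> measurableTypeR R).
  by apply: measurable_funD.
move=> mA; apply/esym/lebesgue_measure_unique => //= _ [[a b]] _ <-.
rewrite /pushforward (_ : _ @^-1` _ = `]a - s, b - s]%classic); last first.
  by apply/seteqP; split => x /=; rewrite !in_itv/= ltrBlDr lerBrDr.
rewrite !lebesgue_measure_itv/= !lte_fin ltrD2r.
by case: ifP => // _; rewrite -!EFinB; congr (_%:E); ring.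
Qed.

Lemma integral_translation (s : R) (g : R -> R) : mu.-integrable setT (fun x => (g x)%:E) ->
  mu.-integrable setT (fun x => (g (x + s))%:E) /\ \int[mu]_x g (x + s) = \int[mu]_x g x.
Proof.
move=> ig; have ms : measurable_fun setT ((fun x => x + s) : measurableTypeR R -> measurableTypeR R).
  by apply: measurable_funD.
have mg := measurable_int _ ig.
have ig' : mu.-integrable setT (fun x => (g (x + s))%:E).
  apply/integrableP; split; first exact: (measurableT_comp mg ms).
  have [_] := integrableP _ _ _ ig; congr (_ < _)%E.
  rewrite -[RHS](@ge0_integral_pushforward _ _ _ _ _ _ ms mu setT (fun y => `|(g y)%:E|)%E) //.
    by apply: eq_measure_integral => A mA _; exact/esym/lebesgue_measure_translation.
  exact: measurableT_comp.
split => //; rewrite /Rintegral; congr fine.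
rewrite -[LHS](@integral_pushforward _ _ _ _ _ _ ms mu setT (fun y => (g y)%:E)) //.
by apply: eq_measure_integral => A mA _; exact: lebesgue_measure_translation.
Qed.

End translation.

Section density.
Context {R : realType}.
Local Notation mu := (@lebesgue_measure R).
Local Notation H := (@halfline R).
Implicit Types (f h u : R -> R[i]) (a b c d s x : R).

Lemma cintegral_translation f c d s : cintegrable `]c + s, d + s[ f ->
  cintegrable `]c, d[ (fun t => f (t + s)) /\
  cintegral `]c, d[ (fun t => f (t + s)) = cintegral `]c + s, d + s[ f.
Proof.
move=> i_f; have E : cutoff `]c, d[ (fun t => f (t + s)) = fun t => cutoff `]c + s, d + s[ f (t + s).
  apply/funext => t; rewrite /cutoff !mem_oo !ltrD2r; exact: erefl.
have /(cintegrable_mkcond _ (measurable_itv _)) [iR iI] := i_f.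
have [jR ER] := integral_translation s iR; have [jI EI] := integral_translation s iI.
split.
  by apply/(cintegrable_mkcond _ (measurable_itv _)); rewrite E; split; [exact: jR|exact: jI].
rewrite cintegral_mkcond [RHS]cintegral_mkcond E.
by apply: complex_ext; rewrite ?Re_cintegral ?Im_cintegral; [exact: ER|exact: EI].
Qed.

Lemma derive_seq (G : R -> R) x l (s : nat -> R) : is_derive x 1 G l ->
  s @ \oo --> (0 : R) -> (forall n, s n != 0) ->
  (fun n => (s n)^-1 * (G (x + s n) - G x)) @ \oo --> l.
Proof.
move=> dG s0 sn; have [dv <-] := dG.
have cs : s @ \oo --> (0 : R)^'.
  move=> A /= hA; have h : \forall n \near \oo, s n != 0 -> A (s n) := s0 _ hA.
  by move: h; apply: filterS => n; apply; exact: sn.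
have := cvg_comp _ _ cs dv; apply: cvg_trans; apply: near_eq_cvg; near=> n => /=.
by rewrite scaler1 [s n + x]addrC.
Unshelve. all: by end_near. Qed.

Lemma L2_dominated (w : nat -> R -> R[i]) (G : R -> R) :
  (forall n, cmeas H (w n)) -> mu.-integrable H (fun x => (G x)%:E) ->
  (forall n x, 0 < x -> normc (w n x) ^+ 2 <= G x) ->
  {ae mu, forall x, 0 < x -> (fun n => normc (w n x) ^+ 2) @ \oo --> (0 : R)} ->
  (fun n => L2sq (w n)) @ \oo --> 0%E.
Proof.
move=> mw iG wG w0.
have [|||||_ _] := @dominated_convergence _ _ _ mu H measurable_halfline
  (fun n x => (normc (w n x) ^+ 2)%:E) (fun=> 0%E) (fun x => (G x)%:E).
- by move=> n; apply/measurable_EFinP; exact: measurable_normc_sqr.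
- exact: measurable_cst.
- apply: ae_mono w0 => x hx Hx; apply: cvg_EFin; first by near=> n.
  by apply: hx; rewrite -halflineE.
- exact: iG.
- by apply: ae_all => x n Hx; rewrite /= ger0_norm ?sqr_ge0// lee_fin wG// -halflineE.
by rewrite integral0.
Unshelve. all: by end_near. Qed.

Section steklov.
Variables (f : R -> R[i]) (a b N : R).
Hypotheses (a0 : 0 < a) (ab : a < b) (mf : cmeas setT f) (fN : forall x, normc (f x) <= N).
Hypothesis f0 : forall x, ~~ (a < x < b) -> f x = 0.

Let If c d : cintegrable `]c, d[ f.
Proof.
apply: (bounded_cintegrable (a := c) (b := d) (M := N)) => //.
- exact: oo_cc.
- exact: cmeasS mf.
Qed.

(* [steklov s x] is the mean of [f] over [x, x + s]; it is defined as a
   primitive of [steklov' s] to exhibit it as a test function. *)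
Definition steklov' s t := (s^-1)%:C * (f (t + s) - f t).
Definition steklov s x := cintegral `]0, x[ (steklov' s).

Let IT s c d : cintegrable `]c, d[ (fun t => f (t + s)) := (cintegral_translation (If (c + s) (d + s))).1.

(** Since s < a, [f] vanishes on ]0, s[, so the integrals of the translate and of [f] over ]0,
    x[ differ by the integral over ]x, x + s[. *)
Lemma steklovE s x : 0 < s -> s < a -> 0 <= x -> steklov s x = (s^-1)%:C * cintegral `]x, x + s[ f.
Proof.
move=> s0 sa x0; have mI : measurable (`]0, x[ : set R) by exact: measurable_itv.
have -> : steklov s x = (s^-1)%:C * (cintegral `]s, x + s[ f - cintegral `]0, x[ f).
  rewrite /steklov (cintegralZ _ mI (cintegrableB mI (IT s 0 x) (If 0 x))).
  by rewrite (cintegralB mI (IT s 0 x) (If 0 x)) (cintegral_translation (If _ _)).2 add0r.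
congr (_ * _); have xs : x < x + s by rewrite ltrDl.
have sxs : s <= x + s by rewrite lerDr.
have [_ _ E1] : [/\ True, True & cintegral `]0, x + s[ f = cintegral `]0, x[ f + cintegral `]x, x + s[ f].
  by have [_ _ E] := @cintegral_split R 0 x (BLeft (x + s)) f x0 xs (If _ _).
have <- : cintegral `]0, x + s[ f = cintegral `]s, x + s[ f.
  apply: cintegral_supp; first by apply: oo_sub; exact: ltW.
  move=> t /in_oo[t0 tx] h; apply: f0; apply/negP => /andP[at_ _]; apply: h.
  by rewrite /= in_itv/= tx (lt_trans sa).
by rewrite E1 addrC addKr.
Qed.

(** The forward mean moves the left end of the support to a - s, which stays above a / 2; the right
    end does not move. *)
Lemma steklov_test s : 0 < s -> s < a / 2 -> test_fun (a / 2) b (steklov' s) (steklov s).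
Proof.
move=> s0 sa; split.
- by rewrite divr_gt0.
- by apply: lt_trans ab; have := a0; lra.
- apply: cmeasM; first exact: cmeas_cst.
  apply: cmeasB mf; have ms : measurable_fun setT (fun x : R => x + s) by apply: measurable_funD.
  by split; [exact: measurableT_comp mf.1 ms|exact: measurableT_comp mf.2 ms].
- exists (s^-1 * (N + N)) => x; rewrite normcM normc_real ger0_norm ?invr_ge0 ?(ltW s0)//.
  apply: ler_wpM2l; first by rewrite invr_ge0 ltW.
  by apply: (le_trans (le_normcD _ _)); rewrite normcN; apply: lerD.
- move=> x xn; rewrite /steklov' !f0 ?subr0 ?mulr0//; apply: contra xn => /andP[h1 h2]; apply/andP; split; lra.
- rewrite -/(steklov s b) steklovE//; [|have := a0; lra|have := a0; have := ab; lra].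
  rewrite (_ : cintegral _ _ = 0) ?mulr0// -[RHS](cintegral0 `]b, b + s[).
  apply: eq_cintegral => t /set_mem/in_oo[bt _]; apply: f0; apply/negP => /andP[_].
  by rewrite ltNge (ltW bt).
- by [].
Qed.

Lemma steklov_bound s x : 0 < s -> s < a / 2 -> 0 < x -> normc (steklov s x) <= 2 * N.
Proof.
move=> s0 sa x0; rewrite steklovE//; [|have := a0; lra|exact: ltW].
rewrite normcM normc_real ger0_norm ?invr_ge0 ?(ltW s0)//.
rewrite mulrC ler_pdivrMr//.
have xs : x <= x + s by rewrite lerDl ltW.
have := normc_cintegral_oo xs (If x (x + s)) (fun t _ => fN t).
by rewrite (_ : x + s - x = s) ?mulrA//; ring.
Qed.

(** Lebesgue's differentiation theorem: the mean is a difference quotient of the primitive of [f],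
    absolutely continuous by [loc_AC_oo]. *)
Lemma steklov_cvg (s : nat -> R) : (forall n, 0 < s n) -> (forall n, s n < a / 2) -> s @ \oo --> (0 : R) ->
  {ae mu, forall x, 0 < x -> (fun n => normc (steklov (s n) x - f x) ^+ 2) @ \oo --> (0 : R)}.
Proof.
move=> s0 sa s_cvg; pose F x := cintegral `]0, x[ f.
have [dF _] : loc_AC_derive F f.
  apply: loc_AC_oo => c d c0 cd; split; first exact: If.
  have [_ _ E] := @cintegral_split R 0 c (BLeft d) f (ltW c0) cd (If _ _).
  by rewrite /F E addrC addKr.
apply: ae_mono dF => x dFx x0; have {dFx}[dR dI] := dFx x0.
have E n : steklov (s n) x = ((s n)^-1)%:C * (F (x + s n) - F x).
  have sna : s n < a by apply: lt_trans (sa n) _; have := a0; lra.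
  rewrite (steklovE (s0 n) sna (ltW x0)).
  congr (_ * _); have xs : x < x + s n by rewrite ltrDl.
  have [_ _ E] := @cintegral_split R 0 x (BLeft (x + s n)) f (ltW x0) xs (If _ _).
  by rewrite /F E [RHS]addrC addKr.
have nz n : s n != 0 by rewrite gt_eqF.
have cR := derive_seq dR s_cvg nz; have cI := derive_seq dI s_cvg nz.
have sq (p : nat -> R) (q : R) : p @ \oo --> q -> (fun n => (p n - q) ^+ 2) @ \oo --> (0 : R).
  move=> hp; rewrite (_ : 0 = (q - q) * (q - q)); last by rewrite subrr mul0r.
  by apply: cvgM; apply: cvgB => //; exact: cvg_cst.
rewrite -[0 in X in _ --> X]addr0.
rewrite (_ : (fun n => normc _ ^+ 2) = (fun n => ((s n)^-1 * (Re (F (x + s n)) - Re (F x)) - Re (f x)) ^+ 2 +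
  ((s n)^-1 * (Im (F (x + s n)) - Im (F x)) - Im (f x)) ^+ 2)); first exact: cvgD (sq _ _ cR) (sq _ _ cI).
apply/funext => n; rewrite normcE2 E /=; congr (_ ^+ 2 + _ ^+ 2).
- rewrite !cRe_add !cRe_opp cRe_mul cRe_add cRe_opp /= mul0r subr0; exact: erefl.
- rewrite !cIm_add !cIm_opp cIm_mul cIm_add cIm_opp /= mul0r addr0; exact: erefl.
Qed.

End steklov.

Lemma cvg0_le (w : nat -> \bar R) (e : R) : w @ \oo --> 0%E -> 0 < e -> exists n, (w n <= e%:E)%E.
Proof.
move=> /fine_cvgP[fin cv] e0; have lt : \forall n \near \oo, fine (w n) < e by exact: (cvgr_lt _ cv).
have : \forall n \near \oo, (w n <= e%:E)%E.
  near=> n; have fn : w n \is a fin_num by near: n.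
  by rewrite -(fineK fn) lee_fin; apply: ltW; near: n.
by move=> [n _ /(_ n (leqnn n)) hn]; exists n.
Unshelve. all: by end_near. Qed.

Lemma bounded_approx f (a b N e : R) : 0 < a -> a < b -> cmeas setT f -> (forall x, normc (f x) <= N) ->
  (forall x, ~~ (a < x < b) -> f x = 0) -> 0 < e ->
  exists u, (exists a b h, test_fun a b h u) /\ (L2sq (fun x => u x - f x)%R <= e%:E)%E.
Proof.
move=> a0 ab mf fN f0 e0.
pose s (n : nat) : R := a / 4 / n.+1%:R.
have s0 n : 0 < s n by rewrite !divr_gt0.
have sa n : s n < a / 2.
  by rewrite /s ltr_pdivrMr//; apply: (@lt_le_trans _ _ (a / 2 * 1)); [lra|rewrite ler_wpM2l ?ler1n//; lra].
have s_cvg : s @ \oo --> (0 : R).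
  rewrite -(mulr0 (a / 4)); apply: cvgM; first exact: cvg_cst.
  exact: cvg_harmonic.
have N0 : 0 <= N := le_trans (normc_ge0 _) (fN 0).
have T n := steklov_test a0 ab mf fN f0 (s0 n) (sa n).
pose J := (`]a / 2, b[%classic : set R).
have mJ : measurable J by exact: measurable_itv.
have mH := @measurable_halfline R.
have JH : J `<=` H by move=> x /in_oo[ax _]; rewrite halflineE; lra.
have : (fun n => L2sq (fun x => steklov f (s n) x - f x)) @ \oo --> 0%E.
  (* The means are bounded by [2 * N] and [f] by [N], and both vanish off [J]. *)
  apply: (L2_dominated (G := (fun=> (3 * N) ^+ 2) \_ J)).
  - move=> n; apply: cmeasB; first exact: test_f_meas (T n).
    exact: cmeasS mf.
  - have iJ : mu.-integrable J (fun=> ((3 * N) ^+ 2)%:E).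
      have := bounded_cintegrable (a := a / 2) (b := b) (f := fun=> ((3 * N) ^+ 2)%:C) (M := (3 * N) ^+ 2) mJ.
      move=> /(_ (@oo_cc _ _ _)) []; first exact: cmeas_cst.
        by move=> x _; rewrite normc_real ger0_norm ?sqr_ge0.
      by [].
    have := (rintegrable_mkcond (fun=> (3 * N) ^+ 2) mJ).1 iJ.
    by apply: rintegrableS => //; exact: measurableT.
  - move=> n x x0; rewrite patchE; case: ifPn => xJ.
      apply: lerXn2r; rewrite ?nnegrE ?normc_ge0 ?mulr_ge0//.
      apply: (le_trans (le_normcD _ _)); rewrite normcN.
      have h1 := steklov_bound a0 mf fN f0 (s0 n) (sa n) x0; have h2 := fN x; lra.
    have xn : ~~ (a / 2 < x < b) by rewrite -mem_oo.
    rewrite (test_eq0 (T n) xn) f0 ?subr0 ?normc0 ?expr0n//.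
    by apply: contra xn => /andP[h1 h2]; apply/andP; split; lra.
  - exact: (steklov_cvg a0 mf fN f0 s0 sa s_cvg).
move=> /cvg0_le/(_ e0)[n hn]; exists (steklov f (s n)); split => //.
by exists (a / 2), b, (steklov' f (s n)).
Qed.

Lemma truncation_approx f (e : R) : inL2 f -> 0 < e -> exists (g : R -> R[i]) (a b N : R),
  [/\ 0 < a, a < b, cmeas setT g, (forall x, normc (g x) <= N) &
   (forall x, ~~ (a < x < b) -> g x = 0) /\ (L2sq (fun x => g x - f x)%R <= e%:E)%E].
Proof.
move=> f2 e0; have mH := @measurable_halfline R.
(* Both the support and the values are truncated at level [n.+2]; the shift by 2 makes the interval
   from its inverse to itself nonempty already at n = 0. *)
have leN2 (n : nat) : n%:R <= n.+2%:R :> R by rewrite ler_nat leqW.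
pose f1 := cutoff H f; have mf1 : cmeas setT f1 by exact: cmeas_cutoffT f2.1.
pose E (n : nat) : set R := `](n.+2%:R)^-1, n.+2%:R[ `&` [set x | normc (f1 x) <= n.+2%:R].
have mE n : measurable (E n).
  apply: measurableI; first exact: measurable_itv.
  rewrite (_ : [set x | _] = setT `&` (fun x => normc (f1 x)) @^-1` `]-oo, n.+2%:R]).
    exact: (cmeas_normc mf1 measurableT (measurable_itv _)).
  by rewrite setTI; apply/seteqP; split => x /=; rewrite in_itv.
pose g n := cutoff (E n) f1.
have mg n : cmeas setT (g n) by apply: cmeas_cutoffT => //; exact: cmeasS mf1.
have f1E x : 0 < x -> f1 x = f x by move=> x0; rewrite /f1 cutoff_in//; apply: mem_set; rewrite halflineE.
have : (fun n => L2sq (fun x => g n x - f x)) @ \oo --> 0%E.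
  apply: (L2_dominated (G := fun x => normc (f x) ^+ 2)).
  - by move=> n; apply: cmeasB f2.1; exact: cmeasS (mg n).
  - exact: inL2_sqr_integrable.
  - move=> n x x0; rewrite /g /cutoff; case: ifP => _; last by rewrite sub0r normcN.
    by rewrite f1E// subrr normc0 expr0n sqr_ge0.
  - apply: ae_all => x x0; apply: cvg_near_cst; near=> n.
    rewrite /g cutoff_in ?f1E ?subrr ?normc0 ?expr0n//; apply: mem_set; split.
      rewrite /= in_itv/=; apply/andP; split.
        by rewrite invf_plt ?posrE//; apply: (lt_le_trans _ (leN2 n)); near: n; exact: nbhs_infty_gtr.
      by apply: (lt_le_trans _ (leN2 n)); near: n; exact: nbhs_infty_gtr.
    by rewrite /= f1E//; apply: (le_trans _ (leN2 n)); near: n; exact: nbhs_infty_ger.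
move=> /cvg0_le/(_ e0)[n hn]; exists (g n), (n.+2%:R)^-1, n.+2%:R, n.+2%:R; split => //.
- by apply: (@lt_trans _ _ 1); rewrite ?invf_lt1 ?ltr1n.
- move=> x; rewrite /g /cutoff; case: ifPn => [/set_mem[_ //]|_].
  by rewrite normc0.
- split => // x xn; rewrite /g cutoff_notin//; apply/negP => /set_mem[/= h _].
  by move: h; rewrite in_itv/=; exact/negP.
Unshelve. all: by end_near. Qed.

Lemma test_dense f : inL2 f ->
  exists u : nat -> R -> R[i], (forall n, exists a b h, test_fun a b h (u n)) /\ L2cvg u f.
Proof.
move=> f2; have ap n : exists u, (exists a b h, test_fun a b h u) /\ (L2sq (fun x => u x - f x)%R <= (n.+1%:R^-1)%:E)%E.
  (* Two errors of one quarter, each doubled by [L2sqD_le], add up to the required bound. *)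
  have e0 : 0 < n.+1%:R^-1 / 4 :> R by rewrite divr_gt0.
  have [g [a [b [N [a0 ab mg gN [g0 hg]]]]]] := truncation_approx f2 e0.
  have [u [tu hu]] := bounded_approx a0 ab mg gN g0 e0.
  exists u; split => //; have [a' [b' [h T]]] := tu.
  have mu' := test_f_meas T.
  have mg' : cmeas H g by exact: cmeasS mg.
  rewrite (@eq_L2sq _ _ (fun x => (u x - g x) + (g x - f x))); last by move=> x _; rewrite addrA subrK.
  apply: (le_trans (L2sqD_le (cmeasB mu' mg') (cmeasB mg' f2.1))).
  apply: (@le_trans _ _ (2%:E * (n.+1%:R^-1 / 4)%:E + 2%:E * (n.+1%:R^-1 / 4)%:E)%E).
    by apply: leeD; apply: lee_wpmul2l.
  by rewrite -!EFinM -EFinD lee_fin; move: (n.+1%:R^-1) => z; lra.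
have [u hu] := choice ap; exists u; split; first by move=> n; exact: (hu n).1.
apply: (squeeze_cvge (f := fun=> 0%E) (h := fun n => (n.+1%:R^-1)%:E)).
- by apply: nearW => n; rewrite L2sq_ge0 (hu n).2.
- exact: cvg_cst.
- by apply: cvg_EFin; [exact: nearW|exact: cvg_harmonic].
Qed.

End density.

(** * Closures and unitarity *)

Section closures.
Context {R : realType}.
Local Notation mu := (@lebesgue_measure R).
Implicit Types (f g u v : R -> R[i]) (T : @L2op R) (B : (R -> R[i]) -> R -> R[i]).

Lemma L2closure_sub T f g : (forall f g, T f g -> inL2 f /\ inL2 g) -> T f g -> L2closure T f g.
Proof.
move=> TL Tfg; have [f2 g2] := TL _ _ Tfg; split => //; exists (fun=> f), (fun=> g).
have c0 (h : R -> R[i]) : L2cvg (fun=> h) h.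
  rewrite /L2cvg (_ : (fun _ => _) = fun=> 0%E); first exact: cvg_cst.
  apply/funext => _; rewrite (@eq_L2sq _ _ (fun=> 0 * 0)); last by move=> x _; rewrite subrr mul0r.
  by rewrite (L2sqZ _ (cmeas_cst _ 0)) normc0 expr0n mul0e.
by split.
Qed.

(** For S_{0+} and P_- the test functions appear as values, not as arguments, so it is their
    transposed graph that is compared with A or A'. *)
Definition flip T : @L2op R := fun f g => T g f.

Lemma L2closure_flip T f g : L2closure (flip T) f g <-> L2closure T g f.
Proof.
by split => -[h1 h2 [u [v [h3 h4 h5]]]]; split => //; exists v, u; split.
Qed.

Lemma unitary_flip T : unitary_in_L2 (flip T) -> unitary_in_L2 T.
Proof.
move=> [on1 on2 iso]; split.
- by move=> f /on2[g g2 /L2closure_flip h]; exists g.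
- by move=> g /on1[f f2 /L2closure_flip h]; exists f.
- move=> f1 g1 f2 g2 /(L2closure_flip T) h1 /(L2closure_flip T) h2.
  by rewrite (iso _ _ _ _ h1 h2).
Qed.

Section bounded_operator.
Variables (B : (R -> R[i]) -> R -> R[i]) (C : R).
Hypothesis B2 : forall f, inL2 f -> inL2 (B f).
Hypothesis BC : forall f, inL2 f -> (L2sq (B f) <= C%:E * L2sq f)%E.
Hypothesis BB : forall f g x, inL2 f -> inL2 g -> 0 < x -> B (fun t => f t - g t) x = B f x - B g x.

Lemma bounded_operator_diff f g : inL2 f -> inL2 g ->
  (L2sq (fun x => B f x - B g x)%R <= C%:E * L2sq (fun x => f x - g x)%R)%E.
Proof.
move=> f2 g2; rewrite -(@eq_L2sq _ (B (fun t => f t - g t))); last by move=> x; exact: BB.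
exact: BC (inL2B f2 g2).
Qed.

(** The graph of a bounded operator is closed: [g - B f] is the difference of [v n - B f], small
    because [v n = B (u n)] almost everywhere, and [v n - g]. *)
Lemma L2closure_graph T f g : (forall f g, T f g -> [/\ inL2 f, inL2 g &
    {ae mu, forall x, 0 < x -> g x = B f x}]) ->
  L2closure T f g -> {ae mu, forall x, 0 < x -> g x = B f x}.
Proof.
move=> TB [f2 g2 [u [v [Tuv uf vg]]]]; have Bf2 := B2 f2.
have d2 := inL2B g2 Bf2.
suff : L2sq (fun x => g x - B f x) = 0%E.
  by move=> /(L2sq_eq0 d2.1); apply: ae_mono => x h x0; apply/eqP; rewrite -subr_eq0 h.
apply/eqP; rewrite eq_le L2sq_ge0 andbT.
pose w n := (2%:E * L2sq (fun x => v n x - g x)%R + 2%:E * (C%:E * L2sq (fun x => u n x - f x)%R))%E.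
have w0 : w @ \oo --> 0%E.
  rewrite (_ : 0%E = (2%:E * 0 + 2%:E * (C%:E * 0))%E); last by rewrite !mule0 adde0.
  apply: cvgeD; first by rewrite !mule0.
    exact: cvgeZl.
  by apply: cvgeZl => //; exact: cvgeZl.
have wle n : (L2sq (fun x => g x - B f x)%R <= w n)%E.
  have [u2 v2 vB] := TB _ _ (Tuv n).
  rewrite (@eq_L2sq _ _ (fun x => (v n x - B f x) - (v n x - g x))); last by move=> x _; ring.
  apply: (le_trans (L2sqB_le (inL2B v2 Bf2).1 (inL2B v2 g2).1)).
  rewrite addeC /w; apply: leeD => //; apply: lee_wpmul2l => //.
  rewrite (ae_eq_L2sq (inL2B v2 Bf2).1 (inL2B (B2 u2) Bf2).1); first exact: bounded_operator_diff.
  by apply: ae_mono vB => x h x0; rewrite h.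
by apply/lee_addgt0Pr => e e0; rewrite add0e; have [n hn] := cvg0_le w0 e0; exact: le_trans (wle n) hn.
Qed.

(** Approximate [f] by test functions [u n]; boundedness makes [B (u n)] converge to [B f]. *)
Lemma graph_L2closure T f g : (forall u a b h, test_fun a b h u -> T u (B u)) ->
  inL2 f -> inL2 g -> {ae mu, forall x, 0 < x -> g x = B f x} -> L2closure T f g.
Proof.
move=> TT f2 g2 gB; split => //; have [u [tu uf]] := test_dense f2.
have u2 n : inL2 (u n) by have [a [b [h tf]]] := tu n; exact: test_L2 tf.
exists u, (fun n => B (u n)); split => //.
  by move=> n; have [a [b [h tf]]] := tu n; exact: TT tf.
have Bf2 := B2 f2.
apply: (squeeze_cvge (f := fun=> 0%E) (h := fun n => (C%:E * L2sq (fun x => u n x - f x)%R)%E)).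
- apply: nearW => n; rewrite L2sq_ge0/=.
  rewrite (ae_eq_L2sq (inL2B (B2 (u2 n)) g2).1 (inL2B (B2 (u2 n)) Bf2).1); first exact: bounded_operator_diff.
  by apply: ae_mono gB => x h x0; rewrite h.
- exact: cvg_cst.
- by rewrite -(mule0 C%:E); exact: cvgeZl.
Qed.

Lemma unitary_graph T (B' : (R -> R[i]) -> R -> R[i]) : (forall f g, L2closure T f g <->
    [/\ inL2 f, inL2 g & {ae mu, forall x, 0 < x -> g x = B f x}]) ->
  (forall g, inL2 g -> inL2 (B' g)) -> (forall g x, inL2 g -> 0 < x -> B (B' g) x = g x) ->
  (forall f g, inL2 f -> inL2 g -> L2inner (B f) (B g) = L2inner f g) -> unitary_in_L2 T.
Proof.
move=> TE B'2 BB' iso; split.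
- move=> f f2; exists (B f); first exact: B2.
  by apply/TE; split => //; [exact: B2|exact: ae_all].
- move=> g g2; exists (B' g); first exact: B'2.
  by apply/TE; split => //; [exact: B'2|apply: ae_all => x x0; rewrite BB'].
- move=> f1 g1 f2 g2 /TE[f12 g12 E1] /TE[f22 g22 E2]; rewrite -(iso _ _ f12 f22).
  apply: (ae_eq_cintegral measurable_halfline).
  + exact: cintegrable_meas (inL2_mul_integrable g12 (inL2_conj g22)).
  + exact: cintegrable_meas (inL2_mul_integrable (B2 f12) (inL2_conj (B2 f22))).
  + apply: ae_mono (ae_and E1 E2) => x [h1 h2] Hx; rewrite halflineE in Hx.
    by rewrite (h1 Hx) (h2 Hx).
Qed.

End bounded_operator.

End closures.

(** * Unitarity for a real reproducing kernel *)

Section reproducing_kernel.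
Context {R : realType}.
Local Notation mu := (@lebesgue_measure R).
Local Notation H := (@halfline R).
Variables (k : R -> R[i]) (M : R).
Hypothesis bk : bounded_kernel k M.
Implicit Types (f g : R -> R[i]) (x : R).

Lemma Kop_ae f g x : inL2 f -> inL2 g -> {ae mu, forall t, 0 < t -> f t = g t} -> 0 < x ->
  Kop k f x = Kop k g x.
Proof.
move=> f2 g2 fg x0; apply: (ae_eq_cintegral (measurable_itv _)).
- exact: cintegrable_meas (Kop_int bk f2 x0).
- exact: cintegrable_meas (Kop_int bk g2 x0).
- by apply: ae_mono fg => t h /in_oo[t0 _]; rewrite h.
Qed.

Lemma Kop'_ae f g x : inL2 f -> inL2 g -> {ae mu, forall t, 0 < t -> f t = g t} -> 0 < x ->
  Kop' k f x = Kop' k g x.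
Proof.
move=> f2 g2 fg x0; apply: (ae_eq_cintegral (measurable_itv _)).
- exact: cintegrable_meas (Kop'_int bk f2 x0).
- exact: cintegrable_meas (Kop'_int bk g2 x0).
- by apply: ae_mono fg => t h /in_oy xt; rewrite h// (lt_trans x0).
Qed.

Lemma AopB f g x : inL2 f -> inL2 g -> 0 < x ->
  Aop k (fun t => f t - g t) x = Aop k f x - Aop k g x.
Proof. by move=> f2 g2 x0; rewrite /Aop (KopB bk)//; ring. Qed.

Lemma Aop'B f g x : inL2 f -> inL2 g -> 0 < x ->
  Aop' k (fun t => f t - g t) x = Aop' k f x - Aop' k g x.
Proof. by move=> f2 g2 x0; rewrite /Aop' (Kop'B bk)//; ring. Qed.

Definition Aop_bound : R := 2 + 2 * (16 * M ^+ 2).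

Lemma sub_bound f g : cmeas H f -> cmeas H g -> (L2sq g <= (16 * M ^+ 2)%:E * L2sq f)%E ->
  (L2sq (fun x => f x - g x)%R <= Aop_bound%:E * L2sq f)%E.
Proof.
move=> mf mg gf; apply: (le_trans (L2sqB_le mf mg)).
have c0 : 0 <= 2 * (16 * M ^+ 2) by have := sqr_ge0 M; move: (M ^+ 2) => z; lra.
have -> : (Aop_bound%:E * L2sq f = 2%:E * L2sq f + (2 * (16 * M ^+ 2))%:E * L2sq f)%E.
  by rewrite /Aop_bound EFinD ge0_muleDl// lee_fin.
apply: leeD => //.
by rewrite EFinM -muleA; apply: lee_wpmul2l.
Qed.

Lemma Aop_le f : inL2 f -> (L2sq (Aop k f) <= Aop_bound%:E * L2sq f)%E.
Proof. by move=> f2; have [K2 Kle] := Kop_L2 bk f2; apply: sub_bound => //; [exact: f2.1|exact: K2.1]. Qed.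

Lemma Aop'_le f : inL2 f -> (L2sq (Aop' k f) <= Aop_bound%:E * L2sq f)%E.
Proof. by move=> f2; have [K2 Kle] := Kop'_L2 bk f2; apply: sub_bound => //; [exact: f2.1|exact: K2.1]. Qed.

Hypothesis J1 : forall s t, 0 < s -> s <= t ->
  cintegral `]t, +oo[ (fun x => k (t / x) * k (s / x) * ((x^-1) ^+ 2)%:C) = k (s / t) * (t^-1)%:C.
Hypothesis J2 : forall x y, 0 < x -> x <= y ->
  cintegral `]0, x[ (fun t => k (t / x) * k (t / y)) = x%:C * k (x / y).
Hypothesis kR : forall x, (k x)^* = k x.

Lemma conj_Aop f x : inL2 f -> 0 < x -> (Aop k f x)^* = Aop k (fun t => (f t)^*) x.
Proof.
move=> f2 x0; rewrite /Aop ccB; congr (_ - _).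
rewrite /Kop -(cintegral_conj (measurable_itv _) (Kop_int bk f2 x0)).
by apply: eq_cintegral => t _; rewrite !ccM kR ccR.
Qed.

Lemma conj_Aop' f x : inL2 f -> 0 < x -> (Aop' k f x)^* = Aop' k (fun t => (f t)^*) x.
Proof.
move=> f2 x0; rewrite /Aop' ccB; congr (_ - _).
rewrite /Kop' -(cintegral_conj (measurable_itv _) (Kop'_int bk f2 x0)).
by apply: eq_cintegral => t _; rewrite !mulr1 !ccM kR ccR.
Qed.

Let mH := @measurable_halfline R.

(** A real kernel commutes with conjugation, so the transpose A' also acts as the adjoint of A, and
    A' A = 1 concludes. *)
Lemma Aop_isometry f g : inL2 f -> inL2 g -> L2inner (Aop k f) (Aop k g) = L2inner f g.
Proof.
move=> f2 g2; pose h t := (g t)^*; have h2 : inL2 h by exact: inL2_conj.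
have Ah := Aop_L2 bk h2; have [K2 _] := Kop_L2 bk f2; have [K2' _] := Kop'_L2 bk Ah.
transitivity (cintegral H (fun x => f x * Aop k h x - Kop k f x * Aop k h x)).
  apply: eq_cintegral => x /set_mem xH; rewrite halflineE in xH.
  by rewrite conj_Aop// -mulrBl.
rewrite (cintegralB mH (inL2_mul_integrable f2 Ah) (inL2_mul_integrable K2 Ah)).
rewrite (Kop_adj bk f2 Ah) -(cintegralB mH (inL2_mul_integrable f2 Ah) (inL2_mul_integrable f2 K2')).
apply: eq_cintegral => x /set_mem xH; rewrite halflineE in xH.
by rewrite -mulrBr -/(Aop' k (Aop k h) x) (Aop'_Aop bk J1 h2 xH).
Qed.

Lemma Aop'_isometry f g : inL2 f -> inL2 g -> L2inner (Aop' k f) (Aop' k g) = L2inner f g.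
Proof.
move=> f2 g2; pose h t := (g t)^*; have h2 : inL2 h by exact: inL2_conj.
have Ah := Aop'_L2 bk h2; have [K2 _] := Kop'_L2 bk f2; have [K2' _] := Kop_L2 bk Ah.
transitivity (cintegral H (fun x => Aop' k h x * f x - Aop' k h x * Kop' k f x)).
  apply: eq_cintegral => x /set_mem xH; rewrite halflineE in xH.
  by rewrite conj_Aop'// -mulrBr mulrC.
rewrite (cintegralB mH (inL2_mul_integrable Ah f2) (inL2_mul_integrable Ah K2)).
rewrite -(Kop_adj bk Ah f2) -(cintegralB mH (inL2_mul_integrable Ah f2) (inL2_mul_integrable K2' f2)).
apply: eq_cintegral => x /set_mem xH; rewrite halflineE in xH.
by rewrite -mulrBl -/(Aop k (Aop' k h) x) (Aop_Aop' bk J2 h2 xH) mulrC.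
Qed.

Lemma Aop_swap f g : inL2 f -> inL2 g ->
  {ae mu, forall x, 0 < x -> f x = Aop k g x} <-> {ae mu, forall x, 0 < x -> g x = Aop' k f x}.
Proof.
move=> f2 g2; split => E.
- have E' : {ae mu, forall x, 0 < x -> Aop k g x = f x} by apply: ae_mono E => x h x0; rewrite h.
  apply: ae_mono E => x h x0; rewrite -(Aop'_Aop bk J1 g2 x0) /Aop' -h//; congr (_ - _).
  exact: (Kop'_ae (Aop_L2 bk g2) f2 E').
- have E' : {ae mu, forall x, 0 < x -> Aop' k f x = g x} by apply: ae_mono E => x h x0; rewrite h.
  apply: ae_mono E => x h x0; rewrite -(Aop_Aop' bk J2 f2 x0) /Aop -h//; congr (_ - _).
  exact: (Kop_ae (Aop'_L2 bk f2) g2 E').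
Qed.

End reproducing_kernel.

(** * Closures of the four operators for integer nu *)

Section sufficiency.
Context {R : realType}.
Local Notation mu := (@lebesgue_measure R).
Variables (nu : R[i]) (n : nat).
Hypothesis nuE : nu * (nu + 1) = (n * n.+1)%:R.
Local Notation p := (leg_poly n : {poly R}).
Local Notation k := (cpoly p^`()).
Local Notation P := (legendreP nu).

Let hP z : -1 < z -> P z = cpoly p z := legendreP_poly nuE (z := z).
Let P1 : P 1 = 1. Proof. by rewrite hP ?cpoly_leg1//; lra. Qed.
Let dP z : -1 < z -> is_cderive P z (k z).
Proof.
move=> z1; apply: near_eq_is_cderive (is_cderive_cpoly p z); near=> y.
by rewrite hP//; near: y; exact: lt_nbhsr.
Unshelve. all: by end_near. Qed.
Let dk z : -1 < z -> is_cderive k z (cpoly p^`()^`() z). Proof. by move=> _; exact: is_cderive_cpoly. Qed.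
Let dk2 z : -1 < z -> cdiff (cpoly p^`()^`()) z. Proof. by move=> _; exact: cdiff_cpoly. Qed.
Let ode z : -1 < z ->
  (1 - z ^+ 2)%:C * cpoly p^`()^`() z - (2 * z)%:C * k z + nu * (nu + 1) * P z = 0.
Proof. by move=> z1; rewrite hP// nuE; exact: leg_poly_ode_horner. Qed.
Let kR x : (k x)^* = k x. Proof. exact: ccR. Qed.
Let J1 := @leg_kernel_J1 R n.
Let J2 (x y : R) (x0 : 0 < x) (xy : x <= y) := leg_kernel_J2 n x0 (lt_le_trans x0 xy).

Lemma closure_P0 f g : L2closure (BE_P0 nu) f g <->
  [/\ inL2 f, inL2 g & {ae mu, forall x, 0 < x -> g x = Aop k f x}].
Proof.
have [M bk] := poly_kernel_bounded p^`(); split=> [cl|[f2 g2 E]].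
- have [f2 g2 _] := cl; split => //.
  apply: (L2closure_graph (Aop_L2 bk) (Aop_le bk) (AopB bk) _ cl) => u v T.
  by have [u2 v2 _] := T; split => //; exact: (BE_P0_Aop hP T).
- apply: (graph_L2closure (Aop_L2 bk) (Aop_le bk) (AopB bk) _ f2 g2 E) => u a b h tf.
  exact: (test_P0 P1 dP dk bk tf).
Qed.

Lemma closure_Sm f g : L2closure (BE_Sm nu) f g <->
  [/\ inL2 f, inL2 g & {ae mu, forall x, 0 < x -> g x = Aop' k f x}].
Proof.
have [M bk] := poly_kernel_bounded p^`(); split=> [cl|[f2 g2 E]].
- have [f2 g2 _] := cl; split => //.
  apply: (L2closure_graph (Aop'_L2 bk) (Aop'_le bk) (Aop'B bk) _ cl) => u v T.
  by have [u2 v2 _ _] := T; split => //; exact: (BE_Sm_Aop' P1 dP dk bk T).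
- apply: (graph_L2closure (Aop'_L2 bk) (Aop'_le bk) (Aop'B bk) _ f2 g2 E) => u a b h tf.
  exact: (test_Sm P1 dP dk bk tf).
Qed.

Lemma closure_S0 f g : L2closure (flip (BE_S0 nu)) f g <->
  [/\ inL2 f, inL2 g & {ae mu, forall x, 0 < x -> g x = Aop k f x}].
Proof.
have [M bk] := poly_kernel_bounded p^`(); split=> [cl|[f2 g2 E]].
- have [f2 g2 _] := cl; split => //.
  apply: (L2closure_graph (Aop_L2 bk) (Aop_le bk) (AopB bk) _ cl) => u v T.
  by have [v2 u2 _ _] := T; split => //; exact: (BE_S0_Aop hP T).
- apply: (graph_L2closure (Aop_L2 bk) (Aop_le bk) (AopB bk) _ f2 g2 E) => u a b h tf.
  exact: (test_S0 P1 dP dk dk2 ode bk tf).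
Qed.

Lemma closure_Pm f g : L2closure (flip (BE_Pm nu)) f g <->
  [/\ inL2 f, inL2 g & {ae mu, forall x, 0 < x -> g x = Aop' k f x}].
Proof.
have [M bk] := poly_kernel_bounded p^`(); split=> [cl|[f2 g2 E]].
- have [f2 g2 _] := cl; split => //.
  apply: (L2closure_graph (Aop'_L2 bk) (Aop'_le bk) (Aop'B bk) _ cl) => u v T.
  by have [v2 u2 _] := T; split => //; exact: (BE_Pm_Aop' hP T).
- apply: (graph_L2closure (Aop'_L2 bk) (Aop'_le bk) (Aop'B bk) _ f2 g2 E) => u a b h tf.
  exact: (test_Pm P1 dP dk dk2 ode bk tf).
Qed.

Lemma integer_unitary : [/\ unitary_in_L2 (BE_S0 nu), unitary_in_L2 (BE_P0 nu),
  unitary_in_L2 (BE_Pm nu) & unitary_in_L2 (BE_Sm nu)].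
Proof.
have [M bk] := poly_kernel_bounded p^`().
have A f x (f2 : inL2 f) (x0 : 0 < x) := Aop_Aop' bk J2 f2 x0.
have A' f x (f2 : inL2 f) (x0 : 0 < x) := Aop'_Aop bk J1 f2 x0.
split.
- apply: unitary_flip; exact: (unitary_graph (Aop_L2 bk) closure_S0 (Aop'_L2 bk) A (Aop_isometry bk J1 kR)).
- exact: (unitary_graph (Aop_L2 bk) closure_P0 (Aop'_L2 bk) A (Aop_isometry bk J1 kR)).
- apply: unitary_flip; exact: (unitary_graph (Aop'_L2 bk) closure_Pm (Aop_L2 bk) A' (Aop'_isometry bk J2 kR)).
- exact: (unitary_graph (Aop'_L2 bk) closure_Sm (Aop_L2 bk) A' (Aop'_isometry bk J2 kR)).
Qed.

Lemma integer_inverse :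
  mutually_inverse_in_L2 (BE_S0 nu) (BE_Pm nu) /\ mutually_inverse_in_L2 (BE_Sm nu) (BE_P0 nu).
Proof.
have [M bk] := poly_kernel_bounded p^`(); split => f g.
- split => [/(L2closure_flip (BE_S0 nu))/closure_S0[g2 f2 /(Aop_swap bk J1 J2 f2 g2) E]|].
    by apply/(L2closure_flip (BE_Pm nu))/closure_Pm.
  move=> /(L2closure_flip (BE_Pm nu))/closure_Pm[f2 g2 /(Aop_swap bk J1 J2 f2 g2) E].
  by apply/(L2closure_flip (BE_S0 nu))/closure_S0.
- split => [/closure_Sm[f2 g2 /(Aop_swap bk J1 J2 f2 g2) E]|/closure_P0[g2 f2 /(Aop_swap bk J1 J2 f2 g2) E]].
    exact/closure_P0.
  exact/closure_Sm.
Qed.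

End sufficiency.

(** * From unitarity to integrality *)

Section necessity.
Context {R : realType}.
Variable nu : R[i].
Local Notation P := (legendreP nu).

Lemma hump_orthogonal (c d : R) : 0 < c -> 3 * c < d -> L2inner (hump c) (hump d) = 0.
Proof.
move=> c0 cd; rewrite /L2inner -(cintegral0 (@halfline R)); apply: eq_cintegral => x _.
have [xc|xc] := boolP (c < x < 3 * c); last by rewrite hump_out ?mul0r.
rewrite (@hump_out R d) ?conjC0 ?mulr0//; apply/negP => /andP[dx _].
by move: xc; rewrite (lt_gtF (lt_trans cd dx)) andbF.
Qed.

Lemma hump_orthogonal' (c d : R) : 0 < c -> 3 * c < d -> L2inner (hump d) (hump c) = 0.
Proof.
move=> c0 cd; rewrite /L2inner -(cintegral0 (@halfline R)); apply: eq_cintegral => x _.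
have [xc|xc] := boolP (c < x < 3 * c); last by rewrite (@hump_out R c) ?conjC0 ?mulr0.
rewrite (@hump_out R d) ?mul0r//; apply/negP => /andP[dx _].
by move: xc; rewrite (lt_gtF (lt_trans cd dx)) andbF.
Qed.

(** The closures are used only through the pairs formed by a bump and its image under A or A', in
    one order or the other. Preservation of inner products on them, read in either direction, makes
    the images of disjoint bumps orthogonal. *)
Lemma unitary_integer : [\/ unitary_in_L2 (BE_S0 nu), unitary_in_L2 (BE_P0 nu),
  unitary_in_L2 (BE_Pm nu) | unitary_in_L2 (BE_Sm nu)] -> exists m : int, nu = m%:~R.
Proof.
have [k [k2 [P1 dP dk dk2 ode]]] := legendreP_ode nu.
have ck z : -1 < z -> cdiff k z by move=> z1; exact: (cdiffk dk z1).
have [M _ hM] := kernel_bounded 1 ck; have [N _ hN] := kernel_bounded 1 dk2.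
have bk : bounded_kernel k M.
  split; first exact: kernel_meas01.
  by move=> y /andP[y0 y1]; apply: hM; rewrite !ltW.
suff key : [\/ forall c, 3 < c -> L2inner (Aop k (hump 1)) (Aop k (hump c)) = 0 |
    forall c, 0 < c -> 3 * c < 1 -> L2inner (Aop' k (hump 1)) (Aop' k (hump c)) = 0] ->
    k 0 * P 0 = 0.
  move=> U; have kP : k 0 * P 0 = 0.
    have cS0 c : 0 < c -> L2closure (BE_S0 nu) (Aop k (hump c)) (hump c).
      move=> c0; apply: L2closure_sub; first by move=> f g [].
      exact: (test_S0 P1 dP dk dk2 ode bk (hump_test c0)).
    have cP0 c : 0 < c -> L2closure (BE_P0 nu) (hump c) (Aop k (hump c)).
      move=> c0; apply: L2closure_sub; first by move=> f g [].
      exact: (test_P0 P1 dP dk bk (hump_test c0)).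
    have cPm c : 0 < c -> L2closure (BE_Pm nu) (Aop' k (hump c)) (hump c).
      move=> c0; apply: L2closure_sub; first by move=> f g [].
      exact: (test_Pm P1 dP dk dk2 ode bk (hump_test c0)).
    have cSm c : 0 < c -> L2closure (BE_Sm nu) (hump c) (Aop' k (hump c)).
      move=> c0; apply: L2closure_sub; first by move=> f g [].
      exact: (test_Sm P1 dP dk bk (hump_test c0)).
    have c3 (c : R) : 3 < c -> 0 < c by apply: lt_trans.
    apply: key; case: U => -[_ _ iso].
    - left => c hc; rewrite -(iso _ _ _ _ (cS0 1 ltr01) (cS0 c (c3 c hc))).
      by rewrite hump_orthogonal// mulr1.
    - left => c hc; rewrite (iso _ _ _ _ (cP0 1 ltr01) (cP0 c (c3 c hc))).
      by rewrite hump_orthogonal// mulr1.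
    - right => c c0 hc; rewrite -(iso _ _ _ _ (cPm 1 ltr01) (cPm c c0)).
      exact: hump_orthogonal'.
    - right => c c0 hc; rewrite (iso _ _ _ _ (cSm 1 ltr01) (cSm c c0)).
      exact: hump_orthogonal'.
  have [j jE] := legendre_eigenvalue P1 dP dk ode kP; exact: eigenvalue_int jE.
by move=> [h|h]; [exact: (inner_Aop_zero P1 dP dk dk2 bk hN h)|exact: (inner_Aop'_zero P1 dP dk dk2 bk hN h)].
Qed.

End necessity.

(** The integers n and -(n + 1) give the same value of m (m + 1), so negative integers need no
    separate treatment. *)
Lemma int_eigenvalue {R : realType} (m : int) : exists n : nat, (m%:~R : R[i]) * (m%:~R + 1) = (n * n.+1)%:R.
Proof.
case: m => n; [exists n|exists n].
  by rewrite -pmulrn natrM -natr1.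
rewrite NegzE mulrNz -pmulrn natrM -!natr1; ring.
Qed.

Theorem theorem7 (R : realType) (nu : R[i]) :
  [/\ unitary_in_L2 (BE_S0 nu) <-> (exists m : int, nu = m%:~R),
      unitary_in_L2 (BE_P0 nu) <-> (exists m : int, nu = m%:~R),
      unitary_in_L2 (BE_Pm nu) <-> (exists m : int, nu = m%:~R) &
      unitary_in_L2 (BE_Sm nu) <-> (exists m : int, nu = m%:~R)] /\
  ((exists m : int, nu = m%:~R) ->
     mutually_inverse_in_L2 (BE_S0 nu) (BE_Pm nu) /\
     mutually_inverse_in_L2 (BE_Sm nu) (BE_P0 nu)).
Proof.
have ev : (exists m : int, nu = m%:~R) -> exists n : nat, nu * (nu + 1) = (n * n.+1)%:R.
  by move=> [m ->]; exact: int_eigenvalue.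
split; last by move=> /ev[n nE]; exact: integer_inverse nE.
split; split; try by move=> /ev[n /integer_unitary[]].
- by move=> U; apply: unitary_integer; constructor 1.
- by move=> U; apply: unitary_integer; constructor 2.
- by move=> U; apply: unitary_integer; constructor 3.
- by move=> U; apply: unitary_integer; constructor 4.
Qed.
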